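(* Let $R,P>0$, $S=\{(x,y)\in\mathbb{R}^2:|y|\le R\}$, $a\ne0$, $k\ge0$ an integer and $\alpha\in(0,1)$. Suppose $\phi^\pm\in C^{k+2,\alpha}(\mathbb{R})$ satisfy $\phi^\pm(x+P)\equiv\phi^\pm(x)$. Then there exists a unique $v\in C^{k+2,\alpha}(S)$ satisfying $$\frac{\partial}{\partial x}\Bigl[(v^2+y^2+a^2)^{-1/2}\frac{\partial v}{\partial x}\Bigr]+2\frac{\partial^2v}{\partial y^2}=0,$$ $v(x+P,y)\equiv v(x,y)$, and $v(x,\pm R)\equiv\phi^\pm(x)$.
   Context: $C^{k,\alpha}$ denotes the Hölder space of $C^k$ functions whose derivatives up to order $k$ are bounded and whose $k$-th derivatives are uniformly $\alpha$-Hölder continuous. *)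

(* Defs.v *)
From Stdlib Require Import Reals List.
From Coquelicot Require Import Coquelicot.
Open Scope R_scope.

Definition holder1 (m : nat) (alpha : R) (f : R -> R) : Prop :=
  (forall n, (n < m)%nat -> forall x, ex_derive (Derive_n f n) x) /\
  (forall n, (n <= m)%nat -> exists M, forall x, Rabs (Derive_n f n x) <= M) /\
  (exists C, forall x1 x2, x1 <> x2 ->
      Rabs (Derive_n f m x1 - Derive_n f m x2) <= C * Rpower (Rabs (x1 - x2)) alpha).

Definition pdx (f : R -> R -> R) : R -> R -> R :=
  fun x y => Derive (fun t => f t y) x.
Definition pdy (f : R -> R -> R) : R -> R -> R :=
  fun x y => Derive (fun t => f x t) y.

Fixpoint pd (l : list bool) (f : R -> R -> R) : R -> R -> R :=
  match l with
  | nil => f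
  | b :: l' => (if b then pdy else pdx) (pd l' f)
  end.

Definition dist2 (x1 y1 x2 y2 : R) : R :=
  sqrt ((x1 - x2) ^ 2 + (y1 - y2) ^ 2).

(** Hölder space C^{m,alpha}(S) on the closed strip S = {|y| <= Rs}:
    all partial derivatives up to order m exist in the interior |y| < Rs,
    are bounded there, those of order m are uniformly alpha-Hölder there,
    and v is continuous on the closed strip (so all derivatives of order
    <= m extend continuously to S, as usual). *)
Definition holder_strip (m : nat) (alpha Rs : R) (v : R -> R -> R) : Prop :=
  (forall l, (length l < m)%nat -> forall x y, Rabs y < Rs ->
      ex_derive (fun t => pd l v t y) x /\ ex_derive (fun t => pd l v x t) y) /\
  (forall l, (length l <= m)%nat -> exists M, forall x y, Rabs y < Rs ->
      Rabs (pd l v x y) <= M) /\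
  (forall l, length l = m -> exists C, forall x1 y1 x2 y2,
      Rabs y1 < Rs -> Rabs y2 < Rs -> (x1, y1) <> (x2, y2) ->
      Rabs (pd l v x1 y1 - pd l v x2 y2) <= C * Rpower (dist2 x1 y1 x2 y2) alpha) /\
  (forall x y, Rabs y <= Rs -> forall eps, 0 < eps -> exists delta, 0 < delta /\
      forall x' y', Rabs y' <= Rs -> Rabs (x' - x) < delta -> Rabs (y' - y) < delta ->
      Rabs (v x' y' - v x y) < eps).

Definition pde_holds (a Rs : R) (v : R -> R -> R) : Prop :=
  forall x y, Rabs y < Rs ->
    Derive (fun s => / sqrt (v s y ^ 2 + y ^ 2 + a ^ 2) * pdx v s y) x
    + 2 * pdy (pdy v) x y = 0.

Definition is_solution (k : nat) (alpha a Rs P : R) (phip phim : R -> R)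
  (v : R -> R -> R) : Prop :=
  holder_strip (k + 2) alpha Rs v /\
  pde_holds a Rs v /\
  (forall x y, Rabs y <= Rs -> v (x + P) y = v x y) /\
  (forall x, v x Rs = phip x) /\
  (forall x, v x (- Rs) = phim x).

(* Main.v *)
(** The equation is discretised on an [n] by [n] grid by a monotone scheme, which is solved by
    iterating an order preserving relaxation. All estimates come from the maximum principle
    applied to [w (i + d) j - w i j - B d], where [B] is a concave barrier: a logarithm for
    [w = v], which absorbs the quadratic gradient term, and a parabola for the higher
    differences in [x], which solve linear equations whose right-hand sides are controlled by
    the contact point itself. This bounds [k + 2] differences in [x] together with the Hoelder
    seminorm of the last one, up to the boundary. The equation then controls second
    differences in [y], interpolation gives the first and the mixed ones, and repeated use of
    the equation gives all the others, uniformly in [n]. An ultralimit of the discrete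
    solutions solves the problem.

    For uniqueness, let [W] be the primitive in [x] of the difference of two solutions. Its
    value over a period is affine in [y], hence zero, so [W] is periodic. At a maximum of
    [W x1 y - W x2 y + eps y^2] the two solutions agree, so that the nonlinear coefficients
    coincide and the integrated equation contradicts maximality in [y]. *)

Require Import Defs.
From Stdlib Require Import Reals List.
From Coquelicot Require Import Coquelicot.
From Stdlib Require Import Lra Lia Psatz ZArith Classical ClassicalEpsilon FunctionalExtensionality.
From mathcomp.classical Require filter.
Open Scope R_scope.

(** * Ultralimits *)

(** Only increments in [x] are estimated directly, since translations in [x] respect both the
    equation and the boundary rows. At a contact point the equations at the two ends of the
    increment, each with its own coefficient, contribute elliptic terms of the same sign. The
    obstacle is the Hoelder estimate of the difference of order [k + 2]. Its right-hand side
    involves differences of order [k + 3] at several neighbouring nodes, while contact controls them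
    at single nodes. Hence two scales: for an index [e] the data are mollified at width about [1/e],
    which bounds the differences of order [k + 4] by a constant depending on [e], and only then [n]
    is taken larger than this constant. The difference of order [k + 3] then changes by at most 1
    from node to node, and the final bounds do not depend on [e]. Uniformity is carried by index
    types: membership of a family in a class is a statement with one constant, and when a bound has
    to be uniform in a further quantity (a node, a row, a size [K]), that quantity becomes part of
    the index. *)

(** Limits along a nonprincipal ultrafilter: they exist for all bounded sequences of grid
    values at once, so that no subsequence has to be extracted. *)
Record ultralimit (U : (nat -> Prop) -> Prop) (lim : (nat -> R) -> R) : Prop := {
  ul_and : forall A B, U A -> U B -> U (fun n => A n /\ B n);
  ul_mono : forall A B : nat -> Prop, (forall n, A n -> B n) -> U A -> U B;
  ul_ex : forall A, U A -> exists n, A n;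
  ul_ev : forall n0, U (fun n => (n0 <= n)%nat);
  ul_lim : forall f B, (exists n0, forall n, (n0 <= n)%nat -> Rabs (f n) <= B) ->
    forall eps, 0 < eps -> U (fun n => Rabs (f n - lim f) < eps) }.

Lemma ultralimit_exists : exists U lim, ultralimit U lim.
Proof.
  set (F := (fun A : nat -> Prop => exists n0, forall n, (n0 <= n)%nat -> A n)
            : classical_sets.set_system nat).
  assert (FF : filter.ProperFilter F).
  { split.
    - intros [n0 H]. exact (H n0 (le_n _)).
    - split.
      + exists 0%nat. intros n _. exact I.
      + intros A B [n1 H1] [n2 H2]. exists (Nat.max n1 n2). intros n Hn.
        split; [apply H1 | apply H2]; lia.
      + intros A B HAB [n0 H]. exists n0. intros n Hn. apply HAB, H, Hn. }
  destruct (@filter.ultraFilterLemma nat F FF) as [G [GU FG]].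
  assert (GP := @filter.ultra_proper _ _ GU).
  assert (GF := @filter.filter_filter _ _ GP).
  set (U := G : (nat -> Prop) -> Prop).
  assert (Uand : forall A B, U A -> U B -> U (fun n => A n /\ B n)).
  { intros A B HA HB. exact (@filter.filterI _ _ GF A B HA HB). }
  assert (Umono : forall A B : nat -> Prop, (forall n, A n -> B n) -> U A -> U B).
  { intros A B H HA. exact (@filter.filterS _ _ GF A B H HA). }
  assert (Uex : forall A, U A -> exists n, A n).
  { intros A HA. apply NNPP. intro H. apply (@filter.filter_not_empty _ _ GP).
    apply (Umono A); [| exact HA]. intros n Hn. apply H. exists n; exact Hn. }
  assert (Uev : forall n0, U (fun n => (n0 <= n)%nat)).
  { intro n0. apply FG. exists n0. auto. }
  assert (Uor : forall A : nat -> Prop, U A \/ U (fun n => ~ A n)).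
  { intro A. exact (@filter.in_ultra_setVsetC nat G A GU). }
  (* The limit is the supremum of the levels reached for [U]-almost all [n]. It is finite for
     bounded [f]; otherwise [real] supplies a default value. *)
  exists U, (fun f => real (Lub_Rbar (fun t => U (fun n => t <= f n)))).
  split; auto.
  intros f B [n0 HB] eps Heps.
  set (E := fun t => U (fun n => t <= f n)).
  assert (Hub : forall t, E t -> t <= B).
  { intros t Ht. destruct (Uex _ (Uand _ _ Ht (Uev n0))) as [n [H1 H2]].
    specialize (HB n H2). apply Rabs_le_between in HB. lra. }
  assert (Hlb : E (- B)).
  { unfold E. apply (Umono _ _) with (2 := Uev n0). intros n Hn.
    specialize (HB n Hn). apply Rabs_le_between in HB. lra. }
  destruct (Lub_Rbar_correct E) as [L1 L2].
  assert (HL : Rbar_le (Lub_Rbar E) B) by (apply L2; intros t Ht; apply Hub, Ht).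
  assert (HL' := L1 _ Hlb).
  change (U (fun n => Rabs (f n - Lub_Rbar E) < eps)).
  destruct (Lub_Rbar E) as [L| |]; simpl in *; try tauto.
  assert (HA : U (fun n => L - eps < f n)).
  { apply NNPP. intro Hn.
    assert (L <= L - eps); [| lra].
    apply (L2 (Finite (L - eps))). intros t Ht. simpl. apply Rnot_lt_le. intro Hlt. apply Hn.
    apply (Umono _ _) with (2 := Ht). intros n H. lra. }
  (* Maximality of the ultrafilter enters here: if this set is not in [U] its complement is, and
     then [L + eps] belongs to [E]. *)
  assert (HC : U (fun n => f n < L + eps)).
  { destruct (Uor (fun n => f n < L + eps)) as [H|H]; auto. exfalso.
    assert (HE : E (L + eps)). { apply (Umono _ _) with (2 := H). intros n Hn. lra. }
    specialize (L1 _ HE). simpl in L1. lra. }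
  apply (Umono _ _) with (2 := Uand _ _ HA HC). intros n [H1 H2].
  apply Rabs_def1; lra.
Qed.

(** * Grid functions and classes stable under algebraic operations *)

(** [f t i j] is the value at the node [(i, j)] of the [t]-th grid. Whole families of grids
    are considered, so that membership in a class of such [f] means bounds uniform in [t].
    As in [pd], the direction [x] is coded by [false] and [y] by [true]. *)
Definition grid (T : Type) := T -> Z -> Z -> R.

Definition shift {T} (b : bool) (f : grid T) : grid T :=
  fun t i j => if b then f t i (j + 1)%Z else f t (i + 1)%Z j.

Definition dquot {T} (n : T -> R) (b : bool) (f : grid T) : grid T :=
  fun t i j => (shift b f t i j - f t i j) * n t.

(** These are the operations from which the nonlinear coefficient is built. The lower bound [d] is
    required at every node; a sum of squares with [a ^ 2] satisfies it whatever the other terms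
    are. *)
Record stable_class {T} (C : grid T -> Prop) : Prop := {
  g_const : forall c, C (fun _ _ _ => c);
  g_add : forall f g, C f -> C g -> C (fun t i j => f t i j + g t i j);
  g_mul : forall f g, C f -> C g -> C (fun t i j => f t i j * g t i j);
  g_inv : forall f d, 0 < d -> (forall t i j, d <= f t i j) -> C f ->
    C (fun t i j => / f t i j);
  g_sqrt : forall f d, 0 < d -> (forall t i j, d <= f t i j) -> C f ->
    C (fun t i j => sqrt (f t i j));
  g_sh : forall b f, C f -> C (shift b f) }.

Definition diff_class1 {T} (n : T -> R) (L : list bool) (C : grid T -> Prop) (f : grid T) :=
  C f /\ forall b, In b L -> C (dquot n b f).

(** A discrete [C^m] over [C]: all differences up to order [m] in the directions of [L] lie in [C].
    Iterating a one-step closure lets one proof of stability cover every [m]. *)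
Fixpoint diff_class {T} (n : T -> R) (L : list bool) (m : nat) (C : grid T -> Prop) :=
  match m with O => C | S m => diff_class1 n L (diff_class n L m C) end.

Ltac grid_ext := extensionality t; extensionality i; extensionality j.

Lemma grid_eq {T} (C : grid T -> Prop) f g :
  C f -> (forall t i j, f t i j = g t i j) -> C g.
Proof. intros H E. replace g with f; auto. grid_ext. apply E. Qed.

Lemma stable_class_opp {T} (C : grid T -> Prop) f : stable_class C -> C f -> C (fun t i j => - f t i j).
Proof.
  intros G H. apply grid_eq with (1 := g_mul _ G _ _ (g_const _ G (-1)) H).
  intros; ring.
Qed.

Lemma shift_lower {T} b (f : grid T) d :
  (forall t i j, d <= f t i j) -> forall t i j, d <= shift b f t i j.
Proof. intros H t i j. unfold shift. destruct b; apply H. Qed.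

Lemma shift_map {T} b (f : grid T) (F : R -> R) t i j :
  shift b (fun t i j => F (f t i j)) t i j = F (shift b f t i j).
Proof. unfold shift. destruct b; reflexivity. Qed.

(** Discrete product, quotient and chain rules. The difference quotient of each operation is again
    an expression in members of [C] and their shifts, which is why shifts belong to a stable
    class. *)
Lemma stable_class_diff_class1 {T} n L (C : grid T -> Prop) : stable_class C -> stable_class (diff_class1 n L C).
Proof.
  intro G. split.
  - intro c. split. { apply g_const, G. } intros b _.
    apply grid_eq with (1 := g_const _ G 0).
    intros t i j. unfold dquot, shift. destruct b; ring.
  - intros f g [F1 F2] [G1 G2]. split. { apply g_add; auto. }
    intros b Hb. apply grid_eq with (1 := g_add _ G _ _ (F2 b Hb) (G2 b Hb)).
    intros t i j. unfold dquot, shift. destruct b; ring.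
  - intros f g [F1 F2] [G1 G2]. split. { apply g_mul; auto. }
    intros b Hb.
    apply grid_eq with (1 := g_add _ G _ _ (g_mul _ G _ _ (F2 b Hb) G1)
                             (g_mul _ G _ _ (g_sh _ G b _ F1) (G2 b Hb))).
    intros t i j. unfold dquot, shift. destruct b; ring.
  - intros f d Hd Hf [F1 F2]. split. { apply (g_inv _ G f d); auto. }
    intros b Hb.
    assert (I1 : C (fun t i j => / f t i j)) by (apply (g_inv _ G f d); auto).
    apply grid_eq with (1 := stable_class_opp _ _ G
      (g_mul _ G _ _ (F2 b Hb) (g_mul _ G _ _ I1 (g_sh _ G b _ I1)))).
    intros t i j. assert (H1 := Hf t i j). assert (H2 := shift_lower b f d Hf t i j).
    unfold dquot. unfold shift in *. destruct b; field; lra.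
  - intros f d Hd Hf [F1 F2]. split. { apply (g_sqrt _ G f d); auto. }
    intros b Hb.
    assert (I1 : C (fun t i j => sqrt (f t i j))) by (apply (g_sqrt _ G f d); auto).
    assert (I2 : C (fun t i j => / (sqrt (f t i j) + shift b (fun t i j => sqrt (f t i j)) t i j))).
    { apply (g_inv _ G (fun t i j => sqrt (f t i j) + shift b (fun t i j => sqrt (f t i j)) t i j)
               (sqrt d)).
      - apply sqrt_lt_R0, Hd.
      - intros t i j. rewrite (shift_map b f sqrt).
        assert (sqrt d <= sqrt (f t i j)) by (apply sqrt_le_1_alt, Hf).
        assert (0 <= sqrt (shift b f t i j)) by apply sqrt_pos. lra.
      - apply g_add; auto. apply g_sh; auto. }
    apply grid_eq with (1 := g_mul _ G _ _ (F2 b Hb) I2).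
    intros t i j. assert (H1 := Hf t i j). assert (H2 := shift_lower b f d Hf t i j).
    unfold dquot. rewrite (shift_map b f sqrt).
    assert (0 < sqrt (f t i j)) by (apply sqrt_lt_R0; lra).
    assert (0 <= sqrt (shift b f t i j)) by apply sqrt_pos.
    replace (shift b f t i j - f t i j) with
      (sqrt (shift b f t i j) * sqrt (shift b f t i j) - sqrt (f t i j) * sqrt (f t i j))
      by (rewrite !sqrt_sqrt by lra; reflexivity).
    field. lra.
  - intros b f [F1 F2]. split. { apply g_sh; auto. }
    intros b' Hb'. apply grid_eq with (1 := g_sh _ G b _ (F2 b' Hb')).
    intros t i j. unfold dquot, shift. destruct b, b'; reflexivity.
Qed.

Lemma stable_class_diff_class {T} n L m (C : grid T -> Prop) : stable_class C -> stable_class (diff_class n L m C).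
Proof. intro G. induction m; simpl; auto. apply stable_class_diff_class1, IHm. Qed.

Lemma diff_class_bounded_modulus {T} n L m (C : grid T -> Prop) f : diff_class n L m C f -> C f.
Proof. induction m; simpl; auto. intros [H _]. auto. Qed.

Lemma diff_class_le {T} n L m m' (C : grid T -> Prop) f :
  (m' <= m)%nat -> diff_class n L m C f -> diff_class n L m' C f.
Proof.
  intro H. induction H; auto. intros [H1 _]. auto.
Qed.

Lemma diff_class_dquot {T} n L m (C : grid T -> Prop) b f :
  In b L -> diff_class n L (S m) C f -> diff_class n L m C (dquot n b f).
Proof. intros Hb [_ H]. auto. Qed.

Definition dxn {T} (n : T -> R) (p : nat) (f : grid T) := Nat.iter p (dquot n false) f.

Lemma dxn_S {T} (n : T -> R) p f : dxn n (S p) f = dxn n p (dquot n false f).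
Proof. apply Nat.iter_succ_r. Qed.

Lemma diff_class_dxn {T} n m p (C : grid T -> Prop) f :
  diff_class n (false :: nil) (p + m) C f -> diff_class n (false :: nil) m C (dxn n p f).
Proof.
  revert f. induction p; intros f H; auto. rewrite dxn_S. apply IHp.
  apply (diff_class_dquot _ _ (p + m)); simpl; auto.
Qed.

Lemma dxn_diff_class {T} n m (C : grid T -> Prop) f :
  (forall p, (p <= m)%nat -> C (dxn n p f)) -> diff_class n (false :: nil) m C f.
Proof.
  revert f. induction m; intros f H.
  - apply (H 0%nat). lia.
  - split.
    + apply IHm. intros; apply H; lia.
    + intros b [<-|[]]. apply IHm. intros p Hp. rewrite <- dxn_S. apply H. lia.
Qed.

Lemma dquot_comm {T} (n : T -> R) b b' f : dquot n b (dquot n b' f) = dquot n b' (dquot n b f).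
Proof. grid_ext. unfold dquot, shift. destruct b, b'; ring. Qed.

(** [Q r t i j i' j' w] selects a pair of nodes and the weight [w] of their increment;
    [r] is the number of rows at the top which are ignored. *)
Definition bounded_modulus {T} (Q : nat -> T -> Z -> Z -> Z -> Z -> R -> Prop) (f : grid T) :=
  exists (r : nat) (B : R), forall t i j i' j' w, Q r t i j i' j' w ->
    Rabs (f t i j) <= B /\ Rabs (f t i' j') <= B /\ Rabs (f t i j - f t i' j') <= B * w.

(** A shift may cost one more row and a factor 2 in the weight. The factor pays for weights that
    grow with the distance from node 0, as in [Qlip]. *)
Definition admissible {T} (Q : nat -> T -> Z -> Z -> Z -> Z -> R -> Prop) :=
  (forall r r' t i j i' j' w, (r <= r')%nat -> Q r' t i j i' j' w -> Q r t i j i' j' w) /\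
  (forall r t i j i' j' w, Q r t i j i' j' w -> 0 <= w) /\
  (forall r (b : bool) t i j i' j' w, Q (S r) t i j i' j' w ->
     if b then Q r t i (j + 1)%Z i' (j' + 1)%Z (2 * w)
     else Q r t (i + 1)%Z j (i' + 1)%Z j' (2 * w)).

Lemma bounded_modulus_stable_class {T} (Q : nat -> T -> Z -> Z -> Z -> Z -> R -> Prop) :
  admissible Q -> stable_class (bounded_modulus Q).
Proof.
  intros (Qm & Qw & Qs). split.
  - intro c. exists 0%nat, (Rabs c). intros t i j i' j' w H.
    specialize (Qw _ _ _ _ _ _ _ H). rewrite Rminus_diag, Rabs_R0.
    assert (0 <= Rabs c) by apply Rabs_pos. repeat split; try lra. nra.
  - intros f g (r1 & B1 & H1) (r2 & B2 & H2). exists (Nat.max r1 r2), (B1 + B2).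
    intros t i j i' j' w H.
    destruct (H1 t i j i' j' w) as (A1 & A2 & A3). { eapply Qm; [|apply H]; lia. }
    destruct (H2 t i j i' j' w) as (C1 & C2 & C3). { eapply Qm; [|apply H]; lia. }
    repeat split.
    + eapply Rle_trans; [apply Rabs_triang | lra].
    + eapply Rle_trans; [apply Rabs_triang | lra].
    + replace (f t i j + g t i j - (f t i' j' + g t i' j'))
        with ((f t i j - f t i' j') + (g t i j - g t i' j')) by ring.
      eapply Rle_trans; [apply Rabs_triang | lra].
  - intros f g (r1 & B1 & H1) (r2 & B2 & H2). exists (Nat.max r1 r2), (2 * (B1 * B2)).
    intros t i j i' j' w H.
    destruct (H1 t i j i' j' w) as (A1 & A2 & A3). { eapply Qm; [|apply H]; lia. }
    destruct (H2 t i j i' j' w) as (C1 & C2 & C3). { eapply Qm; [|apply H]; lia. }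
    assert (P1 := Rabs_pos (f t i j)). assert (P2 := Rabs_pos (f t i' j')).
    assert (P3 := Rabs_pos (g t i j)). assert (P4 := Rabs_pos (g t i' j')).
    assert (P5 := Rabs_pos (f t i j - f t i' j')).
    assert (P6 := Rabs_pos (g t i j - g t i' j')).
    repeat split.
    + rewrite Rabs_mult. nra.
    + rewrite Rabs_mult. nra.
    + replace (f t i j * g t i j - f t i' j' * g t i' j')
        with ((f t i j - f t i' j') * g t i j + f t i' j' * (g t i j - g t i' j')) by ring.
      eapply Rle_trans; [apply Rabs_triang|]. rewrite !Rabs_mult.
      assert (Rabs (f t i j - f t i' j') * Rabs (g t i j) <= (B1 * w) * B2)
        by (apply Rmult_le_compat; auto).
      assert (Rabs (f t i' j') * Rabs (g t i j - g t i' j') <= B1 * (B2 * w))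
        by (apply Rmult_le_compat; auto).
      lra.
  - intros f d Hd Hf (r & B & H1). exists r, (/ d + Rabs B * / d * / d).
    intros t i j i' j' w H. assert (Hw := Qw _ _ _ _ _ _ _ H).
    destruct (H1 _ _ _ _ _ _ H) as (A1 & A2 & A3).
    assert (Hf1 := Hf t i j). assert (Hf2 := Hf t i' j').
    assert (Hid : 0 < / d) by (apply Rinv_0_lt_compat, Hd).
    assert (I1 : / f t i j <= / d) by (apply Rinv_le_contravar; lra).
    assert (I2 : / f t i' j' <= / d) by (apply Rinv_le_contravar; lra).
    assert (J1 : 0 < / f t i j) by (apply Rinv_0_lt_compat; lra).
    assert (J2 : 0 < / f t i' j') by (apply Rinv_0_lt_compat; lra).
    assert (HB : 0 <= Rabs B) by apply Rabs_pos. assert (HB' : B <= Rabs B) by apply Rle_abs.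
    assert (0 <= Rabs B * / d * / d) by (apply Rmult_le_pos; [apply Rmult_le_pos|]; lra).
    repeat split.
    + rewrite Rabs_pos_eq; lra.
    + rewrite Rabs_pos_eq; lra.
    + replace (/ f t i j - / f t i' j') with (- (f t i j - f t i' j') * (/ f t i j * / f t i' j'))
        by (field; lra).
      rewrite Rabs_mult, Rabs_Ropp, (Rabs_pos_eq (/ f t i j * / f t i' j')) by nra.
      assert (Rabs (f t i j - f t i' j') * (/ f t i j * / f t i' j') <= (Rabs B * w) * (/ d * / d)).
      { apply Rmult_le_compat; try apply Rabs_pos; nra. }
      nra.
  - intros f d Hd Hf (r & B & H1).
    assert (Hs : 0 < sqrt d) by (apply sqrt_lt_R0, Hd).
    assert (Hid : 0 < / sqrt d) by (apply Rinv_0_lt_compat, Hs).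
    exists r, (1 + Rabs B + Rabs B * / sqrt d).
    intros t i j i' j' w H. assert (Hw := Qw _ _ _ _ _ _ _ H).
    destruct (H1 _ _ _ _ _ _ H) as (A1 & A2 & A3).
    assert (Hf1 := Hf t i j). assert (Hf2 := Hf t i' j').
    assert (HB : 0 <= Rabs B) by apply Rabs_pos. assert (HB' : B <= Rabs B) by apply Rle_abs.
    assert (K1 : sqrt d <= sqrt (f t i j)) by (apply sqrt_le_1_alt, Hf).
    assert (K2 : sqrt d <= sqrt (f t i' j')) by (apply sqrt_le_1_alt, Hf).
    assert (0 <= Rabs B * / sqrt d) by (apply Rmult_le_pos; lra).
    assert (U : forall x, 0 < x -> Rabs x <= B -> sqrt x <= 1 + Rabs B).
    { intros x Hx Hx'. rewrite Rabs_pos_eq in Hx' by lra.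
      assert (E := sqrt_sqrt x (Rlt_le _ _ Hx)). assert (E' := sqrt_pos x). nra. }
    repeat split.
    + rewrite Rabs_pos_eq by lra. assert (UU := U (f t i j)). lra.
    + rewrite Rabs_pos_eq by lra. assert (UU := U (f t i' j')). lra.
    + assert (J : 0 < / (sqrt (f t i j) + sqrt (f t i' j'))) by (apply Rinv_0_lt_compat; lra).
      assert (J' : / (sqrt (f t i j) + sqrt (f t i' j')) <= / sqrt d)
        by (apply Rinv_le_contravar; lra).
      replace (sqrt (f t i j) - sqrt (f t i' j'))
        with ((f t i j - f t i' j') * / (sqrt (f t i j) + sqrt (f t i' j'))).
      2:{ rewrite <- (sqrt_sqrt (f t i j)) at 1 by lra.
          rewrite <- (sqrt_sqrt (f t i' j')) at 1 by lra. field. lra. }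
      rewrite Rabs_mult, (Rabs_pos_eq (/ _)) by lra.
      assert (Rabs (f t i j - f t i' j') * / (sqrt (f t i j) + sqrt (f t i' j'))
              <= (Rabs B * w) * / sqrt d).
      { apply Rmult_le_compat; try apply Rabs_pos; try lra. nra. }
      nra.
  - intros b f (r & B & H1). exists (S r), (2 * Rabs B). intros t i j i' j' w H.
    assert (Hw := Qw _ _ _ _ _ _ _ H). assert (HB' : B <= Rabs B) by apply Rle_abs.
    assert (HB : 0 <= Rabs B) by apply Rabs_pos.
    specialize (Qs _ b _ _ _ _ _ _ H). unfold shift. destruct b.
    + destruct (H1 _ _ _ _ _ _ Qs) as (A1 & A2 & A3). repeat split; try lra. nra.
    + destruct (H1 _ _ _ _ _ _ Qs) as (A1 & A2 & A3). repeat split; try lra. nra.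
Qed.

(** With this choice of mean the flux [coef a y v w * (w - v)] is monotone in [v] and in [w]. *)
Definition coef (a y v w : R) : R := 2 / (sqrt (v ^ 2 + y ^ 2 + a ^ 2) + sqrt (w ^ 2 + y ^ 2 + a ^ 2)).

Lemma stable_class_coef {T} (C : grid T -> Prop) a (v y : grid T) : a <> 0 -> stable_class C -> C v -> C y ->
  C (fun t i j => coef a (y t i j) (v t i j) (v t (i + 1)%Z j)).
Proof.
  intros Ha G Hv Hy.
  assert (A2 : 0 < a ^ 2) by (apply pow2_gt_0, Ha).
  assert (S : forall u, C u -> C (fun t i j => sqrt (u t i j ^ 2 + y t i j ^ 2 + a ^ 2))).
  { intros u Hu. apply (g_sqrt _ G (fun t i j => u t i j ^ 2 + y t i j ^ 2 + a ^ 2) (a ^ 2)); auto.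
    - intros t i j. assert (0 <= u t i j ^ 2) by apply pow2_ge_0.
      assert (0 <= y t i j ^ 2) by apply pow2_ge_0. lra.
    - apply grid_eq with (1 := g_add _ G _ _ (g_add _ G _ _ (g_mul _ G _ _ Hu Hu)
         (g_mul _ G _ _ Hy Hy)) (g_const _ G (a ^ 2))). intros; ring. }
  assert (SL : forall x z, sqrt (a ^ 2) <= sqrt (x ^ 2 + z ^ 2 + a ^ 2)).
  { intros x z. apply sqrt_le_1_alt. assert (0 <= x ^ 2) by apply pow2_ge_0.
    assert (0 <= z ^ 2) by apply pow2_ge_0. lra. }
  assert (Hs : 0 < sqrt (a ^ 2)) by (apply sqrt_lt_R0, A2).
  apply grid_eq with (1 := g_mul _ G _ _ (g_const _ G 2)
    (g_inv _ G (fun t i j => sqrt (v t i j ^ 2 + y t i j ^ 2 + a ^ 2)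
       + sqrt (shift false v t i j ^ 2 + y t i j ^ 2 + a ^ 2)) (sqrt (a ^ 2)) Hs
       ltac:(intros t i j; assert (U1 := SL (v t i j) (y t i j));
             assert (U2 := SL (shift false v t i j) (y t i j)); lra)
       (g_add _ G _ _ (S _ Hv) (S _ (g_sh _ G false _ Hv))))).
  intros t i j. unfold coef, shift. reflexivity.
Qed.

(** The increments of row [j] at distance [i'] from node 0 are allowed to grow linearly. *)
Definition Qlip {T} (n K : T -> R) (r : nat) (t : T) (i j i' j' : Z) (w : R) : Prop :=
  i = (i' + 1)%Z /\ j = j' /\ K t * (1 + Rabs (IZR i')) <= w * n t.

Lemma abs_IZR_succ i : 1 + Rabs (IZR (i + 1)) <= 2 * (1 + Rabs (IZR i)).
Proof.
  rewrite plus_IZR. assert (H := Rabs_triang (IZR i) 1). rewrite Rabs_R1 in H.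
  assert (0 <= Rabs (IZR i)) by apply Rabs_pos. lra.
Qed.

Lemma Qlip_admissible {T} (n K : T -> R) :
  (forall t, 0 < n t) -> (forall t, 1 <= K t) -> admissible (Qlip n K).
Proof.
  intros Hn HK. split; [|split].
  - intros. assumption.
  - intros r t i j i' j' w (H1 & H2 & H3).
    assert (A := Hn t). assert (B := HK t).
    assert (0 <= Rabs (IZR i')) by apply Rabs_pos.
    destruct (Rle_lt_dec 0 w); auto. nra.
  - intros r b t i j i' j' w (-> & -> & H3).
    assert (A := Hn t). assert (B := HK t).
    assert (P := Rabs_pos (IZR i')).
    destruct b; repeat split; auto. nra.
    assert (H := abs_IZR_succ i'). nra.
Qed.

Lemma bounded_modulus_Qlip {T} (n K : T -> R) f : (forall t, 0 < n t) -> (forall t, 1 <= K t) ->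
  bounded_modulus (Qlip n K) f -> exists B, 0 <= B /\ forall t i j, Rabs (f t i j) <= B /\
    Rabs (dquot n false f t i j) <= B * (K t * (1 + Rabs (IZR i))).
Proof.
  intros Hn HK (r & B & H). exists (Rabs B). split. apply Rabs_pos. intros t i j.
  assert (A := Hn t). assert (A' := HK t).
  destruct (H t (i + 1)%Z j i j (K t * (1 + Rabs (IZR i)) / n t)) as (H1 & H2 & H3).
  { repeat split. right. field. lra. }
  assert (HB := Rle_abs B). split; [lra|].
  unfold dquot, shift. rewrite Rabs_mult, (Rabs_pos_eq (n t)) by lra.
  assert (P := Rabs_pos (IZR i)).
  apply Rle_trans with (B * (K t * (1 + Rabs (IZR i)) / n t) * n t).
  { apply Rmult_le_compat_r; lra. }
  replace (B * (K t * (1 + Rabs (IZR i)) / n t) * n t) with (B * (K t * (1 + Rabs (IZR i))))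
    by (field; lra).
  apply Rmult_le_compat_r; nra.
Qed.

Lemma bounded_modulus_Qlip_intro {T} (n K : T -> R) f B : (forall t, 0 < n t) -> (forall t, 1 <= K t) ->
  0 <= B -> (forall t i j, Rabs (f t i j) <= B /\
    Rabs (dquot n false f t i j) <= B * (K t * (1 + Rabs (IZR i)))) ->
  bounded_modulus (Qlip n K) f.
Proof.
  intros Hn HK HB H. exists 0%nat, B. intros t i j i' j' w (-> & -> & H3).
  destruct (H t (i' + 1)%Z j') as [A1 _]. destruct (H t i' j') as [A2 A3].
  repeat split; auto. assert (A := Hn t).
  unfold dquot, shift in A3. rewrite Rabs_mult, (Rabs_pos_eq (n t)) in A3 by lra.
  apply Rmult_le_reg_r with (n t); auto. nra.
Qed.

Lemma bounded_modulus_Qlip_of_lip {T} (n K : T -> R) f B : (forall t, 0 < n t) -> (forall t, 1 <= K t) ->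
  (forall t i j, Rabs (f t i j) <= B /\ Rabs (dquot n false f t i j) <= B) ->
  bounded_modulus (Qlip n K) f.
Proof.
  intros Hn HK H. apply bounded_modulus_Qlip_intro with (B := Rabs B); auto. apply Rabs_pos.
  intros t i j. destruct (H t i j) as [H1 H2]. assert (HB := Rle_abs B).
  assert (P := Rabs_pos (IZR i)). specialize (HK t). assert (P' := Rabs_pos B).
  assert (1 <= K t * (1 + Rabs (IZR i))) by nra.
  split; [lra|]. nra.
Qed.

(** Commuting [D^(m+1)] past the coefficient of [c * Du] only produces terms which are
    at most linear in the top order difference [D^(m+1) u]. *)
Lemma commutator_bound {T} (n K : T -> R) c u m :
  (forall t, 0 < n t) -> (forall t, 1 <= K t) -> (1 <= m)%nat ->
  diff_class n (false :: nil) m (bounded_modulus (Qlip n K)) c ->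
  diff_class n (false :: nil) m (bounded_modulus (Qlip n K)) u ->
  exists B, 0 <= B /\ forall t i j,
    Rabs (dxn n (S m) (fun t i j => c t i j * dquot n false u t i j) t i j
          - c t i j * dxn n (S (S m)) u t i j) <= B * (K t * (1 + Rabs (IZR i))).
Proof.
  intros Hn HK Hm Hc Hu.
  assert (G := bounded_modulus_stable_class _ (Qlip_admissible n K Hn HK)).
  set (C := bounded_modulus (Qlip n K)) in *. set (L := false :: nil) in *.
  (* [R p] is the error after [p] differences. One more difference yields the difference of [R p]
     plus [Dc] times a shifted [D^(p+1) u], so each step loses one order of regularity and [R m]
     still lies in [C]. *)
  set (R := fun p (t : T) i j => dxn n p (fun t i j => c t i j * dquot n false u t i j) t i j
          - c t i j * dxn n (S p) u t i j).
  assert (HS : forall p t i j, R (S p) t i j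
    = dquot n false (R p) t i j + dquot n false c t i j * shift false (dxn n (S p) u) t i j).
  { intros p t i j. unfold R. simpl. unfold dquot, shift. ring. }
  assert (HR : forall p, (p <= m)%nat -> diff_class n L (m - p) C (R p)).
  { induction p; intro Hp.
    - apply grid_eq with (1 := g_const _ (stable_class_diff_class n L (m - 0) C G) 0).
      intros t i j. unfold R. simpl. unfold dquot, shift. ring.
    - apply grid_eq with (fun t i j => dquot n false (R p) t i j
         + dquot n false c t i j * shift false (dxn n (S p) u) t i j);
        [| intros; symmetry; apply HS].
      assert (Gm := stable_class_diff_class n L (m - S p) C G).
      apply g_add; auto.
      + apply diff_class_dquot. simpl; auto. replace (S (m - S p)) with (m - p)%nat by lia.
        apply IHp; lia.
      + apply g_mul; auto.
        * apply diff_class_le with (m - 1)%nat. lia. apply diff_class_dquot. simpl; auto.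
          replace (S (m - 1)) with m by lia. exact Hc.
        * apply g_sh; auto. apply diff_class_dxn. replace (S p + (m - S p))%nat with m by lia. exact Hu. }
  assert (H1 := HR m (le_n m)). rewrite Nat.sub_diag in H1. simpl in H1.
  (* Here [1 <= m] enters: [Dc] is bounded, so its product with [D^(m+1) u] stays linear in [K]. For
     [m = 0] both factors could be of size [K]. *)
  assert (H2 : C (dquot n false c)).
  { apply (diff_class_bounded_modulus n L (m - 1)). apply diff_class_dquot. simpl; auto.
    replace (S (m - 1)) with m by lia. exact Hc. }
  assert (H3 : C (dxn n m u)).
  { apply (diff_class_dxn n 0 m). replace (m + 0)%nat with m by lia. exact Hu. }
  destruct (bounded_modulus_Qlip n K _ Hn HK H1) as (B1 & P1 & B1').
  destruct (bounded_modulus_Qlip n K _ Hn HK H2) as (B2 & P2 & B2').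
  destruct (bounded_modulus_Qlip n K _ Hn HK H3) as (B3 & P3 & B3').
  exists (B1 + B2 * (2 * B3)). split. { nra. }
  intros t i j. change (Rabs (R (S m) t i j) <= (B1 + B2 * (2 * B3)) * (K t * (1 + Rabs (IZR i)))).
  rewrite HS. eapply Rle_trans; [apply Rabs_triang|]. rewrite Rabs_mult.
  destruct (B1' t i j) as [_ Q1]. destruct (B2' t i j) as [Q2 _].
  destruct (B3' t (i + 1)%Z j) as [_ Q3].
  change (shift false (dxn n (S m) u) t i j) with (dquot n false (dxn n m u) t (i + 1)%Z j).
  assert (E := abs_IZR_succ i). specialize (HK t).
  assert (P := Rabs_pos (IZR i)).
  assert (Q4 : Rabs (dquot n false (dxn n m u) t (i + 1)%Z j) <= (2 * B3) * (K t * (1 + Rabs (IZR i)))).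
  { eapply Rle_trans; [apply Q3|].
    replace (2 * B3 * (K t * (1 + Rabs (IZR i)))) with (B3 * (K t * (2 * (1 + Rabs (IZR i))))) by ring.
    apply Rmult_le_compat_l; auto. apply Rmult_le_compat_l; lra. }
  assert (Rabs (dquot n false c t i j) * Rabs (dquot n false (dxn n m u) t (i + 1)%Z j)
    <= B2 * ((2 * B3) * (K t * (1 + Rabs (IZR i))))).
  { apply Rmult_le_compat; auto; apply Rabs_pos. }
  lra.
Qed.

(** * Comparison principles *)

Lemma finite_max {A} (f : A -> R) (l : list A) x0 : In x0 l ->
  exists x, In x l /\ forall y, In y l -> f y <= f x.
Proof.
  revert x0. induction l as [|a l IH]; intros x0 H. destruct H.
  destruct l as [|b l].
  - exists a. split. left; auto. intros y [<-|[]]. lra.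
  - destruct (IH b (or_introl eq_refl)) as (x & Hx & Hm).
    destruct (Rle_lt_dec (f a) (f x)).
    + exists x. split. right; auto. intros y [<-|Hy]; auto.
    + exists a. split. left; auto. intros y [<-|Hy]. lra.
      specialize (Hm y Hy). lra.
Qed.

Definition zrange (n : Z) : list Z := map Z.of_nat (seq 0 (S (Z.to_nat n))).

Lemma zrange_in n k : (0 <= n)%Z -> In k (zrange n) <-> (0 <= k <= n)%Z.
Proof.
  intro Hn. unfold zrange. rewrite in_map_iff. split.
  - intros (x & <- & H). apply in_seq in H. lia.
  - intro H. exists (Z.to_nat k). split. lia. apply in_seq. lia.
Qed.

Definition periodic (n : Z) (w : Z -> Z -> R) := forall i j, w (i + n)%Z j = w i j.

Lemma periodic_mod n w i j : (0 < n)%Z -> periodic n w -> w i j = w (i mod n)%Z j.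
Proof.
  intros Hn H.
  assert (E : forall k i, (0 <= k)%Z -> w (i + k * n)%Z j = w i j).
  { intros k i0 Hk. revert k Hk. apply natlike_ind.
    - f_equal. lia.
    - intros k Hk IH. rewrite <- IH. rewrite <- (H (i0 + k * n)%Z j). f_equal. lia. }
  assert (D := Z.div_mod i n ltac:(lia)).
  destruct (Z_le_gt_dec 0 (i / n)).
  - rewrite <- (E (i / n)%Z (i mod n)%Z); auto. f_equal. lia.
  - rewrite <- (E (- (i / n))%Z i); try lia. f_equal. lia.
Qed.

(** A positive maximum of [w (i+d) j - w i j - B d] cannot be interior. *)
Lemma doubling (n : Z) (w : Z -> Z -> R) (B : Z -> R) (q : Z) :
  (0 < n)%Z -> (0 <= q)%Z -> periodic n w -> 0 <= B 0%Z ->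
  (forall i j, (0 <= j <= n)%Z -> w (i + q)%Z j - w i j <= B q) ->
  (forall i d, (0 <= d <= q)%Z -> w (i + d)%Z 0%Z - w i 0%Z <= B d /\
                                 w (i + d)%Z n - w i n <= B d) ->
  (forall i j d s, (0 < j < n)%Z -> (0 < d < q)%Z -> 0 < s ->
     w (i + d)%Z j - w i j = B d + s ->
     (forall i' j' d', (0 <= j' <= n)%Z -> (0 <= d' <= q)%Z ->
        w (i' + d')%Z j' - w i' j' <= B d' + s) -> False) ->
  forall i j d, (0 <= j <= n)%Z -> (0 <= d <= q)%Z -> w (i + d)%Z j - w i j <= B d.
Proof.
  intros Hn Hq0 Hp H0 Hq Hb Hint.
  set (F := fun x : Z * (Z * Z) => w (fst x + snd (snd x))%Z (fst (snd x))
                                   - w (fst x) (fst (snd x)) - B (snd (snd x))).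
  (* Periodicity in [i] reduces the supremum over all [i] to this finite list. *)
  set (l := list_prod (zrange n) (list_prod (zrange n) (zrange q))).
  assert (Hl : forall i j d, In (i, (j, d)) l <-> (0 <= i <= n /\ 0 <= j <= n /\ 0 <= d <= q)%Z).
  { intros i j d. unfold l. rewrite !in_prod_iff, !zrange_in by lia. tauto. }
  destruct (finite_max F l (0, (0, 0))%Z) as ((i0 & j0 & d0) & Hin & Hmax).
  { apply Hl. lia. }
  apply Hl in Hin.
  assert (Hall : forall i j d, (0 <= j <= n)%Z -> (0 <= d <= q)%Z ->
            w (i + d)%Z j - w i j - B d <= F (i0, (j0, d0))).
  { intros i j d Hj Hd.
    specialize (Hmax ((i mod n)%Z, (j, d))). unfold F at 1 in Hmax. simpl in Hmax.
    assert (M := Z.mod_pos_bound i n Hn).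
    rewrite (periodic_mod n w i), (periodic_mod n w (i + d)) by auto.
    rewrite (periodic_mod n w (i mod n + d)) in Hmax by auto.
    rewrite Zplus_mod_idemp_l in Hmax. apply Hmax. apply Hl. lia. }
  destruct (Rle_lt_dec (F (i0, (j0, d0))) 0) as [Hle|Hgt].
  { intros i j d Hj Hd. specialize (Hall i j d Hj Hd). lra. }
  exfalso. unfold F in Hgt, Hall; simpl in Hgt, Hall.
  destruct (Z.eq_dec d0 0) as [->|Hd0].
  { replace (i0 + 0)%Z with i0 in Hgt by lia. lra. }
  destruct (Z.eq_dec d0 q) as [->|Hdq].
  { specialize (Hq i0 j0 ltac:(lia)). lra. }
  destruct (Z.eq_dec j0 0) as [->|Hj0].
  { destruct (Hb i0 d0 ltac:(lia)). lra. }
  destruct (Z.eq_dec j0 n) as [->|Hjn].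
  { destruct (Hb i0 d0 ltac:(lia)). lra. }
  eapply (Hint i0 j0 d0 _ ltac:(lia) ltac:(lia) Hgt).
  - ring.
  - intros i' j' d' Hj' Hd'. specialize (Hall i' j' d' Hj' Hd'). lra.
Qed.

(** A concave parabola in [d h] whose second difference is [- 2 th s h ^ 2]. The offset [b] leaves
    room for Hoelder data at small [d]. *)
Definition quad_barrier (h b s th : R) (d : Z) : R := b + s * (IZR d * h - th * (IZR d * h) ^ 2).

(** At a contact point the two ends of the increment are moved separately. Concavity of the barrier
    makes the second [x]-difference at most [- 2 th s h ^ 2] at [i + d] and at least [2 th s h ^ 2]
    at [i], and the second [y]-differences are ordered. Subtracting the two equations, each with its
    own coefficient, leaves a total of [4 lam th s] that the right-hand sides cannot match. The last
    hypothesis concerns only nodes whose neighbouring slopes satisfy the bounds forced by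
    contact. *)
Lemma barrier_quad (n : Z) (w c R0 : Z -> Z -> R) (h kap lam b s th : R) (q : Z) :
  (0 < n)%Z -> (0 <= q)%Z -> periodic n w -> 0 < h -> 0 < kap -> 0 <= lam ->
  0 <= b -> 0 < s -> 0 <= th -> 2 * th * (IZR q * h) <= 1 ->
  (forall i j, (0 < j < n)%Z ->
     c i j * (w (i + 1)%Z j - 2 * w i j + w (i - 1)%Z j)
     + kap * (w i (j + 1)%Z - 2 * w i j + w i (j - 1)%Z) = R0 i j * h ^ 2 /\ lam <= c i j) ->
  (forall i j, (0 <= j <= n)%Z -> w (i + q)%Z j - w i j <= quad_barrier h b s th q) ->
  (forall i d, (0 <= d <= q)%Z -> w (i + d)%Z 0%Z - w i 0%Z <= quad_barrier h b s th d /\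
                                 w (i + d)%Z n - w i n <= quad_barrier h b s th d) ->
  (forall i j d, (0 < j < n)%Z -> (0 < d < q)%Z ->
     w (i + d + 1)%Z j - w (i + d)%Z j <= s * h ->
     0 <= w (i + d)%Z j - w (i + d - 1)%Z j ->
     w i j - w (i - 1)%Z j <= s * h -> 0 <= w (i + 1)%Z j - w i j ->
     Rabs (R0 (i + d)%Z j) + Rabs (R0 i j) < 4 * lam * th * s) ->
  forall i j d, (0 <= j <= n)%Z -> (0 <= d <= q)%Z ->
    w (i + d)%Z j - w i j <= quad_barrier h b s th d.
Proof.
  intros Hn Hq0 Hp Hh Hk Hlam Hb0 Hs Hth Hqh Heq Hq Hb HR.
  apply doubling; auto. { unfold quad_barrier. simpl. nra. }
  intros i j d sg Hj Hd Hsg Hc Hall.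
  assert (Hdq : IZR d + 1 <= IZR q). { rewrite <- plus_IZR. apply IZR_le. lia. }
  assert (Hd1 : 1 <= IZR d). { apply IZR_le. lia. }
  assert (Qp : quad_barrier h b s th (d + 1) - quad_barrier h b s th d
               = s * h * (1 - 2 * th * (IZR d * h) - th * h)).
  { unfold quad_barrier. rewrite plus_IZR. ring. }
  assert (Qm : quad_barrier h b s th d - quad_barrier h b s th (d - 1)
               = s * h * (1 - 2 * th * (IZR d * h) + th * h)).
  { unfold quad_barrier. rewrite minus_IZR. ring. }
  assert (A0 : 0 <= th * h) by nra.
  assert (A1 : 2 * th * (IZR d * h) + 2 * (th * h) <= 1).
  { replace (2 * th * (IZR d * h) + 2 * (th * h)) with (2 * (th * h) * (IZR d + 1)) by ring.
    replace (2 * th * (IZR q * h)) with (2 * (th * h) * IZR q) in Hqh by ring. nra. }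
  assert (A2 : 0 <= 2 * th * (IZR d * h)).
  { apply Rmult_le_pos; nra. }
  assert (sh0 : 0 < s * h) by nra.
  (* [I1] and [I2] move the end [i + d], [I3] and [I4] move the end [i] while the other stays fixed,
     [I5] and [I6] move the row. *)
  assert (I1 := Hall i j (d + 1)%Z ltac:(lia) ltac:(lia)).
  assert (I2 := Hall i j (d - 1)%Z ltac:(lia) ltac:(lia)).
  assert (I3 := Hall (i + 1)%Z j (d - 1)%Z ltac:(lia) ltac:(lia)).
  assert (I4 := Hall (i - 1)%Z j (d + 1)%Z ltac:(lia) ltac:(lia)).
  assert (I5 := Hall i (j + 1)%Z d ltac:(lia) ltac:(lia)).
  assert (I6 := Hall i (j - 1)%Z d ltac:(lia) ltac:(lia)).
  replace (i + (d + 1))%Z with (i + d + 1)%Z in I1 by lia.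
  replace (i + (d - 1))%Z with (i + d - 1)%Z in I2 by lia.
  replace (i + 1 + (d - 1))%Z with (i + d)%Z in I3 by lia.
  replace (i - 1 + (d + 1))%Z with (i + d)%Z in I4 by lia.
  destruct (Heq (i + d)%Z j Hj) as [E1 L1]. destruct (Heq i j Hj) as [E2 L2].
  assert (HRR : Rabs (R0 (i + d)%Z j) + Rabs (R0 i j) < 4 * lam * th * s).
  { assert (F0 : 0 <= s * h * (1 - 2 * th * (IZR d * h) - th * h)) by (apply Rmult_le_pos; lra).
    assert (F1 : 0 <= s * h * (2 * th * (IZR d * h) + th * h)) by (apply Rmult_le_pos; lra).
    assert (F2 : 0 <= s * h * (th * h)) by (apply Rmult_le_pos; lra).
    apply HR; auto; lra. }
  assert (X1 : w (i + d + 1)%Z j - 2 * w (i + d)%Z j + w (i + d - 1)%Z j <= - (2 * th * s * h ^ 2)).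
  { replace (2 * th * s * h ^ 2) with (2 * (s * h * (th * h))) by ring. lra. }
  assert (X2 : 2 * th * s * h ^ 2 <= w (i + 1)%Z j - 2 * w i j + w (i - 1)%Z j).
  { replace (2 * th * s * h ^ 2) with (2 * (s * h * (th * h))) by ring. lra. }
  assert (X3 : (w (i + d)%Z (j + 1)%Z - 2 * w (i + d)%Z j + w (i + d)%Z (j - 1)%Z)
     - (w i (j + 1)%Z - 2 * w i j + w i (j - 1)%Z) <= 0) by lra.
  assert (P0 : 0 <= 2 * th * s * h ^ 2).
  { assert (0 <= h ^ 2) by apply pow2_ge_0. assert (0 <= th * s) by nra. nra. }
  set (X := w (i + d + 1)%Z j - 2 * w (i + d)%Z j + w (i + d - 1)%Z j) in *.
  set (Y := w (i + 1)%Z j - 2 * w i j + w (i - 1)%Z j) in *.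
  set (D := 2 * th * s * h ^ 2) in *.
  assert (Y1 : lam * D <= c (i + d)%Z j * - X).
  { apply Rle_trans with (c (i + d)%Z j * D).
    apply Rmult_le_compat_r; auto. apply Rmult_le_compat_l; lra. }
  assert (Y2 : lam * D <= c i j * Y).
  { apply Rle_trans with (c i j * D).
    apply Rmult_le_compat_r; auto. apply Rmult_le_compat_l; lra. }
  assert (Y3 : R0 (i + d)%Z j * h ^ 2 - R0 i j * h ^ 2 <= - (2 * (lam * D))).
  { rewrite <- E1, <- E2.
    apply (Rmult_le_compat_l kap) in X3; [|lra]. lra. }
  assert (h2 : 0 < h ^ 2) by (apply pow_lt, Hh).
  assert (Y4 : R0 (i + d)%Z j - R0 i j <= - (4 * lam * th * s)).
  { apply (Rmult_le_reg_r (h ^ 2)); auto. unfold D in Y3. lra. }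
  assert (Z1 := Rle_abs (- R0 (i + d)%Z j)). rewrite Rabs_Ropp in Z1.
  assert (Z2 := Rle_abs (R0 i j)). lra.
Qed.

(** * The difference scheme *)

Definition ynode (Rs : R) (n j : Z) : R := - Rs + 2 * Rs * (IZR j / IZR n).

Definition flux (a y s t : R) : R := coef a y s t * (t - s).

(** The period and the strip are both rescaled to [n] cells of width [1/n]; up to a factor,
    the equation becomes the one below with [kap = P^2 / (2 Rs^2)]. *)
Definition residual (a Rs kap : R) (n : Z) (v : Z -> Z -> R) (i j : Z) : R :=
  flux a (ynode Rs n j) (v i j) (v (i + 1)%Z j) - flux a (ynode Rs n j) (v (i - 1)%Z j) (v i j)
  + kap * (v i (j + 1)%Z - 2 * v i j + v i (j - 1)%Z).

Definition discrete_solution (a Rs kap : R) (n : Z) (v : Z -> Z -> R) : Prop :=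
  periodic n v /\ forall i j, (0 < j < n)%Z -> residual a Rs kap n v i j = 0.

Lemma ynode_bound Rs n j : 0 < Rs -> (0 < n)%Z -> (0 <= j <= n)%Z -> Rabs (ynode Rs n j) <= Rs.
Proof.
  intros HR Hn Hj. unfold ynode. assert (0 < IZR n) by (apply IZR_lt; lia).
  assert (0 <= IZR j) by (apply IZR_le; lia). assert (IZR j <= IZR n) by (apply IZR_le; lia).
  assert (0 <= IZR j / IZR n) by (apply Rdiv_le_0_compat; lra).
  assert (IZR j / IZR n <= 1) by (apply Rle_div_l; lra).
  apply Rabs_le. nra.
Qed.

Lemma sqrt_norm_pos a y s : a <> 0 ->
  Rabs a <= sqrt (s ^ 2 + y ^ 2 + a ^ 2) /\ Rabs s <= sqrt (s ^ 2 + y ^ 2 + a ^ 2)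
  /\ 0 < sqrt (s ^ 2 + y ^ 2 + a ^ 2).
Proof.
  intro Ha. assert (A2 : 0 < a ^ 2) by (apply pow2_gt_0, Ha).
  assert (S2 := pow2_ge_0 s). assert (Y2 := pow2_ge_0 y).
  split; [|split].
  - rewrite <- sqrt_Rsqr_abs. apply sqrt_le_1_alt. unfold Rsqr. lra.
  - rewrite <- sqrt_Rsqr_abs. apply sqrt_le_1_alt. unfold Rsqr. lra.
  - apply sqrt_lt_R0. lra.
Qed.

Lemma sqrt_norm_lip a y s t : a <> 0 ->
  Rabs (sqrt (s ^ 2 + y ^ 2 + a ^ 2) - sqrt (t ^ 2 + y ^ 2 + a ^ 2)) <= Rabs (s - t).
Proof.
  intro Ha. destruct (sqrt_norm_pos a y s Ha) as (_ & S1 & S2).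
  destruct (sqrt_norm_pos a y t Ha) as (_ & T1 & T2).
  assert (A2 := pow2_ge_0 a). assert (Q1 := pow2_ge_0 s). assert (Q2 := pow2_ge_0 y).
  assert (Q3 := pow2_ge_0 t).
  assert (E1 := sqrt_sqrt (s ^ 2 + y ^ 2 + a ^ 2) ltac:(lra)).
  assert (E2 := sqrt_sqrt (t ^ 2 + y ^ 2 + a ^ 2) ltac:(lra)).
  set (S := sqrt (s ^ 2 + y ^ 2 + a ^ 2)) in *. set (T := sqrt (t ^ 2 + y ^ 2 + a ^ 2)) in *.
  replace (S - T) with ((s - t) * ((s + t) * / (S + T))).
  2:{ replace ((s - t) * ((s + t) * / (S + T))) with ((S * S - T * T) * / (S + T))
        by (rewrite E1, E2; ring). field. lra. }
  rewrite Rabs_mult. rewrite <- (Rmult_1_r (Rabs (s - t))) at 2.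
  apply Rmult_le_compat_l. apply Rabs_pos.
  rewrite Rabs_mult, (Rabs_pos_eq (/ (S + T))) by (apply Rlt_le, Rinv_0_lt_compat; lra).
  apply (Rle_div_l _ 1); try lra. assert (H := Rabs_triang s t). lra.
Qed.

Lemma coef_sym a y s t : coef a y s t = coef a y t s.
Proof. unfold coef. rewrite Rplus_comm. reflexivity. Qed.

Lemma coef_lower a y s t M Rs : a <> 0 -> Rabs y <= Rs -> Rabs s <= M -> Rabs t <= M ->
  / sqrt (M ^ 2 + Rs ^ 2 + a ^ 2) <= coef a y s t.
Proof.
  intros Ha Hy Hs Ht.
  assert (Sq : forall x X, Rabs x <= X -> x ^ 2 <= X ^ 2).
  { intros x X H. rewrite <- (pow2_abs x). apply pow_incr. split; auto. apply Rabs_pos. }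
  destruct (sqrt_norm_pos a y s Ha) as (_ & _ & S2).
  destruct (sqrt_norm_pos a y t Ha) as (_ & _ & T2).
  assert (U1 : sqrt (s ^ 2 + y ^ 2 + a ^ 2) <= sqrt (M ^ 2 + Rs ^ 2 + a ^ 2)).
  { apply sqrt_le_1_alt. specialize (Sq s M Hs) as E1. specialize (Sq y Rs Hy) as E2. lra. }
  assert (U2 : sqrt (t ^ 2 + y ^ 2 + a ^ 2) <= sqrt (M ^ 2 + Rs ^ 2 + a ^ 2)).
  { apply sqrt_le_1_alt. specialize (Sq t M Ht) as E1. specialize (Sq y Rs Hy) as E2. lra. }
  unfold coef.
  set (S := sqrt (s ^ 2 + y ^ 2 + a ^ 2)) in *. set (T := sqrt (t ^ 2 + y ^ 2 + a ^ 2)) in *.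
  set (W := sqrt (M ^ 2 + Rs ^ 2 + a ^ 2)) in *.
  apply Rle_div_r; try lra. apply (Rmult_le_reg_l W); try lra.
  replace (W * (/ W * (S + T))) with (S + T) by (field; lra). lra.
Qed.

Lemma coef_lip a y s t s' t' : a <> 0 ->
  Rabs (coef a y s t - coef a y s' t') <= (Rabs (s - s') + Rabs (t - t')) / (2 * a ^ 2).
Proof.
  intro Ha. unfold coef.
  destruct (sqrt_norm_pos a y s Ha) as (S1 & _ & S2).
  destruct (sqrt_norm_pos a y t Ha) as (T1 & _ & T2).
  destruct (sqrt_norm_pos a y s' Ha) as (S1' & _ & S2').
  destruct (sqrt_norm_pos a y t' Ha) as (T1' & _ & T2').
  assert (L1 := sqrt_norm_lip a y s s' Ha). assert (L2 := sqrt_norm_lip a y t t' Ha).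
  assert (A2 : 0 < a ^ 2) by (apply pow2_gt_0, Ha).
  assert (A1 := Rabs_pos_lt a Ha).
  set (S := sqrt (s ^ 2 + y ^ 2 + a ^ 2)) in *. set (T := sqrt (t ^ 2 + y ^ 2 + a ^ 2)) in *.
  set (S' := sqrt (s' ^ 2 + y ^ 2 + a ^ 2)) in *. set (T' := sqrt (t' ^ 2 + y ^ 2 + a ^ 2)) in *.
  replace (2 / (S + T) - 2 / (S' + T')) with
    (- ((S - S') + (T - T')) * (2 / ((S + T) * (S' + T')))) by (field; lra).
  rewrite Rabs_mult, Rabs_Ropp.
  assert (D : 0 < (S + T) * (S' + T')) by nra.
  rewrite (Rabs_pos_eq (2 / _)) by (apply Rlt_le, Rdiv_lt_0_compat; lra).
  unfold Rdiv. apply Rmult_le_compat.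
  - apply Rabs_pos.
  - apply Rlt_le, Rdiv_lt_0_compat; lra.
  - eapply Rle_trans; [apply Rabs_triang|]. lra.
  - replace (/ (2 * a ^ 2)) with (2 * / (4 * a ^ 2)) by (field; auto).
    apply Rmult_le_compat_l; try lra. apply Rinv_le_contravar. lra.
    rewrite <- (pow2_abs a). nra.
Qed.

Lemma flux_antisym a y s t : flux a y s t = - flux a y t s.
Proof. unfold flux. rewrite coef_sym. ring. Qed.

(** With [S], [T], [U] the norms at [s], [t], [t'], the increment of the flux is a positive multiple
    of [((t' - t) S + s (U - T)) + (t' T - t U)]. The first bracket is nonnegative because the norm
    is 1-Lipschitz and dominates [|s|]; the second expresses that [t / sqrt (t ^ 2 + y ^ 2 + a ^ 2)]
    increases in [t]. *)
Lemma flux_mono a y s t t' : a <> 0 -> t <= t' -> flux a y s t <= flux a y s t'.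
Proof.
  intros Ha Ht. unfold flux, coef.
  destruct (sqrt_norm_pos a y s Ha) as (_ & S1 & S2).
  destruct (sqrt_norm_pos a y t Ha) as (_ & T1 & T2).
  destruct (sqrt_norm_pos a y t' Ha) as (_ & U1 & U2).
  assert (L := sqrt_norm_lip a y t' t Ha).
  assert (A2 := pow2_ge_0 a). assert (Q2 := pow2_ge_0 y).
  assert (Q1 := pow2_ge_0 t). assert (Q3 := pow2_ge_0 t').
  assert (E1 := sqrt_sqrt (t ^ 2 + y ^ 2 + a ^ 2) ltac:(lra)).
  assert (E2 := sqrt_sqrt (t' ^ 2 + y ^ 2 + a ^ 2) ltac:(lra)).
  set (S := sqrt (s ^ 2 + y ^ 2 + a ^ 2)) in *. set (T := sqrt (t ^ 2 + y ^ 2 + a ^ 2)) in *.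
  set (U := sqrt (t' ^ 2 + y ^ 2 + a ^ 2)) in *.
  assert (M1 : 0 <= t' * T - t * U).
  { destruct (Rle_lt_dec 0 t); [|destruct (Rle_lt_dec t' 0)].
    - assert (t * t <= t' * t') by nra.
      assert (0 <= (y ^ 2 + a ^ 2) * (t' * t' - t * t)) by (apply Rmult_le_pos; lra).
      assert (T * T * (t' * t') >= U * U * (t * t)) by (rewrite E1, E2; lra).
      destruct (Rle_lt_dec 0 (t' * T - t * U)); auto. exfalso.
      assert (0 <= t' * T) by nra. assert (0 <= t * U) by nra. nra.
    - assert (t' * t' <= t * t) by nra.
      assert (0 <= (y ^ 2 + a ^ 2) * (t * t - t' * t')) by (apply Rmult_le_pos; lra).
      assert (U * U * (t * t) >= T * T * (t' * t')) by (rewrite E1, E2; lra).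
      destruct (Rle_lt_dec 0 (t' * T - t * U)); auto. exfalso.
      assert (t' * T <= 0) by nra. assert (t * U <= 0) by nra. nra.
    - nra. }
  assert (M2 : 0 <= (t' - t) * S + s * (U - T)).
  { rewrite (Rabs_pos_eq (t' - t)) in L by lra.
    assert (B := Rle_abs (- (s * (U - T)))). rewrite Rabs_Ropp, Rabs_mult in B.
    assert (Rabs s * Rabs (U - T) <= S * (t' - t)).
    { apply Rmult_le_compat; auto; apply Rabs_pos. } lra. }
  replace (2 / (S + T) * (t - s)) with (2 * (t - s) * (S + U) * / ((S + T) * (S + U)))
    by (field; lra).
  replace (2 / (S + U) * (t' - s)) with (2 * (t' - s) * (S + T) * / ((S + T) * (S + U)))
    by (field; lra).
  apply Rmult_le_compat_r.
  - apply Rlt_le, Rinv_0_lt_compat. apply Rmult_lt_0_compat; lra.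
  - nra.
Qed.

Lemma flux_mono_l a y s s' t : a <> 0 -> s <= s' -> flux a y s' t <= flux a y s t.
Proof.
  intros Ha Hs. rewrite (flux_antisym a y s' t), (flux_antisym a y s t).
  apply Ropp_le_contravar, flux_mono; auto.
Qed.

Lemma flux_lip a y s t t' : a <> 0 ->
  Rabs (flux a y s t - flux a y s t') <= 2 / Rabs a * Rabs (t - t').
Proof.
  intros Ha. unfold flux, coef.
  destruct (sqrt_norm_pos a y s Ha) as (S0 & S1 & S2).
  destruct (sqrt_norm_pos a y t Ha) as (T0 & T1 & T2).
  destruct (sqrt_norm_pos a y t' Ha) as (U0 & U1 & U2).
  assert (L := sqrt_norm_lip a y t' t Ha). assert (A1 := Rabs_pos_lt a Ha).
  set (S := sqrt (s ^ 2 + y ^ 2 + a ^ 2)) in *. set (T := sqrt (t ^ 2 + y ^ 2 + a ^ 2)) in *.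
  set (U := sqrt (t' ^ 2 + y ^ 2 + a ^ 2)) in *.
  replace (2 / (S + T) * (t - s) - 2 / (S + U) * (t' - s))
    with (2 / (S + U) * ((t - t') + (t - s) * / (S + T) * (U - T))) by (field; lra).
  rewrite Rabs_mult, (Rabs_pos_eq (2 / _)) by (apply Rlt_le, Rdiv_lt_0_compat; lra).
  assert (B : Rabs ((t - t') + (t - s) * / (S + T) * (U - T)) <= 2 * Rabs (t - t')).
  { eapply Rle_trans; [apply Rabs_triang|].
    assert (I : 0 < / (S + T)) by (apply Rinv_0_lt_compat; lra).
    assert (K : Rabs ((t - s) * / (S + T)) <= 1).
    { rewrite Rabs_mult, (Rabs_pos_eq (/ _)) by lra. apply (Rle_div_l _ 1); try lra.
      assert (H := Rabs_triang t (- s)). rewrite Rabs_Ropp in H. unfold Rminus. lra. }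
    rewrite Rabs_mult, (Rabs_minus_sym t t').
    assert (Rabs ((t - s) * / (S + T)) * Rabs (U - T) <= 1 * Rabs (t' - t))
      by (apply Rmult_le_compat; auto; apply Rabs_pos). lra. }
  apply Rle_trans with (2 / (S + U) * (2 * Rabs (t - t'))).
  { apply Rmult_le_compat_l; auto. apply Rlt_le, Rdiv_lt_0_compat; lra. }
  assert (P := Rabs_pos (t - t')).
  replace (2 / (S + U) * (2 * Rabs (t - t'))) with (4 * Rabs (t - t') * / (S + U)) by (field; lra).
  replace (2 / Rabs a * Rabs (t - t')) with (4 * Rabs (t - t') * / (2 * Rabs a)) by (field; lra).
  apply Rmult_le_compat_l; try lra. apply Rinv_le_contravar; lra.
Qed.

Lemma flux_lip2 a y s t s' t' : a <> 0 ->
  Rabs (flux a y s t - flux a y s' t') <= 2 / Rabs a * (Rabs (s - s') + Rabs (t - t')).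
Proof.
  intro Ha.
  replace (flux a y s t - flux a y s' t') with
    ((flux a y s t - flux a y s t') - (flux a y t' s - flux a y t' s')).
  2:{ rewrite (flux_antisym a y t' s), (flux_antisym a y t' s'). ring. }
  assert (H1 := flux_lip a y s t t' Ha). assert (H2 := flux_lip a y t' s s' Ha).
  eapply Rle_trans. { unfold Rminus at 1. apply Rabs_triang. }
  rewrite Rabs_Ropp. lra.
Qed.

(** * Solving the scheme by monotone iteration *)

Section Iteration.
Variables (a Rs kap M : R) (n : Z).
Hypotheses (Ha : a <> 0) (Hkap : 0 < kap) (Hn : (0 < n)%Z).

(** The flux has Lipschitz constant [2 / |a|] in each argument. The central value enters two fluxes
    and, with weight 2, the [y]-difference, so this step length keeps the relaxation increasing in
    it. *)
Let tau := / (4 / Rabs a + 2 * kap).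

Definition relax (v : Z -> Z -> R) : Z -> Z -> R := fun i j =>
  if ((0 <? j)%Z && (j <? n)%Z)%bool then v i j + tau * residual a Rs kap n v i j else v i j.

Lemma tau_pos : 0 < tau /\ tau * (4 / Rabs a + 2 * kap) = 1.
Proof.
  assert (A := Rabs_pos_lt a Ha). assert (0 < 4 / Rabs a) by (apply Rdiv_lt_0_compat; lra).
  unfold tau. split. apply Rinv_0_lt_compat; lra. field. split; nra.
Qed.

Lemma relax_mono v w : (forall i j, v i j <= w i j) -> forall i j, relax v i j <= relax w i j.
Proof.
  intros H i j. unfold relax. destruct ((0 <? j)%Z && (j <? n)%Z)%bool; auto.
  destruct tau_pos as [T0 T1]. unfold residual. set (y := ynode Rs n j).
  assert (F1 : flux a y (v i j) (v (i + 1)%Z j) <= flux a y (v i j) (w (i + 1)%Z j))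
    by (apply flux_mono; auto).
  assert (F2 : flux a y (w (i - 1)%Z j) (v i j) <= flux a y (v (i - 1)%Z j) (v i j))
    by (apply flux_mono_l; auto).
  assert (F3 := flux_lip a y (w (i - 1)%Z j) (v i j) (w i j) Ha).
  assert (F4 := flux_lip2 a y (v i j) (w (i + 1)%Z j) (w i j) (w (i + 1)%Z j) Ha).
  assert (W := H i j). rewrite (Rabs_minus_sym (v i j)), (Rabs_pos_eq (w i j - v i j)) in F3, F4 by lra.
  rewrite Rminus_diag, Rabs_R0, Rplus_0_r in F4.
  apply Rabs_le_between in F3. apply Rabs_le_between in F4.
  assert (Y1 := H i (j + 1)%Z). assert (Y2 := H i (j - 1)%Z).
  set (r1 := flux a y (v i j) (v (i + 1)%Z j)) in *.
  set (r2 := flux a y (v (i - 1)%Z j) (v i j)) in *.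
  set (r3 := flux a y (w i j) (w (i + 1)%Z j)) in *.
  set (r4 := flux a y (w (i - 1)%Z j) (w i j)) in *.
  set (r5 := flux a y (v i j) (w (i + 1)%Z j)) in *.
  set (r6 := flux a y (w (i - 1)%Z j) (v i j)) in *.
  assert (E : (r1 - r2 + kap * (v i (j + 1)%Z - 2 * v i j + v i (j - 1)%Z))
    - (r3 - r4 + kap * (w i (j + 1)%Z - 2 * w i j + w i (j - 1)%Z))
    <= (4 / Rabs a + 2 * kap) * (w i j - v i j)).
  { replace (4 / Rabs a) with (2 / Rabs a + 2 / Rabs a) by (field; apply Rabs_no_R0, Ha). nra. }
  apply (Rmult_le_compat_l tau) in E; [|lra].
  rewrite <- Rmult_assoc, T1 in E. lra.
Qed.

Lemma relax_const c i j : relax (fun _ _ => c) i j = c.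
Proof.
  unfold relax, residual, flux. destruct ((0 <? j)%Z && (j <? n)%Z)%bool; auto. ring.
Qed.

Lemma relax_periodic v : periodic n v -> periodic n (relax v).
Proof.
  intros H i j. unfold relax, residual. rewrite H.
  replace (i + n + 1)%Z with (i + 1 + n)%Z by lia. replace (i + n - 1)%Z with (i - 1 + n)%Z by lia.
  rewrite !H. reflexivity.
Qed.

(** The relaxation is order preserving and fixes constants, so its iterates decrease
    from the supersolution [M] to a solution. *)
Lemma discrete_solution_exists (bm bp : Z -> R) :
  (forall i, bm (i + n)%Z = bm i) -> (forall i, bp (i + n)%Z = bp i) ->
  (forall i, Rabs (bm i) <= M) -> (forall i, Rabs (bp i) <= M) ->
  exists v, discrete_solution a Rs kap n v /\ (forall i j, Rabs (v i j) <= M) /\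
    (forall i, v i 0%Z = bm i) /\ (forall i, v i n = bp i).
Proof.
  intros Pm Pp Bm Bp.
  (* Rows beyond the edges repeat the boundary values, so that the bound [M] holds at every node.
     Inside, the start is the constant [M], which makes the first step decreasing. *)
  set (v0 := fun i j : Z => if (j <=? 0)%Z then bm i else if (n <=? j)%Z then bp i else M).
  set (u := fun k => Nat.iter k relax v0).
  assert (Hv0 : forall i j, - M <= v0 i j <= M).
  { intros i j. unfold v0. specialize (Bm i). specialize (Bp i).
    apply Rabs_le_between in Bm. apply Rabs_le_between in Bp.
    destruct (j <=? 0)%Z, (n <=? j)%Z; lra. }
  assert (Hbd : forall k i j, (j <= 0 \/ n <= j)%Z -> u k i j = v0 i j).
  { induction k; intros i j Hj; auto. simpl. unfold relax at 1.
    replace ((0 <? j)%Z && (j <? n)%Z)%bool with false. apply IHk, Hj.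
    symmetry. apply Bool.andb_false_iff. rewrite !Z.ltb_ge. lia. }
  assert (Hlow : forall k i j, - M <= u k i j <= M).
  { induction k; auto. intros i j.
    split.
    - rewrite <- (relax_const (- M) i j). apply relax_mono. intros; apply IHk.
    - rewrite <- (relax_const M i j). apply relax_mono. intros; apply IHk. }
  assert (Hdec : forall k i j, u (S k) i j <= u k i j).
  { induction k; intros i j.
    - destruct (Z_lt_le_dec 0 j) as [H1|H1]; [destruct (Z_lt_le_dec j n) as [H2|H2]|].
      + replace (u 0%nat i j) with M. apply Hlow. unfold u, v0. simpl.
        replace (j <=? 0)%Z with false by (symmetry; apply Z.leb_gt; lia).
        replace (n <=? j)%Z with false by (symmetry; apply Z.leb_gt; lia). reflexivity.
      + rewrite !Hbd by lia. lra.
      + rewrite !Hbd by lia. lra.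
    - apply relax_mono. auto. }
  assert (Hper : forall k, periodic n (u k)).
  { induction k.
    - intros i j. unfold u, v0. simpl. rewrite Pm, Pp. reflexivity.
    - apply relax_periodic, IHk. }
  assert (Hlim : forall i j, exists l : R, is_lim_seq (fun k => u k i j) l).
  { intros i j. apply (ex_finite_lim_seq_decr _ (- M)). intro k; apply Hdec. intro; apply Hlow. }
  set (v := fun i j => real (Lim_seq (fun k => u k i j))).
  assert (Hv : forall i j, is_lim_seq (fun k => u k i j) (v i j)).
  { intros i j. destruct (Hlim i j) as [l Hl]. unfold v.
    rewrite (is_lim_seq_unique _ _ Hl). exact Hl. }
  assert (Hvb : forall i j, (j <= 0 \/ n <= j)%Z -> v i j = v0 i j).
  { intros i j Hj. unfold v. rewrite (Lim_seq_ext _ (fun _ => v0 i j)).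
    - rewrite Lim_seq_const. reflexivity.
    - intro k. apply Hbd, Hj. }
  exists v. split; [split|split; [|split]].
  - intros i j. unfold v. f_equal. apply Lim_seq_ext. intro k. apply Hper.
  - intros i j Hj. destruct tau_pos as [T0 T1].
    assert (C : forall x x' z z', is_lim_seq (fun k => u k x x') (v x x') ->
                is_lim_seq (fun k => u k z z') (v z z') ->
                is_lim_seq (fun k => flux a (ynode Rs n j) (u k x x') (u k z z'))
                           (flux a (ynode Rs n j) (v x x') (v z z'))).
    { intros x x' z z' L1 L2.
      assert (L3 : is_lim_seq (fun k => 2 / Rabs a * (Rabs (u k x x' - v x x') + Rabs (u k z z' - v z z'))) 0).
      { replace (Finite 0) with (Rbar_mult (2 / Rabs a) (Rbar_plus 0 0)) by (simpl; f_equal; ring).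
        apply is_lim_seq_scal_l. apply is_lim_seq_plus'.
        - apply (proj1 (is_lim_seq_abs_0 _)). replace (Finite 0) with (Finite (v x x' - v x x')) by (f_equal; ring).
          apply is_lim_seq_minus'; auto. apply is_lim_seq_const.
        - apply (proj1 (is_lim_seq_abs_0 _)). replace (Finite 0) with (Finite (v z z' - v z z')) by (f_equal; ring).
          apply is_lim_seq_minus'; auto. apply is_lim_seq_const. }
      apply is_lim_seq_ext with (fun k => flux a (ynode Rs n j) (v x x') (v z z') +
         (flux a (ynode Rs n j) (u k x x') (u k z z') - flux a (ynode Rs n j) (v x x') (v z z'))).
      { intro k. ring. }
      replace (Finite (flux a (ynode Rs n j) (v x x') (v z z'))) with
        (Finite (flux a (ynode Rs n j) (v x x') (v z z') + 0)) by (f_equal; ring).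
      apply is_lim_seq_plus'. apply is_lim_seq_const.
      apply (proj2 (is_lim_seq_abs_0 _)).
      apply is_lim_seq_le_le with (2 := is_lim_seq_const 0) (3 := L3).
      intro k. split. apply Rabs_pos. apply flux_lip2, Ha. }
    assert (L : is_lim_seq (fun k => residual a Rs kap n (u k) i j) (residual a Rs kap n v i j)).
    { unfold residual. apply is_lim_seq_plus'. apply is_lim_seq_minus'; apply C; apply Hv.
      apply (is_lim_seq_scal_l _ kap (Finite _)).
      apply is_lim_seq_plus'; [apply is_lim_seq_minus'|]; try apply Hv.
      apply (is_lim_seq_scal_l _ 2 (Finite _)). apply Hv. }
    (* The residual is also the increment of the iterates divided by [tau], which tends to 0. *)
    assert (L' : is_lim_seq (fun k => residual a Rs kap n (u k) i j) (/ tau * (v i j - v i j))).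
    { apply is_lim_seq_ext with (fun k => / tau * (u (S k) i j - u k i j)).
      - intro k. simpl. unfold relax at 1.
        replace ((0 <? j)%Z && (j <? n)%Z)%bool with true.
        + change (Nat.iter k relax v0) with (u k). field. lra.
        + symmetry. apply andb_true_intro. rewrite !Z.ltb_lt. lia.
      - apply (is_lim_seq_scal_l _ (/ tau) (Finite _)). apply is_lim_seq_minus'; auto.
        apply -> (is_lim_seq_incr_1 (fun k => u k i j)). apply Hv. }
    apply is_lim_seq_unique in L. apply is_lim_seq_unique in L'.
    rewrite L in L'. injection L' as ->. ring.
  - intros i j. apply Rabs_le. split.
    + apply (is_lim_seq_le (fun _ => - M) _ (- M) (v i j) (fun k => proj1 (Hlow k i j))
        (is_lim_seq_const _) (Hv i j)).
    + apply (is_lim_seq_le _ (fun _ => M) (v i j) M (fun k => proj2 (Hlow k i j))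
        (Hv i j) (is_lim_seq_const _)).
  - intro i. rewrite Hvb by lia. reflexivity.
  - intro i. rewrite Hvb by lia. unfold v0.
    replace (n <=? 0)%Z with false by (symmetry; apply Z.leb_gt; lia).
    rewrite Z.leb_refl. reflexivity.
Qed.

End Iteration.

(** * The first difference *)

Lemma ln_le_sub x : 0 < x -> ln x <= x - 1.
Proof.
  intro Hx. assert (H := exp_ineq1_le (ln x)). rewrite exp_ln in H; lra.
Qed.

(** Convexity: the tangent at [x m] lies below the graph at 0 and at [m]. *)
Lemma exp_chord m x : 0 <= x <= 1 -> exp (x * m) <= 1 + x * (exp m - 1).
Proof.
  intro Hx.
  assert (T : forall z, exp (x * m) * (1 + (z - x * m)) <= exp z).
  { intro z. replace (exp z) with (exp (x * m) * exp (z - x * m)).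
    - apply Rmult_le_compat_l. apply Rlt_le, exp_pos. apply exp_ineq1_le.
    - rewrite <- exp_plus. f_equal. ring. }
  assert (T0 := T 0). assert (T1 := T m). rewrite exp_0 in T0.
  apply (Rmult_le_compat_l (1 - x)) in T0; [|lra].
  apply (Rmult_le_compat_l x) in T1; [|lra]. nra.
Qed.

Lemma discrete_solution_opp a Rs kap n v : discrete_solution a Rs kap n v -> discrete_solution a Rs kap n (fun i j => - v i j).
Proof.
  intros [H1 H2]. split.
  - intros i j. rewrite H1. reflexivity.
  - intros i j Hj. rewrite <- Ropp_0. rewrite <- (H2 i j Hj). unfold residual, flux, coef.
    assert (E : forall s : R, (- s) ^ 2 = s ^ 2) by (intro; ring). rewrite !E. ring.
Qed.

(** [B(r) = ln (1 + K r) / kk] satisfies [B'' = - kk B'^2], which beats the quadratic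
    gradient term of the equation. *)
Lemma log_barrier a Rs kap n v M L kk K :
  a <> 0 -> 0 < Rs -> 0 < kap -> (0 < n)%Z -> 0 <= M -> 0 < L ->
  kk = 1 + 2 * sqrt ((M + 1) ^ 2 + Rs ^ 2 + a ^ 2) / a ^ 2 ->
  K = exp (kk * L) - 1 -> K <= IZR n -> discrete_solution a Rs kap n v ->
  (forall i j, (0 <= j <= n)%Z -> Rabs (v i j) <= M) ->
  (forall i j, j = 0%Z \/ j = n -> (v (i + 1)%Z j - v i j) * IZR n <= L) ->
  forall i j d, (0 <= j <= n)%Z -> (0 <= d <= n)%Z ->
    v (i + d)%Z j - v i j <= ln (1 + K * (IZR d / IZR n)) / kk.
Proof.
  intros Ha HRs Hkap Hn HM HL Hkk HK HKn [Hper Heq] HvM Hb.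
  assert (N0 : 0 < IZR n) by (apply IZR_lt; lia).
  assert (A2 : 0 < a ^ 2) by (apply pow2_gt_0, Ha).
  set (W := sqrt ((M + 1) ^ 2 + Rs ^ 2 + a ^ 2)) in *.
  assert (W0 : 0 < W).
  { unfold W. apply sqrt_lt_R0. assert (0 <= (M + 1) ^ 2) by apply pow2_ge_0.
    assert (0 <= Rs ^ 2) by apply pow2_ge_0. lra. }
  assert (WA : 0 < W / a ^ 2) by (apply Rdiv_lt_0_compat; lra).
  assert (kk1 : 1 <= kk).
  { rewrite Hkk. replace (2 * W / a ^ 2) with (2 * (W / a ^ 2)) by (field; lra). lra. }
  assert (K0 : 0 < K).
  { rewrite HK. assert (H := exp_ineq1_le (kk * L)). nra. }
  set (B := fun d : Z => ln (1 + K * (IZR d / IZR n)) / kk).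
  assert (ln_nonneg : forall x, 1 <= x -> 0 <= ln x).
  { intros x Hx. rewrite <- ln_1. destruct (Req_dec 1 x) as [<-|]. lra.
    apply Rlt_le, ln_increasing; lra. }
  assert (Bpos : forall d, (0 <= d)%Z -> 0 <= B d).
  { intros d Hd. unfold B. apply Rdiv_le_0_compat; try lra. apply ln_nonneg.
    assert (0 <= IZR d / IZR n). { apply Rdiv_le_0_compat; auto. apply IZR_le; lia. } nra. }
  apply (doubling n v B n); auto; try lia.
  - apply Bpos; lia.
  - intros i j Hj. rewrite Hper, Rminus_diag. apply Bpos; lia.
  (* On the boundary rows an increment is at most [L] times the distance. [K] is chosen so that the
     barrier equals [L] at distance 1, and a concave function lies above its chord. *)
  - assert (Hbd : forall i j d, j = 0%Z \/ j = n -> (0 <= d <= n)%Z ->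
              v (i + d)%Z j - v i j <= B d).
    { intros i j d Hj Hd.
      assert (Hlin : v (i + d)%Z j - v i j <= IZR d * (L / IZR n)).
      { destruct Hd as [Hd _]. revert d Hd. apply natlike_ind.
        - rewrite Z.add_0_r. lra.
        - intros d Hd IH. unfold Z.succ. rewrite plus_IZR.
          assert (H := Hb (i + d)%Z j Hj). rewrite Z.add_assoc.
          apply Rle_div_r in H; auto. lra. }
      eapply Rle_trans; [apply Hlin|]. unfold B.
      apply (proj1 (Rle_div_r _ _ kk ltac:(lra))).
      set (x := IZR d / IZR n).
      assert (Hx : 0 <= x <= 1).
      { unfold x. split. apply Rdiv_le_0_compat; auto. apply IZR_le; lia.
        apply Rle_div_l; auto. rewrite Rmult_1_l. apply IZR_le; lia. }
      replace (IZR d * (L / IZR n) * kk) with (x * (kk * L)) by (unfold x; field; lra).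
      replace (x * (kk * L)) with (ln (exp (x * (kk * L)))) by apply ln_exp.
      assert (E := exp_chord (kk * L) x Hx).
      destruct E as [E|E].
      + apply Rlt_le, ln_increasing. apply exp_pos. rewrite HK. lra.
      + rewrite E, HK. right. f_equal. ring. }
    intros i d Hd. split; apply Hbd; auto.
  - intros i j d s Hj Hd Hs Hc Hall.
    assert (D1 : 1 <= IZR d) by (apply IZR_le; lia).
    set (X := 1 + K * (IZR d / IZR n)). set (del := K / IZR n).
    assert (del0 : 0 <= del) by (unfold del; apply Rdiv_le_0_compat; lra).
    assert (del1 : del <= 1) by (unfold del; apply Rle_div_l; lra).
    assert (HX : X = 1 + del * IZR d) by (unfold X, del; field; lra).
    assert (X1 : 1 + del <= X) by (rewrite HX; nra).
    (* [e] is the relative step of the argument of the logarithm. The threshold [K <= IZR n] gives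
       [del <= 1], hence [e <= 1 / 2], which controls the logarithm of [1 - e]. *)
    set (e := del / X).
    assert (e0 : 0 <= e) by (unfold e; apply Rdiv_le_0_compat; lra).
    assert (e1 : e <= 1 / 2). { unfold e. apply (proj2 (Rle_div_l _ _ X ltac:(lra))). lra. }
    set (p := ln (1 + e) / kk). set (q := - ln (1 - e) / kk).
    assert (Hp : B (d + 1)%Z - B d = p).
    { unfold B, p. rewrite plus_IZR. fold X.
      replace (1 + K * ((IZR d + 1) / IZR n)) with (X * (1 + e)).
      - rewrite ln_mult by lra. field. lra.
      - replace (X * (1 + e)) with (X + del) by (unfold e; field; lra).
        unfold X, del. field. lra. }
    assert (Hq : B d - B (d - 1)%Z = q).
    { unfold B, q. rewrite minus_IZR. fold X.
      replace (1 + K * ((IZR d - 1) / IZR n)) with (X * (1 - e)).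
      - rewrite ln_mult by lra. field. lra.
      - replace (X * (1 - e)) with (X - del) by (unfold e; field; lra).
        unfold X, del. field. lra. }
    assert (p0 : 0 <= p).
    { unfold p. apply Rdiv_le_0_compat; try lra. apply ln_nonneg. lra. }
    assert (pe : p * kk <= e).
    { unfold p. replace (ln (1 + e) / kk * kk) with (ln (1 + e)) by (field; lra).
      assert (H := ln_le_sub (1 + e) ltac:(lra)). lra. }
    assert (qe : q * kk <= 2 * e).
    { unfold q. replace (- ln (1 - e) / kk * kk) with (- ln (1 - e)) by (field; lra).
      rewrite <- ln_Rinv by lra.
      assert (H := ln_le_sub (/ (1 - e)) ltac:(apply Rinv_0_lt_compat; lra)).
      assert (/ (1 - e) <= 1 + 2 * e).
      { apply (Rmult_le_reg_l (1 - e)); try lra. rewrite Rinv_r by lra. nra. }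
      lra. }
    (* The discrete form of [B'' = - kk B' ^ 2]: [p] and [q] are at most of order [e / kk], while
       their difference is at least [e ^ 2 / kk]. *)
    assert (qp : e ^ 2 <= (q - p) * kk).
    { replace ((q - p) * kk) with (- (ln (1 - e) + ln (1 + e))) by (unfold p, q; field; lra).
      rewrite <- ln_mult by lra.
      assert (H := ln_le_sub ((1 - e) * (1 + e)) ltac:(nra)). nra. }
    assert (q1 : 0 <= q <= 1) by (split; nra).
    assert (p1 : p <= 1) by nra.
    set (y := ynode Rs n j). set (t := v i j). set (u := v (i + d)%Z j).
    assert (I1 := Hall i j (d + 1)%Z ltac:(lia) ltac:(lia)).
    assert (I2 := Hall i j (d - 1)%Z ltac:(lia) ltac:(lia)).
    assert (I3 := Hall (i + 1)%Z j (d - 1)%Z ltac:(lia) ltac:(lia)).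
    assert (I4 := Hall (i - 1)%Z j (d + 1)%Z ltac:(lia) ltac:(lia)).
    assert (I5 := Hall i (j + 1)%Z d ltac:(lia) ltac:(lia)).
    assert (I6 := Hall i (j - 1)%Z d ltac:(lia) ltac:(lia)).
    replace (i + (d + 1))%Z with (i + d + 1)%Z in I1 by lia.
    replace (i + (d - 1))%Z with (i + d - 1)%Z in I2 by lia.
    replace (i + 1 + (d - 1))%Z with (i + d)%Z in I3 by lia.
    replace (i - 1 + (d + 1))%Z with (i + d)%Z in I4 by lia.
    assert (E1 := Heq (i + d)%Z j Hj). assert (E2 := Heq i j Hj).
    unfold residual in E1, E2. fold y t u in E1, E2, I1, I2, I3, I4, I5, I6, Hc.
    (* Monotonicity of the flux replaces the unknown neighbours by the extreme values that the
       barrier allows, so that all four fluxes involve only [u], [t], [p] and [q]. *)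
    assert (F1 : flux a y u (v (i + d + 1)%Z j) <= flux a y u (u + p))
      by (apply flux_mono; auto; lra).
    assert (F2 : flux a y (u - q) u <= flux a y (v (i + d - 1)%Z j) u)
      by (apply flux_mono_l; auto; lra).
    assert (F3 : flux a y t (t + q) <= flux a y t (v (i + 1)%Z j))
      by (apply flux_mono; auto; lra).
    assert (F4 : flux a y (v (i - 1)%Z j) t <= flux a y (t - p) t)
      by (apply flux_mono_l; auto; lra).
    assert (F : 0 <= flux a y u (u + p) - flux a y (u - q) u - flux a y t (t + q)
                     + flux a y (t - p) t).
    { assert (0 <= kap * (2 * (u - t) - (v (i + d)%Z (j + 1)%Z - v i (j + 1)%Z)
        - (v (i + d)%Z (j - 1)%Z - v i (j - 1)%Z))) by (apply Rmult_le_pos; lra). lra. }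
    unfold flux in F.
    assert (Hy : Rabs y <= Rs) by (apply ynode_bound; auto; lia).
    assert (Hu : Rabs u <= M) by (apply HvM; lia).
    assert (Ht : Rabs t <= M) by (apply HvM; lia).
    apply Rabs_le_between in Hu. apply Rabs_le_between in Ht.
    (* As [q <= 1], the shifted arguments stay within [M + 1], the bound built into [W]. *)
    assert (C1 : / W <= coef a y (u - q) u) by (apply coef_lower; auto; apply Rabs_le; lra).
    assert (C2 : / W <= coef a y t (t + q)) by (apply coef_lower; auto; apply Rabs_le; lra).
    assert (C3 := coef_lip a y u (u + p) (u - q) u Ha).
    assert (C4 := coef_lip a y (t - p) t t (t + q) Ha).
    replace (u - (u - q)) with q in C3 by ring. replace (u + p - u) with p in C3 by ring.
    replace (t - p - t) with (- p) in C4 by ring. replace (t - (t + q)) with (- q) in C4 by ring.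
    rewrite ?Rabs_Ropp, (Rabs_pos_eq p), (Rabs_pos_eq q) in C3 by lra.
    rewrite !Rabs_Ropp, (Rabs_pos_eq p), (Rabs_pos_eq q) in C4 by lra.
    apply Rabs_le_between in C3. apply Rabs_le_between in C4.
    replace (u + p - u) with p in F by ring. replace (u - (u - q)) with q in F by ring.
    replace (t + q - t) with q in F by ring. replace (t - (t - p)) with p in F by ring.
    set (c1 := coef a y u (u + p)) in *. set (c2 := coef a y (u - q) u) in *.
    set (c3 := coef a y t (t + q)) in *. set (c4 := coef a y (t - p) t) in *.
    (* Ellipticity against the variation of the coefficients. The left side is at least of order
       [e ^ 2 / kk] and the right side at most of order [e ^ 2 / kk ^ 2], so a large [kk] gives the
       contradiction. *)
    assert (Z : (q - p) * (c2 + c3) <= p * ((p + q) / a ^ 2)).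
    { replace ((p + q) / a ^ 2) with ((p + q) / (2 * a ^ 2) + (p + q) / (2 * a ^ 2)) by (field; lra).
      assert (p * (c1 - c2) <= p * ((p + q) / (2 * a ^ 2))) by (apply Rmult_le_compat_l; lra).
      assert (p * (c4 - c3) <= p * ((p + q) / (2 * a ^ 2))) by (apply Rmult_le_compat_l; lra).
      lra. }
    assert (qp0 : 0 <= q - p).
    { apply (Rmult_le_reg_r kk); [lra|]. rewrite Rmult_0_l.
      apply Rle_trans with (2 := qp). apply pow2_ge_0. }
    assert (Z2 : (q - p) * (2 * / W) <= p * ((p + q) / a ^ 2)).
    { apply Rle_trans with (2 := Z). apply Rmult_le_compat_l; lra. }
    assert (Z3 : (q - p) * kk * (2 * kk) * a ^ 2 <= (p * kk) * ((p + q) * kk) * W).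
    { apply (Rmult_le_compat_r (W * a ^ 2 * (kk * kk))) in Z2.
      - replace ((q - p) * (2 * / W) * (W * a ^ 2 * (kk * kk))) with ((q - p) * kk * (2 * kk) * a ^ 2)
          in Z2 by (field; lra).
        replace (p * ((p + q) / a ^ 2) * (W * a ^ 2 * (kk * kk))) with ((p * kk) * ((p + q) * kk) * W)
          in Z2 by (field; lra). exact Z2.
      - apply Rmult_le_pos; apply Rmult_le_pos; lra. }
    assert (Z4 : (p * kk) * ((p + q) * kk) <= 3 * e ^ 2).
    { replace (3 * e ^ 2) with (e * (3 * e)) by ring.
      apply Rmult_le_compat; try lra; apply Rmult_le_pos; lra. }
    assert (kW : kk * a ^ 2 = a ^ 2 + 2 * W) by (rewrite Hkk; field; lra).
    assert (ep : 0 < e) by (apply Rdiv_lt_0_compat; [unfold del; apply Rdiv_lt_0_compat|]; lra).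
    assert (e2 : 0 < e ^ 2) by (apply pow_lt, ep).
    assert (Z5 : e ^ 2 * (2 * (a ^ 2 + 2 * W)) <= 3 * e ^ 2 * W).
    { rewrite <- kW. apply Rle_trans with ((q - p) * kk * (2 * kk) * a ^ 2).
      - replace (e ^ 2 * (2 * (kk * a ^ 2))) with (e ^ 2 * ((2 * kk) * a ^ 2)) by ring.
        replace ((q - p) * kk * (2 * kk) * a ^ 2) with ((q - p) * kk * ((2 * kk) * a ^ 2)) by ring.
        apply Rmult_le_compat_r; auto. apply Rmult_le_pos; lra.
      - eapply Rle_trans; [apply Z3|]. apply Rmult_le_compat_r; lra. }
    assert (0 < e ^ 2 * (2 * a ^ 2 + W)) by (apply Rmult_lt_0_compat; lra). lra.
Qed.

(** The barrier over one cell is at most [K / n], which bounds the quotient from above; the lower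
    bound is the same statement for [- v], the scheme being odd. Using [L + 1] makes the boundary
    slope positive, and the threshold on [n] is the one the logarithmic barrier asks for. *)
Lemma lipschitz_first a Rs kap M L : a <> 0 -> 0 < Rs -> 0 < kap -> 0 <= M -> 0 <= L ->
  exists B, forall n v, (0 < n)%Z -> B <= IZR n -> discrete_solution a Rs kap n v ->
  (forall i j, (0 <= j <= n)%Z -> Rabs (v i j) <= M) ->
  (forall i j, j = 0%Z \/ j = n -> Rabs ((v (i + 1)%Z j - v i j) * IZR n) <= L) ->
  forall i j, (0 <= j <= n)%Z -> Rabs ((v (i + 1)%Z j - v i j) * IZR n) <= B.
Proof.
  intros Ha HR Hk HM HL.
  set (kk := 1 + 2 * sqrt ((M + 1) ^ 2 + Rs ^ 2 + a ^ 2) / a ^ 2).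
  set (K := exp (kk * (L + 1)) - 1).
  assert (A2 : 0 < a ^ 2) by (apply pow2_gt_0, Ha).
  assert (kk1 : 1 <= kk).
  { assert (0 <= 2 * sqrt ((M + 1) ^ 2 + Rs ^ 2 + a ^ 2) / a ^ 2); [|unfold kk; lra].
    apply Rdiv_le_0_compat; auto. apply Rmult_le_pos; [lra|apply sqrt_pos]. }
  assert (K0 : 0 < K).
  { assert (H := exp_ineq1_le (kk * (L + 1))). unfold K. nra. }
  exists K. intros n v Hn HKn Hv HM' Hb.
  assert (N0 : 0 < IZR n) by (apply IZR_lt; lia).
  assert (Main : forall w, discrete_solution a Rs kap n w -> (forall i j, (0 <= j <= n)%Z -> Rabs (w i j) <= M) ->
    (forall i j, j = 0%Z \/ j = n -> Rabs ((w (i + 1)%Z j - w i j) * IZR n) <= L) ->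
    forall i j, (0 <= j <= n)%Z -> (w (i + 1)%Z j - w i j) * IZR n <= K).
  { intros w Hw HwM Hwb i j Hj.
    assert (H := log_barrier a Rs kap n w M (L + 1) kk K Ha HR Hk Hn HM ltac:(lra) eq_refl eq_refl
      HKn Hw HwM).
    assert (H2 := H ltac:(intros i' j' Hj'; specialize (Hwb i' j' Hj');
      apply Rabs_le_between in Hwb; lra) i j 1%Z Hj ltac:(lia)).
    assert (P : 0 < 1 / IZR n) by (apply Rdiv_lt_0_compat; lra).
    assert (H3 := ln_le_sub (1 + K * (1 / IZR n)) ltac:(nra)).
    assert (H4 : ln (1 + K * (1 / IZR n)) / kk <= K * (1 / IZR n)).
    { apply (proj2 (Rle_div_l _ _ kk ltac:(lra))).
      assert (0 <= K * (1 / IZR n)) by (apply Rmult_le_pos; lra). nra. }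
    apply Rle_trans with (K * (1 / IZR n) * IZR n).
    - apply Rmult_le_compat_r; lra.
    - right. field. lra. }
  intros i j Hj. apply Rabs_le. split.
  - assert (H := Main _ (discrete_solution_opp _ _ _ _ _ Hv)
      ltac:(intros i' j' H; cbv beta; rewrite Rabs_Ropp; auto)
      ltac:(intros i' j' H; cbv beta; rewrite <- Rabs_Ropp;
            replace (- ((- v (i' + 1)%Z j' - - v i' j') * IZR n)) with ((v (i' + 1)%Z j' - v i' j') * IZR n)
              by ring; auto) i j Hj). lra.
  - apply Main; auto.
Qed.

(** * Higher differences in the periodic direction *)

Section Powers.
Variable alpha : R.
Hypothesis Hal : 0 < alpha < 1.

Lemma pw_pos x : 0 < Rpower x alpha.
Proof. apply exp_pos. Qed.

Lemma pw_mono x y : 0 < x -> x <= y -> Rpower x alpha <= Rpower y alpha.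
Proof. intros. apply Rle_Rpower_l; lra. Qed.

Lemma pw_le1 x : 0 < x <= 1 -> x <= Rpower x alpha <= 1.
Proof.
  intros [H1 H2]. assert (L : ln x <= 0).
  { rewrite <- ln_1. destruct H2 as [H2| ->]; [|lra]. apply Rlt_le, ln_increasing; lra. }
  split.
  - rewrite <- (Rpower_1 x) at 1 by lra. unfold Rpower.
    assert (alpha * ln x >= 1 * ln x) by nra.
    destruct (Req_dec (1 * ln x) (alpha * ln x)) as [->|]; [lra|].
    apply Rlt_le, exp_increasing. lra.
  - unfold Rpower. rewrite <- exp_0. assert (alpha * ln x <= 0) by nra.
    destruct (Req_dec (alpha * ln x) 0) as [->|]; [lra|].
    apply Rlt_le, exp_increasing. lra.
Qed.

Lemma pw_ge1 x : 1 <= x -> 1 <= Rpower x alpha.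
Proof.
  intro H. rewrite <- (Rpower_O 1) at 1 by lra. replace (Rpower 1 0) with (Rpower 1 alpha).
  - apply pw_mono; lra.
  - unfold Rpower. rewrite ln_1, !Rmult_0_r. reflexivity.
Qed.

Lemma pw_mult x y : 0 < x -> 0 < y -> Rpower (x * y) alpha = Rpower x alpha * Rpower y alpha.
Proof. intros. symmetry. apply Rpower_mult_distr; auto. Qed.

(** An affine majorant of the power at the scale [d], through which Hoelder data are compared with a
    barrier. Below [d] monotonicity suffices, and above it [r ^ alpha <= r] for [r = x / d]. *)
Lemma pw_tangent x d : 0 < x -> 0 < d ->
  Rpower x alpha <= Rpower d alpha + Rpower d alpha / d * x.
Proof.
  intros Hx Hd. assert (P := pw_pos d).
  assert (Q : 0 < Rpower d alpha / d) by (apply Rdiv_lt_0_compat; auto).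
  destruct (Rle_lt_dec x d) as [H|H].
  - assert (Rpower x alpha <= Rpower d alpha) by (apply pw_mono; auto). nra.
  - set (r := x / d). assert (Hr : 1 < r) by (unfold r; apply Rlt_div_r; lra).
    replace x with (r * d) at 1 by (unfold r; field; lra).
    rewrite pw_mult by lra. replace (Rpower d alpha / d * x) with (r * Rpower d alpha)
      by (unfold r; field; lra).
    assert (Rpower r alpha <= r).
    { rewrite <- (Rpower_1 r) at 2 by lra. apply Rle_Rpower; lra. }
    nra.
Qed.

Lemma pw_double x : 0 < x -> Rpower (2 * x) alpha <= 2 * Rpower x alpha.
Proof.
  intro Hx. assert (H := pw_tangent (2 * x) x ltac:(lra) Hx).
  rewrite pw_mult by lra. apply Rmult_le_compat_r. apply Rlt_le, pw_pos.
  rewrite <- (Rpower_1 2) at 2 by lra. apply Rle_Rpower; lra.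
Qed.

End Powers.

(** A row seen from a moving node becomes a member of a family with a single row. *)
Definition recenter {T T'} (pi : T' -> T) (I J : T' -> Z) (f : grid T) : grid T' :=
  fun x s _ => f (pi x) (I x + s)%Z (J x).

Lemma recenter_dxn {T T'} (n : T -> R) (pi : T' -> T) (I J : T' -> Z) p f :
  dxn (fun x => n (pi x)) p (recenter pi I J f) = recenter pi I J (dxn n p f).
Proof.
  revert f. induction p; intro f; auto. rewrite !dxn_S, <- IHp. f_equal.
  grid_ext. unfold dquot, shift, recenter. rewrite Z.add_assoc. reflexivity.
Qed.

Lemma dxn_succ {T} (n : T -> R) p f t i j :
  dxn n (S p) f t i j = (dxn n p f t (i + 1)%Z j - dxn n p f t i j) * n t.
Proof. reflexivity. Qed.

(** * The differenced equation and its remainder *)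

Section Families.
Context {T : Type}.
Variables (N : T -> Z) (a Rs kap : R) (v : grid T).
Hypotheses (HN : forall t, (0 < N t)%Z) (Ha : a <> 0) (HRs : 0 < Rs) (Hkap : 0 < kap).

Definition mesh (t : T) : R := IZR (N t).

Lemma mesh_pos t : 0 < mesh t.
Proof. apply IZR_lt, HN. Qed.

Definition edge_coef : grid T := fun t i j => coef a (ynode Rs (N t) j) (v t i j) (v t (i + 1)%Z j).

(** Differencing the flux and removing its principal part leaves, up to sign, the right-hand side of
    the linear equation for [D^m v]. *)
Definition flux_remainder (m : nat) : grid T := fun t i j =>
  dxn mesh (S m) (fun t i j => edge_coef t i j * dquot mesh false v t i j) t i j
  - edge_coef t i j * dxn mesh (S (S m)) v t i j.

(** Every quadruple in [P] becomes a one-row family recentred at [(I, J)] with weight [K], so that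
    the constant of the commutator estimate is uniform over all nodes and all sizes [K]. In each
    member the height is a constant and only [x]-differences occur. *)
Lemma remainder_bound m M (P : T -> Z -> Z -> R -> Prop) : (1 <= m)%nat ->
  (forall p t i j, (p <= m)%nat -> (0 <= j <= N t)%Z -> Rabs (dxn mesh p v t i j) <= M) ->
  (forall t I J K, P t I J K -> (0 <= J <= N t)%Z /\ 1 <= K /\
     forall s, Rabs (dxn mesh (S m) v t (I + s)%Z J) <= K * (1 + Rabs (IZR s))) ->
  exists B, 0 <= B /\ forall t I J K, P t I J K -> Rabs (flux_remainder m t I J) <= B * K.
Proof.
  intros Hm HM HP.
  set (T' := {x : T * Z * Z * R | let '(t, i, j, k) := x in P t i j k}).
  set (pi := fun x : T' => fst (fst (fst (proj1_sig x)))).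
  set (I := fun x : T' => snd (fst (fst (proj1_sig x)))).
  set (J := fun x : T' => snd (fst (proj1_sig x))).
  set (K := fun x : T' => snd (proj1_sig x)).
  assert (HP' : forall x, P (pi x) (I x) (J x) (K x)).
  { intros [[[[t i] j] k] H]. exact H. }
  set (n' := fun x => mesh (pi x)).
  assert (Hn' : forall x, 0 < n' x) by (intro; apply mesh_pos).
  assert (HK : forall x, 1 <= K x) by (intro x; apply (HP _ _ _ _ (HP' x))).
  assert (G := bounded_modulus_stable_class _ (Qlip_admissible n' K Hn' HK)).
  assert (Gm := stable_class_diff_class n' (false :: nil) m _ G).
  set (u := recenter pi I J v).
  set (y := (fun x _ _ => ynode Rs (N (pi x)) (J x)) : grid T').
  assert (Hu : diff_class n' (false :: nil) m (bounded_modulus (Qlip n' K)) u).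
  { apply dxn_diff_class. intros p Hp. unfold u, n'. rewrite recenter_dxn.
    destruct (le_lt_eq_dec _ _ Hp) as [Hp'| ->].
    - apply bounded_modulus_Qlip_of_lip with (B := M); auto. intros x i j.
      destruct (HP _ _ _ _ (HP' x)) as (HJ & _ & _). split.
      + apply HM; auto.
      + replace (dquot (fun x => mesh (pi x)) false (recenter pi I J (dxn mesh p v)) x i j)
          with (recenter pi I J (dxn mesh (S p) v) x i j).
        * apply HM; auto.
        * unfold recenter, dquot, shift. rewrite dxn_succ, Z.add_assoc. reflexivity.
    - apply bounded_modulus_Qlip_intro with (B := Rmax M 1); auto.
      { apply Rle_trans with (2 := Rmax_r _ _). lra. }
      intros x i j. destruct (HP _ _ _ _ (HP' x)) as (HJ & HK1 & Hs). split.
      + apply Rle_trans with M. apply HM; auto. apply Rmax_l.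
      + replace (dquot (fun x => mesh (pi x)) false (recenter pi I J (dxn mesh m v)) x i j)
          with (recenter pi I J (dxn mesh (S m) v) x i j).
        * apply Rle_trans with (1 := Hs i). assert (1 <= Rmax M 1) by apply Rmax_r.
          assert (0 <= Rabs (IZR i)) by apply Rabs_pos.
          assert (0 <= K x * (1 + Rabs (IZR i))) by (apply Rmult_le_pos; lra). nra.
        * unfold recenter, dquot, shift. rewrite dxn_succ, Z.add_assoc. reflexivity. }
  assert (Hy : diff_class n' (false :: nil) m (bounded_modulus (Qlip n' K)) y).
  { apply dxn_diff_class. intros p Hp. destruct p.
    - apply bounded_modulus_Qlip_of_lip with (B := Rs); auto. intros x i j.
      destruct (HP _ _ _ _ (HP' x)) as (HJ & _ & _). split.
      + apply ynode_bound; auto.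
      + unfold dquot, shift, dxn, y. simpl. rewrite Rminus_diag, Rmult_0_l, Rabs_R0. lra.
    - apply grid_eq with (1 := g_const _ G 0).
      rewrite dxn_S. replace (dquot n' false y) with (fun (_ : T') (_ _ : Z) => 0).
      + clear. induction p; auto. intros t i j. rewrite dxn_succ, <- !IHp. ring.
      + grid_ext. unfold dquot, shift, y. ring. }
  assert (Hc := stable_class_coef _ a u y Ha Gm Hu Hy).
  destruct (commutator_bound n' K _ u m Hn' HK Hm Hc Hu) as (B & HB & HB').
  exists B. split; auto. intros t I0 J0 K0 H0.
  specialize (HB' (exist _ (t, I0, J0, K0) H0) 0%Z 0%Z).
  rewrite Rabs_R0, Rplus_0_r, Rmult_1_r in HB'. unfold K in HB' at 1. simpl snd in HB'.
  eapply Rle_trans; [|apply HB']. right. f_equal.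
  replace (fun (t : T') i j => coef a (y t i j) (u t i j) (u t (i + 1)%Z j) * dquot n' false u t i j)
    with (recenter pi I J (fun t i j => edge_coef t i j * dquot mesh false v t i j)).
  - unfold flux_remainder, n', u. rewrite !recenter_dxn. unfold recenter, y, pi, I, J, edge_coef. simpl proj1_sig.
    cbv beta iota zeta. simpl fst. simpl snd. rewrite !Z.add_0_r. reflexivity.
  - extensionality x. extensionality i. extensionality j. unfold recenter, edge_coef, y, u, dquot, shift, n', recenter. rewrite !Z.add_assoc. reflexivity.
Qed.

Hypothesis Hsol : forall t, discrete_solution a Rs kap (N t) (v t).

Lemma dxn_periodic p t : periodic (N t) (dxn mesh p v t).
Proof.
  induction p; intros i j. apply Hsol.
  rewrite !dxn_succ. replace (i + N t + 1)%Z with (i + 1 + N t)%Z by lia.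
  rewrite !IHp. reflexivity.
Qed.

(** A flux is attached to the left end of its edge, hence the node [i - 1]. *)
Lemma dxn_equation m t i j : (0 < j < N t)%Z ->
  dxn mesh (S m) (fun t i j => edge_coef t i j * dquot mesh false v t i j) t (i - 1)%Z j
  + kap * mesh t ^ 2 * (dxn mesh m v t i (j + 1)%Z - 2 * dxn mesh m v t i j
                      + dxn mesh m v t i (j - 1)%Z) = 0.
Proof.
  intro Hj. rewrite dxn_S. revert i. induction m; intro i.
  - destruct (Hsol t) as [_ H]. specialize (H i j Hj). unfold residual, flux in H.
    simpl. unfold dquot, shift, edge_coef. replace (i - 1 + 1)%Z with i by lia.
    apply (f_equal (fun z => mesh t ^ 2 * z)) in H. rewrite Rmult_0_r in H. rewrite <- H. ring.
  - assert (H1 := IHm (i + 1)%Z). assert (H2 := IHm i).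
    replace (i + 1 - 1)%Z with (i - 1 + 1)%Z in H1 by lia.
    rewrite !dxn_succ.
    transitivity (mesh t * 0 - mesh t * 0); [|ring]. rewrite <- H1 at 1. rewrite <- H2. ring.
Qed.

Lemma dxn_elliptic m t i j : (0 < j < N t)%Z ->
  edge_coef t (i - 1)%Z j * (dxn mesh m v t (i + 1)%Z j - 2 * dxn mesh m v t i j + dxn mesh m v t (i - 1)%Z j)
  + kap * (dxn mesh m v t i (j + 1)%Z - 2 * dxn mesh m v t i j + dxn mesh m v t i (j - 1)%Z)
  = - flux_remainder m t (i - 1)%Z j * (/ mesh t) ^ 2.
Proof.
  intro Hj. assert (H := dxn_equation m t i j Hj). assert (P := mesh_pos t).
  unfold flux_remainder.
  assert (E : dxn mesh (S (S m)) v t (i - 1)%Z j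
     = mesh t ^ 2 * (dxn mesh m v t (i + 1)%Z j - 2 * dxn mesh m v t i j + dxn mesh m v t (i - 1)%Z j)).
  { rewrite !dxn_succ. replace (i - 1 + 1)%Z with i by lia. ring. }
  rewrite E. set (X := dxn mesh (S m) _ t (i - 1)%Z j) in *.
  replace X with (- (kap * mesh t ^ 2 * (dxn mesh m v t i (j + 1)%Z - 2 * dxn mesh m v t i j
                      + dxn mesh m v t i (j - 1)%Z))) by lra.
  field. lra.
Qed.

Lemma edge_coef_lower M t i j : (forall i j, (0 <= j <= N t)%Z -> Rabs (v t i j) <= M) ->
  (0 <= j <= N t)%Z -> / sqrt (M ^ 2 + Rs ^ 2 + a ^ 2) <= edge_coef t i j.
Proof.
  intros HM Hj. apply coef_lower; auto. apply ynode_bound; auto.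
Qed.

End Families.

Lemma range_exists r0 h : 0 < h -> h <= r0 -> exists q, (0 < q)%Z /\ r0 <= IZR q * h <= 2 * r0.
Proof.
  intros Hh Hr. exists (up (r0 / h)). destruct (archimed (r0 / h)) as [H1 H2].
  assert (1 <= r0 / h) by (apply Rle_div_r; lra).
  split. { apply lt_IZR. lra. }
  assert (E : r0 = r0 / h * h) by (field; lra).
  set (x := r0 / h) in *. split; nra.
Qed.

Lemma increment_sum n (w : Z -> Z -> R) L i j d : 0 < n -> (0 <= d)%Z ->
  (forall i, (w (i + 1)%Z j - w i j) * n <= L) -> w (i + d)%Z j - w i j <= L * (IZR d * / n).
Proof.
  intros Hn Hd H. revert d Hd. apply natlike_ind.
  - rewrite Z.add_0_r. lra.
  - intros d Hd IH. unfold Z.succ. rewrite plus_IZR, Z.add_assoc.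
    specialize (H (i + d)%Z). apply Rle_div_r in H; auto. unfold Rdiv in H. lra.
Qed.

(** * Lipschitz and Hoelder estimates with the quadratic barrier *)

Section Families.
Context {T : Type}.
Variables (N : T -> Z) (a Rs kap : R) (v : grid T).
Hypotheses (HN : forall t, (0 < N t)%Z) (Ha : a <> 0) (HRs : 0 < Rs) (Hkap : 0 < kap).
Hypothesis Hsol : forall t, discrete_solution a Rs kap (N t) (v t).
Notation D p := (dxn (mesh N) p v).

Variables (m : nat) (M : R).
Hypothesis Hm : (1 <= m)%nat.
Hypothesis HM : forall p t i j, (p <= m)%nat -> (0 <= j <= N t)%Z -> Rabs (D p t i j) <= M.

Lemma sup_nonneg : T -> 0 <= M.
Proof.
  intro t. apply Rle_trans with (2 := HM 0%nat t 0%Z 0%Z ltac:(lia) ltac:(specialize (HN t); lia)).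
  apply Rabs_pos.
Qed.

(** Both signs of [D m] are treated at once. The remainders sit on the edges to the left of the two
    ends, where contact bounds the slope on one side only. The other side comes from the edge to the
    right and the second difference, whence the terms with [D (S (S m))]. *)
Lemma barrier_family lam th b s q t : 0 < lam ->
  (forall i j, (0 <= j <= N t)%Z -> lam <= edge_coef N a Rs v t i j) ->
  0 <= b -> 0 < s -> 0 <= th -> (0 <= q)%Z -> 2 * th * (IZR q * / mesh N t) <= 1 ->
  2 * M <= quad_barrier (/ mesh N t) b s th q ->
  (forall i j d, j = 0%Z \/ j = N t -> (0 <= d <= q)%Z ->
      Rabs (D m t (i + d)%Z j - D m t i j) <= quad_barrier (/ mesh N t) b s th d) ->
  (forall i j d, (0 < j < N t)%Z -> (0 < d < q)%Z ->
     (Rabs ((D m t (i + d)%Z j - D m t (i + d - 1)%Z j) * mesh N t)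
       <= s + Rabs (D (S (S m)) t (i + d - 1)%Z j * / mesh N t)) ->
     (Rabs ((D m t i j - D m t (i - 1)%Z j) * mesh N t)
       <= s + Rabs (D (S (S m)) t (i - 1)%Z j * / mesh N t)) ->
     Rabs (flux_remainder N a Rs v m t (i + d - 1)%Z j) + Rabs (flux_remainder N a Rs v m t (i - 1)%Z j)
       < 4 * lam * th * s) ->
  forall i j d, (0 <= j <= N t)%Z -> (0 <= d <= q)%Z ->
    Rabs (D m t (i + d)%Z j - D m t i j) <= quad_barrier (/ mesh N t) b s th d.
Proof.
  intros Hlam Hcl Hb Hs Hth Hq Hqh HMq Hbd HR.
  assert (P := mesh_pos N HN t). set (h := / mesh N t) in *.
  assert (Ph : 0 < h) by (apply Rinv_0_lt_compat, P).
  assert (hP : mesh N t * h = 1) by (unfold h; field; lra).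
  assert (HD2 : forall i j, D m t (i + 1)%Z j - 2 * D m t i j + D m t (i - 1)%Z j
            = D (S (S m)) t (i - 1)%Z j * h * h).
  { intros i j. rewrite !dxn_succ. replace (i - 1 + 1)%Z with i by lia.
    unfold h. field. lra. }
  assert (Main : forall e w, (e = 1 \/ e = -1) -> (forall i j, w i j = e * D m t i j) ->
    forall i j d, (0 <= j <= N t)%Z -> (0 <= d <= q)%Z ->
      w (i + d)%Z j - w i j <= quad_barrier h b s th d).
  { intros e w He Hw.
    assert (Habs : forall x, e * x <= Rabs x).
    { intro x. destruct He as [-> | ->].
      - rewrite Rmult_1_l. apply Rle_abs.
      - rewrite <- Rabs_Ropp. replace (-1 * x) with (- x) by ring. apply Rle_abs. }
    apply barrier_quad with (c := fun i j => edge_coef N a Rs v t (i - 1)%Z j)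
      (R0 := fun i j => - (e * flux_remainder N a Rs v m t (i - 1)%Z j)) (kap := kap) (lam := lam); auto; try lra.
    - intros i j. rewrite !Hw. f_equal. apply (dxn_periodic N a Rs kap v Hsol).
    - intros i j Hj. split.
      + rewrite !Hw. assert (E := dxn_elliptic N a Rs kap v HN Hsol m t i j Hj).
        fold h in E. apply (f_equal (fun z => e * z)) in E.
        transitivity (e * (- flux_remainder N a Rs v m t (i - 1)%Z j * h ^ 2)); [rewrite <- E|]; ring.
      + apply Hcl. lia.
    - intros i j Hj. rewrite !Hw. replace (e * D m t (i + q)%Z j - e * D m t i j)
        with (e * (D m t (i + q)%Z j - D m t i j)) by ring.
      apply Rle_trans with (1 := Habs _). apply Rle_trans with (2 := HMq).
      assert (A1 := HM m t (i + q)%Z j (le_n m) Hj). assert (A2 := HM m t i j (le_n m) Hj).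
      apply Rabs_le_between in A1. apply Rabs_le_between in A2. apply Rabs_le. lra.
    - intros i d Hd. rewrite !Hw.
      replace (e * D m t (i + d)%Z 0%Z - e * D m t i 0%Z)
        with (e * (D m t (i + d)%Z 0%Z - D m t i 0%Z)) by ring.
      replace (e * D m t (i + d)%Z (N t) - e * D m t i (N t))
        with (e * (D m t (i + d)%Z (N t) - D m t i (N t))) by ring.
      split; apply Rle_trans with (1 := Habs _); apply Hbd; auto.
    - intros i j d Hj Hd C1 C2 C3 C4. rewrite !Rabs_Ropp, !Rabs_mult.
      replace (Rabs e) with 1
        by (destruct He as [-> | ->]; [rewrite Rabs_R1 | rewrite Rabs_m1]; reflexivity).
      rewrite !Rmult_1_l. rewrite !Hw in C1, C2, C3, C4.
      assert (A : forall i0, e * D m t (i0 + 1)%Z j - e * D m t i0 j <= s * h ->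
                0 <= e * D m t i0 j - e * D m t (i0 - 1)%Z j ->
                Rabs ((D m t i0 j - D m t (i0 - 1)%Z j) * mesh N t)
                 <= s + Rabs (D (S (S m)) t (i0 - 1)%Z j * h)).
      { intros i0 K1 K2. assert (K3 := HD2 i0 j).
        assert (K4 := Habs (- (D (S (S m)) t (i0 - 1)%Z j * h))). rewrite Rabs_Ropp in K4.
        apply (f_equal (fun z => e * z)) in K3.
        set (z := Rabs (D (S (S m)) t (i0 - 1)%Z j * h)) in *.
        assert (K5 : e * (D m t i0 j - D m t (i0 - 1)%Z j) <= (s + z) * h).
        { apply (Rmult_le_compat_r h) in K4; [|lra]. lra. }
        replace (Rabs ((D m t i0 j - D m t (i0 - 1)%Z j) * mesh N t))
          with (e * (D m t i0 j - D m t (i0 - 1)%Z j) * mesh N t).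
        - apply (Rmult_le_reg_r h); auto. rewrite Rmult_assoc, hP. lra.
        - rewrite Rabs_mult, (Rabs_pos_eq (mesh N t)) by lra. f_equal.
          destruct He as [-> | ->].
          + rewrite Rabs_pos_eq; lra.
          + rewrite Rabs_left1; lra. }
      assert (A' : forall i0, e * D m t i0 j - e * D m t (i0 - 1)%Z j <= s * h ->
                0 <= e * D m t (i0 + 1)%Z j - e * D m t i0 j ->
                Rabs ((D m t i0 j - D m t (i0 - 1)%Z j) * mesh N t)
                 <= s + Rabs (D (S (S m)) t (i0 - 1)%Z j * h)).
      { intros i0 K1 K2. assert (K3 := HD2 i0 j).
        assert (K4 := Habs ((D (S (S m)) t (i0 - 1)%Z j * h))).
        apply (f_equal (fun z => e * z)) in K3.
        assert (Z0 := Rabs_pos (D (S (S m)) t (i0 - 1)%Z j * h)).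
        set (z := Rabs (D (S (S m)) t (i0 - 1)%Z j * h)) in *.
        rewrite Rabs_mult, (Rabs_pos_eq (mesh N t)) by lra.
        apply (Rmult_le_reg_r h); auto. rewrite Rmult_assoc, hP, Rmult_1_r.
        replace (Rabs (D m t i0 j - D m t (i0 - 1)%Z j))
          with (Rabs (e * (D m t i0 j - D m t (i0 - 1)%Z j))).
        - apply (Rmult_le_compat_r h) in K4; [|lra].
          assert (0 <= s * h) by (apply Rmult_le_pos; lra).
          assert (0 <= z * h) by (apply Rmult_le_pos; lra). apply Rabs_le. lra.
        - rewrite Rabs_mult. destruct He as [-> | ->]; [rewrite Rabs_R1 | rewrite Rabs_m1]; ring. }
      apply (HR i j d); auto. }
  intros i j d Hj Hd. apply Rabs_le. split.
  - assert (H := Main (-1) (fun i j => -1 * D m t i j) ltac:(auto) ltac:(auto) i j d Hj Hd).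
    cbv beta in H. lra.
  - assert (H := Main 1 (fun i j => 1 * D m t i j) ltac:(auto) ltac:(auto) i j d Hj Hd).
    cbv beta in H. lra.
Qed.

Lemma ellipticity : exists lam, 0 < lam /\
  forall t i j, (0 <= j <= N t)%Z -> lam <= edge_coef N a Rs v t i j.
Proof.
  exists (/ sqrt (M ^ 2 + Rs ^ 2 + a ^ 2)). split.
  - apply Rinv_0_lt_compat. apply (sqrt_norm_pos a Rs M Ha).
  - intros t i j Hj. apply edge_coef_lower; auto. intros i' j' Hj'. apply (HM 0%nat t i' j'); auto. lia.
Qed.

(** The remainder is at most [B] times the maximum [K] of the very quantity to be estimated. As
    [lam th = B + 1], a barrier of slope [K / 2] already beats it. So the maximum is at most [K / 2]
    unless it is below the constant [K0] determined by [L] and [M], and it follows that it is below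
    [K0]. *)
Lemma lipschitz_step L :
  (forall t i j, j = 0%Z \/ j = N t -> Rabs (D (S m) t i j) <= L) ->
  exists B, forall t i j, (0 <= j <= N t)%Z -> Rabs (D (S m) t i j) <= B.
Proof.
  intro HL.
  destruct ellipticity as (lam & lam0 & Hlam).
  destruct (remainder_bound N a Rs v HN Ha HRs m M
    (fun t I J K => (0 <= J <= N t)%Z /\ 1 <= K /\
       forall i j, (0 <= j <= N t)%Z -> Rabs (D (S m) t i j) <= K) Hm HM) as (B & B0 & HB).
  { intros t I J K (H1 & H2 & H3). split; [|split]; auto. intro s.
    apply Rle_trans with (1 := H3 (I + s)%Z J H1).
    assert (P := Rabs_pos (IZR s)). nra. }
  set (th := (B + 1) / lam).
  assert (th0 : 0 < th) by (apply Rdiv_lt_0_compat; lra).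
  (* With [th r0 = 1 / 4] and a range of length at most [2 r0], the barrier stays above half of its
     initial tangent. *)
  set (r0 := / (4 * th)). assert (r00 : 0 < r0) by (apply Rinv_0_lt_compat; lra).
  assert (Hr : th * r0 = / 4) by (unfold r0; field; lra).
  assert (Hth : lam * th = B + 1) by (unfold th; field; lra).
  (* [2 L] makes the barrier dominate the boundary rows. [4 M / r0] makes it exceed [2 M] at the end
     [q] of the range, where the increment is bounded trivially. *)
  set (K0 := Rmax 1 (Rmax (2 * L) (4 * M / r0))).
  assert (K01 : 1 <= K0) by apply Rmax_l.
  assert (K02 : 2 * L <= K0) by (apply Rle_trans with (2 := Rmax_r _ _); apply Rmax_l).
  assert (K03 : 4 * M / r0 <= K0) by (apply Rle_trans with (2 := Rmax_r _ _); apply Rmax_r).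
  exists K0. intros t. assert (M0 := sup_nonneg t). assert (P := mesh_pos N HN t).
  set (h := / mesh N t). assert (Ph : 0 < h) by (apply Rinv_0_lt_compat, P).
  assert (hP : mesh N t * h = 1) by (unfold h; field; lra).
  destruct (Rle_lt_dec h r0) as [Hh|Hh].
  2:{ intros i j Hj. rewrite dxn_succ.
      assert (A1 := HM m t (i + 1)%Z j (le_n m) Hj). assert (A2 := HM m t i j (le_n m) Hj).
      apply Rabs_le_between in A1. apply Rabs_le_between in A2.
      rewrite Rabs_mult, (Rabs_pos_eq (mesh N t)) by lra.
      apply Rle_trans with (2 := K03). apply (proj1 (Rle_div_r _ _ r0 r00)).
      assert (A3 : Rabs (D m t (i + 1)%Z j - D m t i j) <= 2 * M) by (apply Rabs_le; lra).
      assert (A4 : mesh N t * r0 <= 1) by nra.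
      assert (A5 : 0 <= mesh N t * r0) by nra.
      rewrite Rmult_assoc. apply Rle_trans with (2 * M * 1); [|lra].
      apply Rmult_le_compat; auto. apply Rabs_pos. }
  destruct (range_exists r0 h Ph Hh) as (q & Hq0 & Hq1 & Hq2).
  assert (Hn0 := HN t).
  destruct (finite_max (fun x : Z * Z => Rabs (D (S m) t (fst x) (snd x)))
     (list_prod (zrange (N t)) (zrange (N t))) (0, 0)%Z) as ((i0 & j0) & Hin & Hmax).
  { apply in_prod; apply zrange_in; lia. }
  apply in_prod_iff in Hin. rewrite !zrange_in in Hin by lia. cbv beta in Hmax.
  change (snd (i0, j0)) with j0 in Hmax. change (fst (i0, j0)) with i0 in Hmax.
  set (Kx := Rabs (D (S m) t i0 j0)) in *.
  assert (Hall : forall i j, (0 <= j <= N t)%Z -> Rabs (D (S m) t i j) <= Kx).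
  { intros i j Hj. rewrite (periodic_mod (N t) _ i j Hn0 (dxn_periodic N a Rs kap v Hsol (S m) t)).
    assert (Q := Z.mod_pos_bound i (N t) Hn0).
    apply (Hmax ((i mod N t)%Z, j)). apply in_prod; apply zrange_in; lia. }
  set (K := Rmax 1 Kx). set (s := Rmax K0 (K / 2)).
  assert (K1 : 1 <= K) by apply Rmax_l. assert (K2 : Kx <= K) by apply Rmax_r.
  assert (s1 : K0 <= s) by apply Rmax_l. assert (s2 : K / 2 <= s) by apply Rmax_r.
  assert (qge : forall d, (0 <= d <= q)%Z -> s / 2 * (IZR d * h) <= quad_barrier h 0 s th d).
  { intros d Hd. assert (0 <= IZR d) by (apply IZR_le; lia).
    assert (IZR d <= IZR q) by (apply IZR_le; lia).
    assert (E1 : 0 <= IZR d * h) by nra. assert (E2 : IZR d * h <= 2 * r0) by nra.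
    assert (E3 : th * (IZR d * h) <= / 2) by nra.
    unfold quad_barrier. set (x := IZR d * h) in *.
    replace (0 + s * (x - th * x ^ 2)) with (s * x * (1 - th * x)) by ring.
    replace (s / 2 * x) with (s * x * / 2) by field. apply Rmult_le_compat_l.
    apply Rmult_le_pos; lra. lra. }
  assert (Hconc : forall i j d, (0 <= j <= N t)%Z -> (0 <= d <= q)%Z ->
    Rabs (D m t (i + d)%Z j - D m t i j) <= quad_barrier h 0 s th d).
  { apply (barrier_family lam); auto; try lra; try lia.
    - fold h. replace (2 * th * (IZR q * h)) with (2 * (th * (IZR q * h))) by ring. nra.
    - fold h. apply Rle_trans with (2 := qge q ltac:(lia)).
      apply (Rmult_le_compat_r r0) in K03; [|lra].
      replace (4 * M / r0 * r0) with (4 * M) in K03 by (field; lra).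
      assert (K0 * r0 <= s * (IZR q * h)) by (apply Rmult_le_compat; lra). lra.
    - intros i j d Hj Hd. fold h. apply Rle_trans with (2 := qge d Hd).
      apply Rle_trans with (L * (IZR d * h)).
      + apply Rabs_le. split.
        * assert (A := increment_sum (mesh N t) (fun i j => - D m t i j) L i j d P ltac:(lia)).
          cbv beta in A. unfold h. enough (- D m t (i + d)%Z j - - D m t i j <= L * (IZR d * / mesh N t)) by lra.
          apply A. intro i'. specialize (HL t i' j Hj). rewrite dxn_succ in HL.
          apply Rabs_le_between in HL. lra.
        * apply (increment_sum (mesh N t) (D m t) L i j d P ltac:(lia)).
          intro i'. specialize (HL t i' j Hj). rewrite dxn_succ in HL.
          apply Rabs_le_between in HL. lra.
      + apply Rmult_le_compat_r; [|lra]. apply Rmult_le_pos; [apply IZR_le; lia|lra].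
    - intros i j d Hj Hd _ _.
      assert (A1 := HB t (i + d - 1)%Z j K ltac:(split; [lia|split; auto]; intros;
        apply Rle_trans with (2 := K2); auto)).
      assert (A2 := HB t (i - 1)%Z j K ltac:(split; [lia|split; auto]; intros;
        apply Rle_trans with (2 := K2); auto)).
      apply Rle_lt_trans with (2 * B * K). lra.
      replace (4 * lam * th * s) with (4 * (B + 1) * s) by (rewrite <- Hth; ring). nra. }
  assert (Hfin : forall i j, (0 <= j <= N t)%Z -> Rabs (D (S m) t i j) <= s).
  { intros i j Hj. rewrite dxn_succ, Rabs_mult, (Rabs_pos_eq (mesh N t)) by lra.
    assert (A := Hconc i j 1%Z Hj ltac:(lia)).
    assert (quad_barrier h 0 s th 1 <= s * h).
    { unfold quad_barrier. assert (0 <= th * (1 * h) ^ 2). { apply Rmult_le_pos; [lra|apply pow2_ge_0]. } nra. }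
    apply (Rmult_le_reg_r h); auto. rewrite Rmult_assoc, hP. lra. }
  assert (Kx <= s) by (apply Hfin; lia).
  assert (Kx <= K0).
  { unfold s, K in H. unfold Rmax in H at 1 2. destruct (Rle_dec 1 Kx) in H.
    - destruct (Rle_dec K0 (Kx / 2)); lra.
    - destruct (Rle_dec K0 (1 / 2)); lra. }
  intros i j Hj. apply Rle_trans with Kx; auto.
Qed.

Variable alpha : R.
Hypothesis Hal : 0 < alpha < 1.

(** The barrier is run at the scale of the increment to be estimated; the assumption on
    [D^(m+2) v] makes the shifted first differences in the remainder comparable to the one
    at the contact point. *)
Lemma holder_step H :
  (forall t i j d, j = 0%Z \/ j = N t -> (0 < d)%Z ->
     Rabs (D m t (i + d)%Z j - D m t i j) <= H * Rpower (IZR d / mesh N t) alpha) ->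
  (forall t i j, (0 <= j <= N t)%Z -> Rabs (D (S (S m)) t i j) <= mesh N t) ->
  exists C, forall t i j d, (0 <= j <= N t)%Z -> (0 < d)%Z ->
     Rabs (D m t (i + d)%Z j - D m t i j) <= C * Rpower (IZR d / mesh N t) alpha.
Proof.
  intros HH H2.
  destruct ellipticity as (lam & lam0 & Hlam).
  destruct (remainder_bound N a Rs v HN Ha HRs m M
    (fun t I J K => (0 <= J <= N t)%Z /\ 1 <= K /\ Rabs (D (S m) t I J) <= K) Hm HM)
    as (B & B0 & HB).
  { intros t I J K (h1 & h2 & h3). split; [|split]; auto. intro s.
    assert (P := mesh_pos N HN t).
    (* The hypothesis on [D (S (S m))] says that neighbouring values of [D (S m)] differ by at most
       1, so linear growth from any node is automatic. *)
    assert (St : forall i, Rabs (D (S m) t (i + 1)%Z J - D (S m) t i J) <= 1).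
    { intro i. assert (Q := H2 t i J h1). rewrite dxn_succ, Rabs_mult, (Rabs_pos_eq (mesh N t)) in Q by lra.
      apply (Rmult_le_reg_r (mesh N t)); auto. lra. }
    assert (Hk : Rabs (D (S m) t (I + s)%Z J) <= K + Rabs (IZR s)).
    { assert (F : forall d, (0 <= d)%Z -> Rabs (D (S m) t (I + d)%Z J) <= K + IZR d /\
                  Rabs (D (S m) t (I - d)%Z J) <= K + IZR d).
      { apply natlike_ind.
        - rewrite Z.add_0_r, Z.sub_0_r. lra.
        - intros d Hd [IH1 IH2]. unfold Z.succ. rewrite plus_IZR.
          assert (S1 := St (I + d)%Z). assert (S2 := St (I - (d + 1))%Z).
          replace (I - (d + 1) + 1)%Z with (I - d)%Z in S2 by lia. rewrite Z.add_assoc.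
          apply Rabs_le_between in IH1. apply Rabs_le_between in IH2.
          apply Rabs_le_between in S1. apply Rabs_le_between in S2.
          split; apply Rabs_le; lra. }
      destruct (Z_le_gt_dec 0 s).
      - rewrite (Rabs_pos_eq (IZR s)) by (apply IZR_le; auto). apply F; auto.
      - rewrite (Rabs_left1 (IZR s)) by (apply IZR_le; lia).
        assert (Q := proj2 (F (- s)%Z ltac:(lia))). rewrite opp_IZR in Q.
        replace (I - - s)%Z with (I + s)%Z in Q by lia. exact Q. }
    assert (Q := Rabs_pos (IZR s)). nra. }
  (* The added 1 makes [r0 <= 1], so that [del < r0] lies in the range where
     [del ^ alpha >= del]. *)
  set (th := (B + 1) / lam + 1).
  assert (thB : 0 < (B + 1) / lam) by (apply Rdiv_lt_0_compat; lra).
  assert (th0 : 1 <= th) by (unfold th; lra).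
  set (r0 := / (4 * th)). assert (r00 : 0 < r0) by (apply Rinv_0_lt_compat; lra).
  assert (r01 : r0 <= 1).
  { unfold r0. rewrite <- Rinv_1. apply Rinv_le_contravar; lra. }
  assert (Hr : th * r0 = / 4) by (unfold r0; field; lra).
  assert (Hth : B + 1 <= lam * th).
  { unfold th. replace (lam * ((B + 1) / lam + 1)) with (B + 1 + lam) by (field; lra). lra. }
  set (H' := Rmax (Rmax 1 H) (2 * Rabs M / r0)).
  assert (H'1 : 1 <= H') by (apply Rle_trans with (2 := Rmax_l _ _); apply Rmax_l).
  assert (H'2 : H <= H') by (apply Rle_trans with (2 := Rmax_l _ _); apply Rmax_r).
  assert (H'3 : 2 * Rabs M / r0 <= H') by apply Rmax_r.
  exists (3 * H'). intros t i0 j0 d0 Hj0 Hd0.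
  assert (M0 := sup_nonneg t). rewrite (Rabs_pos_eq M) in H'3 by auto.
  assert (P := mesh_pos N HN t).
  set (h := / mesh N t). assert (Ph : 0 < h) by (apply Rinv_0_lt_compat, P).
  assert (d01 : 1 <= IZR d0) by (apply IZR_le; lia).
  set (del := IZR d0 / mesh N t). assert (Edel : del = IZR d0 * h) by reflexivity.
  assert (del0 : 0 < del) by (rewrite Edel; nra).
  assert (hdel : h <= del) by (rewrite Edel; nra).
  assert (gpos := pw_pos alpha del). set (g := Rpower del alpha) in *.
  destruct (Rle_lt_dec r0 del) as [Hlarge|Hsmall].
  { apply Rle_trans with (2 * M).
    - assert (A1 := HM m t (i0 + d0)%Z j0 (le_n m) Hj0). assert (A2 := HM m t i0 j0 (le_n m) Hj0).
      apply Rabs_le_between in A1. apply Rabs_le_between in A2. apply Rabs_le. lra.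
    - assert (Hg : r0 <= g).
      { destruct (Rle_lt_dec del 1).
        - apply Rle_trans with del; auto. apply pw_le1; auto.
        - apply Rle_trans with 1; auto. apply pw_ge1; lra. }
      assert (A : 2 * M <= H' * r0).
      { apply (Rmult_le_compat_r r0) in H'3; [|lra].
        replace (2 * M / r0 * r0) with (2 * M) in H'3 by (field; lra). exact H'3. }
      assert (0 <= H' * (g - r0)) by (apply Rmult_le_pos; lra).
      assert (0 <= H' * g) by (apply Rmult_le_pos; lra). lra. }
  destruct (range_exists r0 h Ph ltac:(lra)) as (q & Hq0 & Hq1 & Hq2).
  assert (Hdq : (d0 <= q)%Z).
  { apply le_IZR. apply (Rmult_le_reg_r h); auto. rewrite <- Edel. lra. }
  assert (Hgd : 1 <= g / del).
  { apply (proj1 (Rle_div_r _ _ del del0)). rewrite Rmult_1_l. apply pw_le1; auto. lra. }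
  (* The barrier is at least [H'] times the affine majorant of the power at scale [del], so it
     dominates the boundary data; at [del] itself it is at most [b + s del = 3 H' g]. *)
  set (b := H' * g). set (s := 2 * H' * (g / del)).
  assert (b0 : 0 < b) by (unfold b; apply Rmult_lt_0_compat; lra).
  assert (s1 : 2 * H' <= s).
  { unfold s. assert (0 <= 2 * H' * (g / del - 1)) by (apply Rmult_le_pos; lra). lra. }
  assert (qge : forall d, (0 <= d <= q)%Z -> b + s / 2 * (IZR d * h) <= quad_barrier h b s th d).
  { intros d Hd. assert (0 <= IZR d) by (apply IZR_le; lia).
    assert (IZR d <= IZR q) by (apply IZR_le; lia).
    assert (E1 : 0 <= IZR d * h) by nra. assert (E2 : IZR d * h <= 2 * r0) by nra.
    assert (E3 : th * (IZR d * h) <= / 2) by nra.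
    unfold quad_barrier. set (x := IZR d * h) in *.
    replace (b + s * (x - th * x ^ 2)) with (b + s * x * (1 - th * x)) by ring.
    replace (s / 2 * x) with (s * x * / 2) by field. apply Rplus_le_compat_l.
    apply Rmult_le_compat_l. apply Rmult_le_pos; lra. lra. }
  assert (Hconc : forall i j d, (0 <= j <= N t)%Z -> (0 <= d <= q)%Z ->
    Rabs (D m t (i + d)%Z j - D m t i j) <= quad_barrier h b s th d).
  { apply (barrier_family lam); auto; try lra; try lia.
    - fold h. replace (2 * th * (IZR q * h)) with (2 * (th * (IZR q * h))) by ring. nra.
    - fold h. apply Rle_trans with (2 := qge q ltac:(lia)).
      assert (A : 2 * M <= H' * r0).
      { apply (Rmult_le_compat_r r0) in H'3; [|lra].
        replace (2 * M / r0 * r0) with (2 * M) in H'3 by (field; lra). exact H'3. }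
      assert (H' * r0 <= s / 2 * (IZR q * h)) by (apply Rmult_le_compat; lra). lra.
    - intros i j d Hj Hd. fold h. apply Rle_trans with (2 := qge d Hd).
      destruct (Z.eq_dec d 0) as [->|Hd'].
      + rewrite Z.add_0_r, Rminus_diag, Rabs_R0. lra.
      + apply Rle_trans with (1 := HH t i j d Hj ltac:(lia)).
        assert (dpos : 0 < IZR d) by (apply IZR_lt; lia).
        assert (xpos : 0 < IZR d / mesh N t) by (apply Rdiv_lt_0_compat; auto).
        assert (A := pw_tangent alpha Hal (IZR d / mesh N t) del xpos del0).
        fold g in A. change (IZR d / mesh N t) with (IZR d * h) in *.
        assert (A1 := pw_pos alpha (IZR d * h)).
        apply Rle_trans with (H' * Rpower (IZR d * h) alpha).
        { apply Rmult_le_compat_r; lra. }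
        apply (Rmult_le_compat_l H') in A; [|lra]. unfold b, s.
        replace (2 * H' * (g / del) / 2) with (H' * (g / del)) by (field; lra). lra.
    - intros i j d Hj Hd C1 C2.
      assert (Q : forall i', Rabs (D (S (S m)) t i' j * / mesh N t) <= 1).
      { intro i'. rewrite Rabs_mult, (Rabs_pos_eq (/ mesh N t)) by (apply Rlt_le, Ph).
        apply (Rmult_le_reg_r (mesh N t)); auto. rewrite Rmult_assoc, Rinv_l by lra.
        rewrite Rmult_1_r, Rmult_1_l. apply H2. lia. }
      assert (Q1 := Q (i + d - 1)%Z). assert (Q2 := Q (i - 1)%Z).
      assert (A1 := HB t (i + d - 1)%Z j (s + 1) ltac:(split; [lia|split; [lra|]];
         rewrite dxn_succ; replace (i + d - 1 + 1)%Z with (i + d)%Z by lia; lra)).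
      assert (A2 := HB t (i - 1)%Z j (s + 1) ltac:(split; [lia|split; [lra|]];
         rewrite dxn_succ; replace (i - 1 + 1)%Z with i by lia; lra)).
      apply Rle_lt_trans with (2 * B * (s + 1)). lra.
      apply Rlt_le_trans with (4 * (B + 1) * s). nra.
      replace (4 * lam * th * s) with (4 * (lam * th) * s) by ring.
      apply Rmult_le_compat_r; lra. }
  apply Rle_trans with (1 := Hconc i0 j0 d0 Hj0 ltac:(lia)).
  unfold quad_barrier. rewrite <- Edel.
  assert (E : s * del = 2 * H' * g) by (unfold s; field; lra).
  assert (0 <= s * (th * del ^ 2)).
  { apply Rmult_le_pos; [lra|]. apply Rmult_le_pos; [lra|apply pow2_ge_0]. }
  unfold b. lra.
Qed.

End Families.

(** * Interpolation *)

Lemma chain1 (g : Z -> R) n w0 e i0 d : (0 <= d)%Z ->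
  (forall s, (0 <= s < d)%Z -> Rabs ((g (i0 + s + 1)%Z - g (i0 + s)%Z) * n - w0) <= e) ->
  Rabs ((g (i0 + d)%Z - g i0) * n - IZR d * w0) <= IZR d * e.
Proof.
  intros Hd H.
  assert (F : forall k, (0 <= k)%Z -> (k <= d)%Z ->
    Rabs ((g (i0 + k)%Z - g i0) * n - IZR k * w0) <= IZR k * e).
  { apply (natlike_ind (fun k => (k <= d)%Z ->
      Rabs ((g (i0 + k)%Z - g i0) * n - IZR k * w0) <= IZR k * e)).
    - intros _. rewrite Z.add_0_r. replace ((g i0 - g i0) * n - 0 * w0) with 0 by ring.
      rewrite Rabs_R0. lra.
    - intros k Hk IH Hk'. unfold Z.succ. rewrite plus_IZR, Z.add_assoc.
      specialize (IH ltac:(lia)). specialize (H k ltac:(lia)).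
      replace ((g (i0 + k + 1)%Z - g i0) * n - (IZR k + 1) * w0) with
        (((g (i0 + k)%Z - g i0) * n - IZR k * w0)
         + ((g (i0 + k + 1)%Z - g (i0 + k)%Z) * n - w0)) by ring.
      eapply Rle_trans; [apply Rabs_triang|]. lra. }
  apply F; lia.
Qed.

(** A second difference with step [d] is [d ^ 2] times a weighted mean of the one-cell second
    differences inside, hence it inherits their distance from [w0]. *)
Lemma chain2 (g : Z -> R) n w0 e i0 d : (0 <= d)%Z ->
  (forall s, (0 <= s /\ s + 2 <= 2 * d)%Z ->
     Rabs ((g (i0 + s + 2)%Z - 2 * g (i0 + s + 1)%Z + g (i0 + s)%Z) * n ^ 2 - w0) <= e) ->
  Rabs ((g (i0 + 2 * d)%Z - 2 * g (i0 + d)%Z + g i0) * n ^ 2 - IZR d ^ 2 * w0) <= IZR d ^ 2 * e.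
Proof.
  intros Hd H.
  assert (A := chain1 (fun k => (g (k + d)%Z - g k) * n) n (IZR d * w0) (IZR d * e) i0 d Hd).
  replace (IZR d ^ 2 * e) with (IZR d * (IZR d * e)) by ring.
  replace ((g (i0 + 2 * d)%Z - 2 * g (i0 + d)%Z + g i0) * n ^ 2 - IZR d ^ 2 * w0) with
    (((g (i0 + d + d)%Z - g (i0 + d)%Z) * n - (g (i0 + d)%Z - g i0) * n) * n - IZR d * (IZR d * w0)).
  2:{ replace (i0 + 2 * d)%Z with (i0 + d + d)%Z by lia. ring. }
  apply A. intros s Hs. cbv beta.
  assert (B := chain1 (fun k => (g (k + 1)%Z - g k) * n) n w0 e (i0 + s) d Hd).
  replace (((g (i0 + s + 1 + d)%Z - g (i0 + s + 1)%Z) * n - (g (i0 + s + d)%Z - g (i0 + s)%Z) * n) * n)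
    with (((g (i0 + s + d + 1)%Z - g (i0 + s + d)%Z) * n - (g (i0 + s + 1)%Z - g (i0 + s)%Z) * n) * n).
  2:{ replace (i0 + s + 1 + d)%Z with (i0 + s + d + 1)%Z by lia. ring. }
  apply B. intros r Hr. specialize (H (s + r)%Z ltac:(lia)). cbv beta.
  replace (((g (i0 + s + r + 1 + 1)%Z - g (i0 + s + r + 1)%Z) * n
     - (g (i0 + s + r + 1)%Z - g (i0 + s + r)%Z) * n) * n - w0) with
    ((g (i0 + (s + r) + 2)%Z - 2 * g (i0 + (s + r) + 1)%Z + g (i0 + (s + r))%Z) * n ^ 2 - w0).
  exact H.
  replace (i0 + s + r + 1 + 1)%Z with (i0 + (s + r) + 2)%Z by lia.
  replace (i0 + s + r + 1)%Z with (i0 + (s + r) + 1)%Z by lia.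
  replace (i0 + s + r)%Z with (i0 + (s + r))%Z by lia. ring.
Qed.

Lemma dyadic d : (0 < d)%Z -> exists l : nat, (d < 2 ^ Z.of_nat l <= 2 * d)%Z.
Proof.
  intro Hd. exists (S (Z.to_nat (Z.log2 d))).
  rewrite Nat2Z.inj_succ, Z2Nat.id by apply Z.log2_nonneg.
  destruct (Z.log2_spec d Hd) as [H1 H2]. split; auto.
  rewrite Z.pow_succ_r by apply Z.log2_nonneg. lia.
Qed.

Section Interpolation.
Context {T : Type}.
Variables (N : T -> Z) (alpha : R) (U : grid T) (B : R).
Hypotheses (HN : forall t, (0 < N t)%Z) (Hal : 0 < alpha < 1) (B0 : 0 <= B).
Notation X := (dquot (mesh N) false).
Notation Y := (dquot (mesh N) true).

Definition modulus (t : T) (d : Z) : R := Rpower (IZR d / mesh N t) alpha.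

Lemma modulus_pos t d : 0 < modulus t d.
Proof. apply pw_pos. Qed.

Lemma frac_pos t d : (0 < d)%Z -> 0 < IZR d / mesh N t.
Proof. intro. apply Rdiv_lt_0_compat. apply IZR_lt; auto. apply mesh_pos, HN. Qed.

Lemma modulus_double t d : (0 < d)%Z -> modulus t (2 * d) = Rpower 2 alpha * modulus t d.
Proof.
  intro Hd. unfold modulus. rewrite mult_IZR.
  replace (2 * IZR d / mesh N t) with (2 * (IZR d / mesh N t)) by (unfold Rdiv; ring).
  apply pw_mult. lra. apply frac_pos, Hd.
Qed.

Lemma modulus_mono t d d' : (0 < d <= d')%Z -> modulus t d <= modulus t d'.
Proof.
  intro H. apply pw_mono; auto. apply frac_pos; lia.
  apply Rmult_le_compat_r. apply Rlt_le, Rinv_0_lt_compat, mesh_pos, HN. apply IZR_le; lia.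
Qed.

Lemma modulus_lower t d : (0 < d)%Z -> (d <= N t)%Z -> IZR d / mesh N t <= modulus t d.
Proof.
  intros Hd Hd'. apply pw_le1; auto. split. apply frac_pos, Hd.
  apply (proj2 (Rle_div_l _ _ _ (mesh_pos N HN t))). rewrite Rmult_1_l. apply IZR_le; auto.
Qed.

Lemma modulus_quarter t d : (0 < d)%Z -> (N t <= 4 * d)%Z -> / 4 <= modulus t d.
Proof.
  intros Hd H. destruct (Z_le_gt_dec d (N t)).
  - apply Rle_trans with (2 := modulus_lower t d Hd l).
    apply (proj1 (Rle_div_r _ _ _ (mesh_pos N HN t))). unfold mesh.
    apply IZR_le in H. rewrite mult_IZR in H. lra.
  - apply Rle_trans with 1. lra. apply pw_ge1; auto.
    apply (proj1 (Rle_div_r _ _ _ (mesh_pos N HN t))). rewrite Rmult_1_l. apply IZR_le; lia.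
Qed.

Lemma modulus_le1 t d : (0 < d <= N t)%Z -> modulus t d <= 1.
Proof.
  intros H. apply pw_le1; auto. split. apply frac_pos; lia.
  apply (proj2 (Rle_div_l _ _ _ (mesh_pos N HN t))). rewrite Rmult_1_l. apply IZR_le; lia.
Qed.

Lemma two_pow : 1 < Rpower 2 alpha < 2.
Proof.
  split.
  - rewrite <- (Rpower_O 2) by lra. apply Rpower_lt; lra.
  - rewrite <- (Rpower_1 2) at 2 by lra. apply Rpower_lt; lra.
Qed.

Hypothesis HU : forall t i j, (0 <= j <= N t)%Z -> Rabs (U t i j) <= B.
Hypothesis Hf : forall t i j, (0 <= j)%Z -> (j + 2 <= N t)%Z -> Rabs (Y (Y U) t i j) <= B.

(** The mean slope of a whole column is at most [2 B], and by the bound on [Y (Y U)] the slope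
    varies by at most [B] along it. *)
Lemma dy_bounded t i j : (0 <= j < N t)%Z -> Rabs (Y U t i j) <= 3 * B.
Proof.
  intro Hj. assert (P := mesh_pos N HN t).
  assert (S : forall j' d, (0 <= j')%Z -> (0 <= d)%Z -> (j' + d < N t)%Z ->
            Rabs (Y U t i (j' + d)%Z - Y U t i j') <= B).
  { intros j' d H0 H1 H2.
    assert (C := chain1 (fun k => Y U t i k) (mesh N t) 0 B j' d H1).
    assert (C1 := C ltac:(intros s Hs; cbv beta; rewrite Rminus_0_r; apply (Hf t i (j' + s)%Z); lia)).
    rewrite Rmult_0_r, Rminus_0_r, Rabs_mult, (Rabs_pos_eq (mesh N t)) in C1 by lra.
    apply (Rmult_le_reg_r (mesh N t)); auto. apply Rle_trans with (1 := C1).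
    rewrite (Rmult_comm B). apply Rmult_le_compat_r; auto. apply IZR_le; lia. }
  assert (C := chain1 (fun k => U t i k) (mesh N t) (Y U t i j) B 0 (N t) ltac:(lia)).
  assert (C1 := C ltac:(intros s Hs; cbv beta;
    change (Rabs (Y U t i (0 + s)%Z - Y U t i j) <= B);
    destruct (Z_le_gt_dec j s);
    [ replace (0 + s)%Z with (j + (s - j))%Z by lia; apply S; lia
    | rewrite Rabs_minus_sym; replace j with (0 + s + (j - s))%Z at 1 by lia; apply S; lia ])).
  cbv beta in C1. rewrite Z.add_0_l in C1. fold (mesh N t) in C1.
  replace ((U t i (N t) - U t i 0%Z) * mesh N t - mesh N t * Y U t i j)
    with ((U t i (N t) - U t i 0%Z - Y U t i j) * mesh N t) in C1 by ring.
  rewrite Rabs_mult, (Rabs_pos_eq (mesh N t)) in C1 by lra. rewrite Rmult_comm in C1.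
  apply Rmult_le_reg_l in C1; auto.
  assert (A1 := HU t i (N t) ltac:(lia)). assert (A2 := HU t i 0%Z ltac:(lia)).
  apply Rabs_le_between in A1. apply Rabs_le_between in A2. apply Rabs_le_between in C1.
  apply Rabs_le. lra.
Qed.

Hypothesis HW : forall t i j, (0 <= j <= N t)%Z -> Rabs (X (X U) t i j) <= B.
Hypothesis HWx : forall t i j d, (0 <= j <= N t)%Z -> (0 < d)%Z ->
  Rabs (X (X U) t (i + d)%Z j - X (X U) t i j) <= B * modulus t d.
Hypothesis Hfx : forall t i j d, (0 <= j)%Z -> (j + 2 <= N t)%Z -> (0 < d)%Z ->
  Rabs (Y (Y U) t (i + d)%Z j - Y (Y U) t i j) <= B * modulus t d.

Lemma second_x t i j :
  X (X U) t i j = (U t (i + 2)%Z j - 2 * U t (i + 1)%Z j + U t i j) * mesh N t ^ 2.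
Proof. unfold dquot, shift. replace (i + 1 + 1)%Z with (i + 2)%Z by lia. ring. Qed.

Lemma second_y t i j :
  Y (Y U) t i j = (U t i (j + 2)%Z - 2 * U t i (j + 1)%Z + U t i j) * mesh N t ^ 2.
Proof. unfold dquot, shift. replace (j + 1 + 1)%Z with (j + 2)%Z by lia. ring. Qed.

Lemma abs_sub_le x y A B' : Rabs x <= A -> Rabs y <= B' -> Rabs (x - y) <= A + B'.
Proof.
  intros H1 H2. apply Rabs_le_between in H1. apply Rabs_le_between in H2. apply Rabs_le. lra.
Qed.

(** Interpolation: [q], the second [y]-difference of [U], is of size [d^2] in the
    [alpha]-norm while [D_x^2 q] is bounded in the [alpha]-norm. *)
Lemma second_difference_y t i j d : (0 <= j)%Z -> (0 < d)%Z -> (j + 2 * d <= N t)%Z ->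
  Rabs (X (X U) t i (j + 2 * d)%Z - 2 * X (X U) t i (j + d)%Z + X (X U) t i j) <= 10 * B * modulus t d.
Proof.
  intros Hj Hd Hjd.
  set (q := fun i' => U t i' (j + 2 * d)%Z - 2 * U t i' (j + d)%Z + U t i' j).
  assert (n2 : 0 < mesh N t ^ 2) by (apply pow_lt, mesh_pos, HN).
  assert (d1 : 1 <= IZR d) by (apply IZR_le; lia).
  assert (Hq : forall i', Rabs ((q (i' + d)%Z - q i') * mesh N t ^ 2) <= IZR d ^ 2 * (B * modulus t d)).
  { intro i'.
    assert (A := chain2 (fun k => U t (i' + d)%Z k - U t i' k) (mesh N t) 0 (B * modulus t d) j d ltac:(lia)).
    replace ((q (i' + d)%Z - q i') * mesh N t ^ 2) with
      ((U t (i' + d)%Z (j + 2 * d)%Z - U t i' (j + 2 * d)%Z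
        - 2 * (U t (i' + d)%Z (j + d)%Z - U t i' (j + d)%Z)
        + (U t (i' + d)%Z j - U t i' j)) * mesh N t ^ 2 - IZR d ^ 2 * 0) by (unfold q; ring).
    apply A. intros s Hs. assert (H := Hfx t i' (j + s)%Z d ltac:(lia) ltac:(lia) Hd).
    rewrite !second_y in H. cbv beta. eapply Rle_trans; [|apply H]. right. f_equal. ring. }
  set (w0 := X (X U) t i (j + 2 * d)%Z - 2 * X (X U) t i (j + d)%Z + X (X U) t i j).
  (* Over the [2 d] nodes involved each of three rows, with weights 1, 2, 1, varies by at most [B]
     times the modulus at [2 d], which is at most twice the one at [d]. This gives 8, and the two
     increments of [q] add 2. *)
  assert (A := chain2 q (mesh N t) w0 (4 * B * modulus t (2 * d)) i d ltac:(lia)).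
  assert (A1 := A ltac:(idtac; intros s Hs;
    assert (E : (q (i + s + 2)%Z - 2 * q (i + s + 1)%Z + q (i + s)%Z) * mesh N t ^ 2 - w0
     = (X (X U) t (i + s)%Z (j + 2 * d)%Z - X (X U) t i (j + 2 * d)%Z)
       - 2 * (X (X U) t (i + s)%Z (j + d)%Z - X (X U) t i (j + d)%Z)
       + (X (X U) t (i + s)%Z j - X (X U) t i j)) by (unfold w0, q; rewrite !second_x; ring);
    rewrite E; destruct (Z.eq_dec s 0) as [->|Hs0];
    [ rewrite Z.add_0_r; match goal with |- Rabs ?x <= _ => replace x with 0 by ring end;
      rewrite Rabs_R0; assert (O := modulus_pos t (2 * d)); apply Rmult_le_pos; lra
    | assert (W1 := HWx t i (j + 2 * d)%Z s ltac:(lia) ltac:(lia));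
      assert (W2 := HWx t i (j + d)%Z s ltac:(lia) ltac:(lia));
      assert (W3 := HWx t i j s ltac:(lia) ltac:(lia));
      assert (O := modulus_mono t s (2 * d) ltac:(lia));
      assert (O' : B * modulus t s <= B * modulus t (2 * d)) by (apply Rmult_le_compat_l; lra);
      apply Rabs_le_between in W1; apply Rabs_le_between in W2; apply Rabs_le_between in W3;
      apply Rabs_le; lra ])).
  assert (Q1 := Hq (i + d)%Z). assert (Q2 := Hq i).
  replace (i + d + d)%Z with (i + 2 * d)%Z in Q1 by lia.
  assert (TP := two_pow). rewrite modulus_double in A1 by auto.
  assert (O := modulus_pos t d).
  assert (O2 : B * (Rpower 2 alpha * modulus t d) <= B * (2 * modulus t d)).
  { apply Rmult_le_compat_l; auto. apply Rmult_le_compat_r; lra. }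
  assert (D2 : 0 < IZR d ^ 2) by (apply pow_lt; lra).
  assert (F : IZR d ^ 2 * Rabs w0 <= IZR d ^ 2 * (10 * B * modulus t d)).
  { rewrite <- (Rabs_pos_eq (IZR d ^ 2)) at 1 by lra. rewrite <- Rabs_mult.
    apply (Rmult_le_compat_l (IZR d ^ 2)) in O2; [|lra].
    apply Rabs_le_between in A1. apply Rabs_le_between in Q1. apply Rabs_le_between in Q2.
    apply Rabs_le. lra. }
  apply Rmult_le_reg_l in F; auto.
Qed.

(** The second difference yields the first at scale [d] from the first at scale [2 d]: the constant
    reproduces itself if [C 2^alpha / 2 + 5 B <= C], which is solvable because [alpha < 1]. The
    recursion starts at [d >= N / 4], where boundedness suffices. Near the top of the strip the
    interval is doubled downwards instead of upwards. *)
Lemma first_difference_y : exists C, 0 <= C /\ forall t i j d, (0 <= j)%Z -> (0 < d)%Z ->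
  (j + d <= N t)%Z -> Rabs (X (X U) t i (j + d)%Z - X (X U) t i j) <= C * modulus t d.
Proof.
  assert (TP := two_pow). set (ka := Rpower 2 alpha) in *.
  set (C := Rmax (8 * B) (10 * B / (2 - ka))).
  assert (C1 : 8 * B <= C) by apply Rmax_l.
  assert (C2 : 10 * B <= C * (2 - ka)).
  { apply Rle_div_l. lra. apply Rmax_r. }
  exists C. split. lra. intros t i.
  assert (F : forall k, (0 <= k)%Z -> forall j d, (N t - d <= k)%Z -> (0 <= j)%Z -> (0 < d)%Z ->
    (j + d <= N t)%Z -> Rabs (X (X U) t i (j + d)%Z - X (X U) t i j) <= C * modulus t d).
  { apply (Zlt_0_ind (fun k => forall j d, (N t - d <= k)%Z -> (0 <= j)%Z -> (0 < d)%Z ->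
    (j + d <= N t)%Z -> Rabs (X (X U) t i (j + d)%Z - X (X U) t i j) <= C * modulus t d)).
    intros k IH Hk j d Hdk Hj Hd Hjd.
    assert (O := modulus_pos t d).
    destruct (Z_le_gt_dec (N t) (4 * d)) as [H4|H4].
    - assert (O4 := modulus_quarter t d Hd H4).
      assert (A := abs_sub_le _ _ _ _ (HW t i (j + d)%Z ltac:(lia)) (HW t i j ltac:(lia))).
      apply Rle_trans with (1 := A). apply Rle_trans with (8 * B * / 4). lra.
      apply Rmult_le_compat; lra.
    - assert (K : exists j', (0 <= j')%Z /\ (j' + 2 * d <= N t)%Z /\ (j' = j \/ j' = j - d)%Z).
      { destruct (Z_le_gt_dec (j + 2 * d) (N t)).
        - exists j. lia.
        - exists (j - d)%Z. lia. }
      destruct K as (j' & K1 & K2 & K3).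
      assert (S := second_difference_y t i j' d K1 Hd K2).
      assert (L := IH (N t - 2 * d)%Z ltac:(lia) j' (2 * d)%Z ltac:(lia) K1 ltac:(lia) K2).
      rewrite modulus_double in L by auto. fold ka in L.
      apply Rabs_le_between in S. apply Rabs_le_between in L.
      assert (C3 : 10 * B * modulus t d <= C * (2 - ka) * modulus t d) by (apply Rmult_le_compat_r; lra).
      destruct K3 as [-> | ->].
      + apply Rabs_le. lra.
      + replace (j - d + 2 * d)%Z with (j + d)%Z in * by lia.
        replace (j - d + d)%Z with j in * by lia. apply Rabs_le. lra. }
  intros j d Hj Hd Hjd. apply (F (N t - d)%Z) with (d := d); lia.
Qed.

(** The mean of [X (Y U)] over the square of side [D] with lower left corner [(i, j)]. *)
Definition slope (t : T) (D i j : Z) : R :=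
  (U t (i + D)%Z (j + D)%Z - U t (i + D)%Z j - U t i (j + D)%Z + U t i j)
  * (mesh N t / IZR D) ^ 2.

(** Campanato's argument on dyadic squares. The mean over a square is the mean over its quarters.
    Adjacent quarters differ by at most [C1] times the modulus at their side, since their difference
    is a mean of increments in [y] of [X (X U)] or in [x] of [Y (Y U)]. The series over smaller and
    smaller squares is geometric because [alpha > 0]. *)
Lemma mixed_holder : exists C, forall t i j, (0 <= j)%Z -> (j + 1 <= N t)%Z ->
  Rabs (X (Y U) t i j) <= C /\
  (forall d, (0 < d)%Z -> Rabs (X (Y U) t (i + d)%Z j - X (Y U) t i j) <= C * modulus t d) /\
  (forall d, (0 < d)%Z -> (j + d + 1 <= N t)%Z ->
     Rabs (X (Y U) t i (j + d)%Z - X (Y U) t i j) <= C * modulus t d).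
Proof.
  destruct first_difference_y as (C0 & C00 & HC0).
  assert (TP := two_pow). set (ka := Rpower 2 alpha) in *.
  set (C1 := Rmax C0 B). assert (C1a : C0 <= C1) by apply Rmax_l.
  assert (C1b : B <= C1) by apply Rmax_r.
  (* This choice solves [C2 + C1 = C2 2^alpha]: the error at side [D] plus one more generation is
     the error allowed at side [2 D]. *)
  set (C2 := C1 / (ka - 1)).
  assert (HC2 : C2 * (ka - 1) = C1) by (unfold C2; field; lra).
  assert (C20 : 0 <= C2) by (apply Rdiv_le_0_compat; lra).
  assert (Sx : forall t D i j, (0 <= j)%Z -> (0 < D)%Z -> (j + D <= N t)%Z ->
             Rabs (slope t D (i + D) j - slope t D i j) <= C1 * modulus t D).
  { intros t D i j Hj HD HjD. assert (D1 : 0 < IZR D) by (apply IZR_lt; auto).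
    assert (A := chain2 (fun k => U t k (j + D)%Z - U t k j) (mesh N t) 0 (C0 * modulus t D) i D ltac:(lia)).
    assert (A1 := A ltac:(intros s Hs; assert (H := HC0 t (i + s)%Z j D Hj HD HjD);
      rewrite !second_x in H; cbv beta; eapply Rle_trans; [|apply H]; right; f_equal; ring)).
    apply (Rmult_le_reg_l (IZR D ^ 2)). apply pow_lt; auto.
    rewrite <- (Rabs_pos_eq (IZR D ^ 2)) at 1 by (apply pow2_ge_0). rewrite <- Rabs_mult.
    apply Rle_trans with (IZR D ^ 2 * (C0 * modulus t D)).
    - eapply Rle_trans; [|apply A1]. right. f_equal. unfold slope.
      replace (i + D + D)%Z with (i + 2 * D)%Z by lia. field. lra.
    - apply Rmult_le_compat_l. apply pow2_ge_0. apply Rmult_le_compat_r; auto.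
      apply Rlt_le, modulus_pos. }
  assert (Sy : forall t D i j, (0 <= j)%Z -> (0 < D)%Z -> (j + 2 * D <= N t)%Z ->
             Rabs (slope t D i (j + D) - slope t D i j) <= C1 * modulus t D).
  { intros t D i j Hj HD HjD. assert (D1 : 0 < IZR D) by (apply IZR_lt; auto).
    assert (A := chain2 (fun k => U t (i + D)%Z k - U t i k) (mesh N t) 0 (B * modulus t D) j D ltac:(lia)).
    assert (A1 := A ltac:(intros s Hs; assert (H := Hfx t i (j + s)%Z D ltac:(lia) ltac:(lia) HD);
      rewrite !second_y in H; cbv beta; eapply Rle_trans; [|apply H]; right; f_equal; ring)).
    apply (Rmult_le_reg_l (IZR D ^ 2)). apply pow_lt; auto.
    rewrite <- (Rabs_pos_eq (IZR D ^ 2)) at 1 by (apply pow2_ge_0). rewrite <- Rabs_mult.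
    apply Rle_trans with (IZR D ^ 2 * (B * modulus t D)).
    - eapply Rle_trans; [|apply A1]. right. f_equal. unfold slope.
      replace (j + D + D)%Z with (j + 2 * D)%Z by lia. field. lra.
    - apply Rmult_le_compat_l. apply pow2_ge_0. apply Rmult_le_compat_r; auto.
      apply Rlt_le, modulus_pos. }
  assert (Q : forall (l : nat) t i j i1 j1, (0 <= j)%Z -> (j + 2 ^ Z.of_nat l <= N t)%Z ->
     (i <= i1 < i + 2 ^ Z.of_nat l)%Z -> (j <= j1 < j + 2 ^ Z.of_nat l)%Z ->
     Rabs (X (Y U) t i1 j1 - slope t (2 ^ Z.of_nat l) i j) <= C2 * modulus t (2 ^ Z.of_nat l)).
  { induction l; intros t i j i1 j1 Hj HjN Hi1 Hj1.
    - simpl in *. replace i1 with i by lia. replace j1 with j by lia.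
      replace (X (Y U) t i j - slope t 1 i j) with 0.
      + rewrite Rabs_R0. apply Rmult_le_pos; auto. apply Rlt_le, modulus_pos.
      + unfold slope, dquot, shift. field.
    - assert (E : (2 ^ Z.of_nat (S l) = 2 * 2 ^ Z.of_nat l)%Z).
      { rewrite Nat2Z.inj_succ. apply Z.pow_succ_r. lia. }
      assert (HD : (0 < 2 ^ Z.of_nat l)%Z) by (apply Z.pow_pos_nonneg; lia).
      rewrite E in *. set (D := (2 ^ Z.of_nat l)%Z) in *. rewrite modulus_double by auto. fold ka.
      assert (D1 : 0 < IZR D) by (apply IZR_lt; auto).
      assert (Avg : slope t (2 * D) i j = (slope t D i j + slope t D (i + D) j
                    + slope t D i (j + D) + slope t D (i + D) (j + D)) * / 4).
      { unfold slope. replace (i + D + D)%Z with (i + 2 * D)%Z by lia.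
        replace (j + D + D)%Z with (j + 2 * D)%Z by lia. rewrite mult_IZR. field. lra. }
      assert (S1 := Sx t D i j Hj HD ltac:(lia)).
      assert (S2 := Sx t D i (j + D)%Z ltac:(lia) HD ltac:(lia)).
      assert (S3 := Sy t D i j Hj HD HjN).
      assert (S4 := Sy t D (i + D)%Z j Hj HD HjN).
      assert (Quad : exists i2 j2, (i2 = i \/ i2 = i + D)%Z /\ (j2 = j \/ j2 = j + D)%Z /\
               (i2 <= i1 < i2 + D)%Z /\ (j2 <= j1 < j2 + D)%Z).
      { destruct (Z_lt_le_dec i1 (i + D)), (Z_lt_le_dec j1 (j + D)).
        - exists i, j. lia.
        - exists i, (j + D)%Z. lia.
        - exists (i + D)%Z, j. lia.
        - exists (i + D)%Z, (j + D)%Z. lia. }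
      destruct Quad as (i2 & j2 & Hi2 & Hj2 & Hi21 & Hj21).
      assert (I := IHl t i2 j2 i1 j1 ltac:(lia) ltac:(lia) Hi21 Hj21).
      assert (K : Rabs (slope t D i2 j2 - slope t (2 * D) i j) <= C1 * modulus t D).
      { rewrite Avg. apply Rabs_le_between in S1. apply Rabs_le_between in S2.
        apply Rabs_le_between in S3. apply Rabs_le_between in S4.
        destruct Hi2 as [-> | ->], Hj2 as [-> | ->]; apply Rabs_le; lra. }
      apply Rle_trans with (C2 * modulus t D + C1 * modulus t D).
      + replace (X (Y U) t i1 j1 - slope t (2 * D) i j) with
          ((X (Y U) t i1 j1 - slope t D i2 j2) + (slope t D i2 j2 - slope t (2 * D) i j)) by ring.
        eapply Rle_trans; [apply Rabs_triang|]. lra.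
      + rewrite <- HC2. right. ring. }
  set (C3 := 16 * B + C2).
  (* A square whose dyadic side exceeds half of the height fits into the strip, and its slope is at
     most [4 B] times [2 ^ 2]. *)
  assert (Bd : forall t i j, (0 <= j)%Z -> (j + 1 <= N t)%Z -> Rabs (X (Y U) t i j) <= C3).
  { intros t i j Hj HjN. destruct (dyadic (N t) (HN t)) as (l & Hl1 & Hl2).
    destruct l as [|l].
    { simpl in Hl1. specialize (HN t). lia. }
    assert (E : (2 ^ Z.of_nat (S l) = 2 * 2 ^ Z.of_nat l)%Z).
    { rewrite Nat2Z.inj_succ. apply Z.pow_succ_r. lia. }
    rewrite E in *. assert (A := Q l t i (Z.min j (N t - 2 ^ Z.of_nat l)) i j).
    assert (HD : (0 < 2 ^ Z.of_nat l)%Z) by (apply Z.pow_pos_nonneg; lia).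
    set (D := (2 ^ Z.of_nat l)%Z) in *.
    specialize (A ltac:(lia) ltac:(lia) ltac:(lia) ltac:(lia)).
    assert (O := modulus_le1 t D ltac:(lia)).
    assert (D1 : 0 < IZR D) by (apply IZR_lt; auto).
    set (j2 := Z.min j (N t - D)) in *.
    assert (Sl : Rabs (slope t D i j2) <= 16 * B).
    { unfold slope. rewrite Rabs_mult.
      assert (r2 : 0 <= mesh N t / IZR D <= 2).
      { split. apply Rdiv_le_0_compat; auto. apply Rlt_le, mesh_pos, HN.
        apply (proj2 (Rle_div_l _ _ _ D1)). unfold mesh. rewrite <- mult_IZR. apply IZR_le. lia. }
      assert (U1 := HU t (i + D)%Z (j2 + D)%Z ltac:(lia)). assert (U2 := HU t (i + D)%Z j2 ltac:(lia)).
      assert (U3 := HU t i (j2 + D)%Z ltac:(lia)). assert (U4 := HU t i j2 ltac:(lia)).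
      apply Rabs_le_between in U1. apply Rabs_le_between in U2.
      apply Rabs_le_between in U3. apply Rabs_le_between in U4.
      replace (16 * B) with ((4 * B) * 2 ^ 2) by ring.
      apply Rmult_le_compat; try apply Rabs_pos.
      - apply Rabs_le. lra.
      - rewrite Rabs_pos_eq by apply pow2_ge_0. apply pow_incr. auto. }
    assert (C2 * modulus t D <= C2 * 1) by (apply Rmult_le_compat_l; auto).
    unfold C3. apply Rabs_le_between in A. apply Rabs_le_between in Sl. apply Rabs_le. lra. }
  (* Both nodes lie in a common square whose side is between [d] and [2 d], moved down if it would
     leave the strip. If it does not fit, [d] is comparable to the height and boundedness
     suffices. *)
  assert (Ho : forall t i j i2 j2 d, (0 <= j <= j2)%Z -> (j2 + 1 <= N t)%Z -> (i <= i2 <= i + d)%Z ->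
     (j2 <= j + d)%Z -> (0 < d)%Z ->
     Rabs (X (Y U) t i2 j2 - X (Y U) t i j) <= (8 * C3 + 4 * C2) * modulus t d).
  { intros t i j i2 j2 d Hj Hj2 Hi2 Hjd Hd. assert (O := modulus_pos t d).
    assert (C30 : 0 <= C3) by (unfold C3; lra).
    destruct (dyadic d Hd) as (l & Hl1 & Hl2).
    set (D := (2 ^ Z.of_nat l)%Z) in *.
    destruct (Z_le_gt_dec D (N t)) as [HDN|HDN].
    - assert (A1 := Q l t i (Z.min j (N t - D)) i j ltac:(lia) ltac:(fold D; lia) ltac:(fold D; lia)
        ltac:(fold D; lia)).
      assert (A2 := Q l t i (Z.min j (N t - D)) i2 j2 ltac:(lia) ltac:(fold D; lia) ltac:(fold D; lia)
        ltac:(fold D; lia)).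
      fold D in A1, A2.
      assert (O2 : modulus t D <= 2 * modulus t d).
      { apply Rle_trans with (modulus t (2 * d)). apply modulus_mono; lia.
        rewrite modulus_double by auto. fold ka. apply Rmult_le_compat_r; lra. }
      apply (Rmult_le_compat_l C2) in O2; auto.
      apply Rabs_le_between in A1. apply Rabs_le_between in A2.
      assert (0 <= C3 * modulus t d) by (apply Rmult_le_pos; lra). apply Rabs_le. lra.
    - assert (O4 := modulus_quarter t d Hd ltac:(lia)).
      assert (A := abs_sub_le _ _ _ _ (Bd t i2 j2 ltac:(lia) Hj2) (Bd t i j ltac:(lia) ltac:(lia))).
      apply Rle_trans with (1 := A).
      assert (8 * C3 * / 4 <= 8 * C3 * modulus t d) by (apply Rmult_le_compat_l; lra).
      assert (0 <= C2 * modulus t d) by (apply Rmult_le_pos; lra). lra. }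
  exists (8 * C3 + 4 * C2). intros t i j Hj HjN. split; [|split].
  - apply Rle_trans with (1 := Bd t i j Hj HjN). unfold C3. lra.
  - intros d Hd. apply Ho; lia.
  - intros d Hd Hjd. apply Ho; lia.
Qed.

End Interpolation.

(** * All differences up to the top order *)

Definition shift_back {T} (f : grid T) : grid T := fun t i j => f t (i - 1)%Z j.

Fixpoint dquots {T} (n : T -> R) (l : list bool) (f : grid T) : grid T :=
  match l with nil => f | b :: l' => dquot n b (dquots n l' f) end.

Section Regularity.
Context {T : Type}.
Variables (N : T -> Z) (a Rs kap alpha : R) (v : grid T).
Hypotheses (HN : forall t, (0 < N t)%Z) (Ha : a <> 0) (HRs : 0 < Rs) (Hkap : 0 < kap)
  (Hal : 0 < alpha < 1).
Hypothesis Hsol : forall t, discrete_solution a Rs kap (N t) (v t).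
Notation modulus := (modulus N alpha).
Notation X := (dquot (mesh N) false).
Notation Y := (dquot (mesh N) true).
Notation D p := (dxn (mesh N) p v).

(** Increments along one coordinate, in rows at distance at least [r] from the top. The differences
    in [y] are forward ones, so no row is lost at the bottom. *)
Definition Qholder (r : nat) (t : T) (i j i' j' : Z) (w : R) : Prop :=
  (0 <= j' /\ 0 <= j)%Z /\ (j + Z.of_nat r <= N t)%Z /\ (j' + Z.of_nat r <= N t)%Z /\
  exists d, (0 < d)%Z /\ modulus t d <= w /\
    ((i = i' + d)%Z /\ j = j' \/ i = i' /\ (j = j' + d)%Z).

Lemma Qholder_admissible : admissible Qholder.
Proof.
  split; [|split].
  - intros r r' t i j i' j' w Hr (H1 & H2 & H3 & H4). repeat split; auto; lia.
  - intros r t i j i' j' w (H1 & H2 & H3 & d & H4 & H5 & _).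
    apply Rle_trans with (2 := H5). apply Rlt_le, modulus_pos.
  - intros r b t i j i' j' w (H1 & H2 & H3 & d & H4 & H5 & H6).
    assert (O := modulus_pos N alpha t d).
    destruct b; (split; [lia|split; [lia|split; [lia|]]]); exists d; repeat split; auto; try lra; lia.
Qed.

Definition holder_class := bounded_modulus Qholder.
Definition holder_class_n m := diff_class (mesh N) (false :: true :: nil) m holder_class.

Lemma stable_class_holder_class_n m : stable_class (holder_class_n m).
Proof. apply stable_class_diff_class, bounded_modulus_stable_class, Qholder_admissible. Qed.

Lemma holder_class_intro f B r :
  (forall t i j, (0 <= j)%Z -> (j + Z.of_nat r <= N t)%Z -> Rabs (f t i j) <= B) ->
  (forall t i j d, (0 <= j)%Z -> (j + Z.of_nat r <= N t)%Z -> (0 < d)%Z ->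
     Rabs (f t (i + d)%Z j - f t i j) <= B * modulus t d) ->
  (forall t i j d, (0 <= j)%Z -> (0 < d)%Z -> (j + d + Z.of_nat r <= N t)%Z ->
     Rabs (f t i (j + d)%Z - f t i j) <= B * modulus t d) ->
  holder_class f.
Proof.
  intros Hb Hx Hy. exists r, B. intros t i j i' j' w (A1 & A2 & A3 & d & A4 & A5 & A6).
  assert (B0 : 0 <= B).
  { apply Rle_trans with (2 := Hb t i j ltac:(lia) ltac:(lia)). apply Rabs_pos. }
  split; [apply Hb; lia|]. split; [apply Hb; lia|].
  apply Rle_trans with (B * modulus t d).
  - destruct A6 as [[-> ->]|[-> ->]]; [apply Hx|apply Hy]; lia.
  - apply Rmult_le_compat_l; auto.
Qed.

Lemma holder_class_elim f : holder_class f -> exists r B, 0 <= B /\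
  (forall t i j, (0 <= j)%Z -> (j + Z.of_nat r <= N t)%Z -> Rabs (f t i j) <= B) /\
  (forall t i j d, (0 <= j)%Z -> (j + Z.of_nat r <= N t)%Z -> (0 < d)%Z ->
     Rabs (f t (i + d)%Z j - f t i j) <= B * modulus t d) /\
  (forall t i j d, (0 <= j)%Z -> (0 < d)%Z -> (j + d + Z.of_nat r <= N t)%Z ->
     Rabs (f t i (j + d)%Z - f t i j) <= B * modulus t d).
Proof.
  intros (r & B & HB). exists r, (Rabs B). split. apply Rabs_pos.
  assert (A : forall t d, B * modulus t d <= Rabs B * modulus t d).
  { intros t d. apply Rmult_le_compat_r. apply Rlt_le, modulus_pos. apply Rle_abs. }
  assert (A' := Rle_abs B). repeat split.
  - intros t i j Hj Hjr.
    destruct (HB t (i + 1)%Z j i j (modulus t 1)) as (_ & Q & _); [|lra].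
    repeat split; auto. exists 1%Z. repeat split; auto; try lia. lra.
  - intros t i j d Hj Hjr Hd. apply Rle_trans with (2 := A t d). apply HB.
    repeat split; auto. exists d. repeat split; auto. lra.
  - intros t i j d Hj Hd Hjr. apply Rle_trans with (2 := A t d). apply HB.
    repeat split; auto; try lia. exists d. repeat split; auto. lra.
Qed.

(** Membership depends only on the rows of the strip, up to finitely many at the top. This allows
    replacing [Y (Y v)] by the expression that the equation gives in those rows. *)
Definition domext (C : grid T -> Prop) := forall f g (r : nat),
  (forall t i j, (0 <= j)%Z -> (j + Z.of_nat r <= N t)%Z -> f t i j = g t i j) -> C f -> C g.

Lemma domext_holder_class_n m : domext (holder_class_n m).
Proof.
  induction m.
  - intros f g r E (r' & B & HB). exists (Nat.max r r'), B.
    intros t i j i' j' w (A1 & A2 & A3 & A4).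
    rewrite <- !E by lia. apply HB. repeat split; auto; lia.
  - intros f g r E [F1 F2]. split.
    + apply (IHm f g r); auto.
    + intros b Hb. apply (IHm (dquot (mesh N) b f) (dquot (mesh N) b g) (S r)); auto.
      2: apply F2, Hb.
      intros t i j Hj Hjr. unfold dquot, shift. destruct b; rewrite !E by lia; reflexivity.
Qed.

(** The equation expresses [Y (Y v)] by the flux one node to the left, whereas stability provides
    forward shifts. *)
Lemma shift_back_holder_class_n m f : holder_class_n m f -> holder_class_n m (shift_back f).
Proof.
  revert f. induction m; intros f.
  - intros (r & B & HB). exists r, B. intros t i j i' j' w (A1 & A2 & A3 & d & A4 & A5 & A6).
    apply HB. repeat split; try lia. exists d. repeat split; auto; lia.
  - intros [F1 F2]. split. apply IHm, F1. intros b Hb.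
    apply grid_eq with (1 := IHm _ (F2 b Hb)).
    intros t i j. unfold shift_back, dquot, shift. destruct b; auto.
    replace (i - 1 + 1)%Z with (i + 1 - 1)%Z by lia. reflexivity.
Qed.

Variables (k : nat) (M : R).
Hypothesis HM : forall p t i j, (p <= k + 2)%nat -> (0 <= j <= N t)%Z -> Rabs (D p t i j) <= M.
Hypothesis Htop : forall t i j d, (0 <= j <= N t)%Z -> (0 < d)%Z ->
  Rabs (D (k + 2) t (i + d)%Z j - D (k + 2) t i j) <= M * modulus t d.

Lemma lip_holder_x f B t j : (forall i, Rabs (f t i j) <= B) ->
  (forall i, Rabs (X f t i j) <= B) ->
  forall i d, (0 < d)%Z -> Rabs (f t (i + d)%Z j - f t i j) <= 2 * B * modulus t d.
Proof.
  intros H1 H2 i d Hd. assert (O := modulus_pos N alpha t d).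
  assert (B0 : 0 <= B) by (apply Rle_trans with (2 := H1 i); apply Rabs_pos).
  destruct (Z_le_gt_dec d (N t)) as [Hdn|Hdn].
  - assert (C := chain1 (fun i => f t i j) (mesh N t) 0 B i d ltac:(lia)).
    assert (C1 := C ltac:(intros s Hs; cbv beta; rewrite Rminus_0_r; apply (H2 (i + s)%Z))).
    assert (P := mesh_pos N HN t). cbv beta in C1.
    rewrite Rmult_0_r, Rminus_0_r, Rabs_mult, (Rabs_pos_eq (mesh N t)) in C1 by lra.
    assert (L := modulus_lower N alpha HN Hal t d Hd Hdn).
    apply Rle_trans with (B * (IZR d / mesh N t)).
    + apply (Rmult_le_reg_r (mesh N t)); auto. apply Rle_trans with (1 := C1). right. field. lra.
    + apply (Rmult_le_compat_l B) in L; auto. assert (0 <= B * modulus t d) by (apply Rmult_le_pos; lra). lra.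
  - assert (L : 1 <= modulus t d).
    { apply pw_ge1; auto. apply (proj1 (Rle_div_r _ _ _ (mesh_pos N HN t))). rewrite Rmult_1_l.
      apply IZR_le; lia. }
    apply Rle_trans with (1 := abs_sub_le _ _ _ _ (H1 (i + d)%Z) (H1 i)).
    apply (Rmult_le_compat_l (2 * B)) in L; lra.
Qed.

Lemma lip_holder_y f B t i j d : 0 <= B -> (0 <= j)%Z -> (0 < d)%Z -> (j + d <= N t)%Z ->
  (forall j', (j <= j' < j + d)%Z -> Rabs (Y f t i j') <= B) ->
  Rabs (f t i (j + d)%Z - f t i j) <= B * modulus t d.
Proof.
  intros B0 Hj Hd Hjd H2.
  assert (C := chain1 (fun j => f t i j) (mesh N t) 0 B j d ltac:(lia)).
  assert (C1 := C ltac:(intros s Hs; cbv beta; rewrite Rminus_0_r; apply (H2 (j + s)%Z); lia)).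
  assert (P := mesh_pos N HN t). cbv beta in C1.
  rewrite Rmult_0_r, Rminus_0_r, Rabs_mult, (Rabs_pos_eq (mesh N t)) in C1 by lra.
  assert (L := modulus_lower N alpha HN Hal t d Hd ltac:(lia)).
  apply Rle_trans with (B * (IZR d / mesh N t)).
  - apply (Rmult_le_reg_r (mesh N t)); auto. apply Rle_trans with (1 := C1). right. field. lra.
  - apply Rmult_le_compat_l; auto.
Qed.

Lemma M_nonneg (t : T) : 0 <= M.
Proof.
  apply Rle_trans with (2 := HM 0%nat t 0%Z 0%Z ltac:(lia) ltac:(specialize (HN t); lia)).
  apply Rabs_pos.
Qed.

Lemma holder_x p t i j d : (p <= k + 2)%nat -> (0 <= j <= N t)%Z -> (0 < d)%Z ->
  Rabs (D p t (i + d)%Z j - D p t i j) <= 2 * M * modulus t d.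
Proof.
  intros Hp Hj Hd. destruct (le_lt_eq_dec _ _ Hp) as [Hp'| ->].
  - apply lip_holder_x; auto. intro i'. apply (HM (S p)); auto.
  - apply Rle_trans with (1 := Htop t i j d Hj Hd).
    assert (P := M_nonneg t). assert (O := modulus_pos N alpha t d).
    apply Rmult_le_compat_r; lra.
Qed.

Definition gflux : grid T := fun t i j => edge_coef N a Rs v t i j * X v t i j.

Lemma yy_equation p t i j : (0 <= j)%Z -> (j + 2 <= N t)%Z ->
  Y (Y (D p)) t i j = - / kap * dxn (mesh N) (S p) gflux t (i - 1)%Z (j + 1)%Z.
Proof.
  intros Hj Hj2. assert (E := dxn_equation N a Rs kap v Hsol p t i (j + 1)%Z ltac:(lia)).
  fold gflux in E. unfold dquot, shift.
  replace (j + 1 - 1)%Z with j in E by lia.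
  set (g := dxn (mesh N) (S p) gflux t (i - 1)%Z (j + 1)%Z) in *.
  replace g with (- (kap * mesh N t ^ 2 * (D p t i (j + 1 + 1)%Z - 2 * D p t i (j + 1)%Z + D p t i j)))
    by lra. field. lra.
Qed.

(** At this stage nothing is known across rows, so every row becomes a member of the family and only
    increments in [x] are selected; the bounds are then uniform over rows. *)
Lemma flux_rows : exists B, forall p t i j, (p <= k + 1)%nat -> (0 <= j <= N t)%Z ->
  Rabs (dxn (mesh N) p gflux t i j) <= B /\
  forall d, (0 < d)%Z ->
    Rabs (dxn (mesh N) p gflux t (i + d)%Z j - dxn (mesh N) p gflux t i j) <= B * modulus t d.
Proof.
  set (T' := {x : T * Z | (0 <= snd x <= N (fst x))%Z}).
  set (pi := fun x : T' => fst (proj1_sig x)). set (I := fun x : T' => 0%Z).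
  set (J := fun x : T' => snd (proj1_sig x)).
  assert (HJ : forall x, (0 <= J x <= N (pi x))%Z) by (intro x; exact (proj2_sig x)).
  set (n' := fun x => mesh N (pi x)).
  set (Q := fun (r : nat) (x : T') (i j i' j' : Z) (w : R) =>
     exists d, (0 < d)%Z /\ modulus (pi x) d <= w /\ (i = i' + d)%Z /\ j = j').
  assert (HQ : admissible Q).
  { split; [|split].
    - intros; assumption.
    - intros r x i j i' j' w (d & H1 & H2 & _). apply Rle_trans with (2 := H2). apply Rlt_le, modulus_pos.
    - intros r b x i j i' j' w (d & H1 & H2 & H3 & H4).
      assert (O := modulus_pos N alpha (pi x) d). destruct b; exists d; repeat split; auto; try lra; lia. }
  assert (GQ := bounded_modulus_stable_class _ HQ).
  assert (BQ : forall (f : grid T') B, (forall x i j, Rabs (f x i j) <= B) ->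
     (forall x i j d, (0 < d)%Z -> Rabs (f x (i + d)%Z j - f x i j) <= B * modulus (pi x) d) -> bounded_modulus Q f).
  { intros f B H1 H2. exists 0%nat, B. intros x i j i' j' w (d & K1 & K2 & -> & ->).
    assert (B0 : 0 <= B) by (apply Rle_trans with (2 := H1 x i' j'); apply Rabs_pos).
    repeat split; auto. apply Rle_trans with (1 := H2 x i' j' d K1). apply Rmult_le_compat_l; auto. }
  set (u := recenter pi I J v). set (y := (fun x _ _ => ynode Rs (N (pi x)) (J x)) : grid T').
  assert (Hu : diff_class n' (false :: nil) (k + 2) (bounded_modulus Q) u).
  { apply dxn_diff_class. intros p Hp. unfold u, n'. rewrite recenter_dxn.
    apply (BQ _ (2 * M)).
    - intros x i j. assert (P := M_nonneg (pi x)).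
      apply Rle_trans with M; [|lra]. apply HM; auto.
    - intros x i j d Hd. unfold recenter. rewrite Z.add_assoc. apply holder_x; auto. }
  assert (Hy : diff_class n' (false :: nil) (k + 2) (bounded_modulus Q) y).
  { apply dxn_diff_class. intros p Hp. destruct p.
    - apply (BQ _ Rs).
      + intros x i j. apply ynode_bound; auto.
      + intros x i j d Hd. unfold dxn, y. simpl. rewrite Rminus_diag, Rabs_R0.
        apply Rmult_le_pos; [lra|]. apply Rlt_le, modulus_pos.
    - apply grid_eq with (1 := g_const _ GQ 0).
      rewrite dxn_S. replace (dquot n' false y) with (fun (_ : T') (_ _ : Z) => 0).
      + clear. induction p; auto. intros t i j. rewrite dxn_succ, <- !IHp. ring.
      + extensionality x. extensionality i. extensionality j. unfold dquot, shift, y. ring. }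
  assert (Gm := stable_class_diff_class n' (false :: nil) (k + 1) _ GQ).
  assert (Hc : diff_class n' (false :: nil) (k + 1) (bounded_modulus Q)
     (fun t i j => coef a (y t i j) (u t i j) (u t (i + 1)%Z j))).
  { apply stable_class_coef; auto; apply diff_class_le with (k + 2)%nat; auto; lia. }
  assert (Hd : diff_class n' (false :: nil) (k + 1) (bounded_modulus Q) (dquot n' false u)).
  { apply diff_class_dquot. simpl; auto. replace (S (k + 1)) with (k + 2)%nat by lia. exact Hu. }
  assert (HG := g_mul _ Gm _ _ Hc Hd).
  replace (fun (t : T') i j => coef a (y t i j) (u t i j) (u t (i + 1)%Z j) * dquot n' false u t i j)
    with (recenter pi I J gflux) in HG.
  2:{ extensionality x. extensionality i. extensionality j.
      unfold recenter, gflux, edge_coef, y, u, dquot, shift, n', recenter. rewrite !Z.add_assoc. reflexivity. }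
  assert (HB : forall p, (p <= k + 1)%nat -> exists B, forall t i j, (0 <= j <= N t)%Z ->
    Rabs (dxn (mesh N) p gflux t i j) <= B /\
    forall d, (0 < d)%Z ->
      Rabs (dxn (mesh N) p gflux t (i + d)%Z j - dxn (mesh N) p gflux t i j) <= B * modulus t d).
  { intros p Hp.
    assert (A : bounded_modulus Q (dxn n' p (recenter pi I J gflux))).
    { apply (diff_class_dxn n' 0 p). apply diff_class_le with (k + 1)%nat; auto. lia. }
    unfold n' in A. rewrite recenter_dxn in A. destruct A as (r & B & A).
    exists B. intros t i j Hj. set (x := exist _ (t, j) Hj : T').
    assert (E : forall i', recenter pi I J (dxn (mesh N) p gflux) x i' 0%Z = dxn (mesh N) p gflux t i' j).
    { intro i'. unfold recenter, pi, I, J. simpl. reflexivity. }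
    split.
    - destruct (A x (i + 1)%Z 0%Z i 0%Z (modulus t 1)) as (_ & A1 & _).
      { exists 1%Z. split; [lia|split; [right; reflexivity|split; reflexivity]]. }
      rewrite E in A1. exact A1.
    - intros d Hd'. destruct (A x (i + d)%Z 0%Z i 0%Z (modulus t d)) as (_ & _ & A1).
      { exists d. split; [lia|split; [right; reflexivity|split; reflexivity]]. }
      rewrite !E in A1. exact A1. }
  clear - HB. induction (k + 1)%nat as [|q IH].
  - destruct (HB 0%nat (le_n _)) as [B H]. exists B. intros p t i j Hp. replace p with 0%nat by lia. auto.
  - destruct IH as [B1 H1]. { intros p Hp. apply HB. lia. }
    destruct (HB (S q) (le_n _)) as [B2 H2]. exists (Rmax B1 B2). intros p t i j Hp Hj.
    assert (M1 := Rmax_l B1 B2). assert (M2 := Rmax_r B1 B2).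
    destruct (le_lt_eq_dec _ _ Hp) as [Hp'| ->].
    + destruct (H1 p t i j ltac:(lia) Hj) as [A1 A2]. split. lra. intros d Hd.
      apply Rle_trans with (1 := A2 d Hd). apply Rmult_le_compat_r; auto. apply Rlt_le, modulus_pos.
    + destruct (H2 t i j Hj) as [A1 A2]. split. lra. intros d Hd.
      apply Rle_trans with (1 := A2 d Hd). apply Rmult_le_compat_r; auto. apply Rlt_le, modulus_pos.
Qed.

(** Interpolation is applied to [D p]. Its second [y]-difference is controlled through the equation
    by [S p] differences of the flux and its second [x]-difference is [D (S (S p))], which limits
    [p] to [k]. *)
Lemma interpolated : exists C, 0 <= C /\ forall p, (p <= k)%nat ->
  (forall t i j, (0 <= j < N t)%Z -> Rabs (Y (D p) t i j) <= C) /\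
  (forall t i j, (0 <= j)%Z -> (j + 2 <= N t)%Z -> Rabs (Y (Y (D p)) t i j) <= C) /\
  (forall t i j d, (0 <= j)%Z -> (0 < d)%Z -> (j + d <= N t)%Z ->
     Rabs (D (S (S p)) t i (j + d)%Z - D (S (S p)) t i j) <= C * modulus t d) /\
  (forall t i j, (0 <= j)%Z -> (j + 1 <= N t)%Z ->
    Rabs (Y (D (S p)) t i j) <= C /\
    (forall d, (0 < d)%Z -> Rabs (Y (D (S p)) t (i + d)%Z j - Y (D (S p)) t i j) <= C * modulus t d) /\
    (forall d, (0 < d)%Z -> (j + d + 1 <= N t)%Z ->
       Rabs (Y (D (S p)) t i (j + d)%Z - Y (D (S p)) t i j) <= C * modulus t d)).
Proof.
  destruct (classic (exists t : T, True)) as [[t0 _]|HT].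
  2:{ exists 0. split. lra. intros p Hp. repeat split; intros; exfalso; apply HT; exists t; auto. }
  destruct flux_rows as [B HB].
  set (B' := Rmax (2 * M) (/ kap * Rabs B)).
  assert (P := M_nonneg t0).
  assert (B1 : 2 * M <= B') by apply Rmax_l. assert (B2 : / kap * Rabs B <= B') by apply Rmax_r.
  assert (Ik : 0 < / kap) by (apply Rinv_0_lt_compat, Hkap).
  assert (A : forall p, (p <= k)%nat -> exists C, 0 <= C /\
    (forall t i j, (0 <= j < N t)%Z -> Rabs (Y (D p) t i j) <= C) /\
    (forall t i j, (0 <= j)%Z -> (j + 2 <= N t)%Z -> Rabs (Y (Y (D p)) t i j) <= C) /\
    (forall t i j d, (0 <= j)%Z -> (0 < d)%Z -> (j + d <= N t)%Z ->
       Rabs (D (S (S p)) t i (j + d)%Z - D (S (S p)) t i j) <= C * modulus t d) /\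
    (forall t i j, (0 <= j)%Z -> (j + 1 <= N t)%Z ->
      Rabs (Y (D (S p)) t i j) <= C /\
      (forall d, (0 < d)%Z -> Rabs (Y (D (S p)) t (i + d)%Z j - Y (D (S p)) t i j) <= C * modulus t d) /\
      (forall d, (0 < d)%Z -> (j + d + 1 <= N t)%Z ->
         Rabs (Y (D (S p)) t i (j + d)%Z - Y (D (S p)) t i j) <= C * modulus t d))).
  { intros p Hp.
    assert (E1 : forall t i j, (0 <= j <= N t)%Z -> Rabs (D p t i j) <= B').
    { intros. apply Rle_trans with M; [|lra]. apply HM; auto. lia. }
    assert (E2 : forall t i j, (0 <= j)%Z -> (j + 2 <= N t)%Z -> Rabs (Y (Y (D p)) t i j) <= B').
    { intros t i j Hj Hj2. rewrite yy_equation by auto.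
      rewrite Rabs_mult, Rabs_Ropp, (Rabs_pos_eq (/ kap)) by lra.
      apply Rle_trans with (2 := B2). apply Rmult_le_compat_l; [lra|].
      apply Rle_trans with B; [|apply Rle_abs]. apply HB; lia. }
    assert (E3 : forall t i j, (0 <= j <= N t)%Z -> Rabs (X (X (D p)) t i j) <= B').
    { intros t i j Hj. apply Rle_trans with M; [|lra]. apply (HM (S (S p))); auto. lia. }
    assert (E4 : forall t i j d, (0 <= j <= N t)%Z -> (0 < d)%Z ->
        Rabs (X (X (D p)) t (i + d)%Z j - X (X (D p)) t i j) <= B' * modulus t d).
    { intros t i j d Hj Hd. apply Rle_trans with (2 * M * modulus t d).
      apply (holder_x (S (S p))); auto. lia. apply Rmult_le_compat_r; auto. apply Rlt_le, modulus_pos. }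
    assert (E5 : forall t i j d, (0 <= j)%Z -> (j + 2 <= N t)%Z -> (0 < d)%Z ->
        Rabs (Y (Y (D p)) t (i + d)%Z j - Y (Y (D p)) t i j) <= B' * modulus t d).
    { intros t i j d Hj Hj2 Hd. rewrite !yy_equation by auto.
      replace (i + d - 1)%Z with (i - 1 + d)%Z by lia.
      rewrite <- Rmult_minus_distr_l, Rabs_mult, Rabs_Ropp, (Rabs_pos_eq (/ kap)) by lra.
      apply Rle_trans with (/ kap * Rabs B * modulus t d); [|apply Rmult_le_compat_r; auto; apply Rlt_le, modulus_pos].
      rewrite Rmult_assoc. apply Rmult_le_compat_l; [lra|].
      apply Rle_trans with (B * modulus t d). apply HB; lia.
      apply Rmult_le_compat_r. apply Rlt_le, modulus_pos. apply Rle_abs. }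
    assert (B0 : 0 <= B') by lra.
    destruct (first_difference_y N alpha (D p) B' HN Hal B0 E3 E4 E5) as (C1 & C10 & HC1).
    destruct (mixed_holder N alpha (D p) B' HN Hal B0 E1 E3 E4 E5) as (C2 & HC2).
    assert (E6 := dy_bounded N (D p) B' HN B0 E1 E2).
    set (C := Rmax (Rmax C1 C2) (3 * B')).
    assert (K1 : C1 <= C) by (apply Rle_trans with (2 := Rmax_l _ _); apply Rmax_l).
    assert (K2 : C2 <= C) by (apply Rle_trans with (2 := Rmax_l _ _); apply Rmax_r).
    assert (K3 : 3 * B' <= C) by apply Rmax_r.
    exists C. split; [lra|]. split; [|split; [|split]].
    - intros t i j Hj. apply Rle_trans with (2 := K3). apply E6; auto.
    - intros t i j Hj Hj2. specialize (E2 t i j Hj Hj2). lra.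
    - intros t i j d Hj Hd Hjd. apply Rle_trans with (C1 * modulus t d).
      apply HC1; auto. apply Rmult_le_compat_r; auto. apply Rlt_le, modulus_pos.
    - intros t i j Hj Hj1. destruct (HC2 t i j Hj Hj1) as (F1 & F2 & F3).
      change (D (S p)) with (X (D p)). rewrite dquot_comm. split; [|split].
      + lra.
      + intros d Hd. apply Rle_trans with (1 := F2 d Hd). apply Rmult_le_compat_r; auto. apply Rlt_le, modulus_pos.
      + intros d Hd Hjd. apply Rle_trans with (1 := F3 d Hd Hjd). apply Rmult_le_compat_r; auto.
        apply Rlt_le, modulus_pos. }
  clear - A. induction k as [|q IH].
  - destruct (A 0%nat (le_n _)) as [C [C0 HC]]. exists C. split; auto. intros p Hp.
    replace p with 0%nat by lia. auto.
  - destruct IH as (C1 & C10 & H1). { intros p Hp. apply A. lia. }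
    destruct (A (S q) (le_n _)) as (C2 & C20 & H2).
    assert (M1 := Rmax_l C1 C2). assert (M2 := Rmax_r C1 C2). set (C := Rmax C1 C2) in *.
    exists C. split. lra. intros p Hp.
    assert (Mono : forall C' t d x, C' <= C -> x <= C' * modulus t d -> x <= C * modulus t d).
    { intros C' t d x HC' Hx. apply Rle_trans with (1 := Hx). apply Rmult_le_compat_r; auto.
      apply Rlt_le, modulus_pos. }
    assert (K : exists C', C' <= C /\ _) by
      (destruct (le_lt_eq_dec _ _ Hp) as [Hp'|Hp'];
       [exists C1; split; [exact M1|exact (H1 p ltac:(lia))]
       |exists C2; split; [exact M2|rewrite <- Hp' in H2; exact H2]]).
    destruct K as (C' & HC' & F1 & F2 & F3 & F4).
    split; [|split; [|split]].
    + intros t i j Hj. specialize (F1 t i j Hj). lra.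
    + intros t i j Hj Hj'. specialize (F2 t i j Hj Hj'). lra.
    + intros t i j d Hj Hd Hjd. apply (Mono C'); auto.
    + intros t i j Hj Hj'. destruct (F4 t i j Hj Hj') as (G1 & G2 & G3). split; [|split].
      * lra.
      * intros d Hd. apply (Mono C'); auto.
      * intros d Hd Hjd. apply (Mono C'); auto.
Qed.

(** For [p <= 1] Hoelder continuity in [y] follows from a bounded [y]-difference; from [p = 2] on it
    is the interpolation estimate for [D (p - 2)]. *)
Lemma dxn_holder_class p : (p <= k + 2)%nat -> holder_class (D p).
Proof.
  intro Hp. destruct (classic (exists t : T, True)) as [[t0 _]|HT].
  2:{ exists 0%nat, 0. intros t. exfalso. apply HT. exists t; auto. }
  assert (P := M_nonneg t0).
  destruct interpolated as (C & C0 & HC). apply (holder_class_intro _ (2 * M + C) 0).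
  - intros t i j Hj Hjr. assert (Q := HM p t i j Hp ltac:(lia)). lra.
  - intros t i j d Hj Hjr Hd. apply Rle_trans with (2 * M * modulus t d).
    apply holder_x; auto; lia. apply Rmult_le_compat_r. apply Rlt_le, modulus_pos. lra.
  - intros t i j d Hj Hd Hjr. apply Rle_trans with (C * modulus t d).
    2:{ apply Rmult_le_compat_r. apply Rlt_le, modulus_pos. lra. }
    destruct p as [|[|p]].
    + apply lip_holder_y; auto; try lia. intros j' Hj'.
      apply (HC 0%nat ltac:(lia)). lia.
    + apply lip_holder_y; auto; try lia. intros j' Hj'.
      apply (HC 0%nat ltac:(lia)); lia.
    + apply (HC p ltac:(lia)); auto. lia.
Qed.

Lemma dy_dxn_holder_class p : (p <= k + 1)%nat -> holder_class (Y (D p)).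
Proof.
  intro Hp. destruct interpolated as (C & C0 & HC).
  destruct p as [|p].
  - destruct (HC 0%nat ltac:(lia)) as (F1 & F2 & F3 & F4).
    apply (holder_class_intro _ (2 * C) 1).
    + intros t i j Hj Hjr. assert (Q := F1 t i j ltac:(lia)). lra.
    + intros t i j d Hj Hjr Hd. apply lip_holder_x; auto.
      * intro i'. apply F1. lia.
      * intro i'. destruct (F4 t i' j Hj ltac:(lia)) as (Q & _). rewrite dquot_comm. exact Q.
    + intros t i j d Hj Hd Hjr. apply Rle_trans with (C * modulus t d).
      * apply lip_holder_y; auto; try lia. intros j' Hj'. apply F2; lia.
      * apply Rmult_le_compat_r. apply Rlt_le, modulus_pos. lra.
  - destruct (HC p ltac:(lia)) as (F1 & F2 & F3 & F4).
    apply (holder_class_intro _ C 1).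
    + intros t i j Hj Hjr. apply F4; lia.
    + intros t i j d Hj Hjr Hd. apply F4; lia.
    + intros t i j d Hj Hd Hjr. apply F4; lia.
Qed.

Lemma ynode_holder_class_n m : holder_class_n m (fun t _ j => ynode Rs (N t) j).
Proof.
  assert (Y0 : holder_class (fun t _ j => ynode Rs (N t) j)).
  { apply (holder_class_intro _ (2 * Rs) 0).
    - intros t i j Hj Hjr. assert (Q := ynode_bound Rs (N t) j HRs (HN t) ltac:(lia)). lra.
    - intros t i j d Hj Hjr Hd. rewrite Rminus_diag, Rabs_R0. apply Rmult_le_pos. lra.
      apply Rlt_le, modulus_pos.
    - intros t i j d Hj Hd Hjr. unfold ynode. rewrite plus_IZR.
      replace (- Rs + 2 * Rs * ((IZR j + IZR d) / IZR (N t)) - (- Rs + 2 * Rs * (IZR j / IZR (N t))))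
        with (2 * Rs * (IZR d / mesh N t)) by (unfold mesh; field; apply Rgt_not_eq, (mesh_pos N HN t)).
      assert (F := frac_pos N HN t d Hd).
      rewrite Rabs_pos_eq by (apply Rmult_le_pos; lra).
      apply Rmult_le_compat_l. lra. apply modulus_lower; auto. lia. }
  destruct m; auto. assert (Gm := stable_class_holder_class_n m).
  assert (E : forall m, holder_class_n m (fun t _ j => ynode Rs (N t) j)).
  { clear m Gm. induction m; auto. split; auto. intros b Hb.
    apply grid_eq with (1 := g_const _ (stable_class_holder_class_n m) (if b then 2 * Rs else 0)).
    intros t i j. unfold dquot, shift, ynode. destruct b.
    - rewrite plus_IZR. unfold mesh. field. apply Rgt_not_eq, (mesh_pos N HN t).
    - ring. }
  apply E.
Qed.

(** The equation trades two [y]-differences for two [x]-differences. *)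
Lemma dxn_holder_class_n m p : (p + m <= k + 2)%nat -> holder_class_n m (D p).
Proof.
  (* Two consecutive orders are carried along, because replacing two [y]-differences by the equation
     refers to the class two orders lower. *)
  enough (F : (forall p, (p + m <= k + 2)%nat -> holder_class_n m (D p)) /\
              (forall p, (p + S m <= k + 2)%nat -> holder_class_n (S m) (D p))) by (apply F).
  clear p. induction m as [|m [IH1 IH2]].
  - split.
    + intros p Hp. apply dxn_holder_class. lia.
    + intros p Hp. split. apply dxn_holder_class; lia. intros b [<-|[<-|[]]].
      * apply (dxn_holder_class (S p)). lia.
      * apply dy_dxn_holder_class. lia.
  - split; auto. intros p Hp. split. apply IH2; lia. intros b [<-|[<-|[]]].
    + apply (IH2 (S p)). lia.
    + split; [|intros b [<-|[<-|[]]]].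
      * apply (IH2 p ltac:(lia)). simpl; auto.
      * rewrite dquot_comm. apply (IH2 (S p) ltac:(lia)). simpl; auto.
      * assert (Gp := stable_class_diff_class (mesh N) (false :: nil) (S p) _ (stable_class_holder_class_n m)).
        assert (Hv : diff_class (mesh N) (false :: nil) (S (S p)) (holder_class_n m) v).
        { apply dxn_diff_class. intros q Hq. apply IH1. lia. }
        assert (Hy : diff_class (mesh N) (false :: nil) (S p) (holder_class_n m) (fun t _ j => ynode Rs (N t) j)).
        { apply dxn_diff_class. intros q Hq. destruct q. apply ynode_holder_class_n.
          apply grid_eq with (1 := g_const _ (stable_class_holder_class_n m) 0).
          rewrite dxn_S.
          replace (X (fun t _ j => ynode Rs (N t) j)) with (fun (_ : T) (_ _ : Z) => 0).
          + clear. induction q; auto. intros t i j. rewrite dxn_succ, <- !IHq. ring.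
          + grid_ext. unfold dquot, shift. ring. }
        assert (HG : diff_class (mesh N) (false :: nil) (S p) (holder_class_n m) gflux).
        { apply (g_mul _ Gp (edge_coef N a Rs v) (X v)).
          - apply (stable_class_coef _ a v (fun t _ j => ynode Rs (N t) j)); auto.
            apply diff_class_le with (S (S p)); auto.
          - apply diff_class_dquot; simpl; auto. }
        assert (HG' : holder_class_n m (dxn (mesh N) (S p) gflux)).
        { apply (diff_class_dxn (mesh N) 0 (S p)). rewrite Nat.add_0_r. exact HG. }
        apply (domext_holder_class_n m (fun t i j => - / kap * shift true (shift_back (dxn (mesh N) (S p) gflux)) t i j) _ 2%nat).
        { intros t i j Hj Hjr. rewrite yy_equation by lia. reflexivity. }
        apply (g_mul _ (stable_class_holder_class_n m) (fun _ _ _ => - / kap) (shift true (shift_back (dxn (mesh N) (S p) gflux)))).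
        apply (g_const _ (stable_class_holder_class_n m)). apply (g_sh _ (stable_class_holder_class_n m)). apply shift_back_holder_class_n, HG'.
Qed.

Theorem differences_holder l : (length l <= k + 2)%nat -> holder_class (dquots (mesh N) l v).
Proof.
  assert (E : forall l m, (length l + m <= k + 2)%nat -> holder_class_n m (dquots (mesh N) l v)).
  { clear l. induction l as [|b l IH]; intros m Hm.
    - apply (dxn_holder_class_n m 0). exact Hm.
    - simpl in *. apply diff_class_dquot. destruct b; simpl; auto. apply (IH (S m)). lia. }
  intro Hl. apply (E l 0%nat). lia.
Qed.

End Regularity.

(** * Boundary data *)

(** Difference quotients and plain increments are instances of it, so that commutation with
    derivatives and with means is proved once. *)
Definition scaled_increment (s c : R) (f : R -> R) : R -> R := fun x => c * (f (x + s) - f x).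

Definition dq (n : R) : (R -> R) -> R -> R := scaled_increment (/ n) n.

Definition dqn (n : R) (p : nat) (f : R -> R) : R -> R := Nat.iter p (dq n) f.

Definition smooth (m : nat) (f : R -> R) : Prop :=
  forall i, (i < m)%nat -> forall x, ex_derive (Derive_n f i) x.

Lemma scaled_increment_derive s c f x : (forall x, ex_derive f x) ->
  is_derive (scaled_increment s c f) x (scaled_increment s c (Derive f) x).
Proof.
  intro H. unfold scaled_increment.
  assert (H1 := Derive_correct _ _ (H x)). assert (H2 := Derive_correct _ _ (H (x + s))).
  apply (is_derive_scal (fun x => f (x + s) - f x) x c).
  apply (is_derive_minus (fun x => f (x + s)) f x); auto.
  apply (is_derive_ext (fun t => f (1 * t + s))). { intro t. f_equal. ring. }
  replace (Derive f (x + s)) with (scal 1 (Derive f (x + s))) by (unfold scal; simpl; unfold mult; simpl; ring).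
  apply (is_derive_comp f (fun t => 1 * t + s)).
  - rewrite Rmult_1_l. exact H2.
  - auto_derive; auto. ring.
Qed.

Lemma scaled_increment_derive_n s c f m j : smooth m f -> (j <= m)%nat ->
  Derive_n (scaled_increment s c f) j = scaled_increment s c (Derive_n f j).
Proof.
  intros Hf Hj. induction j. reflexivity.
  simpl. rewrite IHj by lia. extensionality x. apply is_derive_unique.
  apply scaled_increment_derive. apply Hf. lia.
Qed.

Lemma scaled_increment_smooth s c f m : smooth m f -> smooth m (scaled_increment s c f).
Proof.
  intros Hf i Hi x. rewrite (scaled_increment_derive_n s c f m) by (auto; lia).
  eexists. apply scaled_increment_derive. apply Hf, Hi.
Qed.

Lemma smooth_le m m' f : (m' <= m)%nat -> smooth m f -> smooth m' f.
Proof. intros H Hf i Hi. apply Hf. lia. Qed.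

(** Quotients commute with derivatives, so the mean value theorem trades them for derivatives one at
    a time. *)
Lemma dqn_bound n m B f : 0 < n -> smooth m f -> (forall x, Rabs (Derive_n f m x) <= B) ->
  forall x, Rabs (dqn n m f x) <= B.
Proof.
  intro Hn. revert f. induction m; intros f Hf HB x. apply HB.
  unfold dqn. rewrite Nat.iter_succ_r. apply IHm.
  - apply scaled_increment_smooth, smooth_le with (S m); auto.
  - intro z. unfold dq. rewrite (scaled_increment_derive_n _ _ _ (S m)) by auto.
    assert (Hi : 0 < / n) by (apply Rinv_0_lt_compat, Hn).
    destruct (MVT_gen (Derive_n f m) z (z + / n) (Derive_n f (S m))) as (w & _ & Hw).
    + intros y _. apply Derive_correct. apply Hf. lia.
    + intros y _. apply continuity_pt_filterlim. apply (ex_derive_continuous (Derive_n f m) y). apply Hf. lia.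
    + unfold scaled_increment. rewrite Hw. replace (n * (Derive_n f (S m) w * (z + / n - z)))
        with (Derive_n f (S m) w) by (field; lra). apply HB.
Qed.

Lemma dqn_scaled_increment n p s c f : dqn n p (scaled_increment s c f) = scaled_increment s c (dqn n p f).
Proof.
  induction p; auto. change (dq n (dqn n p (scaled_increment s c f)) = scaled_increment s c (dq n (dqn n p f))).
  rewrite IHp. extensionality x. unfold dq, scaled_increment.
  replace (x + / n + s) with (x + s + / n) by ring. ring.
Qed.

Lemma dqn_increment n m f C s : 0 < n -> smooth m f ->
  (forall x, Rabs (Derive_n f m (x + s) - Derive_n f m x) <= C) ->
  forall x, Rabs (dqn n m f (x + s) - dqn n m f x) <= C.
Proof.
  intros Hn Hf HC x.
  replace (dqn n m f (x + s) - dqn n m f x) with (dqn n m (scaled_increment s 1 f) x)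
    by (rewrite dqn_scaled_increment; unfold scaled_increment; ring).
  apply dqn_bound; auto. apply scaled_increment_smooth, Hf.
  intro z. rewrite (scaled_increment_derive_n _ _ _ m) by auto. unfold scaled_increment. rewrite Rmult_1_l. apply HC.
Qed.

Fixpoint translate_sum (h : R) (q : nat) (f : R -> R) (x : R) : R :=
  match q with O => 0 | S q => translate_sum h q f x + f (x + INR q * h) end.

(** A mean over grid translates commutes exactly with grid differences, and its own difference
    telescopes to one increment over the whole width. *)
Definition average (h : R) (q : nat) (f : R -> R) : R -> R := fun x => translate_sum h q f x / INR q.

Lemma translate_sum_bound h q f x y B : (forall r, (r < q)%nat -> Rabs (f (x + INR r * h) - y) <= B) ->
  Rabs (translate_sum h q f x - INR q * y) <= INR q * B.
Proof.
  induction q; intro H.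
  - simpl. rewrite Rmult_0_l, Rminus_0_r, Rabs_R0. lra.
  - rewrite S_INR. simpl. assert (H1 := H q (Nat.lt_succ_diag_r q)).
    assert (H2 := IHq ltac:(intros; apply H; lia)).
    replace (translate_sum h q f x + f (x + INR q * h) - (INR q + 1) * y) with
      ((translate_sum h q f x - INR q * y) + (f (x + INR q * h) - y)) by ring.
    eapply Rle_trans; [apply Rabs_triang|]. lra.
Qed.

Lemma average_near h q f x y B : (0 < q)%nat ->
  (forall r, (r < q)%nat -> Rabs (f (x + INR r * h) - y) <= B) -> Rabs (average h q f x - y) <= B.
Proof.
  intros Hq H. assert (P : 0 < INR q) by (apply lt_0_INR, Hq).
  assert (A := translate_sum_bound h q f x y B H). unfold average.
  replace (translate_sum h q f x / INR q - y) with ((translate_sum h q f x - INR q * y) / INR q) by (field; lra).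
  unfold Rdiv. rewrite Rabs_mult, (Rabs_pos_eq (/ INR q)) by (apply Rlt_le, Rinv_0_lt_compat, P).
  apply (proj2 (Rle_div_l _ _ _ P)). lra.
Qed.

Lemma average_bound h q f B : (0 < q)%nat -> (forall x, Rabs (f x) <= B) -> forall x, Rabs (average h q f x) <= B.
Proof.
  intros Hq H x. rewrite <- (Rminus_0_r (average h q f x)). apply average_near; auto.
  intros r _. rewrite Rminus_0_r. apply H.
Qed.

Lemma average_scaled_increment h q s c f : average h q (scaled_increment s c f) = scaled_increment s c (average h q f).
Proof.
  extensionality x. unfold average, scaled_increment.
  assert (E : translate_sum h q (fun x => c * (f (x + s) - f x)) x = c * (translate_sum h q f (x + s) - translate_sum h q f x)).
  { induction q; simpl; [ring|]. rewrite IHq. replace (x + INR q * h + s) with (x + s + INR q * h) by ring. ring. }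
  rewrite E. unfold Rdiv. ring.
Qed.

Lemma average_dqn h q n p f : dqn n p (average h q f) = average h q (dqn n p f).
Proof.
  induction p; auto. change (dq n (dqn n p (average h q f)) = average h q (dq n (dqn n p f))).
  rewrite IHp. symmetry. apply average_scaled_increment.
Qed.

Lemma average_increment h q f C s : (0 < q)%nat -> (forall x, Rabs (f (x + s) - f x) <= C) ->
  forall x, Rabs (average h q f (x + s) - average h q f x) <= C.
Proof.
  intros Hq H x. replace (average h q f (x + s) - average h q f x) with (average h q (scaled_increment s 1 f) x)
    by (rewrite average_scaled_increment; unfold scaled_increment; ring).
  apply average_bound; auto. intro z. unfold scaled_increment. rewrite Rmult_1_l. apply H.
Qed.

Lemma average_gain n q f B : 0 < n -> (0 < q)%nat -> (forall x, Rabs (f x) <= B) ->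
  forall x, Rabs (dq n (average (/ n) q f) x) <= 2 * B * (n / INR q).
Proof.
  intros Hn Hq HB x. unfold dq, scaled_increment, average.
  assert (E : translate_sum (/ n) q f (x + / n) - translate_sum (/ n) q f x = f (x + INR q * / n) - f x).
  { clear Hq. induction q.
    - simpl. rewrite Rmult_0_l, Rplus_0_r. ring.
    - rewrite S_INR. simpl.
      replace (x + (INR q + 1) * / n) with (x + / n + INR q * / n) by ring. lra. }
  assert (P : 0 < INR q) by (apply lt_0_INR, Hq).
  replace (n * (translate_sum (/ n) q f (x + / n) / INR q - translate_sum (/ n) q f x / INR q)) with
    ((translate_sum (/ n) q f (x + / n) - translate_sum (/ n) q f x) * (n / INR q)) by (field; lra).
  assert (Q : 0 <= n / INR q) by (apply Rlt_le, Rdiv_lt_0_compat; auto).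
  rewrite E, Rabs_mult, (Rabs_pos_eq (n / INR q)) by auto.
  apply Rmult_le_compat_r; auto.
  assert (A1 := HB (x + INR q * / n)). assert (A2 := HB x).
  apply Rabs_le_between in A1. apply Rabs_le_between in A2. apply Rabs_le. lra.
Qed.

Lemma lip_of_dq n f B : 0 < n -> (forall x, Rabs (dq n f x) <= B) ->
  forall x r, Rabs (f (x + INR r * / n) - f x) <= B * (INR r * / n).
Proof.
  intros Hn H x. induction r.
  - simpl. rewrite Rmult_0_l, Rplus_0_r, Rminus_diag, Rabs_R0. lra.
  - rewrite S_INR. assert (A := H (x + INR r * / n)). unfold dq, scaled_increment in A.
    rewrite Rabs_mult, (Rabs_pos_eq n) in A by lra.
    replace (x + (INR r + 1) * / n) with (x + INR r * / n + / n) by ring.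
    assert (A' : Rabs (f (x + INR r * / n + / n) - f (x + INR r * / n)) <= B * / n).
    { apply (Rmult_le_reg_l n); auto. apply Rle_trans with (1 := A). right. field. lra. }
    replace (f (x + INR r * / n + / n) - f x) with
      ((f (x + INR r * / n + / n) - f (x + INR r * / n)) + (f (x + INR r * / n) - f x)) by ring.
    eapply Rle_trans; [apply Rabs_triang|]. lra.
Qed.

Lemma row_dxn {T} (n : T -> R) p (v : grid T) t j b : n t <> 0 ->
  (forall i, v t i j = b (IZR i / n t)) ->
  forall i, dxn n p v t i j = dqn (n t) p b (IZR i / n t).
Proof.
  intros Hn H. induction p; intro i. apply H.
  rewrite dxn_succ, !IHp. change (dqn (n t) (S p) b) with (dq (n t) (dqn (n t) p b)).
  unfold dq, scaled_increment. rewrite plus_IZR. replace ((IZR i + 1) / n t) with (IZR i / n t + / n t) by (field; auto).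
  ring.
Qed.

(** [b] is the rescaled datum averaged twice over a width of order [1/e], which makes two
    further differences available, at the cost of powers of [e]. *)
Lemma boundary_data m alpha P phi : (1 <= m)%nat -> 0 < P -> holder1 m alpha phi ->
  (forall x, phi (x + P) = phi x) ->
  exists B, 0 <= B /\ forall (e : nat) (n : Z), (1 <= e)%nat -> (Z.of_nat e <= n)%Z ->
  exists b : R -> R, (forall x, b (x + 1) = b x) /\
    (forall x, Rabs (b x - phi (P * x)) <= B / INR e) /\
    (forall p x, (p <= m)%nat -> Rabs (dqn (IZR n) p b x) <= B) /\
    (forall x s, 0 < s -> Rabs (dqn (IZR n) m b (x + s) - dqn (IZR n) m b x) <= B * Rpower s alpha) /\
    (forall x, Rabs (dqn (IZR n) (S m) b x) <= 4 * B * INR e) /\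
    (forall x, Rabs (dqn (IZR n) (S (S m)) b x) <= 16 * B * INR e ^ 2).
Proof.
  intros Hm HP (D1 & D2 & D3) Hper.
  set (psi := fun x => phi (P * x)).
  assert (Dn : forall p, (p <= m)%nat -> Derive_n psi p = fun x => P ^ p * Derive_n phi p (P * x)).
  { induction p; intro Hp.
    - extensionality x. simpl. unfold psi. ring.
    - simpl. rewrite IHp by lia. extensionality x. apply is_derive_unique.
      replace (P * P ^ p * Derive (Derive_n phi p) (P * x))
        with (P ^ p * (P * Derive (Derive_n phi p) (P * x))) by ring.
      apply (is_derive_scal (fun x => Derive_n phi p (P * x)) x (P ^ p)).
      apply (is_derive_comp (Derive_n phi p) (fun x => P * x)).
      + apply Derive_correct, D1. lia.
      + auto_derive; auto. ring. }
  assert (Sm : smooth m psi).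
  { intros i Hi x. rewrite Dn by lia.
    apply (ex_derive_scal (fun x => Derive_n phi i (P * x))).
    apply (ex_derive_comp (Derive_n phi i) (fun x => P * x)).
    - apply D1, Hi.
    - auto_derive; auto. }
  assert (Bp : exists B, 0 <= B /\ forall p x, (p <= m)%nat -> Rabs (Derive_n psi p x) <= B).
  { assert (Q : forall p, (p <= m)%nat -> exists B, forall x, Rabs (Derive_n psi p x) <= B).
    { intros p Hp. destruct (D2 p Hp) as [M HM]. exists (P ^ p * M). intro x.
      rewrite Dn, Rabs_mult by auto. assert (0 < P ^ p) by (apply pow_lt, HP).
      rewrite (Rabs_pos_eq (P ^ p)) by lra. apply Rmult_le_compat_l. lra. apply HM. }
    clear - Q. induction m.
    - destruct (Q 0%nat (le_n _)) as [B HB]. exists B. split.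
      + apply Rle_trans with (2 := HB 0). apply Rabs_pos.
      + intros p x Hp. replace p with 0%nat by lia. apply HB.
    - destruct IHm as (B1 & B10 & H1). { intros; apply Q; lia. }
      destruct (Q (S m) (le_n _)) as [B2 H2]. exists (Rmax B1 B2).
      assert (M1 := Rmax_l B1 B2). assert (M2 := Rmax_r B1 B2). split. lra.
      intros p x Hp. destruct (le_lt_eq_dec _ _ Hp) as [Hp'| ->].
      + apply Rle_trans with B1; auto. apply H1. lia.
      + apply Rle_trans with B2; auto. }
  destruct Bp as (B1 & B10 & HB1). destruct D3 as [C HC].
  set (C1 := P ^ m * (Rabs C * Rpower P alpha)).
  assert (Pm : 0 < P ^ m) by (apply pow_lt, HP).
  assert (C10 : 0 <= C1).
  { unfold C1. apply Rmult_le_pos. lra. apply Rmult_le_pos. apply Rabs_pos. apply Rlt_le, exp_pos. }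
  assert (HC1 : forall x s, 0 < s -> Rabs (Derive_n psi m (x + s) - Derive_n psi m x) <= C1 * Rpower s alpha).
  { intros x s Hs. rewrite !Dn by auto.
    replace (P ^ m * Derive_n phi m (P * (x + s)) - P ^ m * Derive_n phi m (P * x))
      with (P ^ m * (Derive_n phi m (P * (x + s)) - Derive_n phi m (P * x))) by ring.
    rewrite Rabs_mult, (Rabs_pos_eq (P ^ m)) by lra.
    unfold C1. rewrite Rmult_assoc. apply Rmult_le_compat_l; [lra|].
    assert (Ps : 0 < P * s) by (apply Rmult_lt_0_compat; auto).
    apply Rle_trans with (1 := HC (P * (x + s)) (P * x) ltac:(lra)).
    replace (P * (x + s) - P * x) with (P * s) by ring. rewrite (Rabs_pos_eq (P * s)) by lra.
    rewrite <- Rpower_mult_distr by auto. rewrite Rmult_assoc.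
    apply Rmult_le_compat_r; [|apply Rle_abs].
    apply Rlt_le, Rmult_lt_0_compat; apply exp_pos. }
  set (B := 2 * (B1 + C1)). exists B. split. unfold B; lra.
  intros e n He Hen.
  assert (e0 : 0 < INR e) by (apply lt_0_INR; lia).
  assert (nZ : (1 <= n)%Z) by lia.
  assert (n0 : 0 < IZR n) by (apply IZR_lt; lia).
  (* The width [q / n] lies between [1 / (2 e)] and [1 / e]. The upper bound keeps the mean close to
     the datum; the lower one makes the cost [n / q] of a further difference at most [2 e]. *)
  set (q := Z.to_nat (n / Z.of_nat e)).
  assert (qz : (1 <= n / Z.of_nat e)%Z) by (apply Z.div_le_lower_bound; lia).
  assert (q0 : (0 < q)%nat) by (unfold q; lia).
  assert (qI : INR q = IZR (n / Z.of_nat e)) by (unfold q; rewrite INR_IZR_INZ, Z2Nat.id by lia; reflexivity).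
  assert (Q0 : 0 < INR q) by (apply lt_0_INR, q0).
  assert (q1 : INR q * INR e <= IZR n).
  { rewrite qI, INR_IZR_INZ, <- mult_IZR. apply IZR_le. rewrite Z.mul_comm. apply Z.mul_div_le. lia. }
  assert (q2 : IZR n <= 2 * INR e * INR q).
  { rewrite qI, INR_IZR_INZ, <- !mult_IZR. apply IZR_le.
    assert (R1 := Z.mul_succ_div_gt n (Z.of_nat e) ltac:(lia)). nia. }
  assert (nq : IZR n / INR q <= 2 * INR e).
  { apply (proj2 (Rle_div_l _ _ _ Q0)). lra. }
  assert (nq0 : 0 <= IZR n / INR q) by (apply Rlt_le, Rdiv_lt_0_compat; auto).
  set (A := average (/ IZR n) q). exists (A (A psi)).
  assert (Fm : forall p x, (p <= m)%nat -> Rabs (dqn (IZR n) p psi x) <= B1).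
  { intros p x Hp. apply dqn_bound; auto. apply smooth_le with m; auto. }
  assert (L1 : forall x, Rabs (dq (IZR n) psi x) <= B1).
  { intro x. apply (Fm 1%nat x Hm). }
  assert (qe : INR q * / IZR n <= / INR e).
  { apply (Rmult_le_reg_l (IZR n)); auto. apply (Rmult_le_reg_r (INR e)); auto.
    replace (IZR n * (INR q * / IZR n) * INR e) with (INR q * INR e) by (field; lra).
    replace (IZR n * / INR e * INR e) with (IZR n) by (field; lra). exact q1. }
  assert (Near : forall f x, (forall x, Rabs (dq (IZR n) f x) <= B1) -> Rabs (A f x - f x) <= B1 / INR e).
  { intros f x Hf. apply average_near; auto. intros r Hr.
    apply Rle_trans with (1 := lip_of_dq _ _ _ n0 Hf x r).
    apply Rmult_le_compat_l; auto. apply Rle_trans with (2 := qe).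
    apply Rmult_le_compat_r. apply Rlt_le, Rinv_0_lt_compat, n0. apply le_INR; lia. }
  split; [|split; [|split; [|split; [|split]]]].
  - assert (PA : forall f, (forall x, f (x + 1) = f x) -> forall x, A f (x + 1) = A f x).
    { intros f Hf x. unfold A, average. f_equal. clear - Hf. induction q; simpl; auto.
      rewrite IHq. replace (x + 1 + INR q * / IZR n) with (x + INR q * / IZR n + 1) by ring.
      rewrite Hf. reflexivity. }
    apply PA, PA. intro x. unfold psi. rewrite Rmult_plus_distr_l, Rmult_1_r. apply Hper.
  - intro x. change (phi (P * x)) with (psi x).
    assert (E1 := Near psi x L1).
    assert (E2 := Near (A psi) x ltac:(intro z; change (dq (IZR n) (A psi)) with (dqn (IZR n) 1 (A psi));
      unfold A; rewrite average_dqn; apply average_bound; auto)).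
    replace (A (A psi) x - psi x) with ((A (A psi) x - A psi x) + (A psi x - psi x)) by ring.
    eapply Rle_trans; [apply Rabs_triang|]. unfold B.
    replace (2 * (B1 + C1) / INR e) with (B1 / INR e + B1 / INR e + 2 * C1 / INR e) by (field; lra).
    assert (0 <= 2 * C1 / INR e) by (apply Rdiv_le_0_compat; lra). lra.
  - intros p x Hp. apply Rle_trans with B1; [|unfold B; lra].
    unfold A. rewrite !average_dqn. apply average_bound; auto. apply average_bound; auto.
  - intros x s Hs. unfold A. rewrite !average_dqn. apply Rle_trans with (C1 * Rpower s alpha).
    + apply average_increment; auto. apply average_increment; auto.
      apply dqn_increment; auto.
    + apply Rmult_le_compat_r. apply Rlt_le, exp_pos. unfold B; lra.
  - intro x. change (dqn (IZR n) (S m) (A (A psi))) with (dq (IZR n) (dqn (IZR n) m (A (A psi)))).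
    unfold A. rewrite !average_dqn.
    apply Rle_trans with (2 * B1 * (IZR n / INR q)).
    + apply average_gain; auto. apply average_bound; auto.
    + apply Rle_trans with (2 * B1 * (2 * INR e)). apply Rmult_le_compat_l; lra.
      assert (0 <= C1 * INR e) by (apply Rmult_le_pos; lra).
      assert (0 <= B1 * INR e) by (apply Rmult_le_pos; lra). unfold B. lra.
  - intro x.
    change (dqn (IZR n) (S (S m)) (A (A psi))) with (dq (IZR n) (dqn (IZR n) (S m) (A (A psi)))).
    unfold A at 1. rewrite average_dqn.
    assert (G1 : forall z, Rabs (dqn (IZR n) (S m) (A psi) z) <= 2 * B1 * (2 * INR e)).
    { intro z. change (dqn (IZR n) (S m) (A psi)) with (dq (IZR n) (dqn (IZR n) m (A psi))).
      unfold A. rewrite average_dqn.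
      apply Rle_trans with (2 * B1 * (IZR n / INR q)).
      - apply average_gain; auto.
      - apply Rmult_le_compat_l; lra. }
    apply Rle_trans with (1 := average_gain _ _ _ _ n0 q0 G1 x).
    assert (Z0 : 0 <= 2 * (2 * B1 * (2 * INR e))).
    { apply Rmult_le_pos; [lra|]. apply Rmult_le_pos; lra. }
    apply Rle_trans with (2 * (2 * B1 * (2 * INR e)) * (2 * INR e)).
    { apply Rmult_le_compat_l; auto. }
    assert (0 <= B1 * INR e ^ 2) by (apply Rmult_le_pos; [lra|apply pow2_ge_0]).
    assert (0 <= C1 * INR e ^ 2) by (apply Rmult_le_pos; [lra|apply pow2_ge_0]). unfold B. lra.
Qed.

(** * The family of discrete solutions *)

Lemma dxn_reindex {T T'} (n : T -> R) (n' : T' -> R) p (f : grid T) (f' : grid T') t t' :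
  n t = n' t' -> (forall i j, f t i j = f' t' i j) ->
  forall i j, dxn n p f t i j = dxn n' p f' t' i j.
Proof.
  intros Hn Hf. induction p; intros i j. apply Hf. rewrite !dxn_succ, !IHp, Hn. reflexivity.
Qed.

(** The Lipschitz step is iterated from order 1 on, the order at which the commutator estimate
    begins; the first difference itself is supplied by the logarithmic barrier. *)
Lemma family_bounds {T} (N : T -> Z) a Rs kap (v : grid T) M1 L m :
  (forall t, (0 < N t)%Z) -> a <> 0 -> 0 < Rs -> 0 < kap ->
  (forall t, discrete_solution a Rs kap (N t) (v t)) ->
  (forall p t i j, (p <= 1)%nat -> (0 <= j <= N t)%Z -> Rabs (dxn (mesh N) p v t i j) <= M1) ->
  (forall p t i j, (p <= m)%nat -> j = 0%Z \/ j = N t -> Rabs (dxn (mesh N) p v t i j) <= L) ->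
  exists M, forall p t i j, (p <= m)%nat -> (0 <= j <= N t)%Z -> Rabs (dxn (mesh N) p v t i j) <= M.
Proof.
  intros HN Ha HRs Hkap Hsol H1. destruct m as [|m].
  { intros _. exists M1. intros p t i j Hp. apply H1. lia. }
  induction m as [|m IH]; intro HL.
  { exists M1. intros p t i j Hp. apply H1. lia. }
  destruct IH as [M HM]. { intros p t i j Hp. apply HL. lia. }
  destruct (lipschitz_step N a Rs kap v HN Ha HRs Hkap Hsol (S m) M ltac:(lia) HM L) as [B HB].
  { intros t i j Hj. apply HL; auto. }
  exists (Rmax M B). intros p t i j Hp Hj. destruct (le_lt_eq_dec _ _ Hp) as [Hp'| ->].
  - apply Rle_trans with (2 := Rmax_l _ _). apply HM; auto. lia.
  - apply Rle_trans with (2 := Rmax_r _ _). apply HB; auto.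
Qed.

Section DiscreteFamily.
Variables (k : nat) (alpha a Rs kap P : R) (phip phim : R -> R).
Hypotheses (HRs : 0 < Rs) (HP : 0 < P) (Ha : a <> 0) (Hkap : 0 < kap) (Hal : 0 < alpha < 1)
  (Hp : holder1 (k + 2) alpha phip) (Hm : holder1 (k + 2) alpha phim)
  (Pp : forall x, phip (x + P) = phip x) (Pm : forall x, phim (x + P) = phim x).

Definition boundary_bounds (B : R) (e : nat) (n : Z) (phi : R -> R) (b : R -> R) : Prop :=
  (forall x, Rabs (b x - phi (P * x)) <= B / INR e) /\
  (forall p x, (p <= k + 2)%nat -> Rabs (dqn (IZR n) p b x) <= B) /\
  (forall x s, 0 < s ->
     Rabs (dqn (IZR n) (k + 2) b (x + s) - dqn (IZR n) (k + 2) b x) <= B * Rpower s alpha) /\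
  (forall x, Rabs (dqn (IZR n) (S (k + 2)) b x) <= 4 * B * INR e) /\
  (forall x, Rabs (dqn (IZR n) (S (S (k + 2))) b x) <= 16 * B * INR e ^ 2).

Definition approx (B : R) (e : nat) (n : Z) (v : Z -> Z -> R) : Prop :=
  discrete_solution a Rs kap n v /\ (forall i j, Rabs (v i j) <= B) /\
  (exists b, (forall i, v i 0%Z = b (IZR i / IZR n)) /\ boundary_bounds B e n phim b) /\
  (exists b, (forall i, v i n = b (IZR i / IZR n)) /\ boundary_bounds B e n phip b).

Lemma boundary_bounds_mono B B' e n phi b : (1 <= e)%nat -> B <= B' ->
  boundary_bounds B e n phi b -> boundary_bounds B' e n phi b.
Proof.
  intros He HB (H1 & H2 & H3 & H4 & H5). assert (e0 : 0 < INR e) by (apply lt_0_INR; lia).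
  split; [|split; [|split; [|split]]].
  - intro x. apply Rle_trans with (1 := H1 x). apply Rmult_le_compat_r; auto.
    apply Rlt_le, Rinv_0_lt_compat, e0.
  - intros p x Hpx. specialize (H2 p x Hpx). lra.
  - intros x s Hs. apply Rle_trans with (1 := H3 x s Hs). apply Rmult_le_compat_r; auto.
    apply Rlt_le, exp_pos.
  - intro x. specialize (H4 x). assert (B * INR e <= B' * INR e) by (apply Rmult_le_compat_r; lra). lra.
  - intro x. specialize (H5 x).
    assert (B * INR e ^ 2 <= B' * INR e ^ 2) by (apply Rmult_le_compat_r; auto; apply pow2_ge_0). lra.
Qed.

Lemma approx_exists : exists B, 0 <= B /\ forall (e : nat) (n : Z), (1 <= e)%nat ->
  (Z.of_nat e <= n)%Z -> exists v, approx B e n v.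
Proof.
  destruct (boundary_data (k + 2) alpha P phim ltac:(lia) HP Hm Pm) as (B1 & B10 & H1).
  destruct (boundary_data (k + 2) alpha P phip ltac:(lia) HP Hp Pp) as (B2 & B20 & H2).
  assert (M1 := Rmax_l B1 B2). assert (M2 := Rmax_r B1 B2). set (B := Rmax B1 B2) in *.
  exists B. split. lra. intros e n He Hen.
  destruct (H1 e n He Hen) as (bm & Perm & Bm). destruct (H2 e n He Hen) as (bp & Perp & Bp).
  assert (Bm' : boundary_bounds B e n phim bm) by (apply boundary_bounds_mono with B1; auto).
  assert (Bp' : boundary_bounds B e n phip bp) by (apply boundary_bounds_mono with B2; auto).
  assert (n0 : (0 < n)%Z) by lia. assert (nr0 : 0 < IZR n) by (apply IZR_lt, n0).
  destruct (discrete_solution_exists a Rs kap B n Ha Hkap n0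
    (fun i => bm (IZR i / IZR n)) (fun i => bp (IZR i / IZR n))) as (v & V1 & V2 & V3 & V4).
  - intro i. rewrite plus_IZR. replace ((IZR i + IZR n) / IZR n) with (IZR i / IZR n + 1) by (field; lra).
    apply Perm.
  - intro i. rewrite plus_IZR. replace ((IZR i + IZR n) / IZR n) with (IZR i / IZR n + 1) by (field; lra).
    apply Perp.
  - intro i. apply (proj1 (proj2 Bm') 0%nat). lia.
  - intro i. apply (proj1 (proj2 Bp') 0%nat). lia.
  - exists v. split; [|split; [|split]]; auto.
    + exists bm. split; auto.
    + exists bp. split; auto.
Qed.

(** A bound for all differences of the mollified rows up to order [k + 4]. Its growth in [e] is
    harmless because [n] is chosen after [e]. *)
Definition third_difference_bound (B : R) (e : nat) : R := B + 4 * B * INR e + 16 * B * INR e ^ 2.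

Section Rows.
Context {T : Type}.
Variables (e : T -> nat) (N : T -> Z) (v : grid T) (B : R).
Hypotheses (HN : forall t, (0 < N t)%Z) (B0 : 0 <= B)
  (Hv : forall t, approx B (e t) (N t) (v t)).

Lemma approx_row t j : j = 0%Z \/ j = N t -> exists phi b,
  (forall p i, dxn (mesh N) p v t i j = dqn (IZR (N t)) p b (IZR i / mesh N t)) /\
  boundary_bounds B (e t) (N t) phi b.
Proof.
  intro Hj. destruct (Hv t) as (_ & _ & (b1 & E1 & H1) & (b2 & E2 & H2)).
  assert (n0 := mesh_pos N HN t).
  destruct Hj as [-> | ->].
  - exists phim, b1. split; auto. intros p i. apply (row_dxn (mesh N) p v t); auto. lra.
  - exists phip, b2. split; auto. intros p i. apply (row_dxn (mesh N) p v t); auto. lra.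
Qed.

Lemma approx_row_bound p t i j : j = 0%Z \/ j = N t -> (p <= k + 2)%nat ->
  Rabs (dxn (mesh N) p v t i j) <= B.
Proof.
  intros Hj Hpk. destruct (approx_row t j Hj) as (phi & b & E & Hb).
  rewrite E. apply Hb, Hpk.
Qed.

Lemma approx_row_bound_top p t i j : j = 0%Z \/ j = N t -> (p <= S (S (k + 2)))%nat ->
  Rabs (dxn (mesh N) p v t i j) <= third_difference_bound B (e t).
Proof.
  intros Hj Hpk. destruct (approx_row t j Hj) as (phi & b & E & Hb).
  assert (P1 := pos_INR (e t)). assert (P2 := pow2_ge_0 (INR (e t))).
  assert (0 <= B * INR (e t)) by (apply Rmult_le_pos; auto).
  assert (0 <= B * INR (e t) ^ 2) by (apply Rmult_le_pos; auto).
  destruct Hb as (_ & H2 & _ & H4 & H5). rewrite E. unfold third_difference_bound.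
  destruct (le_lt_dec p (k + 2)) as [Hp1|Hp1].
  - specialize (H2 p (IZR i / mesh N t) Hp1). lra.
  - destruct (Nat.eq_dec p (S (k + 2))) as [->|Hp2].
    + specialize (H4 (IZR i / mesh N t)). lra.
    + replace p with (S (S (k + 2))) by lia. specialize (H5 (IZR i / mesh N t)). lra.
Qed.

End Rows.

Lemma approx_lip B : 0 <= B -> exists B1, B <= B1 /\ forall e n v, (0 < n)%Z -> B1 <= IZR n ->
  approx B e n v -> forall i j, (0 <= j <= n)%Z -> Rabs ((v (i + 1)%Z j - v i j) * IZR n) <= B1.
Proof.
  intro B0. destruct (lipschitz_first a Rs kap B B Ha HRs Hkap B0 B0) as [B1 H].
  exists (Rmax B B1). assert (M1 := Rmax_l B B1). assert (M2 := Rmax_r B B1). split; auto.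
  intros e n v Hn Hn1 Hv i j Hj. apply Rle_trans with (2 := M2).
  apply H; auto; try lra. apply Hv. intros; apply Hv.
  intros i' j' Hj'.
  apply (approx_row_bound (fun _ : unit => e) (fun _ => n) (fun _ => v) B (fun _ => Hn) (fun _ => Hv) 1%nat tt);
    auto. lia.
Qed.

Theorem discrete_family : exists (N : nat -> Z) (v : grid nat) (M : R),
  (forall e, (0 < N e)%Z /\ (Z.of_nat e <= N e)%Z) /\
  (forall e, discrete_solution a Rs kap (N e) (v e)) /\
  (forall p e i j, (p <= k + 2)%nat -> (0 <= j <= N e)%Z -> Rabs (dxn (mesh N) p v e i j) <= M) /\
  (forall e i j d, (0 <= j <= N e)%Z -> (0 < d)%Z ->
     Rabs (dxn (mesh N) (k + 2) v e (i + d)%Z j - dxn (mesh N) (k + 2) v e i j) <= M * modulus N alpha e d) /\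
  (forall e i, Rabs (v e i 0%Z - phim (P * (IZR i / mesh N e))) <= M / INR (S e)) /\
  (forall e i, Rabs (v e i (N e) - phip (P * (IZR i / mesh N e))) <= M / INR (S e)).
Proof.
  destruct approx_exists as (B & B0 & HB).
  destruct (approx_lip B B0) as (B1 & B01 & HB1).
  assert (Sel : forall e : nat, exists nv : Z * (Z -> Z -> R),
    (0 < fst nv)%Z /\ (Z.of_nat e <= fst nv)%Z /\ B1 <= IZR (fst nv) /\
    approx B (S e) (fst nv) (snd nv) /\
    forall i j, (0 <= j <= fst nv)%Z ->
      Rabs (dxn (mesh (fun _ : unit => fst nv)) (S (S (k + 2))) (fun _ => snd nv) tt i j) <= IZR (fst nv)).
  { intro e.
    (* For fixed [e] all sufficiently large [n] form one family, so a single [C] bounds the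
       differences up to order [k + 4] for all of them. Taking [n >= C] gives the bound by [n] that
       the Hoelder estimate requires. *)
    set (T := {n : Z | (Z.of_nat (S e) <= n)%Z /\ B1 <= IZR n}).
    set (N := fun t : T => proj1_sig t).
    assert (HN : forall t, (0 < N t)%Z) by (intros [n [H1 H2]]; unfold N; simpl; lia).
    set (v := fun t : T => epsilon (inhabits (fun _ _ : Z => 0)) (approx B (S e) (N t))).
    assert (Hv : forall t, approx B (S e) (N t) (v t)).
    { intro t. apply epsilon_spec. apply HB. lia. apply (proj2_sig t). }
    destruct (family_bounds N a Rs kap v B1 (third_difference_bound B (S e)) (S (S (k + 2))) HN Ha HRs Hkap
       (fun t => proj1 (Hv t))) as [C HC].
    - intros p t i j Hp1 Hj. destruct p as [|[|p]]; [| |lia].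
      + apply Rle_trans with (2 := B01). apply Hv.
      + apply (HB1 (S e) (N t) (v t)); auto. apply (proj2_sig t).
    - intros p t i j Hp1 Hj.
      apply (approx_row_bound_top (fun _ => S e) N v B HN B0 Hv); auto.
    - destruct (archimed (Rmax B1 C)) as [A _].
      set (n := Z.max (Z.of_nat (S e)) (up (Rmax B1 C))).
      assert (n1 : (Z.of_nat (S e) <= n)%Z) by (unfold n; lia).
      assert (n2 : Rmax B1 C <= IZR n).
      { apply Rle_trans with (IZR (up (Rmax B1 C))). lra. apply IZR_le. unfold n. lia. }
      assert (M1 := Rmax_l B1 C). assert (M2 := Rmax_r B1 C).
      set (t := exist _ n (conj n1 (Rle_trans _ _ _ M1 n2)) : T).
      exists (n, v t). simpl fst. simpl snd. split; [lia|split; [lia|split; [lra|split]]].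
      + apply (Hv t).
      + intros i j Hj. apply Rle_trans with C; [|lra].
        rewrite (dxn_reindex _ (mesh N) _ _ v tt t eq_refl (fun _ _ => eq_refl)). apply HC; auto. }
  set (sel := fun e => proj1_sig (constructive_indefinite_description _ (Sel e))).
  assert (Hsel := fun e => proj2_sig (constructive_indefinite_description _ (Sel e))).
  set (N := fun e => fst (sel e)). set (v := (fun e => snd (sel e)) : grid nat).
  assert (HN : forall e, (0 < N e)%Z) by (intro e; apply (Hsel e)).
  assert (HNe : forall e, (Z.of_nat e <= N e)%Z) by (intro e; apply (Hsel e)).
  assert (HNB : forall e, B1 <= IZR (N e)) by (intro e; apply (Hsel e)).
  assert (Hv : forall e, approx B (S e) (N e) (v e)) by (intro e; apply (Hsel e)).
  assert (Htop2 : forall e i j, (0 <= j <= N e)%Z -> Rabs (dxn (mesh N) (S (S (k + 2))) v e i j) <= mesh N e).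
  { intros e i j Hj. destruct (Hsel e) as (_ & _ & _ & _ & H).
    rewrite (dxn_reindex _ (mesh (fun _ : unit => N e)) _ _ (fun _ => v e) e tt eq_refl (fun _ _ => eq_refl)).
    apply H, Hj. }
  (* The family now runs over [e]. Up to order [k + 2] the boundary rows are bounded by [B] for
     every [e], hence so are the interior differences by one [M]. *)
  destruct (family_bounds N a Rs kap v B1 B (k + 2) HN Ha HRs Hkap (fun t => proj1 (Hv t))) as [M HM].
  { intros p t i j Hp1 Hj. destruct p as [|[|p]]; [| |lia].
    - apply Rle_trans with (2 := B01). apply Hv.
    - apply (HB1 (S t) (N t) (v t)); auto. }
  { intros p t i j Hp1 Hj. apply (approx_row_bound (fun e => S e) N v B HN Hv); auto. }
  destruct (holder_step N a Rs kap v HN Ha HRs Hkap (fun t => proj1 (Hv t)) (k + 2) M ltac:(lia) HM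
    alpha Hal B) as [C HC].
  { intros t i j d Hj Hd. destruct (approx_row (fun e => S e) N v B HN Hv t j Hj) as (phi & b & E & Hb).
    rewrite !E. rewrite plus_IZR.
    replace ((IZR i + IZR d) / mesh N t) with (IZR i / mesh N t + IZR d / mesh N t)
      by (field; apply Rgt_not_eq, (mesh_pos N HN t)).
    apply Hb. apply (frac_pos N HN t d Hd). }
  { exact Htop2. }
  set (M' := Rmax M (Rmax C B)).
  assert (L1 : M <= M') by apply Rmax_l.
  assert (L2 : C <= M') by (apply Rle_trans with (2 := Rmax_r _ _); apply Rmax_l).
  assert (L3 : B <= M') by (apply Rle_trans with (2 := Rmax_r _ _); apply Rmax_r).
  assert (Bd : forall e x, x <= B / INR (S e) -> x <= M' / INR (S e)).
  { intros e x Hx. apply Rle_trans with (1 := Hx). apply Rmult_le_compat_r; auto.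
    apply Rlt_le, Rinv_0_lt_compat, lt_0_INR. lia. }
  exists N, v, M'. split; [|split; [|split; [|split; [|split]]]].
  - auto.
  - intro e. apply Hv.
  - intros p e i j Hp1 Hj. apply Rle_trans with M; auto.
  - intros e i j d Hj Hd. apply Rle_trans with (1 := HC e i j d Hj Hd).
    apply Rmult_le_compat_r; auto. apply Rlt_le, exp_pos.
  - intros e i. apply Bd. destruct (Hv e) as (_ & _ & (b & E & Hb) & _). rewrite E. apply Hb.
  - intros e i. apply Bd. destruct (Hv e) as (_ & _ & _ & (b & E & Hb)). rewrite E. apply Hb.
Qed.

End DiscreteFamily.

(** * Passage to the limit *)

Lemma is_derive_of_estimate F x l C alpha d0 : 0 < alpha -> 0 < d0 ->
  (forall h, h <> 0 -> Rabs h < d0 ->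
     Rabs (F (x + h) - F x - h * l) <= C * (Rabs h * Rpower (Rabs h) alpha)) ->
  is_derive F x l.
Proof.
  intros Hal Hd0 H. apply is_derive_Reals. intros eps Heps.
  set (C' := Rabs C + 1). assert (C0 : 0 < C') by (assert (Q := Rabs_pos C); unfold C'; lra).
  set (d1 := Rpower (eps / (2 * C')) (/ alpha)).
  assert (d10 : 0 < d1) by apply exp_pos.
  assert (d2 : 0 < Rmin d0 d1) by (apply Rmin_glb_lt; auto).
  exists (mkposreal _ d2). intros h Hh Hhd. simpl in Hhd.
  assert (h0 : 0 < Rabs h) by (apply Rabs_pos_lt, Hh).
  assert (A := H h Hh ltac:(apply Rlt_le_trans with (1 := Hhd); apply Rmin_l)).
  assert (B : Rpower (Rabs h) alpha <= eps / (2 * C')).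
  { replace (eps / (2 * C')) with (Rpower d1 alpha).
    - apply Rle_Rpower_l; [lra|]. split; auto. apply Rlt_le, Rlt_le_trans with (1 := Hhd). apply Rmin_r.
    - unfold d1. rewrite Rpower_mult, Rinv_l, Rpower_1 by (try lra; apply Rdiv_lt_0_compat; lra).
      reflexivity. }
  replace ((F (x + h) - F x) / h - l) with ((F (x + h) - F x - h * l) / h) by (field; auto).
  unfold Rdiv. rewrite Rabs_mult, Rabs_inv. apply (Rmult_lt_reg_r (Rabs h)); auto.
  rewrite Rmult_assoc, Rinv_l, Rmult_1_r by lra.
  apply Rle_lt_trans with (1 := A).
  apply Rle_lt_trans with (C' * (Rabs h * (eps / (2 * C')))).
  - apply Rle_trans with (C' * (Rabs h * Rpower (Rabs h) alpha)).
    + apply Rmult_le_compat_r. apply Rmult_le_pos. lra. apply Rlt_le, exp_pos.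
      assert (Q := Rle_abs C). unfold C'. lra.
    + apply Rmult_le_compat_l. lra. apply Rmult_le_compat_l; lra.
  - replace (C' * (Rabs h * (eps / (2 * C')))) with (eps * Rabs h / 2) by (field; lra). nra.
Qed.

Definition cell (x : R) : Z := Int_part x.

Lemma cell_spec x : IZR (cell x) <= x < IZR (cell x) + 1.
Proof. unfold cell. destruct (base_Int_part x). lra. Qed.

Lemma cell_mono x y : x <= y -> (cell x <= cell y)%Z.
Proof.
  intro H. assert (A := cell_spec x). assert (B := cell_spec y).
  apply Z.lt_succ_r. apply lt_IZR. unfold Z.succ. rewrite plus_IZR. lra.
Qed.

Section Limit.
Variables (N : nat -> Z) (alpha : R) (U : (nat -> Prop) -> Prop) (lim : (nat -> R) -> R).
Hypotheses (HN : forall e, (0 < N e)%Z) (HNe : forall e, (Z.of_nat e <= N e)%Z)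
  (Hal : 0 < alpha < 1) (HU : ultralimit U lim).
Notation modulus := (modulus N alpha).
Notation X := (dquot (mesh N) false).
Notation Y := (dquot (mesh N) true).

Definition eventually_all (Q : nat -> Prop) := exists n0, forall e, (n0 <= e)%nat -> Q e.

Lemma ev_and Q1 Q2 : eventually_all Q1 -> eventually_all Q2 -> eventually_all (fun e => Q1 e /\ Q2 e).
Proof.
  intros [n1 H1] [n2 H2]. exists (Nat.max n1 n2). intros e He. split; [apply H1|apply H2]; lia.
Qed.

Lemma ev_U Q : eventually_all Q -> U Q.
Proof.
  intros [n0 H]. apply (ul_mono _ _ HU) with (2 := ul_ev _ _ HU n0). auto.
Qed.

Lemma ev_large K : eventually_all (fun e => K <= mesh N e).
Proof.
  destruct (archimed (Rabs K)) as [A _].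
  exists (Z.to_nat (up (Rabs K))). intros e He.
  assert (0 <= Rabs K) by apply Rabs_pos.
  assert (P : (0 <= up (Rabs K))%Z). { apply le_IZR. lra. }
  apply Rle_trans with (IZR (up (Rabs K))).
  - assert (Q := Rle_abs K). lra.
  - apply IZR_le. specialize (HNe e). lia.
Qed.

Definition is_ulim (f : nat -> R) (l : R) := forall eps, 0 < eps -> U (fun e => Rabs (f e - l) < eps).

(** An eventual inequality passes to the limit. Three terms are what a first order Taylor expansion
    consists of. *)
Lemma is_ulim_combine f1 f2 f3 l1 l2 l3 c1 c2 c3 K :
  is_ulim f1 l1 -> is_ulim f2 l2 -> is_ulim f3 l3 ->
  (forall eps, 0 < eps -> eventually_all (fun e => Rabs (c1 * f1 e + c2 * f2 e + c3 * f3 e) <= K + eps)) ->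
  Rabs (c1 * l1 + c2 * l2 + c3 * l3) <= K.
Proof.
  clear Hal.
  intros H1 H2 H3 H. apply le_epsilon. intros eps Heps.
  set (S := 1 + Rabs c1 + Rabs c2 + Rabs c3).
  assert (P1 := Rabs_pos c1). assert (P2 := Rabs_pos c2). assert (P3 := Rabs_pos c3).
  set (d := eps / (2 * S)). assert (d0 : 0 < d) by (apply Rdiv_lt_0_compat; unfold S; lra).
  assert (Hd : d * S = eps / 2) by (unfold d; field; unfold S; lra).
  destruct (ul_ex _ _ HU _ (ul_and _ _ HU _ _ (ul_and _ _ HU _ _ (H1 d d0) (H2 d d0))
    (ul_and _ _ HU _ _ (H3 d d0) (ev_U _ (H (eps / 2) ltac:(lra)))))) as (e & (E1 & E2) & E3 & E4).
  replace (c1 * l1 + c2 * l2 + c3 * l3) with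
    ((c1 * f1 e + c2 * f2 e + c3 * f3 e) - (c1 * (f1 e - l1) + c2 * (f2 e - l2) + c3 * (f3 e - l3))) by ring.
  assert (B : forall c x, Rabs x < d -> Rabs (c * x) <= Rabs c * d).
  { intros c x Hx. rewrite Rabs_mult. apply Rmult_le_compat_l. apply Rabs_pos. lra. }
  assert (B1 := B c1 _ E1). assert (B2 := B c2 _ E2). assert (B3 := B c3 _ E3).
  apply Rabs_le_between in B1. apply Rabs_le_between in B2. apply Rabs_le_between in B3.
  apply Rabs_le_between in E4. unfold S in Hd. apply Rabs_le. lra.
Qed.

Lemma is_ulim_unique f l l' : is_ulim f l -> is_ulim f l' -> l = l'.
Proof.
  clear Hal.
  intros H1 H2.
  assert (A : Rabs (1 * l + (-1) * l' + 0 * l) <= 0).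
  { apply (is_ulim_combine f f f); auto. intros eps Heps. exists 0%nat. intros e _.
    replace (1 * f e + -1 * f e + 0 * f e) with 0 by ring. rewrite Rabs_R0. lra. }
  assert (B := Rabs_pos (1 * l + (-1) * l' + 0 * l)).
  assert (Z : Rabs (1 * l + (-1) * l' + 0 * l) = 0) by lra.
  apply Rabs_eq_0 in Z. lra.
Qed.

Lemma is_ulim_close f g l : is_ulim f l ->
  (forall eps, 0 < eps -> eventually_all (fun e => Rabs (g e - f e) <= eps)) -> is_ulim g l.
Proof.
  intros H1 H2 eps Heps.
  apply (ul_mono _ _ HU) with (2 := ul_and _ _ HU _ _ (H1 (eps / 2) ltac:(lra)) (ev_U _ (H2 (eps / 2) ltac:(lra)))).
  intros e [A B]. replace (g e - l) with ((g e - f e) + (f e - l)) by ring.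
  eapply Rle_lt_trans; [apply Rabs_triang|]. lra.
Qed.

Lemma is_ulim_const c : is_ulim (fun _ => c) c.
Proof.
  intros eps Heps. apply ev_U. exists 0%nat. intros e _. rewrite Rminus_diag, Rabs_R0. exact Heps.
Qed.

(** At a fixed height strictly between 0 and 1 the [r] rows discarded on either side are eventually
    out of reach. *)
Definition inner_holder (r : Z) (B : R) (f : grid nat) : Prop :=
  (forall e i j, (r <= j)%Z -> (j + r <= N e)%Z -> Rabs (f e i j) <= B) /\
  (forall e i j d, (r <= j)%Z -> (j + r <= N e)%Z -> (0 < d)%Z ->
     Rabs (f e (i + d)%Z j - f e i j) <= B * modulus e d) /\
  (forall e i j d, (r <= j)%Z -> (0 < d)%Z -> (j + d + r <= N e)%Z ->
     Rabs (f e i (j + d)%Z - f e i j) <= B * modulus e d).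

Definition limfun (f : grid nat) (x y : R) : R := lim (fun e => f e (cell (x * mesh N e)) (cell (y * mesh N e))).

Lemma ev_rows y r : 0 < y < 1 ->
  eventually_all (fun e => (r <= cell (y * mesh N e))%Z /\ (cell (y * mesh N e) + r <= N e)%Z).
Proof.
  intros Hy.
  destruct (ev_and _ _ (ev_large ((IZR r + 1) / y)) (ev_large (IZR r / (1 - y)))) as [n0 H].
  exists n0. intros e He. destruct (H e He) as [H1 H2].
  assert (A := cell_spec (y * mesh N e)).
  apply (Rmult_le_compat_l y) in H1; [|lra]. apply (Rmult_le_compat_l (1 - y)) in H2; [|lra].
  replace (y * ((IZR r + 1) / y)) with (IZR r + 1) in H1 by (field; lra).
  replace ((1 - y) * (IZR r / (1 - y))) with (IZR r) in H2 by (field; lra).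
  split.
  - apply le_IZR. lra.
  - apply le_IZR. rewrite plus_IZR. fold (mesh N e). lra.
Qed.

Lemma V_ulim f (B : R) (x y : R) :
  eventually_all (fun e => Rabs (f e (cell (x * mesh N e)) (cell (y * mesh N e))) <= B) ->
  is_ulim (fun e => f e (cell (x * mesh N e)) (cell (y * mesh N e))) (limfun f x y).
Proof. intros H eps Heps. exact (ul_lim _ _ HU _ B H eps Heps). Qed.

Lemma V_inner_holder r B f x y : inner_holder r B f -> 0 < y < 1 ->
  is_ulim (fun e => f e (cell (x * mesh N e)) (cell (y * mesh N e))) (limfun f x y).
Proof.
  intros (H & _) Hy. apply (V_ulim f B). destruct (ev_rows y r Hy) as [n0 E].
  exists n0. intros e He. destruct (E e He). apply H; auto.
Qed.

Lemma V_bound r B f x y : inner_holder r B f -> 0 < y < 1 -> Rabs (limfun f x y) <= B.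
Proof.
  intros H Hy. assert (L := V_inner_holder r B f x y H Hy).
  replace (limfun f x y) with (1 * limfun f x y + 0 * limfun f x y + 0 * limfun f x y) by ring.
  apply (is_ulim_combine _ _ _ _ _ _ 1 0 0 B L L L).
  intros eps Heps. destruct (ev_rows y r Hy) as [n0 E].
  exists n0. intros e He. destruct (E e He) as [E1 E2].
  rewrite Rmult_1_l, !Rmult_0_l, !Rplus_0_r. destruct H as (H & _).
  assert (Q := H e (cell (x * mesh N e)) _ E1 E2). lra.
Qed.

Lemma inner_holder_nonneg r B f : inner_holder r B f -> 0 <= B.
Proof.
  intros (H & _). assert (y0 : 0 < / 2 < 1) by lra. destruct (ev_rows (/ 2) r y0) as [n0 E].
  destruct (E n0 (le_n _)) as [E1 E2].
  apply Rle_trans with (2 := H n0 0%Z _ E1 E2). apply Rabs_pos.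
Qed.

(** The two cells are [h n] nodes apart up to an error of one node, which the factor 2 absorbs as
    soon as [h n >= 1]. *)
Lemma cells x h : 0 < h -> eventually_all (fun e =>
  (0 <= cell ((x + h) * mesh N e) - cell (x * mesh N e))%Z /\
  Rabs (IZR (cell ((x + h) * mesh N e) - cell (x * mesh N e)) - h * mesh N e) <= 1 /\
  ((0 < cell ((x + h) * mesh N e) - cell (x * mesh N e))%Z ->
     modulus e (cell ((x + h) * mesh N e) - cell (x * mesh N e)) <= 2 * Rpower h alpha)).
Proof.
  intro Hh. destruct (ev_large (/ h)) as [n0 H]. exists n0. intros e He. specialize (H e He).
  assert (P := mesh_pos N HN e).
  assert (A := cell_spec (x * mesh N e)). assert (B := cell_spec ((x + h) * mesh N e)).
  assert (Hn : 1 <= h * mesh N e).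
  { apply (Rmult_le_compat_l h) in H; [|lra]. rewrite Rinv_r in H; lra. }
  set (d := (cell ((x + h) * mesh N e) - cell (x * mesh N e))%Z).
  assert (D : Rabs (IZR d - h * mesh N e) <= 1).
  { unfold d. rewrite minus_IZR. apply Rabs_le. lra. }
  split; [|split]; auto.
  - assert (Q := cell_mono (x * mesh N e) ((x + h) * mesh N e) ltac:(nra)). unfold d. lia.
  - intro Hd. apply Rle_trans with (2 := pw_double alpha Hal h Hh). apply pw_mono; auto.
    + apply frac_pos; auto.
    + apply (proj2 (Rle_div_l _ _ _ P)). apply Rabs_le_between in D. lra.
Qed.

Lemma V_holder_x r B f x h y : inner_holder r B f -> 0 < y < 1 -> 0 < h ->
  Rabs (limfun f (x + h) y - limfun f x y) <= 2 * B * Rpower h alpha.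
Proof.
  intros H Hy Hh. assert (B0 := inner_holder_nonneg _ _ _ H).
  assert (L1 := V_inner_holder r B f x y H Hy). assert (L2 := V_inner_holder r B f (x + h) y H Hy).
  replace (limfun f (x + h) y - limfun f x y) with (1 * limfun f (x + h) y + (-1) * limfun f x y + 0 * limfun f x y) by ring.
  apply (is_ulim_combine _ _ _ _ _ _ 1 (-1) 0 _ L2 L1 L1).
  intros eps Heps. destruct (ev_and _ _ (ev_rows y r Hy) (cells x h Hh)) as [n0 E].
  exists n0. intros e He. destruct (E e He) as [[E1 E2] (E3 & E4 & E5)].
  set (i := cell (x * mesh N e)) in *. set (j := cell (y * mesh N e)) in *.
  set (d := (cell ((x + h) * mesh N e) - i)%Z) in *.
  replace (cell ((x + h) * mesh N e)) with (i + d)%Z by (unfold d; lia).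
  replace (1 * f e (i + d)%Z j + -1 * f e i j + 0 * f e i j) with (f e (i + d)%Z j - f e i j) by ring.
  assert (Ph : 0 < Rpower h alpha) by apply exp_pos.
  assert (0 <= 2 * B * Rpower h alpha) by (apply Rmult_le_pos; lra).
  destruct (Z.eq_dec d 0) as [->|Hd].
  - rewrite Z.add_0_r, Rminus_diag, Rabs_R0. lra.
  - destruct H as (_ & H & _). apply Rle_trans with (1 := H e i j d E1 E2 ltac:(lia)).
    specialize (E5 ltac:(lia)). apply (Rmult_le_compat_l B) in E5; auto. lra.
Qed.

Lemma V_holder_y r B f x y h : inner_holder r B f -> 0 < y < 1 -> 0 < h -> y + h < 1 ->
  Rabs (limfun f x (y + h) - limfun f x y) <= 2 * B * Rpower h alpha.
Proof.
  intros H Hy Hh Hyh. assert (B0 := inner_holder_nonneg _ _ _ H).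
  assert (L1 := V_inner_holder r B f x y H Hy). assert (L2 := V_inner_holder r B f x (y + h) H ltac:(lra)).
  replace (limfun f x (y + h) - limfun f x y) with (1 * limfun f x (y + h) + (-1) * limfun f x y + 0 * limfun f x y) by ring.
  apply (is_ulim_combine _ _ _ _ _ _ 1 (-1) 0 _ L2 L1 L1).
  intros eps Heps.
  destruct (ev_and _ _ (ev_and _ _ (ev_rows y r Hy) (ev_rows (y + h) r ltac:(lra))) (cells y h Hh)) as [n0 E].
  exists n0. intros e He. destruct (E e He) as [[[E1 E2] [E1' E2']] (E3 & E4 & E5)].
  set (i := cell (x * mesh N e)) in *. set (j := cell (y * mesh N e)) in *.
  set (d := (cell ((y + h) * mesh N e) - j)%Z) in *.
  replace (cell ((y + h) * mesh N e)) with (j + d)%Z in * by (unfold d; lia).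
  replace (1 * f e i (j + d)%Z + -1 * f e i j + 0 * f e i j) with (f e i (j + d)%Z - f e i j) by ring.
  assert (Ph : 0 < Rpower h alpha) by apply exp_pos.
  assert (0 <= 2 * B * Rpower h alpha) by (apply Rmult_le_pos; lra).
  destruct (Z.eq_dec d 0) as [->|Hd].
  - rewrite Z.add_0_r, Rminus_diag, Rabs_R0. lra.
  - destruct H as (_ & _ & H). apply Rle_trans with (1 := H e i j d E1 ltac:(lia) E2').
    specialize (E5 ltac:(lia)). apply (Rmult_le_compat_l B) in E5; auto. lra.
Qed.

(** Summing the quotient [g] over at most [2 h n] cells produces the first term of the bound;
    rounding [h n] to the integer [d] produces the second. *)
Lemma taylor_step n (F g : Z -> R) B w h i d : 0 < n -> 0 < h -> 0 <= B -> (0 <= d)%Z ->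
  Rabs (IZR d - h * n) <= 1 -> / h <= n -> ((0 < d)%Z -> w <= 2 * Rpower h alpha) ->
  (forall s, (0 <= s < d)%Z -> (F (i + s + 1)%Z - F (i + s)%Z) * n = g (i + s)%Z) ->
  (forall s, (0 <= s < d)%Z -> Rabs (g (i + s)%Z - g i) <= B * w) -> Rabs (g i) <= B ->
  Rabs (F (i + d)%Z - F i - h * g i) <= 4 * B * (h * Rpower h alpha) + B / n.
Proof.
  intros Hn Hh HB Hd Hdh Hhn Hw HF Hg Hgi.
  assert (Hn1 : 1 <= h * n).
  { apply (Rmult_le_compat_l h) in Hhn; [|lra]. rewrite Rinv_r in Hhn; lra. }
  assert (C := chain1 F n (g i) (B * w) i d Hd).
  assert (C1 := C ltac:(intros s Hs; rewrite HF by auto; apply Hg; auto)).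
  assert (Ph : 0 < Rpower h alpha) by apply exp_pos.
  assert (D2 : IZR d <= 2 * (h * n)) by (apply Rabs_le_between in Hdh; lra).
  assert (C2 : IZR d * (B * w) <= (4 * B * (h * Rpower h alpha)) * n).
  { destruct (Z.eq_dec d 0) as [->|Hd0].
    - rewrite Rmult_0_l. apply Rmult_le_pos; [|lra]. apply Rmult_le_pos; [lra|]. apply Rmult_le_pos; lra.
    - specialize (Hw ltac:(lia)). apply (Rmult_le_compat_l B) in Hw; auto.
      assert (0 <= IZR d) by (apply IZR_le; lia).
      apply Rle_trans with (IZR d * (B * (2 * Rpower h alpha))).
      { apply Rmult_le_compat_l; auto. }
      apply Rle_trans with (2 * (h * n) * (B * (2 * Rpower h alpha))).
      { apply Rmult_le_compat_r; auto. apply Rmult_le_pos; lra. }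
      right. ring. }
  apply (Rmult_le_reg_r n); auto.
  rewrite <- (Rabs_pos_eq n) at 1 by lra. rewrite <- Rabs_mult.
  replace ((4 * B * (h * Rpower h alpha) + B / n) * n) with (4 * B * (h * Rpower h alpha) * n + B * 1)
    by (field; lra).
  replace ((F (i + d)%Z - F i - h * g i) * n) with
    (((F (i + d)%Z - F i) * n - IZR d * g i) + g i * (IZR d - h * n)) by ring.
  eapply Rle_trans; [apply Rabs_triang|]. apply Rplus_le_compat. lra.
  rewrite Rabs_mult. apply Rmult_le_compat; auto; apply Rabs_pos.
Qed.

Lemma ev_small B eps : 0 <= B -> 0 < eps -> eventually_all (fun e => B / mesh N e <= eps).
Proof.
  intros HB He. destruct (ev_large (B / eps)) as [n0 H]. exists n0. intros e Hn. specialize (H e Hn).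
  assert (P := mesh_pos N HN e). apply (proj2 (Rle_div_l _ _ _ P)).
  apply (proj1 (Rle_div_l _ _ _ He)) in H. lra.
Qed.

Lemma V_taylor_x r B f x h y : inner_holder r B (X f) -> 0 < y < 1 -> 0 < h ->
  (forall x, is_ulim (fun e => f e (cell (x * mesh N e)) (cell (y * mesh N e))) (limfun f x y)) ->
  Rabs (limfun f (x + h) y - limfun f x y - h * limfun (X f) x y) <= 4 * B * (h * Rpower h alpha).
Proof.
  intros H Hy Hh Hf. assert (B0 := inner_holder_nonneg _ _ _ H).
  assert (L := V_inner_holder r B (X f) x y H Hy).
  replace (limfun f (x + h) y - limfun f x y - h * limfun (X f) x y) with
    (1 * limfun f (x + h) y + (-1) * limfun f x y + (- h) * limfun (X f) x y) by ring.
  apply (is_ulim_combine _ _ _ _ _ _ 1 (-1) (- h) _ (Hf (x + h)) (Hf x) L).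
  intros eps Heps.
  destruct (ev_and _ _ (ev_and _ _ (ev_rows y r Hy) (cells x h Hh))
    (ev_and _ _ (ev_large (/ h)) (ev_small B eps B0 Heps))) as [n0 E].
  exists n0. intros e He. destruct (E e He) as [[[E1 E2] (E3 & E4 & E5)] [E6 E7]].
  set (i := cell (x * mesh N e)) in *. set (j := cell (y * mesh N e)) in *.
  set (d := (cell ((x + h) * mesh N e) - i)%Z) in *.
  replace (cell ((x + h) * mesh N e)) with (i + d)%Z by (unfold d; lia).
  destruct H as (H1 & H2 & _).
  replace (1 * f e (i + d)%Z j + -1 * f e i j + - h * X f e i j) with
    (f e (i + d)%Z j - f e i j - h * X f e i j) by ring.
  apply Rle_trans with (4 * B * (h * Rpower h alpha) + B / mesh N e); [|lra].
  apply (taylor_step (mesh N e) (fun i => f e i j) (fun i => X f e i j) B (modulus e d)); auto.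
  - apply mesh_pos, HN.
  - intros s Hs. destruct (Z.eq_dec s 0) as [->|Hs0].
    + rewrite Z.add_0_r, Rminus_diag, Rabs_R0. apply Rmult_le_pos; auto. apply Rlt_le, modulus_pos.
    + apply Rle_trans with (1 := H2 e i j s E1 E2 ltac:(lia)). apply Rmult_le_compat_l; auto.
      apply modulus_mono; auto. lia.
Qed.

Lemma V_taylor_y r B f x y h : inner_holder r B (Y f) -> 0 < y < 1 -> 0 < h -> y + h < 1 ->
  (forall y, 0 < y < 1 -> is_ulim (fun e => f e (cell (x * mesh N e)) (cell (y * mesh N e))) (limfun f x y)) ->
  Rabs (limfun f x (y + h) - limfun f x y - h * limfun (Y f) x y) <= 4 * B * (h * Rpower h alpha).
Proof.
  intros H Hy Hh Hyh Hf. assert (B0 := inner_holder_nonneg _ _ _ H).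
  assert (L := V_inner_holder r B (Y f) x y H Hy).
  replace (limfun f x (y + h) - limfun f x y - h * limfun (Y f) x y) with
    (1 * limfun f x (y + h) + (-1) * limfun f x y + (- h) * limfun (Y f) x y) by ring.
  apply (is_ulim_combine _ _ _ _ _ _ 1 (-1) (- h) _ (Hf (y + h) ltac:(lra)) (Hf y Hy) L).
  intros eps Heps.
  destruct (ev_and _ _ (ev_and _ _ (ev_and _ _ (ev_rows y r Hy) (ev_rows (y + h) r ltac:(lra))) (cells y h Hh))
    (ev_and _ _ (ev_large (/ h)) (ev_small B eps B0 Heps))) as [n0 E].
  exists n0. intros e He. destruct (E e He) as [[[[E1 E2] [E1' E2']] (E3 & E4 & E5)] [E6 E7]].
  set (i := cell (x * mesh N e)) in *. set (j := cell (y * mesh N e)) in *.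
  set (d := (cell ((y + h) * mesh N e) - j)%Z) in *.
  replace (cell ((y + h) * mesh N e)) with (j + d)%Z in * by (unfold d; lia).
  destruct H as (H1 & _ & H2).
  replace (1 * f e i (j + d)%Z + -1 * f e i j + - h * Y f e i j) with
    (f e i (j + d)%Z - f e i j - h * Y f e i j) by ring.
  apply Rle_trans with (4 * B * (h * Rpower h alpha) + B / mesh N e); [|lra].
  apply (taylor_step (mesh N e) (fun j => f e i j) (fun j => Y f e i j) B (modulus e d)); auto.
  - apply mesh_pos, HN.
  - intros s Hs. destruct (Z.eq_dec s 0) as [->|Hs0].
    + rewrite Z.add_0_r, Rminus_diag, Rabs_R0. apply Rmult_le_pos; auto. apply Rlt_le, modulus_pos.
    + apply Rle_trans with (1 := H2 e i j s E1 ltac:(lia) ltac:(lia)). apply Rmult_le_compat_l; auto.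
      apply modulus_mono; auto. lia.
Qed.

Lemma V_derive_x r B f x y : inner_holder r B (X f) -> 0 < y < 1 ->
  (forall x, is_ulim (fun e => f e (cell (x * mesh N e)) (cell (y * mesh N e))) (limfun f x y)) ->
  is_derive (fun x => limfun f x y) x (limfun (X f) x y).
Proof.
  intros H Hy Hf. assert (B0 := inner_holder_nonneg _ _ _ H).
  apply (is_derive_of_estimate _ _ _ (6 * B) alpha 1); try lra.
  intros h Hh _. assert (Q : 0 <= B * (Rabs h * Rpower (Rabs h) alpha)).
  { apply Rmult_le_pos; auto. apply Rmult_le_pos. apply Rabs_pos. apply Rlt_le, exp_pos. }
  destruct (Rle_lt_dec 0 h) as [Hp|Hm].
  - rewrite (Rabs_pos_eq h) in * by auto. assert (A := V_taylor_x r B f x h y H Hy ltac:(lra) Hf). lra.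
  (* For a negative increment the expansion starts at [x + h], and the Hoelder bound brings the
     derivative back to [x]. The constants add up to [4 B + 2 B]. *)
  - assert (A := V_taylor_x r B f (x + h) (- h) y H Hy ltac:(lra) Hf).
    assert (A2 := V_holder_x r B (X f) (x + h) (- h) y H Hy ltac:(lra)).
    assert (E : @eq R (x + h + - h) x) by (unfold R_AbsRing in *; simpl in *; lra).
    rewrite E in A, A2. rewrite (Rabs_left h) in * by auto.
    apply (Rmult_le_compat_l (- h)) in A2; [|lra].
    rewrite <- (Rabs_pos_eq (- h)) in A2 at 1 by lra. rewrite <- Rabs_mult in A2.
    apply Rabs_le_between in A. apply Rabs_le_between in A2. apply Rabs_le. lra.
Qed.

Lemma V_derive_y r B f x y : inner_holder r B (Y f) -> 0 < y < 1 ->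
  (forall y, 0 < y < 1 -> is_ulim (fun e => f e (cell (x * mesh N e)) (cell (y * mesh N e))) (limfun f x y)) ->
  is_derive (fun y => limfun f x y) y (limfun (Y f) x y).
Proof.
  intros H Hy Hf. assert (B0 := inner_holder_nonneg _ _ _ H).
  apply (is_derive_of_estimate _ _ _ (6 * B) alpha (Rmin y (1 - y))); try lra.
  { apply Rmin_glb_lt; lra. }
  intros h Hh Hd. assert (Q : 0 <= B * (Rabs h * Rpower (Rabs h) alpha)).
  { apply Rmult_le_pos; auto. apply Rmult_le_pos. apply Rabs_pos. apply Rlt_le, exp_pos. }
  assert (M1 := Rmin_l y (1 - y)). assert (M2 := Rmin_r y (1 - y)).
  destruct (Rle_lt_dec 0 h) as [Hp|Hm].
  - rewrite (Rabs_pos_eq h) in * by auto.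
    assert (A := V_taylor_y r B f x y h H Hy ltac:(lra) ltac:(lra) Hf). lra.
  - rewrite (Rabs_left h) in * by auto.
    assert (A := V_taylor_y r B f x (y + h) (- h) H ltac:(lra) ltac:(lra) ltac:(lra) Hf).
    assert (A2 := V_holder_y r B (Y f) x (y + h) (- h) H ltac:(lra) ltac:(lra) ltac:(lra)).
    assert (E : @eq R (y + h + - h) y) by (unfold R_AbsRing in *; simpl in *; lra).
    rewrite E in A, A2.
    apply (Rmult_le_compat_l (- h)) in A2; [|lra].
    rewrite <- (Rabs_pos_eq (- h)) in A2 at 1 by lra. rewrite <- Rabs_mult in A2.
    apply Rabs_le_between in A. apply Rabs_le_between in A2. apply Rabs_le. lra.
Qed.

End Limit.

(** * Existence *)

Lemma sqrt_norm_lip2 a y s y' s' : a <> 0 ->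
  Rabs (sqrt (s ^ 2 + y ^ 2 + a ^ 2) - sqrt (s' ^ 2 + y' ^ 2 + a ^ 2)) <= Rabs (s - s') + Rabs (y - y').
Proof.
  intro Ha. assert (A := sqrt_norm_lip a y s s' Ha). assert (B := sqrt_norm_lip a s' y y' Ha).
  replace (y ^ 2 + s' ^ 2 + a ^ 2) with (s' ^ 2 + y ^ 2 + a ^ 2) in B by ring.
  replace (y' ^ 2 + s' ^ 2 + a ^ 2) with (s' ^ 2 + y' ^ 2 + a ^ 2) in B by ring.
  apply Rabs_le_between in A. apply Rabs_le_between in B. apply Rabs_le. lra.
Qed.

Lemma coef_near a y s t y' s' : a <> 0 ->
  Rabs (coef a y s t - / sqrt (s' ^ 2 + y' ^ 2 + a ^ 2))
    <= (Rabs (s - s') + Rabs (t - s') + 2 * Rabs (y - y')) / (2 * a ^ 2).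
Proof.
  intro Ha. unfold coef.
  destruct (sqrt_norm_pos a y s Ha) as (S1 & _ & S2).
  destruct (sqrt_norm_pos a y t Ha) as (T1 & _ & T2).
  destruct (sqrt_norm_pos a y' s' Ha) as (W1 & _ & W2).
  assert (L1 := sqrt_norm_lip2 a y s y' s' Ha). assert (L2 := sqrt_norm_lip2 a y t y' s' Ha).
  assert (A1 := Rabs_pos_lt a Ha).
  set (S := sqrt (s ^ 2 + y ^ 2 + a ^ 2)) in *. set (T := sqrt (t ^ 2 + y ^ 2 + a ^ 2)) in *.
  set (W := sqrt (s' ^ 2 + y' ^ 2 + a ^ 2)) in *.
  replace (2 / (S + T) - / W) with (- ((S - W) + (T - W)) * / ((S + T) * W)) by (field; lra).
  assert (D : 0 < (S + T) * W) by (apply Rmult_lt_0_compat; lra).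
  rewrite Rabs_mult, Rabs_Ropp, (Rabs_pos_eq (/ _)) by (apply Rlt_le, Rinv_0_lt_compat, D).
  unfold Rdiv. apply Rmult_le_compat.
  - apply Rabs_pos.
  - apply Rlt_le, Rinv_0_lt_compat, D.
  - eapply Rle_trans; [apply Rabs_triang|]. lra.
  - apply Rinv_le_contravar. { assert (0 < a ^ 2) by (apply pow2_gt_0, Ha). lra. }
    rewrite <- (pow2_abs a). replace (2 * Rabs a ^ 2) with ((2 * Rabs a) * Rabs a) by ring.
    apply Rmult_le_compat; lra.
Qed.

Lemma holder1_continuous m alpha phi : (1 <= m)%nat -> holder1 m alpha phi ->
  forall x eps, 0 < eps -> exists d, 0 < d /\ forall x', Rabs (x' - x) < d -> Rabs (phi x' - phi x) < eps.
Proof.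
  intros Hm (H & _) x eps Heps.
  assert (C : continuous phi x).
  { apply (ex_derive_continuous phi x). apply (H 0%nat). lia. }
  destruct (proj1 (filterlim_locally phi (phi x)) C (mkposreal eps Heps)) as [d Hd].
  exists d. split. apply cond_pos. intros x' Hx'. apply (Hd x'). exact Hx'.
Qed.

Lemma dist2_bounds x1 y1 x2 y2 : (x1, y1) <> (x2, y2) ->
  Rabs (x1 - x2) <= dist2 x1 y1 x2 y2 /\ Rabs (y1 - y2) <= dist2 x1 y1 x2 y2 /\
  0 < dist2 x1 y1 x2 y2.
Proof.
  intro H. unfold dist2. assert (A := pow2_ge_0 (x1 - x2)). assert (B := pow2_ge_0 (y1 - y2)).
  assert (L1 : Rabs (x1 - x2) <= sqrt ((x1 - x2) ^ 2 + (y1 - y2) ^ 2)).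
  { rewrite <- sqrt_Rsqr_abs. apply sqrt_le_1_alt. unfold Rsqr. lra. }
  assert (L2 : Rabs (y1 - y2) <= sqrt ((x1 - x2) ^ 2 + (y1 - y2) ^ 2)).
  { rewrite <- sqrt_Rsqr_abs. apply sqrt_le_1_alt. unfold Rsqr. lra. }
  split; [|split]; auto.
  destruct (Req_dec x1 x2) as [E|E].
  - assert (y1 <> y2) by (intro; apply H; congruence).
    assert (0 < Rabs (y1 - y2)) by (apply Rabs_pos_lt; lra). lra.
  - assert (0 < Rabs (x1 - x2)) by (apply Rabs_pos_lt; lra). lra.
Qed.

Lemma strip_open Rs y : Rabs y < Rs -> locally y (fun y' => Rabs y' < Rs).
Proof.
  intro Hy. assert (D : 0 < Rs - Rabs y) by lra. exists (mkposreal _ D). intros y' Hy'.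
  change (Rabs (y' - y) < Rs - Rabs y) in Hy'.
  replace y' with ((y' - y) + y) by ring. eapply Rle_lt_trans; [apply Rabs_triang|]. lra.
Qed.

Section Solution.
Variables (k : nat) (alpha a Rs P : R) (phip phim : R -> R).
Hypotheses (HRs : 0 < Rs) (HP : 0 < P) (Ha : a <> 0) (Hal : 0 < alpha < 1)
  (Hp : holder1 (k + 2) alpha phip) (Hm : holder1 (k + 2) alpha phim).
Let kap := P ^ 2 / (2 * Rs ^ 2).
Variables (N : nat -> Z) (v : grid nat) (M : R).
Hypotheses (HN : forall e, (0 < N e)%Z) (HNe : forall e, (Z.of_nat e <= N e)%Z)
  (Hsol : forall e, discrete_solution a Rs kap (N e) (v e))
  (HM : forall p e i j, (p <= k + 2)%nat -> (0 <= j <= N e)%Z -> Rabs (dxn (mesh N) p v e i j) <= M)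
  (Htop : forall e i j d, (0 <= j <= N e)%Z -> (0 < d)%Z ->
     Rabs (dxn (mesh N) (k + 2) v e (i + d)%Z j - dxn (mesh N) (k + 2) v e i j) <= M * modulus N alpha e d)
  (Hbm : forall e i, Rabs (v e i 0%Z - phim (P * (IZR i / mesh N e))) <= M / INR (S e))
  (Hbp : forall e i, Rabs (v e i (N e) - phip (P * (IZR i / mesh N e))) <= M / INR (S e)).
Variables (U : (nat -> Prop) -> Prop) (lim : (nat -> R) -> R).
Hypothesis HU : ultralimit U lim.
Notation X := (dquot (mesh N) false).
Notation Y := (dquot (mesh N) true).
Notation V := (limfun N lim).
Notation is_ulim := (is_ulim U).

Lemma kap_pos : 0 < kap.
Proof.
  unfold kap. assert (0 < P ^ 2) by (apply pow_lt, HP). assert (0 < Rs ^ 2) by (apply pow_lt, HRs).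
  apply Rdiv_lt_0_compat; lra.
Qed.

Lemma differences_inner_holder l : (length l <= k + 2)%nat -> exists r B, (0 <= r)%Z /\ inner_holder N alpha r B (dquots (mesh N) l v).
Proof.
  intro Hl.
  assert (H := differences_holder N a Rs kap alpha v HN Ha HRs kap_pos Hal Hsol k M HM Htop l Hl).
  destruct (holder_class_elim N alpha _ H) as (r & B & B0 & H1 & H2 & H3).
  exists (Z.of_nat r), B. split. lia. split; [|split].
  - intros; apply H1; lia.
  - intros; apply H2; auto; lia.
  - intros; apply H3; auto; lia.
Qed.

Lemma inner_holder_ulim r B f y : inner_holder N alpha r B f -> 0 < y < 1 ->
  forall x, is_ulim (fun e => f e (cell (x * mesh N e)) (cell (y * mesh N e))) (V f x y).
Proof. intros H Hy x. apply (V_inner_holder N alpha U lim HNe HU r B); auto. Qed.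

Lemma V_dquots_derive_x l x y : (S (length l) <= k + 2)%nat -> 0 < y < 1 ->
  is_derive (fun x => V (dquots (mesh N) l v) x y) x (V (dquots (mesh N) (false :: l) v) x y).
Proof.
  intros Hl Hy. destruct (differences_inner_holder l ltac:(lia)) as (r0 & B0 & _ & H0).
  destruct (differences_inner_holder (false :: l) ltac:(simpl; lia)) as (r & B & _ & H).
  apply (V_derive_x N alpha U lim HN HNe Hal HU r B); auto.
  apply (inner_holder_ulim r0 B0); auto.
Qed.

Lemma V_dquots_derive_y l x y : (S (length l) <= k + 2)%nat -> 0 < y < 1 ->
  is_derive (fun y => V (dquots (mesh N) l v) x y) y (V (dquots (mesh N) (true :: l) v) x y).
Proof.
  intros Hl Hy. destruct (differences_inner_holder l ltac:(lia)) as (r0 & B0 & _ & H0).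
  destruct (differences_inner_holder (true :: l) ltac:(simpl; lia)) as (r & B & _ & H).
  apply (V_derive_y N alpha U lim HN HNe Hal HU r B); auto.
  intros y' Hy'. apply (inner_holder_ulim r0 B0); auto.
Qed.

Definition strip_coord (y : R) : R := (y + Rs) / (2 * Rs).

Lemma strip_coord_range y : Rabs y < Rs -> 0 < strip_coord y < 1.
Proof.
  intro Hy. apply Rabs_def2 in Hy. unfold strip_coord. split.
  - apply Rdiv_lt_0_compat; lra.
  - apply (proj2 (Rlt_div_l _ _ (2 * Rs) ltac:(lra))). lra.
Qed.

(** The boundary values are imposed by definition, and the ultralimit is taken only at interior
    heights. Continuity at the edges therefore becomes a statement to prove. *)
Definition limit_solution (x y : R) : R :=
  if Rle_dec Rs y then phip x else if Rle_dec y (- Rs) then phim x else V v (x / P) (strip_coord y).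

Lemma limit_solution_inner_holder x y : Rabs y < Rs -> limit_solution x y = V v (x / P) (strip_coord y).
Proof.
  intro Hy. apply Rabs_def2 in Hy. unfold limit_solution.
  destruct (Rle_dec Rs y); [lra|]. destruct (Rle_dec y (- Rs)); [lra|]. reflexivity.
Qed.

(** Chain rule factors of the change of variables from the strip to the unit square. *)
Fixpoint scale (l : list bool) : R :=
  match l with nil => 1 | b :: l => (if b then / (2 * Rs) else / P) * scale l end.

Lemma scaled_derive_x l x y : (S (length l) <= k + 2)%nat -> Rabs y < Rs ->
  is_derive (fun x => scale l * V (dquots (mesh N) l v) (x / P) (strip_coord y)) x
    (scale (false :: l) * V (dquots (mesh N) (false :: l) v) (x / P) (strip_coord y)).
Proof.
  intros Hl Hy. apply strip_coord_range in Hy. simpl scale.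
  replace (/ P * scale l * V (dquots (mesh N) (false :: l) v) (x / P) (strip_coord y))
    with (scale l * (/ P * V (dquots (mesh N) (false :: l) v) (x / P) (strip_coord y))) by ring.
  apply (is_derive_scal (fun x => V (dquots (mesh N) l v) (x / P) (strip_coord y)) x (scale l)).
  apply (is_derive_comp (fun x => V (dquots (mesh N) l v) x (strip_coord y)) (fun x => x / P)).
  - apply V_dquots_derive_x; auto.
  - auto_derive; auto. unfold Rdiv. ring.
Qed.

Lemma scaled_derive_y l x y : (S (length l) <= k + 2)%nat -> Rabs y < Rs ->
  is_derive (fun y => scale l * V (dquots (mesh N) l v) (x / P) (strip_coord y)) y
    (scale (true :: l) * V (dquots (mesh N) (true :: l) v) (x / P) (strip_coord y)).
Proof.
  intros Hl Hy. apply strip_coord_range in Hy. simpl scale.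
  replace (/ (2 * Rs) * scale l * V (dquots (mesh N) (true :: l) v) (x / P) (strip_coord y))
    with (scale l * (/ (2 * Rs) * V (dquots (mesh N) (true :: l) v) (x / P) (strip_coord y))) by ring.
  apply (is_derive_scal (fun y => V (dquots (mesh N) l v) (x / P) (strip_coord y)) y (scale l)).
  apply (is_derive_comp (fun y => V (dquots (mesh N) l v) (x / P) y) strip_coord).
  - apply V_dquots_derive_y; auto.
  - unfold strip_coord. auto_derive; auto. field. lra.
Qed.

Lemma pd_limit_solution l : (length l <= k + 2)%nat -> forall x y, Rabs y < Rs ->
  pd l limit_solution x y = scale l * V (dquots (mesh N) l v) (x / P) (strip_coord y).
Proof.
  induction l as [|b l IH]; intros Hl x y Hy.
  - simpl. rewrite Rmult_1_l. apply limit_solution_inner_holder, Hy.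
  - simpl in Hl. assert (IH' := IH ltac:(lia)). destruct b.
    + change (pd (true :: l) limit_solution x y) with (Derive (fun t => pd l limit_solution x t) y).
      apply is_derive_unique.
      apply (is_derive_ext_loc (fun y => scale l * V (dquots (mesh N) l v) (x / P) (strip_coord y))).
      * apply (filter_imp (fun y' => Rabs y' < Rs)).
        { intros y' Hy'. symmetry. apply IH', Hy'. } apply strip_open, Hy.
      * apply scaled_derive_y; auto.
    + change (pd (false :: l) limit_solution x y) with (Derive (fun t => pd l limit_solution t y) x).
      apply is_derive_unique.
      apply (is_derive_ext (fun x => scale l * V (dquots (mesh N) l v) (x / P) (strip_coord y))).
      * intro x'. symmetry. apply IH', Hy.
      * apply scaled_derive_x; auto.
Qed.

Lemma pd_limit_solution_derivable l : (length l < k + 2)%nat -> forall x y, Rabs y < Rs ->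
  ex_derive (fun t => pd l limit_solution t y) x /\ ex_derive (fun t => pd l limit_solution x t) y.
Proof.
  intros Hl x y Hy. split.
  - apply (ex_derive_ext (fun x => scale l * V (dquots (mesh N) l v) (x / P) (strip_coord y))).
    + intro x'. symmetry. apply pd_limit_solution; auto. lia.
    + eexists. apply scaled_derive_x; auto.
  - apply (ex_derive_ext_loc (fun y => scale l * V (dquots (mesh N) l v) (x / P) (strip_coord y))).
    + apply (filter_imp (fun y' => Rabs y' < Rs)).
      { intros y' Hy'. symmetry. apply pd_limit_solution; auto. lia. } apply strip_open, Hy.
    + eexists. apply scaled_derive_y; auto.
Qed.

Lemma V_holder r B f x1 y1 x2 y2 D : inner_holder N alpha r B f -> 0 < y1 < 1 -> 0 < y2 < 1 -> 0 < D ->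
  Rabs (x1 - x2) <= D -> Rabs (y1 - y2) <= D ->
  Rabs (V f x1 y1 - V f x2 y2) <= 4 * B * Rpower D alpha.
Proof.
  intros H Hy1 Hy2 HD Dx Dy. assert (B0 := inner_holder_nonneg N alpha HNe _ _ _ H).
  assert (PD : 0 < Rpower D alpha) by apply exp_pos.
  assert (Mo : forall h, 0 < h -> h <= D -> 2 * B * Rpower h alpha <= 2 * B * Rpower D alpha).
  { intros h H1 H2. apply Rmult_le_compat_l. lra. apply pw_mono; auto. }
  assert (BD : 0 <= 2 * B * Rpower D alpha) by (apply Rmult_le_pos; lra).
  assert (A1 : Rabs (V f x1 y1 - V f x2 y1) <= 2 * B * Rpower D alpha).
  { apply Rabs_le_between in Dx. destruct (Rtotal_order x1 x2) as [L|[->|L]].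
    - rewrite Rabs_minus_sym. replace x2 with (x1 + (x2 - x1)) by ring.
      apply Rle_trans with (2 := Mo (x2 - x1) ltac:(lra) ltac:(lra)).
      apply (V_holder_x N alpha U lim HN HNe Hal HU r); auto. lra.
    - rewrite Rminus_diag, Rabs_R0. exact BD.
    - replace x1 with (x2 + (x1 - x2)) by ring.
      apply Rle_trans with (2 := Mo (x1 - x2) ltac:(lra) ltac:(lra)).
      apply (V_holder_x N alpha U lim HN HNe Hal HU r); auto. lra. }
  assert (A2 : Rabs (V f x2 y1 - V f x2 y2) <= 2 * B * Rpower D alpha).
  { apply Rabs_le_between in Dy. destruct (Rtotal_order y1 y2) as [L|[->|L]].
    - rewrite Rabs_minus_sym. replace y2 with (y1 + (y2 - y1)) by ring.
      apply Rle_trans with (2 := Mo (y2 - y1) ltac:(lra) ltac:(lra)).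
      apply (V_holder_y N alpha U lim HN HNe Hal HU r); auto; lra.
    - rewrite Rminus_diag, Rabs_R0. exact BD.
    - replace y1 with (y2 + (y1 - y2)) by ring.
      apply Rle_trans with (2 := Mo (y1 - y2) ltac:(lra) ltac:(lra)).
      apply (V_holder_y N alpha U lim HN HNe Hal HU r); auto; lra. }
  replace (V f x1 y1 - V f x2 y2) with ((V f x1 y1 - V f x2 y1) + (V f x2 y1 - V f x2 y2)) by ring.
  eapply Rle_trans; [apply Rabs_triang|]. lra.
Qed.

Lemma scaled_distance x1 y1 x2 y2 : (x1, y1) <> (x2, y2) ->
  Rabs (x1 / P - x2 / P) <= (/ P + / (2 * Rs)) * dist2 x1 y1 x2 y2 /\
  Rabs (strip_coord y1 - strip_coord y2) <= (/ P + / (2 * Rs)) * dist2 x1 y1 x2 y2.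
Proof.
  intro Hne. destruct (dist2_bounds _ _ _ _ Hne) as (D1 & D2 & D3).
  assert (I1 : 0 < / P) by (apply Rinv_0_lt_compat, HP).
  assert (I2 : 0 < / (2 * Rs)) by (apply Rinv_0_lt_compat; lra).
  set (D := dist2 x1 y1 x2 y2) in *.
  assert (0 <= / P * D) by (apply Rmult_le_pos; lra).
  assert (0 <= / (2 * Rs) * D) by (apply Rmult_le_pos; lra). split.
  - replace (x1 / P - x2 / P) with (/ P * (x1 - x2)) by (field; lra).
    rewrite Rabs_mult, (Rabs_pos_eq (/ P)) by lra.
    apply (Rmult_le_compat_l (/ P)) in D1; lra.
  - replace (strip_coord y1 - strip_coord y2) with (/ (2 * Rs) * (y1 - y2)) by (unfold strip_coord; field; lra).
    rewrite Rabs_mult, (Rabs_pos_eq (/ (2 * Rs))) by lra.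
    apply (Rmult_le_compat_l (/ (2 * Rs))) in D2; lra.
Qed.

Lemma limit_solution_holder l : (length l <= k + 2)%nat -> exists C, 0 <= C /\ forall x1 y1 x2 y2,
  Rabs y1 < Rs -> Rabs y2 < Rs -> (x1, y1) <> (x2, y2) ->
  Rabs (pd l limit_solution x1 y1 - pd l limit_solution x2 y2) <= C * Rpower (dist2 x1 y1 x2 y2) alpha.
Proof.
  intro Hl. destruct (differences_inner_holder l Hl) as (r & B & _ & H).
  assert (B0 := inner_holder_nonneg N alpha HNe _ _ _ H).
  set (K := / P + / (2 * Rs)).
  assert (I1 : 0 < / P) by (apply Rinv_0_lt_compat, HP).
  assert (I2 : 0 < / (2 * Rs)) by (apply Rinv_0_lt_compat; lra).
  assert (K0 : 0 < K) by (unfold K; lra).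
  exists (Rabs (scale l) * (4 * B) * Rpower K alpha). split.
  { apply Rmult_le_pos; [|apply Rlt_le, exp_pos]. apply Rmult_le_pos; [apply Rabs_pos|lra]. }
  intros x1 y1 x2 y2 H1 H2 Hne. rewrite !pd_limit_solution by auto.
  rewrite <- Rmult_minus_distr_l, Rabs_mult.
  destruct (dist2_bounds _ _ _ _ Hne) as (_ & _ & D3).
  destruct (scaled_distance _ _ _ _ Hne) as (S1 & S2). fold K in S1, S2.
  assert (A := V_holder r B _ (x1 / P) (strip_coord y1) (x2 / P) (strip_coord y2) (K * dist2 x1 y1 x2 y2) H
    (strip_coord_range _ H1) (strip_coord_range _ H2) ltac:(apply Rmult_lt_0_compat; auto) S1 S2).
  rewrite <- Rpower_mult_distr in A by auto.
  apply (Rmult_le_compat_l (Rabs (scale l))) in A; [|apply Rabs_pos]. lra.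
Qed.

Lemma edge_slope : exists C, 0 <= C /\ forall e i j, (0 <= j < N e)%Z -> Rabs (Y v e i j) <= C.
Proof.
  destruct (interpolated N a Rs kap alpha v HN Ha HRs kap_pos Hal Hsol k M HM Htop) as (C & C0 & HC).
  exists C. split; auto. apply (HC 0%nat). lia.
Qed.

Lemma v_ulim x y : 0 < y < 1 -> is_ulim (fun e => v e (cell (x * mesh N e)) (cell (y * mesh N e))) (V v x y).
Proof.
  intro Hy. destruct (differences_inner_holder nil ltac:(simpl; lia)) as (r & B & _ & H).
  apply (inner_holder_ulim r B v y H Hy).
Qed.

Lemma ev_index eps : 0 < eps -> eventually_all (fun e => M / INR (S e) <= eps).
Proof.
  intro He. destruct (archimed (Rabs M / eps)) as [A _].
  assert (Q0 : 0 <= Rabs M / eps) by (apply Rdiv_le_0_compat; auto; apply Rabs_pos).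
  exists (Z.to_nat (up (Rabs M / eps))). intros e Hn.
  assert (S0 : 0 < INR (S e)) by (apply lt_0_INR; lia).
  apply (proj2 (Rle_div_l _ _ _ S0)). apply Rle_trans with (Rabs M). apply Rle_abs.
  replace (Rabs M) with (eps * (Rabs M / eps)) by (field; lra).
  apply Rmult_le_compat_l. lra. rewrite S_INR.
  assert (IZR (up (Rabs M / eps)) <= INR e).
  { rewrite INR_IZR_INZ. apply IZR_le. lia. } lra.
Qed.

Lemma grid_point x eps : 0 < eps -> eventually_all (fun e => Rabs (P * (IZR (cell (x * mesh N e)) / mesh N e) - P * x) < eps).
Proof.
  intro He. destruct (ev_small N HN HNe P (eps / 2) ltac:(lra) ltac:(lra)) as [n0 H].
  exists n0. intros e Hn. specialize (H e Hn). assert (n0' := mesh_pos N HN e).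
  assert (A := cell_spec (x * mesh N e)).
  replace (P * (IZR (cell (x * mesh N e)) / mesh N e) - P * x)
    with (P / mesh N e * (IZR (cell (x * mesh N e)) - x * mesh N e)) by (field; lra).
  assert (Q : 0 < P / mesh N e) by (apply Rdiv_lt_0_compat; auto).
  rewrite Rabs_mult, (Rabs_pos_eq (P / mesh N e)) by lra.
  apply Rle_lt_trans with (eps / 2 * 1); [|lra].
  apply Rmult_le_compat; try lra. apply Rabs_pos. apply Rabs_le. lra.
Qed.

(** The first [y]-difference is bounded up to the edge rows and these rows converge to the data, so
    the deviation from the data is at most linear in the distance to the edge. *)
Lemma boundary_values : exists C, 0 <= C /\ forall x y, Rabs y < Rs ->
  Rabs (limit_solution x y - phim x) <= C * strip_coord y /\ Rabs (limit_solution x y - phip x) <= C * (1 - strip_coord y).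
Proof.
  destruct edge_slope as (C & C0 & HC). exists C. split; auto. intros x y Hy.
  assert (HY := strip_coord_range y Hy). rewrite limit_solution_inner_holder by auto. set (x' := x / P). set (y' := strip_coord y) in *.
  assert (Ex : x = P * x') by (unfold x'; field; lra).
  assert (L := v_ulim x' y' HY).
  assert (Slope : forall e i j d, (0 <= j)%Z -> (0 <= d)%Z -> (j + d <= N e)%Z ->
            Rabs (v e i (j + d)%Z - v e i j) <= C * (IZR d / mesh N e)).
  { intros e i j d Hj Hd Hjd.
    assert (A := chain1 (fun j => v e i j) (mesh N e) 0 C j d Hd).
    assert (A1 := A ltac:(intros s Hs; cbv beta; rewrite Rminus_0_r; apply (HC e i (j + s)%Z); lia)).
    assert (n0 := mesh_pos N HN e). cbv beta in A1.
    rewrite Rmult_0_r, Rminus_0_r, Rabs_mult, (Rabs_pos_eq (mesh N e)) in A1 by lra.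
    apply (Rmult_le_reg_r (mesh N e)); auto. apply Rle_trans with (1 := A1). right. field. lra. }
  split.
  - replace (V v x' y' - phim x) with (1 * V v x' y' + (-1) * phim x + 0 * phim x) by ring.
    apply (is_ulim_combine U lim HU _ _ _ _ _ _ 1 (-1) 0 _ L
      (is_ulim_const U lim HU (phim x)) (is_ulim_const U lim HU (phim x))).
    intros eps He.
    destruct (holder1_continuous (k + 2) alpha phim ltac:(lia) Hm x (eps / 2) ltac:(lra)) as (d & d0 & Hd).
    destruct (ev_and _ _ (ev_and _ _ (ev_rows N HNe y' 0 HY) (ev_index (eps / 2) ltac:(lra)))
      (grid_point x' d d0)) as [n0 E].
    exists n0. intros e Hn. destruct (E e Hn) as [[[E1 E2] E3] E4].
    rewrite <- Ex in E4. specialize (Hd _ E4). specialize (Hbm e (cell (x' * mesh N e))).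
    assert (A := cell_spec (y' * mesh N e)). assert (n0' := mesh_pos N HN e).
    set (i := cell (x' * mesh N e)) in *. set (j := cell (y' * mesh N e)) in *.
    assert (S1 := Slope e i 0%Z j ltac:(lia) E1 ltac:(lia)). rewrite Z.add_0_l in S1.
    assert (Hj : IZR j / mesh N e <= y') by (apply (proj2 (Rle_div_l _ _ _ n0')); lra).
    apply (Rmult_le_compat_l C) in Hj; auto.
    apply Rabs_le_between in S1. apply Rabs_le_between in Hbm. apply Rabs_def2 in Hd.
    apply Rabs_le. lra.
  - replace (V v x' y' - phip x) with (1 * V v x' y' + (-1) * phip x + 0 * phip x) by ring.
    apply (is_ulim_combine U lim HU _ _ _ _ _ _ 1 (-1) 0 _ L
      (is_ulim_const U lim HU (phip x)) (is_ulim_const U lim HU (phip x))).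
    intros eps He.
    destruct (holder1_continuous (k + 2) alpha phip ltac:(lia) Hp x (eps / 3) ltac:(lra)) as (d & d0 & Hd).
    destruct (ev_and _ _ (ev_and _ _ (ev_rows N HNe y' 0 HY) (ev_index (eps / 3) ltac:(lra)))
      (ev_and _ _ (grid_point x' d d0) (ev_small N HN HNe C (eps / 3) C0 ltac:(lra)))) as [n0 E].
    exists n0. intros e Hn. destruct (E e Hn) as [[[E1 E2] E3] [E4 E5]].
    rewrite <- Ex in E4. specialize (Hd _ E4). specialize (Hbp e (cell (x' * mesh N e))).
    assert (A := cell_spec (y' * mesh N e)). assert (n0' := mesh_pos N HN e).
    set (i := cell (x' * mesh N e)) in *. set (j := cell (y' * mesh N e)) in *.
    assert (S1 := Slope e i j (N e - j)%Z ltac:(lia) ltac:(lia) ltac:(lia)).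
    replace (j + (N e - j))%Z with (N e) in S1 by lia.
    rewrite minus_IZR in S1. fold (mesh N e) in S1.
    assert (Hj : (mesh N e - IZR j) / mesh N e <= (1 - y') + 1 / mesh N e).
    { apply (proj2 (Rle_div_l _ _ _ n0')).
      replace ((1 - y' + 1 / mesh N e) * mesh N e) with (mesh N e - y' * mesh N e + 1) by (field; lra). lra. }
    apply (Rmult_le_compat_l C) in Hj; auto.
    replace (C * (1 - y' + 1 / mesh N e)) with (C * (1 - y') + C / mesh N e) in Hj by (field; lra).
    apply Rabs_le_between in S1. apply Rabs_le_between in Hbp. apply Rabs_def2 in Hd.
    apply Rabs_le. lra.
Qed.

Lemma limit_solution_continuous x y : Rabs y <= Rs -> forall eps, 0 < eps -> exists delta, 0 < delta /\
  forall x' y', Rabs y' <= Rs -> Rabs (x' - x) < delta -> Rabs (y' - y) < delta ->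
    Rabs (limit_solution x' y' - limit_solution x y) < eps.
Proof.
  intros Hy eps He. destruct boundary_values as (C & C0 & HC).
  set (d2 := Rmin Rs (eps * Rs / (C + 1))).
  assert (d20 : 0 < d2).
  { apply Rmin_glb_lt; auto. apply Rdiv_lt_0_compat; [apply Rmult_lt_0_compat|]; lra. }
  assert (d2a : d2 <= Rs) by apply Rmin_l.
  assert (d2b : C * (d2 / (2 * Rs)) < eps / 2).
  { assert (Q : d2 <= eps * Rs / (C + 1)) by apply Rmin_r.
    apply (proj2 (Rle_div_r _ _ (C + 1) ltac:(lra))) in Q.
    replace (C * (d2 / (2 * Rs))) with (C * d2 / (2 * Rs)) by (field; lra).
    apply (proj2 (Rlt_div_l _ _ (2 * Rs) ltac:(lra))). lra. }
  destruct (Rlt_dec (Rabs y) Rs) as [Hin|Hout].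
  - destruct (limit_solution_holder nil ltac:(simpl; lia)) as (K & K0 & HK).
    set (g := Rpower (eps / (2 * (K + 1))) (/ alpha)).
    assert (g0 : 0 < g) by apply exp_pos.
    assert (Q0 : 0 < Rmin (g / 2) (Rs - Rabs y)) by (apply Rmin_glb_lt; lra).
    exists (Rmin (g / 2) (Rs - Rabs y)). split; auto. intros x' y' _ Dx Dy.
    assert (M1 := Rmin_l (g / 2) (Rs - Rabs y)). assert (M2 := Rmin_r (g / 2) (Rs - Rabs y)).
    assert (Hin' : Rabs y' < Rs).
    { replace y' with ((y' - y) + y) by ring. eapply Rle_lt_trans; [apply Rabs_triang|]. lra. }
    destruct (classic ((x', y') = (x, y))) as [E|Hne].
    + injection E as -> ->. rewrite Rminus_diag, Rabs_R0. exact He.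
    + apply Rle_lt_trans with (1 := HK x' y' x y Hin' Hin Hne).
      destruct (dist2_bounds _ _ _ _ Hne) as (_ & _ & D3).
      assert (D4 : dist2 x' y' x y <= g).
      { unfold dist2. rewrite <- (sqrt_pow2 g) by lra. apply sqrt_le_1_alt.
        rewrite <- (pow2_abs (x' - x)), <- (pow2_abs (y' - y)).
        assert (Rabs (x' - x) ^ 2 <= (g / 2) ^ 2) by (apply pow_incr; split; [apply Rabs_pos|lra]).
        assert (Rabs (y' - y) ^ 2 <= (g / 2) ^ 2) by (apply pow_incr; split; [apply Rabs_pos|lra]).
        assert (0 <= g ^ 2) by apply pow2_ge_0. lra. }
      apply Rle_lt_trans with (K * (eps / (2 * (K + 1)))).
      * apply Rmult_le_compat_l; auto. apply Rle_trans with (Rpower g alpha).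
        apply pw_mono; auto. unfold g. rewrite Rpower_mult, Rinv_l, Rpower_1 by
          (try lra; apply Rdiv_lt_0_compat; lra). lra.
      * replace (K * (eps / (2 * (K + 1)))) with (K * eps / (2 * (K + 1))) by (field; lra).
        apply (proj2 (Rlt_div_l _ _ (2 * (K + 1)) ltac:(lra))).
        assert (0 <= K * eps) by (apply Rmult_le_pos; lra). lra.
  - assert (Hedge : y = Rs \/ y = - Rs).
    { unfold Rabs in Hy, Hout. destruct (Rcase_abs y); [right|left]; lra. }
    destruct Hedge as [-> | ->].
    + destruct (holder1_continuous (k + 2) alpha phip ltac:(lia) Hp x (eps / 2) ltac:(lra)) as (d & d0 & Hd).
      assert (Q0 : 0 < Rmin d d2) by (apply Rmin_glb_lt; lra).
      exists (Rmin d d2). split; auto. intros x' y' Hy' Dx Dy.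
      assert (M1 := Rmin_l d d2). assert (M2 := Rmin_r d d2).
      specialize (Hd x' ltac:(lra)). apply Rabs_def2 in Dy.
      assert (Es : limit_solution x Rs = phip x) by (unfold limit_solution; destruct (Rle_dec Rs Rs); [reflexivity|lra]).
      rewrite Es. destruct (Rle_dec Rs y') as [Hge|Hlt].
      * unfold limit_solution. destruct (Rle_dec Rs y'); [|lra]. lra.
      * assert (Hin' : Rabs y' < Rs) by (apply Rabs_def1; lra).
        destruct (HC x' y' Hin') as (_ & B2).
        assert (1 - strip_coord y' <= d2 / (2 * Rs)).
        { replace (1 - strip_coord y') with ((Rs - y') / (2 * Rs)) by (unfold strip_coord; field; lra).
          apply Rmult_le_compat_r; [|lra]. apply Rlt_le, Rinv_0_lt_compat. lra. }
        apply (Rmult_le_compat_l C) in H; auto.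
        replace (limit_solution x' y' - phip x) with ((limit_solution x' y' - phip x') + (phip x' - phip x)) by ring.
        eapply Rle_lt_trans; [apply Rabs_triang|]. lra.
    + destruct (holder1_continuous (k + 2) alpha phim ltac:(lia) Hm x (eps / 2) ltac:(lra)) as (d & d0 & Hd).
      assert (Q0 : 0 < Rmin d d2) by (apply Rmin_glb_lt; lra).
      exists (Rmin d d2). split; auto. intros x' y' Hy' Dx Dy.
      assert (M1 := Rmin_l d d2). assert (M2 := Rmin_r d d2).
      specialize (Hd x' ltac:(lra)). apply Rabs_def2 in Dy.
      assert (Es : forall x, limit_solution x (- Rs) = phim x).
      { intro z. unfold limit_solution. destruct (Rle_dec Rs (- Rs)); [lra|].
        destruct (Rle_dec (- Rs) (- Rs)); [reflexivity|lra]. }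
      rewrite Es. destruct (Rle_dec y' (- Rs)) as [Hge|Hlt].
      * unfold limit_solution. destruct (Rle_dec Rs y'); [lra|]. destruct (Rle_dec y' (- Rs)); [|lra]. lra.
      * assert (Hin' : Rabs y' < Rs) by (apply Rabs_def1; lra).
        destruct (HC x' y' Hin') as (B2 & _).
        assert (strip_coord y' <= d2 / (2 * Rs)).
        { unfold strip_coord. apply Rmult_le_compat_r; [|lra]. apply Rlt_le, Rinv_0_lt_compat. lra. }
        apply (Rmult_le_compat_l C) in H; auto.
        replace (limit_solution x' y' - phim x) with ((limit_solution x' y' - phim x') + (phim x' - phim x)) by ring.
        eapply Rle_lt_trans; [apply Rabs_triang|]. lra.
Qed.

Lemma limit_solution_holder_strip : holder_strip (k + 2) alpha Rs limit_solution.
Proof.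
  split; [|split; [|split]].
  - apply pd_limit_solution_derivable.
  - intros l Hl. destruct (differences_inner_holder l Hl) as (r & B & _ & H).
    exists (Rabs (scale l) * B). intros x y Hy. rewrite pd_limit_solution, Rabs_mult by auto.
    apply Rmult_le_compat_l. apply Rabs_pos.
    apply (V_bound N alpha U lim HNe HU r); auto. apply strip_coord_range, Hy.
  - intros l Hl. destruct (limit_solution_holder l ltac:(lia)) as (C & _ & HC). exists C. auto.
  - apply limit_solution_continuous.
Qed.

(** * The equation for the limit *)

Notation G := (gflux N a Rs v).

Lemma is_ulim_scal f l c : is_ulim f l -> is_ulim (fun e => c * f e) (c * l).
Proof.
  intros H eps He. assert (Q : 0 < eps / (Rabs c + 1)).
  { apply Rdiv_lt_0_compat; auto. assert (0 <= Rabs c) by apply Rabs_pos. lra. }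
  apply (ul_mono _ _ HU) with (2 := H _ Q). intros e A.
  rewrite <- Rmult_minus_distr_l, Rabs_mult. assert (C0 := Rabs_pos c).
  apply (proj2 (Rlt_div_r _ _ (Rabs c + 1) ltac:(lra))) in A.
  assert (Z := Rabs_pos (f e - l)). nra.
Qed.

Lemma is_ulim_mult f g l m : is_ulim f l -> is_ulim g m -> is_ulim (fun e => f e * g e) (l * m).
Proof.
  intros H1 H2 eps He. assert (P1 := Rabs_pos l). assert (P2 := Rabs_pos m).
  set (d := Rmin 1 (eps / (Rabs l + Rabs m + 2))).
  assert (d0 : 0 < d) by (apply Rmin_glb_lt; [lra|apply Rdiv_lt_0_compat; lra]).
  assert (d1 : d <= 1) by apply Rmin_l.
  assert (d2 : d * (Rabs l + Rabs m + 2) <= eps).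
  { apply (proj2 (Rle_div_r _ _ (Rabs l + Rabs m + 2) ltac:(lra))). apply Rmin_r. }
  apply (ul_mono _ _ HU) with (2 := ul_and _ _ HU _ _ (H1 d d0) (H2 d d0)). intros e [A B].
  replace (f e * g e - l * m) with ((f e - l) * (g e - m) + (f e - l) * m + l * (g e - m)) by ring.
  eapply Rle_lt_trans; [apply Rabs_triang|].
  eapply Rle_lt_trans; [apply Rplus_le_compat_r, Rabs_triang|]. rewrite !Rabs_mult.
  assert (Q1 := Rabs_pos (f e - l)). assert (Q2 := Rabs_pos (g e - m)).
  assert (Rabs (f e - l) * Rabs (g e - m) <= d * 1) by (apply Rmult_le_compat; lra).
  assert (Rabs (f e - l) * Rabs m <= d * Rabs m) by (apply Rmult_le_compat; lra).
  assert (Rabs l * Rabs (g e - m) <= Rabs l * d) by (apply Rmult_le_compat; lra).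
  lra.
Qed.

Lemma ev_om1 eps : 0 < eps -> eventually_all (fun e => modulus N alpha e 1 <= eps).
Proof.
  intro He. destruct (ev_small N HN HNe 1 (Rpower eps (/ alpha)) ltac:(lra) ltac:(apply exp_pos)) as [n0 H].
  exists n0. intros e Hn. specialize (H e Hn).
  replace eps with (Rpower (Rpower eps (/ alpha)) alpha).
  - apply pw_mono; auto. apply Rdiv_lt_0_compat. lra. apply mesh_pos, HN.
  - rewrite Rpower_mult, Rinv_l, Rpower_1 by lra. reflexivity.
Qed.

Lemma flux_ulim x y : 0 < y < 1 -> is_ulim (fun e => G e (cell (x * mesh N e)) (cell (y * mesh N e))) (V G x y).
Proof.
  intro Hy.
  destruct (flux_rows N a Rs alpha v HN Ha HRs Hal k M HM Htop) as (B & HB).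
  apply (V_ulim N U lim HU G B). destruct (ev_rows N HNe y 0 Hy) as [n0 E].
  exists n0. intros e He. destruct (E e He). apply (HB 0%nat); lia.
Qed.

(** By the scheme the [x]-difference of the flux is [- kap] times a second [y]-difference of [v],
    already known to be Hoelder continuous. So the limit flux is differentiated as a function in its
    own right, which preserves the divergence form. *)
Lemma flux_derivative x y : 0 < y < 1 ->
  is_derive (fun x => V G x y) x (- kap * V (Y (Y v)) x y).
Proof.
  intro Hy. assert (K0 := kap_pos).
  destruct (differences_inner_holder (true :: true :: nil) ltac:(simpl; lia)) as (r & B & r0 & H).
  assert (B0 := inner_holder_nonneg N alpha HNe _ _ _ H).
  change (dquots (mesh N) (true :: true :: nil) v) with (Y (Y v)) in H.
  assert (E : forall e i j, (1 <= j)%Z -> (j + 1 <= N e)%Z ->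
            X G e i j = - kap * Y (Y v) e (i + 1)%Z (j - 1)%Z).
  { intros e i j H1 H2.
    assert (Q := yy_equation N a Rs kap v K0 Hsol 0 e (i + 1)%Z (j - 1)%Z ltac:(lia) ltac:(lia)).
    change (dxn (mesh N) 0 v) with v in Q. rewrite Q.
    replace (i + 1 - 1)%Z with i by lia. replace (j - 1 + 1)%Z with j by lia.
    change (dxn (mesh N) 1 G) with (X G). field. lra. }
  assert (Hi : inner_holder N alpha (r + 1) (kap * B) (X G)).
  { destruct H as (H1 & H2 & H3). split; [|split].
    - intros e i j A1 A2. rewrite E, Rabs_mult, Rabs_Ropp, (Rabs_pos_eq kap) by (try lia; lra).
      apply Rmult_le_compat_l. lra. apply H1; lia.
    - intros e i j d A1 A2 A3. rewrite !E by lia.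
      rewrite <- Rmult_minus_distr_l, Rabs_mult, Rabs_Ropp, (Rabs_pos_eq kap), Rmult_assoc by lra.
      apply Rmult_le_compat_l. lra. replace (i + d + 1)%Z with (i + 1 + d)%Z by lia. apply H2; lia.
    - intros e i j d A1 A2 A3. rewrite !E by lia.
      rewrite <- Rmult_minus_distr_l, Rabs_mult, Rabs_Ropp, (Rabs_pos_eq kap), Rmult_assoc by lra.
      apply Rmult_le_compat_l. lra. replace (j + d - 1)%Z with (j - 1 + d)%Z by lia. apply H3; lia. }
  replace (- kap * V (Y (Y v)) x y) with (V (X G) x y).
  { apply (V_derive_x N alpha U lim HN HNe Hal HU (r + 1) (kap * B)); auto.
    intro x'. apply flux_ulim, Hy. }
  apply (is_ulim_unique U lim HU (fun e => X G e (cell (x * mesh N e)) (cell (y * mesh N e)))).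
  { apply (inner_holder_ulim (r + 1) (kap * B)); auto. }
  (* The nodes on the two sides of the scheme differ by one cell in each direction, an error
     controlled by the modulus at distance 1. *)
  apply (is_ulim_close U lim HU (fun e => - kap * Y (Y v) e (cell (x * mesh N e)) (cell (y * mesh N e)))).
  { apply is_ulim_scal. apply (inner_holder_ulim r B); auto. }
  intros eps He.
  assert (Q0 : 0 < eps / (2 * kap * (B + 1))) by (apply Rdiv_lt_0_compat; auto; nra).
  destruct (ev_and _ _ (ev_rows N HNe y (r + 1) Hy) (ev_om1 _ Q0)) as [n0 En].
  exists n0. intros e Hn. destruct (En e Hn) as [[E1 E2] E3].
  set (i := cell (x * mesh N e)) in *. set (j := cell (y * mesh N e)) in *.
  rewrite E by lia. rewrite <- Rmult_minus_distr_l, Rabs_mult, Rabs_Ropp, (Rabs_pos_eq kap) by lra.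
  destruct H as (_ & H2 & H3).
  assert (A1 := H2 e i (j - 1)%Z 1%Z ltac:(lia) ltac:(lia) ltac:(lia)).
  assert (A2 := H3 e i (j - 1)%Z 1%Z ltac:(lia) ltac:(lia) ltac:(lia)).
  replace (j - 1 + 1)%Z with j in A2 by lia.
  assert (A3 : Rabs (Y (Y v) e (i + 1)%Z (j - 1)%Z - Y (Y v) e i j) <= 2 * B * modulus N alpha e 1).
  { apply Rabs_le_between in A1. apply Rabs_le_between in A2. apply Rabs_le. lra. }
  assert (O := modulus_pos N alpha e 1).
  assert (E4 : modulus N alpha e 1 * (2 * kap * (B + 1)) <= eps).
  { apply (proj2 (Rle_div_r _ _ (2 * kap * (B + 1)) ltac:(nra))). exact E3. }
  apply (Rmult_le_compat_l kap) in A3; [|lra].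
  assert (0 <= kap * modulus N alpha e 1) by (apply Rmult_le_pos; lra). lra.
Qed.

(** The two values entering the mean coefficient lie one cell apart and have the same limit, so the
    mean tends to the coefficient of the equation. *)
Lemma flux_limit x y : 0 < y < 1 ->
  V G x y = / sqrt (V v x y ^ 2 + (- Rs + 2 * Rs * y) ^ 2 + a ^ 2) * V (X v) x y.
Proof.
  intro Hy.
  apply (is_ulim_unique U lim HU (fun e => G e (cell (x * mesh N e)) (cell (y * mesh N e)))).
  { apply flux_ulim, Hy. }
  unfold gflux. apply (is_ulim_mult (fun e => edge_coef N a Rs v e (cell (x * mesh N e)) (cell (y * mesh N e)))).
  2:{ destruct (differences_inner_holder (false :: nil) ltac:(simpl; lia)) as (r & B & _ & H).
      apply (inner_holder_ulim r B (X v) y H Hy). }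
  intros eps He.
  destruct (differences_inner_holder nil ltac:(simpl; lia)) as (r & B & _ & H). simpl in H.
  assert (B0 := inner_holder_nonneg N alpha HNe _ _ _ H).
  assert (a2 : 0 < a ^ 2) by (apply pow2_gt_0, Ha).
  set (d := eps * a ^ 2 / 4). assert (d0 : 0 < d) by (unfold d; nra).
  assert (Q0 : 0 < d / (B + 1)) by (apply Rdiv_lt_0_compat; lra).
  apply (ul_mono _ _ HU) with (2 := ul_and _ _ HU _ _ (v_ulim x y Hy d d0)
     (ev_U U lim HU _ (ev_and _ _ (ev_and _ _ (ev_rows N HNe y r Hy) (ev_om1 _ Q0))
        (ev_small N HN HNe (2 * Rs) (d / 2) ltac:(lra) ltac:(lra))))).
  intros e (A1 & ((E1 & E2) & E3) & E4).
  set (i := cell (x * mesh N e)) in *. set (j := cell (y * mesh N e)) in *.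
  unfold edge_coef. eapply Rle_lt_trans; [apply coef_near, Ha|].
  apply (proj2 (Rlt_div_l _ _ (2 * a ^ 2) ltac:(lra))).
  destruct H as (_ & H2 & _). assert (A2 := H2 e i j 1%Z E1 E2 ltac:(lia)).
  assert (A3 : B * modulus N alpha e 1 <= d).
  { assert (O := modulus_pos N alpha e 1).
    assert (E5 : modulus N alpha e 1 * (B + 1) <= d) by
      (apply (proj2 (Rle_div_r _ _ (B + 1) ltac:(lra))); exact E3). lra. }
  assert (A4 : Rabs (v e (i + 1)%Z j - V v x y) < 2 * d).
  { replace (v e (i + 1)%Z j - V v x y) with ((v e (i + 1)%Z j - v e i j) + (v e i j - V v x y)) by ring.
    eapply Rle_lt_trans; [apply Rabs_triang|]. lra. }
  assert (n0 := mesh_pos N HN e). assert (F := cell_spec (y * mesh N e)). fold j in F.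
  assert (A5 : Rabs (ynode Rs (N e) j - (- Rs + 2 * Rs * y)) <= d / 2).
  { apply Rle_trans with (2 := E4). unfold ynode.
    replace (- Rs + 2 * Rs * (IZR j / IZR (N e)) - (- Rs + 2 * Rs * y))
      with (2 * Rs / mesh N e * (IZR j - y * mesh N e)) by (unfold mesh in *; field; lra).
    assert (Q : 0 < 2 * Rs / mesh N e) by (apply Rdiv_lt_0_compat; lra).
    rewrite Rabs_mult, (Rabs_pos_eq (2 * Rs / mesh N e)) by lra.
    rewrite <- (Rmult_1_r (2 * Rs / mesh N e)) at 2. apply Rmult_le_compat_l. lra.
    apply Rabs_le. lra. }
  assert (eps * (2 * a ^ 2) = 8 * d) by (unfold d; field). lra.
Qed.

Lemma limit_solution_pde : pde_holds a Rs limit_solution.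
Proof.
  intros x y Hy. assert (HY := strip_coord_range y Hy).
  assert (E : forall s, / sqrt (limit_solution s y ^ 2 + y ^ 2 + a ^ 2) * pdx limit_solution s y = / P * V G (s / P) (strip_coord y)).
  { intro s. change (pdx limit_solution s y) with (pd (false :: nil) limit_solution s y).
    rewrite pd_limit_solution by (auto; simpl; lia). rewrite flux_limit by auto. rewrite <- limit_solution_inner_holder by auto.
    replace (- Rs + 2 * Rs * strip_coord y) with y by (unfold strip_coord; field; lra). simpl scale. simpl dquots. ring. }
  assert (D : is_derive (fun s => / P * V G (s / P) (strip_coord y)) x (/ P * (/ P * (- kap * V (Y (Y v)) (x / P) (strip_coord y))))).
  { apply (is_derive_scal (fun s => V G (s / P) (strip_coord y)) x (/ P)).
    apply (is_derive_comp (fun x => V G x (strip_coord y)) (fun s => s / P)).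
    - apply flux_derivative, HY.
    - auto_derive; auto. unfold Rdiv. ring. }
  assert (D' : Derive (fun s : R => / sqrt (limit_solution s y ^ 2 + y ^ 2 + a ^ 2) * pdx limit_solution s y) x
    = / P * (/ P * (- kap * V (Y (Y v)) (x / P) (strip_coord y)))).
  { rewrite (Derive_ext _ _ _ E). apply is_derive_unique, D. }
  rewrite D'.
  change (pdy (pdy limit_solution) x y) with (pd (true :: true :: nil) limit_solution x y).
  (* The value of [kap] balances the factor [/ P ^ 2] from [x] against [2 / (2 Rs) ^ 2] from [y]. *)
  rewrite pd_limit_solution by (auto; simpl; lia). simpl scale. simpl dquots. unfold kap. field. lra.
Qed.

Lemma limit_solution_is_solution : (forall x, phip (x + P) = phip x) -> (forall x, phim (x + P) = phim x) ->
  is_solution k alpha a Rs P phip phim limit_solution.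
Proof.
  intros Pp Pm. split; [|split; [|split; [|split]]].
  - apply limit_solution_holder_strip.
  - apply limit_solution_pde.
  - intros x y _. unfold limit_solution. rewrite Pp, Pm.
    replace (V v ((x + P) / P) (strip_coord y)) with (V v (x / P) (strip_coord y)); [reflexivity|].
    unfold limfun. f_equal. extensionality e.
    replace (cell ((x + P) / P * mesh N e)) with (cell (x / P * mesh N e) + N e)%Z.
    { symmetry. apply (Hsol e). }
    assert (A := cell_spec (x / P * mesh N e)). assert (B := cell_spec ((x + P) / P * mesh N e)).
    replace ((x + P) / P * mesh N e) with (x / P * mesh N e + mesh N e) in * by (field; lra).
    assert (C1 : IZR (cell (x / P * mesh N e) + N e) < IZR (cell (x / P * mesh N e + mesh N e)) + 1)
      by (rewrite plus_IZR; unfold mesh in *; lra).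
    assert (C2 : IZR (cell (x / P * mesh N e + mesh N e)) < IZR (cell (x / P * mesh N e) + N e) + 1)
      by (rewrite plus_IZR; unfold mesh in *; lra).
    rewrite <- plus_IZR in C1. rewrite <- (plus_IZR (cell (x / P * mesh N e) + N e) 1) in C2.
    apply lt_IZR in C1. apply lt_IZR in C2. lia.
  - intro x. unfold limit_solution. destruct (Rle_dec Rs Rs); [reflexivity|lra].
  - intro x. unfold limit_solution. destruct (Rle_dec Rs (- Rs)); [lra|].
    destruct (Rle_dec (- Rs) (- Rs)); [reflexivity|lra].
Qed.

End Solution.

Theorem solution_exists (Rs P a alpha : R) (k : nat) (phip phim : R -> R) :
  0 < Rs -> 0 < P -> a <> 0 -> 0 < alpha < 1 ->
  holder1 (k + 2) alpha phip -> holder1 (k + 2) alpha phim ->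
  (forall x, phip (x + P) = phip x) -> (forall x, phim (x + P) = phim x) ->
  exists v : R -> R -> R, is_solution k alpha a Rs P phip phim v.
Proof.
  intros HRs HP Ha Hal Hp Hm Pp Pm.
  destruct ultralimit_exists as (U & lim & HU).
  destruct (discrete_family k alpha a Rs (P ^ 2 / (2 * Rs ^ 2)) P phip phim HRs HP Ha
    (kap_pos Rs P HRs HP) Hal Hp Hm Pp Pm) as (N & v & M & HN & Hsol & HM & Htop & Hbm & Hbp).
  exists (limit_solution Rs P phip phim N v lim).
  apply (limit_solution_is_solution k alpha a Rs P phip phim HRs HP Ha Hal Hp Hm N v M
    (fun e => proj1 (HN e)) (fun e => proj2 (HN e)) Hsol HM Htop Hbm Hbp U lim HU Pp Pm).
Qed.

(** * Uniqueness *)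

(** A maximising sequence has a coordinatewise ultralimit in the box, and the Lipschitz bound
    carries the values along. *)
Lemma box_max (F : R -> R -> R -> R) P Rs L : 0 <= P -> 0 <= Rs -> 0 <= L ->
  (forall x1 x2 y x1' x2' y', 0 <= x1 <= P -> 0 <= x2 <= P -> Rabs y <= Rs ->
     0 <= x1' <= P -> 0 <= x2' <= P -> Rabs y' <= Rs ->
     Rabs (F x1 x2 y - F x1' x2' y') <= L * (Rabs (x1 - x1') + Rabs (x2 - x2') + Rabs (y - y'))) ->
  exists x1 x2 y, (0 <= x1 <= P) /\ (0 <= x2 <= P) /\ Rabs y <= Rs /\
    forall x1' x2' y', 0 <= x1' <= P -> 0 <= x2' <= P -> Rabs y' <= Rs -> F x1' x2' y' <= F x1 x2 y.
Proof.
  intros HP HR HL Hlip.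
  set (box := fun p : R * R * R => 0 <= fst (fst p) <= P /\ 0 <= snd (fst p) <= P /\ Rabs (snd p) <= Rs).
  set (f := fun p : R * R * R => F (fst (fst p)) (snd (fst p)) (snd p)).
  assert (B0 : box (0, 0, 0)) by (unfold box; simpl; rewrite Rabs_R0; lra).
  destruct (completeness (fun z => exists p, box p /\ z = f p)) as (s & S1 & S2).
  { exists (f (0, 0, 0) + L * (P + P + Rs)). intros z (p & (P1 & P2 & P3) & ->).
    assert (A := Hlip _ _ _ 0 0 0 P1 P2 P3 ltac:(lra) ltac:(lra) ltac:(cbv beta; rewrite Rabs_R0; lra)).
    rewrite !Rminus_0_r in A.
    rewrite (Rabs_pos_eq (fst (fst p))), (Rabs_pos_eq (snd (fst p))) in A by lra.
    assert (L * (fst (fst p) + snd (fst p) + Rabs (snd p)) <= L * (P + P + Rs)) by (apply Rmult_le_compat_l; lra).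
    assert (E := Rle_abs (F (fst (fst p)) (snd (fst p)) (snd p) - F 0 0 0)). unfold f. simpl. lra. }
  { exists (f (0, 0, 0)), (0, 0, 0). auto. }
  assert (Seq : forall e : nat, exists p, box p /\ s - / (INR e + 1) < f p).
  { intro e. apply NNPP. intro H.
    assert (P0 : 0 < / (INR e + 1)) by (apply Rinv_0_lt_compat; assert (Q := pos_INR e); lra).
    assert (s <= s - / (INR e + 1)); [|lra].
    apply S2. intros z (p & Hp & ->). apply Rnot_lt_le. intro Hlt. apply H. exists p. auto. }
  set (p := fun e => proj1_sig (constructive_indefinite_description _ (Seq e))).
  assert (Hp : forall e, box (p e) /\ s - / (INR e + 1) < f (p e))
    by (intro e; exact (proj2_sig (constructive_indefinite_description _ (Seq e)))).
  destruct ultralimit_exists as (U & lim & HU).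
  assert (La := ul_lim _ _ HU (fun e => fst (fst (p e))) P).
  assert (Lb := ul_lim _ _ HU (fun e => snd (fst (p e))) P).
  assert (Lc := ul_lim _ _ HU (fun e => snd (p e)) Rs).
  specialize (La ltac:(exists 0%nat; intros e _; destruct (Hp e) as ((Q & _) & _); rewrite Rabs_pos_eq; lra)).
  specialize (Lb ltac:(exists 0%nat; intros e _; destruct (Hp e) as ((_ & Q & _) & _); rewrite Rabs_pos_eq; lra)).
  specialize (Lc ltac:(exists 0%nat; intros e _; destruct (Hp e) as ((_ & _ & Q) & _); exact Q)).
  set (a := lim (fun e => fst (fst (p e)))) in *. set (b := lim (fun e => snd (fst (p e)))) in *.
  set (c := lim (fun e => snd (p e))) in *.
  assert (Near : forall eps, 0 < eps -> exists e, Rabs (fst (fst (p e)) - a) < eps /\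
      Rabs (snd (fst (p e)) - b) < eps /\ Rabs (snd (p e) - c) < eps /\ / (INR e + 1) <= eps).
  { intros eps He. destruct (archimed (/ eps)) as [A _].
    destruct (ul_ex _ _ HU _ (ul_and _ _ HU _ _ (ul_and _ _ HU _ _ (La eps He) (Lb eps He))
      (ul_and _ _ HU _ _ (Lc eps He) (ul_ev _ _ HU (Z.to_nat (up (/ eps))))))) as (e & (E1 & E2) & E3 & E4).
    exists e. repeat split; auto.
    assert (I : 0 < / eps) by (apply Rinv_0_lt_compat, He).
    rewrite <- (Rinv_inv eps). apply Rinv_le_contravar; auto.
    assert (IZR (up (/ eps)) <= INR e). { rewrite INR_IZR_INZ. apply IZR_le. lia. } lra. }
  assert (Ha : 0 <= a <= P).
  { split; apply le_epsilon; intros eps He; destruct (Near eps He) as (e & E1 & _);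
      destruct (Hp e) as ((Q & _) & _); apply Rabs_def2 in E1; lra. }
  assert (Hb : 0 <= b <= P).
  { split; apply le_epsilon; intros eps He; destruct (Near eps He) as (e & _ & E1 & _);
      destruct (Hp e) as ((_ & Q & _) & _); apply Rabs_def2 in E1; lra. }
  assert (Hc : Rabs c <= Rs).
  { apply le_epsilon; intros eps He; destruct (Near eps He) as (e & _ & _ & E1 & _);
      destruct (Hp e) as ((_ & _ & Q) & _).
    replace c with (snd (p e) - (snd (p e) - c)) by ring.
    unfold Rminus at 1. eapply Rle_trans; [apply Rabs_triang|]. rewrite Rabs_Ropp. lra. }
  exists a, b, c. split; [|split; [|split]]; auto. intros x1 x2 y H1 H2 H3.
  apply Rle_trans with s.
  { apply S1. exists (x1, x2, y). split; auto. repeat split; simpl; auto; lra. }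
  apply le_epsilon. intros eps He.
  assert (Q0 : 0 < eps / (3 * L + 1)) by (apply Rdiv_lt_0_compat; lra).
  destruct (Near _ Q0) as (e & E1 & E2 & E3 & E4).
  destruct (Hp e) as ((P1 & P2 & P3) & P4).
  assert (A := Hlip _ _ _ a b c P1 P2 P3 Ha Hb Hc).
  assert (L * (Rabs (fst (fst (p e)) - a) + Rabs (snd (fst (p e)) - b) + Rabs (snd (p e) - c))
    <= L * (3 * (eps / (3 * L + 1)))) by (apply Rmult_le_compat_l; lra).
  assert (E5 : L * (3 * (eps / (3 * L + 1))) + eps / (3 * L + 1) = eps) by (field; lra).
  apply Rabs_le_between in A. unfold f in P4. lra.
Qed.

Lemma fermat (f : R -> R) x0 l d : 0 < d -> is_derive f x0 l ->
  (forall x, Rabs (x - x0) < d -> f x <= f x0) -> l = 0.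
Proof.
  intros Hd Hf Hmax. apply is_derive_Reals in Hf.
  destruct (Req_dec l 0) as [|Hl]; auto. exfalso.
  destruct (Hf (Rabs l / 2)) as [[del Hdel] H].
  { assert (Q := Rabs_pos_lt l Hl). lra. }
  simpl in H.
  set (s := if Rlt_dec 0 l then 1 else -1).
  assert (Hs : s * l = Rabs l /\ (s = 1 \/ s = -1)).
  { unfold s. destruct (Rlt_dec 0 l). rewrite Rabs_pos_eq; lra. rewrite Rabs_left1; lra. }
  destruct Hs as [Hs Hs1].
  set (h := s * (Rmin del d / 2)).
  assert (M1 := Rmin_l del d). assert (M2 := Rmin_r del d).
  assert (M0 : 0 < Rmin del d) by (apply Rmin_glb_lt; auto).
  assert (Hh : Rabs h = Rmin del d / 2).
  { unfold h. rewrite Rabs_mult, (Rabs_pos_eq (_ / 2)) by lra.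
    destruct Hs1 as [-> | ->]; [rewrite Rabs_R1|rewrite Rabs_m1]; lra. }
  assert (h0 : h <> 0) by (intro E; rewrite E, Rabs_R0 in Hh; lra).
  assert (A := H h h0 ltac:(lra)).
  assert (B := Hmax (x0 + h) ltac:(replace (x0 + h - x0) with h by ring; lra)).
  assert (C : Rabs (f (x0 + h) - f x0 - h * l) < Rabs l / 2 * Rabs h).
  { replace (f (x0 + h) - f x0 - h * l) with (((f (x0 + h) - f x0) / h - l) * h) by (field; auto).
    rewrite Rabs_mult. apply Rmult_lt_compat_r; auto. apply Rabs_pos_lt, h0. }
  assert (E : h * l = Rabs h * Rabs l).
  { rewrite Hh, <- Hs. unfold h. ring. }
  apply Rabs_def2 in C. rewrite E in C. assert (0 < Rabs h * Rabs l).
  { apply Rmult_lt_0_compat; apply Rabs_pos_lt; auto. } lra.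
Qed.

(** If [l] were positive, [f'], which vanishes at [x0], would be positive just to the right and [f]
    would increase there. *)
Lemma second_derivative_max (f f' : R -> R) x0 l d : 0 < d ->
  (forall x, Rabs (x - x0) < d -> is_derive f x (f' x)) -> is_derive f' x0 l ->
  (forall x, Rabs (x - x0) < d -> f x <= f x0) -> f' x0 = 0 /\ l <= 0.
Proof.
  intros Hd Hf Hf' Hmax.
  assert (F0 : f' x0 = 0).
  { apply (fermat f x0 _ d); auto. apply Hf. rewrite Rminus_diag, Rabs_R0. exact Hd. }
  split; auto. apply Rnot_lt_le. intro Hl.
  apply is_derive_Reals in Hf'. destruct (Hf' (l / 2) ltac:(lra)) as [[del Hdel] H]. simpl in H.
  set (h := Rmin del d / 2).
  assert (M1 := Rmin_l del d). assert (M2 := Rmin_r del d).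
  assert (M0 : 0 < Rmin del d) by (apply Rmin_glb_lt; auto).
  assert (h0 : 0 < h) by (unfold h; lra).
  assert (Pos : forall x, x0 < x <= x0 + h -> 0 < f' x).
  { intros x Hx. assert (A := H (x - x0) ltac:(lra) ltac:(rewrite Rabs_pos_eq; unfold h in *; lra)).
    replace (x0 + (x - x0)) with x in A by ring. rewrite F0, Rminus_0_r in A.
    apply Rabs_def2 in A.
    replace (f' x) with (f' x / (x - x0) * (x - x0)) by (field; lra).
    apply Rmult_lt_0_compat; lra. }
  assert (Dm : forall x, x0 <= x <= x0 + h -> is_derive f x (f' x)).
  { intros x Hx. apply Hf. rewrite Rabs_pos_eq; unfold h in *; lra. }
  (* Only on the left half can the mean value point be [x0], where [f'] vanishes; the right half
     makes the increase strict. *)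
  destruct (MVT_gen f (x0 + h / 2) (x0 + h) f') as (c & Hc & E).
  - intros x Hx. rewrite Rmin_left, Rmax_right in Hx by lra. apply Dm. lra.
  - intros x Hx. rewrite Rmin_left, Rmax_right in Hx by lra.
    apply continuity_pt_filterlim. apply (ex_derive_continuous f x). eexists. apply Dm. lra.
  - rewrite Rmin_left, Rmax_right in Hc by lra.
    destruct (MVT_gen f x0 (x0 + h / 2) f') as (c' & Hc' & E').
    + intros x Hx. rewrite Rmin_left, Rmax_right in Hx by lra. apply Dm. lra.
    + intros x Hx. rewrite Rmin_left, Rmax_right in Hx by lra.
      apply continuity_pt_filterlim. apply (ex_derive_continuous f x). eexists. apply Dm. lra.
    + rewrite Rmin_left, Rmax_right in Hc' by lra.
      assert (P1 := Pos c ltac:(lra)).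
      assert (P2 : 0 <= f' c').
      { destruct (Req_dec c' x0) as [->|]. lra. apply Rlt_le, Pos. lra. }
      assert (B := Hmax (x0 + h) ltac:(replace (x0 + h - x0) with h by ring; rewrite Rabs_pos_eq; unfold h in *; lra)).
      nra.
Qed.

Lemma lipschitz_of_derive (f f' : R -> R) a b M :
  (forall x, Rmin a b <= x <= Rmax a b -> is_derive f x (f' x)) ->
  (forall x, Rmin a b <= x <= Rmax a b -> Rabs (f' x) <= M) ->
  Rabs (f b - f a) <= M * Rabs (b - a).
Proof.
  intros H1 H2. destruct (MVT_gen f a b f') as (c & Hc & E).
  - intros x Hx. apply H1. lra.
  - intros x Hx. apply continuity_pt_filterlim. apply (ex_derive_continuous f x). eexists. apply H1, Hx.
  - rewrite E, Rabs_mult. apply Rmult_le_compat_r. apply Rabs_pos. apply H2, Hc.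
Qed.

(** * Regularity of an arbitrary solution *)

Section Facts.
Variables (k : nat) (alpha a Rs P : R) (phip phim : R -> R) (v : R -> R -> R).
Hypotheses (HRs : 0 < Rs) (Ha : a <> 0) (Hal : 0 < alpha < 1).
Hypothesis Hv : is_solution k alpha a Rs P phip phim v.

Lemma pd_derive l x y : (length l < k + 2)%nat -> Rabs y < Rs ->
  is_derive (fun t => pd l v t y) x (pd (false :: l) v x y) /\
  is_derive (fun t => pd l v x t) y (pd (true :: l) v x y).
Proof.
  intros Hl Hy. destruct Hv as ((H & _) & _). destruct (H l Hl x y Hy) as [H1 H2].
  split; apply Derive_correct; assumption.
Qed.

Lemma pd_bounded l : (length l <= k + 2)%nat -> exists M, 0 <= M /\ forall x y, Rabs y < Rs -> Rabs (pd l v x y) <= M.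
Proof.
  intro Hl. destruct Hv as ((_ & H & _) & _). destruct (H l Hl) as [M HM]. exists M. split; auto.
  apply Rle_trans with (2 := HM 0 0 ltac:(cbv beta; rewrite Rabs_R0; lra)). apply Rabs_pos.
Qed.

Lemma between_inside y1 y2 y : Rabs y1 < Rs -> Rabs y2 < Rs -> Rmin y1 y2 <= y <= Rmax y1 y2 -> Rabs y < Rs.
Proof.
  intros H1 H2 H. apply Rabs_def2 in H1. apply Rabs_def2 in H2.
  unfold Rmin, Rmax in H. destruct (Rle_dec y1 y2) in H; apply Rabs_def1; lra.
Qed.

(** Below the top order the next derivatives are bounded; at the top order the Hoelder condition is
    used. *)
Lemma pd_continuous l x y : (length l <= k + 2)%nat -> Rabs y < Rs ->
  forall eps, 0 < eps -> exists d, 0 < d /\ forall x' y', Rabs (x' - x) < d -> Rabs (y' - y) < d ->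
    Rabs y' < Rs /\ Rabs (pd l v x' y' - pd l v x y) < eps.
Proof.
  intros Hl Hy eps He.
  assert (Inside : forall y', Rabs (y' - y) < Rs - Rabs y -> Rabs y' < Rs).
  { intros y' H. replace y' with ((y' - y) + y) by ring. eapply Rle_lt_trans; [apply Rabs_triang|]. lra. }
  destruct (le_lt_eq_dec _ _ Hl) as [Hl'|Hl'].
  - destruct (pd_bounded (false :: l) ltac:(simpl; lia)) as (M1 & M10 & H1).
    destruct (pd_bounded (true :: l) ltac:(simpl; lia)) as (M2 & M20 & H2).
    set (d := Rmin (Rs - Rabs y) (eps / (2 * (M1 + M2 + 1)))).
    assert (Q0 : 0 < eps / (2 * (M1 + M2 + 1))) by (apply Rdiv_lt_0_compat; lra).
    assert (d0 : 0 < d) by (apply Rmin_glb_lt; lra).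
    assert (D1 : d <= Rs - Rabs y) by apply Rmin_l.
    assert (D2 : d <= eps / (2 * (M1 + M2 + 1))) by apply Rmin_r.
    exists d. split; auto. intros x' y' Hx Hy'. assert (Hin := Inside y' ltac:(lra)). split; auto.
    assert (A1 : Rabs (pd l v x' y' - pd l v x y') <= M1 * Rabs (x' - x)).
    { apply (lipschitz_of_derive (fun t => pd l v t y') (fun t => pd (false :: l) v t y')).
      intros; apply pd_derive; auto. intros; apply H1; auto. }
    assert (A2 : Rabs (pd l v x y' - pd l v x y) <= M2 * Rabs (y' - y)).
    { apply (lipschitz_of_derive (fun t => pd l v x t) (fun t => pd (true :: l) v x t)).
      - intros t Ht. apply pd_derive; auto. apply between_inside with (3 := Ht); auto.
      - intros t Ht. apply H2. apply between_inside with (3 := Ht); auto. }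
    assert (M1 * Rabs (x' - x) <= M1 * d) by (apply Rmult_le_compat_l; lra).
    assert (M2 * Rabs (y' - y) <= M2 * d) by (apply Rmult_le_compat_l; lra).
    assert (E : (M1 + M2 + 1) * d <= eps / 2).
    { apply (Rmult_le_compat_l (M1 + M2 + 1)) in D2; [|lra].
      replace ((M1 + M2 + 1) * (eps / (2 * (M1 + M2 + 1)))) with (eps / 2) in D2 by (field; lra). exact D2. }
    replace (pd l v x' y' - pd l v x y) with ((pd l v x' y' - pd l v x y') + (pd l v x y' - pd l v x y)) by ring.
    eapply Rle_lt_trans; [apply Rabs_triang|]. lra.
  - destruct Hv as ((_ & _ & H & _) & _). destruct (H l Hl') as [C HC].
    set (K := Rabs C + 1). assert (K0 : 0 < K) by (unfold K; assert (Q := Rabs_pos C); lra).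
    set (g := Rpower (eps / (2 * K)) (/ alpha)).
    assert (g0 : 0 < g) by apply exp_pos.
    set (d := Rmin (Rs - Rabs y) (g / 2)).
    assert (d0 : 0 < d) by (apply Rmin_glb_lt; lra).
    assert (D1 : d <= Rs - Rabs y) by apply Rmin_l.
    assert (D2 : d <= g / 2) by apply Rmin_r.
    exists d. split; auto. intros x' y' Hx Hy'. assert (Hin := Inside y' ltac:(lra)). split; auto.
    destruct (classic ((x', y') = (x, y))) as [E|Hne].
    + injection E as -> ->. rewrite Rminus_diag, Rabs_R0. exact He.
    + apply Rle_lt_trans with (1 := HC x' y' x y Hin Hy Hne).
      assert (D3 : 0 < dist2 x' y' x y).
      { unfold dist2. apply sqrt_lt_R0. assert (A := pow2_ge_0 (x' - x)). assert (B := pow2_ge_0 (y' - y)).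
        destruct (Req_dec x' x) as [E|E].
        - assert (y' - y <> 0) by (intro; apply Hne; f_equal; lra).
          assert (0 < (y' - y) ^ 2) by (apply pow2_gt_0; auto). lra.
        - assert (0 < (x' - x) ^ 2) by (apply pow2_gt_0; lra). lra. }
      assert (D4 : dist2 x' y' x y <= g).
      { unfold dist2. rewrite <- (sqrt_pow2 g) by lra. apply sqrt_le_1_alt.
        rewrite <- (pow2_abs (x' - x)), <- (pow2_abs (y' - y)).
        assert (Rabs (x' - x) ^ 2 <= (g / 2) ^ 2) by (apply pow_incr; split; [apply Rabs_pos|lra]).
        assert (Rabs (y' - y) ^ 2 <= (g / 2) ^ 2) by (apply pow_incr; split; [apply Rabs_pos|lra]).
        assert (0 <= g ^ 2) by apply pow2_ge_0. lra. }
      assert (D5 : Rpower (dist2 x' y' x y) alpha <= eps / (2 * K)).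
      { replace (eps / (2 * K)) with (Rpower g alpha).
        - apply Rle_Rpower_l; lra.
        - unfold g. rewrite Rpower_mult, Rinv_l, Rpower_1 by (try lra; apply Rdiv_lt_0_compat; lra).
          reflexivity. }
      apply Rle_lt_trans with (K * (eps / (2 * K))).
      * apply Rle_trans with (K * Rpower (dist2 x' y' x y) alpha).
        -- apply Rmult_le_compat_r. apply Rlt_le, exp_pos. assert (Q := Rle_abs C). unfold K. lra.
        -- apply Rmult_le_compat_l; lra.
      * replace (K * (eps / (2 * K))) with (eps / 2) by (field; lra). lra.
Qed.

(** Derivatives are given in the open strip. The contraction of [y] by [1 - s] moves both points
    inside, and continuity on the closed strip makes the resulting error small. *)
Lemma strip_lipschitz_y : exists M, 0 <= M /\ forall x y y', Rabs y <= Rs -> Rabs y' <= Rs ->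
  Rabs (v x y - v x y') <= M * Rabs (y - y').
Proof.
  destruct (pd_bounded (true :: nil) ltac:(simpl; lia)) as (M & M0 & HM).
  exists M. split; auto. intros x y y' Hy Hy'. apply le_epsilon. intros eps He.
  destruct Hv as ((_ & _ & _ & Hc) & _).
  destruct (Hc x y Hy (eps / 2) ltac:(lra)) as (d1 & d10 & H1).
  destruct (Hc x y' Hy' (eps / 2) ltac:(lra)) as (d2 & d20 & H2).
  set (d := Rmin (Rmin d1 d2) Rs).
  assert (D1 : d <= d1) by (apply Rle_trans with (1 := Rmin_l _ _); apply Rmin_l).
  assert (D2 : d <= d2) by (apply Rle_trans with (1 := Rmin_l _ _); apply Rmin_r).
  assert (D3 : d <= Rs) by apply Rmin_r.
  assert (d0 : 0 < d) by (repeat apply Rmin_glb_lt; auto).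
  set (s := d / (2 * Rs)).
  assert (s0 : 0 < s) by (apply Rdiv_lt_0_compat; lra).
  assert (s1 : s <= / 2).
  { unfold s. apply (Rmult_le_reg_r (2 * Rs)). lra.
    replace (d / (2 * Rs) * (2 * Rs)) with d by (field; lra). lra. }
  assert (sR : s * Rs = d / 2) by (unfold s; field; lra).
  assert (Sh : forall z, Rabs z <= Rs -> Rabs ((1 - s) * z) < Rs /\ Rabs ((1 - s) * z - z) <= d / 2).
  { intros z Hz. split.
    - rewrite Rabs_mult, (Rabs_pos_eq (1 - s)) by lra. assert (Q := Rabs_pos z). nra.
    - replace ((1 - s) * z - z) with (- (s * z)) by ring.
      rewrite Rabs_Ropp, Rabs_mult, (Rabs_pos_eq s) by lra. rewrite <- sR. apply Rmult_le_compat_l; lra. }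
  destruct (Sh y Hy) as [I1 I2]. destruct (Sh y' Hy') as [I1' I2'].
  assert (E1 := H1 x ((1 - s) * y) ltac:(lra) ltac:(rewrite Rminus_diag, Rabs_R0; lra) ltac:(lra)).
  assert (E2 := H2 x ((1 - s) * y') ltac:(lra) ltac:(rewrite Rminus_diag, Rabs_R0; lra) ltac:(lra)).
  assert (E3 : Rabs (v x ((1 - s) * y) - v x ((1 - s) * y')) <= M * Rabs ((1 - s) * y - (1 - s) * y')).
  { apply (lipschitz_of_derive (fun t => v x t) (fun t => pd (true :: nil) v x t)).
    - intros t Ht. apply (pd_derive nil x t); [simpl; lia|]. apply between_inside with (3 := Ht); auto.
    - intros t Ht. apply HM. apply between_inside with (3 := Ht); auto. }
  assert (E4 : M * Rabs ((1 - s) * y - (1 - s) * y') <= M * Rabs (y - y')).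
  { apply Rmult_le_compat_l; auto. rewrite <- Rmult_minus_distr_l, Rabs_mult, (Rabs_pos_eq (1 - s)) by lra.
    assert (Q := Rabs_pos (y - y')). nra. }
  replace (v x y - v x y') with ((v x ((1 - s) * y) - v x ((1 - s) * y'))
    + (v x ((1 - s) * y') - v x y') - (v x ((1 - s) * y) - v x y)) by ring.
  apply Rabs_def2 in E1. apply Rabs_def2 in E2. apply Rabs_le_between in E3. apply Rabs_le. lra.
Qed.

Lemma strip_continuous_x x y : Rabs y <= Rs -> continuous (fun t => v t y) x.
Proof.
  intro Hy. destruct Hv as ((_ & _ & _ & Hc) & _).
  apply (proj2 (filterlim_locally (fun t => v t y) (v x y))). intros [eps He].
  destruct (Hc x y Hy eps He) as (d & d0 & H). exists (mkposreal d d0). intros t Ht.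
  apply (H t y Hy Ht). rewrite Rminus_diag, Rabs_R0. exact d0.
Qed.

Definition weighted_dx (x y : R) : R := / sqrt (v x y ^ 2 + y ^ 2 + a ^ 2) * pdx v x y.

(** The equation is stated with the total function [Derive], so differentiability of the flux has to
    be established before the equation yields its derivative. *)
Lemma weighted_dx_derive x y : Rabs y < Rs -> is_derive (fun s => weighted_dx s y) x (- (2 * pdy (pdy v) x y)).
Proof.
  intro Hy. assert (E : ex_derive (fun s => weighted_dx s y) x).
  { destruct (pd_derive nil x y ltac:(simpl; lia) Hy) as [D0 _].
    destruct (pd_derive (false :: nil) x y ltac:(simpl; lia) Hy) as [D1 _].
    unfold weighted_dx. apply (ex_derive_mult (fun s => / sqrt (v s y ^ 2 + y ^ 2 + a ^ 2)) (fun s => pdx v s y)).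
    - assert (a2 : 0 < a ^ 2) by (apply pow2_gt_0, Ha).
      assert (S0 : 0 < v x y ^ 2 + y ^ 2 + a ^ 2).
      { assert (A := pow2_ge_0 (v x y)). assert (B := pow2_ge_0 y). lra. }
      apply ex_derive_inv.
      + apply (ex_derive_comp sqrt (fun s => v s y ^ 2 + y ^ 2 + a ^ 2)).
        * eexists. apply is_derive_Reals, derivable_pt_lim_sqrt, S0.
        * apply (ex_derive_plus (fun s => v s y ^ 2 + y ^ 2) (fun s => a ^ 2)).
          apply (ex_derive_plus (fun s => v s y ^ 2) (fun s => y ^ 2)).
          apply (ex_derive_pow (fun s => v s y) 2 x). eexists; apply D0.
          apply ex_derive_const. apply ex_derive_const.
      + apply Rgt_not_eq, sqrt_lt_R0, S0.
    - eexists. apply D1. }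
  apply Derive_correct in E. destruct Hv as (_ & Hp & _). specialize (Hp x y Hy).
  change (Derive (fun s => weighted_dx s y) x + 2 * pdy (pdy v) x y = 0) in Hp.
  replace (- (2 * pdy (pdy v) x y)) with (Derive (fun s => weighted_dx s y) x) by lra. exact E.
Qed.

Lemma weighted_dx_periodic x y : Rabs y < Rs -> weighted_dx (x + P) y = weighted_dx x y.
Proof.
  intro Hy. destruct Hv as (_ & _ & Hp & _). unfold weighted_dx. rewrite Hp by lra. f_equal.
  unfold pdx. rewrite <- (Derive_ext (fun t => v (t + P) y) (fun t => v t y) x) by (intro t; apply Hp; lra).
  symmetry. apply is_derive_unique.
  replace (Derive (fun t => v t y) (x + P)) with (1 * Derive (fun t => v t y) (x + P)) by ring.
  apply (is_derive_comp (fun t => v t y) (fun t => t + P)).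
  - apply (pd_derive nil (x + P) y); auto. simpl; lia.
  - auto_derive; auto.
Qed.

End Facts.

(** * Comparison of two solutions *)

Section Uniqueness.
Variables (k : nat) (alpha a Rs P : R) (phip phim : R -> R) (v1 v2 : R -> R -> R).
Hypotheses (HRs : 0 < Rs) (HP : 0 < P) (Ha : a <> 0) (Hal : 0 < alpha < 1).
Hypothesis H1 : is_solution k alpha a Rs P phip phim v1.
Hypothesis H2 : is_solution k alpha a Rs P phip phim v2.

Let w x y := v1 x y - v2 x y.
Let wy x y := pdy v1 x y - pdy v2 x y.
Let wyy x y := pdy (pdy v1) x y - pdy (pdy v2) x y.
Let q x y := weighted_dx a v1 x y - weighted_dx a v2 x y.

Lemma w_continuous_x x y : Rabs y <= Rs -> continuous (fun t => w t y) x.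
Proof.
  intro Hy. apply (continuous_minus (fun t => v1 t y) (fun t => v2 t y));
    eapply strip_continuous_x; eauto.
Qed.

Lemma w_lipschitz_y : exists M, 0 <= M /\ forall x y y', Rabs y <= Rs -> Rabs y' <= Rs ->
  Rabs (w x y - w x y') <= M * Rabs (y - y').
Proof.
  destruct (strip_lipschitz_y _ _ _ _ _ _ _ _ HRs H1) as (M1 & P1 & L1).
  destruct (strip_lipschitz_y _ _ _ _ _ _ _ _ HRs H2) as (M2 & P2 & L2).
  exists (M1 + M2). split. lra. intros x y y' Hy Hy'.
  specialize (L1 x y y' Hy Hy'). specialize (L2 x y y' Hy Hy'). unfold w.
  apply Rabs_le_between in L1. apply Rabs_le_between in L2. apply Rabs_le. lra.
Qed.

Lemma w_boundary x : w x Rs = 0 /\ w x (- Rs) = 0.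
Proof.
  destruct H1 as (_ & _ & _ & A1 & B1). destruct H2 as (_ & _ & _ & A2 & B2).
  unfold w. rewrite A1, A2, B1, B2. lra.
Qed.

(** Integration in [x] removes the outer derivative: the second [y]-derivative becomes [- / 2] times
    [q x y - q 0 y], and [q] is of first order in [w]. The value at 0 drops out of differences
    between two points, whence the doubling of [x]. *)
Definition primitive (x y : R) : R := RInt (fun t => w t y) 0 x.

Lemma w_integrable y b c : Rabs y <= Rs -> ex_RInt (fun t => w t y) b c.
Proof. intro Hy. apply (@ex_RInt_continuous R_CompleteNormedModule). intros z _. apply w_continuous_x, Hy. Qed.

Lemma primitive_derive_x x y : Rabs y <= Rs -> is_derive (fun x => primitive x y) x (w x y).
Proof.
  intro Hy. unfold primitive. apply (is_derive_RInt (fun t => w t y) _ 0 x).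
  - exists (mkposreal 1 Rlt_0_1). intros b _. apply (@RInt_correct R_CompleteNormedModule), w_integrable, Hy.
  - apply w_continuous_x, Hy.
Qed.

Lemma pd_difference_near l x y : (length l <= 2)%nat -> Rabs y < Rs ->
  forall eps, 0 < eps -> exists d, 0 < d /\ forall x' y', Rabs (x' - x) < d -> Rabs (y' - y) < d ->
    Rabs y' < Rs /\ Rabs ((pd l v1 x' y' - pd l v2 x' y') - (pd l v1 x y - pd l v2 x y)) < eps.
Proof.
  intros Hl Hy eps He.
  destruct (pd_continuous _ _ _ _ _ _ _ _ HRs Hal H1 l x y ltac:(lia) Hy (eps / 2) ltac:(lra)) as (d1 & d10 & K1).
  destruct (pd_continuous _ _ _ _ _ _ _ _ HRs Hal H2 l x y ltac:(lia) Hy (eps / 2) ltac:(lra)) as (d2 & d20 & K2).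
  exists (Rmin d1 d2). split. { apply Rmin_glb_lt; auto. }
  assert (M1 := Rmin_l d1 d2). assert (M2 := Rmin_r d1 d2). intros x' y' Hx Hy'.
  destruct (K1 x' y' ltac:(lra) ltac:(lra)) as [I1 E1]. destruct (K2 x' y' ltac:(lra) ltac:(lra)) as [_ E2].
  split; auto. apply Rabs_def2 in E1. apply Rabs_def2 in E2. apply Rabs_def1; lra.
Qed.

Lemma pd_difference_continuous_x l x y : (length l <= 2)%nat -> Rabs y < Rs ->
  continuous (fun t => pd l v1 t y - pd l v2 t y) x.
Proof.
  intros Hl Hy. apply (proj2 (filterlim_locally (fun t => pd l v1 t y - pd l v2 t y) _)). intros [eps He].
  destruct (pd_difference_near l x y Hl Hy eps He) as (d & d0 & H). exists (mkposreal d d0). intros t Ht.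
  apply (H t y Ht). rewrite Rminus_diag, Rabs_R0. exact d0.
Qed.

Lemma integral_derive_y l x y : (length l <= 1)%nat -> Rabs y < Rs ->
  is_derive (fun y => RInt (fun t => pd l v1 t y - pd l v2 t y) 0 x) y
    (RInt (fun t => pd (true :: l) v1 t y - pd (true :: l) v2 t y) 0 x).
Proof.
  intros Hl Hy.
  assert (Dy : forall t y, Rabs y < Rs -> is_derive (fun y => pd l v1 t y - pd l v2 t y) y
            (pd (true :: l) v1 t y - pd (true :: l) v2 t y)).
  { intros t y' Hy'. apply (is_derive_minus (fun y => pd l v1 t y) (fun y => pd l v2 t y)).
    - apply (pd_derive _ _ _ _ _ _ _ _ H1); auto. lia.
    - apply (pd_derive _ _ _ _ _ _ _ _ H2); auto. lia. }
  rewrite (RInt_ext _ (fun t => Derive (fun u => pd l v1 t u - pd l v2 t u) y)).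
  2:{ intros t _. symmetry. apply is_derive_unique, Dy, Hy. }
  apply (is_derive_RInt_param (fun u t => pd l v1 t u - pd l v2 t u) 0 x y).
  - apply (filter_imp (fun y' => Rabs y' < Rs)); [|apply strip_open, Hy].
    intros y' Hy' t _. eexists. apply Dy, Hy'.
  - intros t _.
    apply (continuity_2d_pt_ext_loc (fun u t => pd (true :: l) v1 t u - pd (true :: l) v2 t u)).
    + destruct (strip_open Rs y Hy) as [d Hd]. exists d. intros u s Hu _. symmetry.
      apply is_derive_unique, Dy. apply Hd. exact Hu.
    + intros [eps He]. destruct (pd_difference_near (true :: l) t y ltac:(simpl; lia) Hy eps He) as (d & d0 & H).
      exists (mkposreal d d0). intros u s Hu Hs. apply H; auto.
  - apply (filter_imp (fun y' => Rabs y' < Rs)); [|apply strip_open, Hy].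
    intros y' Hy'. apply (@ex_RInt_continuous R_CompleteNormedModule). intros z _. apply pd_difference_continuous_x; auto.
Qed.

Lemma integral_wyy x y : Rabs y < Rs ->
  RInt (fun t => wyy t y) 0 x = - / 2 * (q x y - q 0 y).
Proof.
  intro Hy.
  assert (D : forall t, is_derive (fun s => - / 2 * q s y) t (wyy t y)).
  { intro t. replace (wyy t y) with (- / 2 * (- (2 * pdy (pdy v1) t y) - - (2 * pdy (pdy v2) t y)))
      by (unfold wyy; field).
    apply (is_derive_scal (fun s => q s y) t (- / 2)).
    apply (is_derive_minus (fun s => weighted_dx a v1 s y) (fun s => weighted_dx a v2 s y));
      eapply weighted_dx_derive; eauto. }
  apply is_RInt_unique.
  replace (- / 2 * (q x y - q 0 y)) with (minus (- / 2 * q x y) (- / 2 * q 0 y))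
    by (unfold minus, plus, opp; simpl; ring).
  apply (is_RInt_derive (fun s => - / 2 * q s y) (fun t => wyy t y)).
  - intros t _. apply D.
  - intros t _. apply (pd_difference_continuous_x (true :: true :: nil)); auto.
Qed.

Lemma q_periodic x y : Rabs y < Rs -> q (x + P) y = q x y.
Proof. intro Hy. unfold q. rewrite (weighted_dx_periodic _ _ _ _ _ _ _ _ H1), (weighted_dx_periodic _ _ _ _ _ _ _ _ H2); auto. Qed.

(** By the equation, the mean over a period is affine in [y]. *)
Lemma mean_zero y : Rabs y <= Rs -> primitive P y = 0.
Proof.
  intro Hy.
  destruct w_lipschitz_y as (M & M0 & HM).
  assert (Bd : primitive P Rs = 0 /\ primitive P (- Rs) = 0).
  { unfold primitive. split; rewrite (RInt_ext _ (fun _ => 0)) by (intros t _; apply w_boundary);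
      rewrite RInt_const; unfold scal; simpl; unfold mult; simpl; ring. }
  set (m' := fun y => RInt (fun t => wy t y) 0 P).
  assert (D1 : forall y, Rabs y < Rs -> is_derive (fun y => primitive P y) y (m' y))
    by (intros z Hz; apply (integral_derive_y nil P z); simpl; auto).
  assert (D2 : forall y, Rabs y < Rs -> is_derive m' y 0).
  { intros z Hz. assert (A := integral_derive_y (true :: nil) P z ltac:(simpl; lia) Hz).
    change (is_derive m' z (RInt (fun t => wyy t z) 0 P)) in A.
    rewrite integral_wyy in A by auto.
    replace (q P z - q 0 z) with 0 in A.
    - replace 0 with (- / 2 * 0) by ring. exact A.
    - rewrite <- (q_periodic 0 z) by auto. rewrite Rplus_0_l. ring. }
  assert (LJ : forall y y', Rabs y <= Rs -> Rabs y' <= Rs -> Rabs (primitive P y - primitive P y') <= P * M * Rabs (y - y')).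
  { intros z z' Hz Hz'. unfold primitive.
    replace (RInt (fun t => w t z) 0 P - RInt (fun t => w t z') 0 P)
      with (RInt (fun t => w t z - w t z') 0 P).
    - apply Rle_trans with ((P - 0) * (M * Rabs (z - z'))); [|right; ring].
      apply abs_RInt_le_const. lra.
      + apply (ex_RInt_minus (fun t => w t z) (fun t => w t z')); apply w_integrable; auto.
      + intros t _. apply HM; auto.
    - apply (RInt_minus (fun t => w t z) (fun t => w t z')); apply w_integrable; auto. }
  destruct (Rle_lt_or_eq_dec _ _ Hy) as [Hlt|Heq].
  2:{ unfold Rabs in Heq. destruct (Rcase_abs y).
      - replace y with (- Rs) by lra. apply Bd.
      - rewrite Heq. apply Bd. }
  assert (Const : forall z z', Rabs z < Rs -> Rabs z' < Rs -> m' z = m' z').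
  { intros z z' Hz Hz'.
    assert (A := lipschitz_of_derive m' (fun _ => 0) z' z 0
      (fun t Ht => D2 t (between_inside Rs z' z t Hz' Hz Ht)) (fun t _ => ltac:(cbv beta; rewrite Rabs_R0; lra))).
    rewrite Rmult_0_l in A. assert (B := Rabs_pos (m' z - m' z')).
    assert (E : Rabs (m' z - m' z') = 0) by lra. apply Rabs_eq_0 in E. lra. }
  set (c := m' y).
  assert (Aff : forall z, Rabs z < Rs -> primitive P z - primitive P y = c * (z - y)).
  { intros z Hz.
    destruct (MVT_gen (fun y => primitive P y) y z m') as (x & Hx & E).
    - intros t Ht. apply D1. apply (between_inside Rs y z); auto. lra.
    - intros t Ht. apply continuity_pt_filterlim. apply (ex_derive_continuous (fun y => primitive P y) t).
      eexists. apply D1. apply (between_inside Rs y z); auto.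
    - rewrite E. unfold c. rewrite (Const x y); auto. apply (between_inside Rs y z); auto. }
  apply Rabs_def2 in Hlt.
  (* The affine relation is known in the open strip; the Lipschitz bound [LJ] extends it to both
     edges, where the mean vanishes. *)
  assert (Lim : forall e, e = 1 \/ e = -1 -> primitive P (e * Rs) - primitive P y = c * (e * Rs - y)).
  { intros e He. apply Rminus_diag_uniq. apply Rabs_eq_0. apply Rle_antisym; [|apply Rabs_pos].
    apply le_epsilon. intros eps Heps.
    set (K := P * M + Rabs c + 1). assert (K0 : 0 < K).
    { assert (Q1 := Rabs_pos c). assert (0 <= P * M) by (apply Rmult_le_pos; lra). unfold K. lra. }
    set (s := Rmin Rs (eps / K)).
    assert (S0 : 0 < s) by (apply Rmin_glb_lt; auto; apply Rdiv_lt_0_compat; auto).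
    assert (S1 : s <= Rs) by apply Rmin_l. assert (S2 : s * K <= eps).
    { assert (Q : s <= eps / K) by apply Rmin_r. apply (Rmult_le_compat_r K) in Q; [|lra].
      replace (eps / K * K) with eps in Q by (field; lra). exact Q. }
    set (z := e * (Rs - s)).
    assert (Hz : Rabs z < Rs).
    { unfold z. rewrite Rabs_mult, (Rabs_pos_eq (Rs - s)) by lra.
      destruct He as [-> | ->]; [rewrite Rabs_R1|rewrite Rabs_m1]; lra. }
    assert (He' : Rabs (e * Rs) <= Rs).
    { rewrite Rabs_mult, (Rabs_pos_eq Rs) by lra.
      destruct He as [-> | ->]; [rewrite Rabs_R1|rewrite Rabs_m1]; lra. }
    assert (L := LJ (e * Rs) z He' ltac:(lra)).
    assert (Ez : Rabs (e * Rs - z) = s).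
    { unfold z. replace (e * Rs - e * (Rs - s)) with (e * s) by ring.
      rewrite Rabs_mult, (Rabs_pos_eq s) by lra.
      destruct He as [-> | ->]; [rewrite Rabs_R1|rewrite Rabs_m1]; lra. }
    rewrite Ez in L. assert (A := Aff z Hz).
    replace (primitive P (e * Rs) - primitive P y - c * (e * Rs - y)) with
      ((primitive P (e * Rs) - primitive P z) - c * (e * Rs - z)) by lra.
    eapply Rle_trans; [apply Rabs_triang|]. rewrite Rabs_Ropp, Rabs_mult, Ez.
    unfold K in S2. lra. }
  assert (E1 := Lim 1 ltac:(auto)). assert (E2 := Lim (-1) ltac:(auto)).
  replace (1 * Rs) with Rs in E1 by ring. replace (-1 * Rs) with (- Rs) in E2 by ring.
  destruct Bd as [B1 B2]. rewrite B1 in E1. rewrite B2 in E2.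
  assert (Ec : c = 0) by nra. rewrite Ec in E1. lra.
Qed.

Lemma primitive_periodic x y : Rabs y <= Rs -> primitive (x + P) y = primitive x y.
Proof.
  intro Hy. assert (D : forall t, is_derive (fun x => primitive (x + P) y - primitive x y) t 0).
  { intro t. replace 0 with (w (t + P) y - w t y).
    - apply (is_derive_minus (fun x => primitive (x + P) y) (fun x => primitive x y)); [|apply primitive_derive_x, Hy].
      replace (w (t + P) y) with (1 * w (t + P) y) by ring.
      apply (is_derive_comp (fun x => primitive x y) (fun x => x + P)). apply primitive_derive_x, Hy. auto_derive; auto.
    - unfold w. destruct H1 as (_ & _ & Q1 & _). destruct H2 as (_ & _ & Q2 & _).
      rewrite Q1, Q2 by auto. ring. }
  assert (A := lipschitz_of_derive (fun x => primitive (x + P) y - primitive x y) (fun _ => 0) 0 x 0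
    (fun t _ => D t) (fun t _ => ltac:(cbv beta; rewrite Rabs_R0; lra))).
  cbv beta in A. rewrite Rmult_0_l, Rplus_0_l, mean_zero in A by auto.
  assert (J0 : primitive 0 y = 0) by (exact (RInt_point (V:=R_CompleteNormedModule) 0 (fun t => w t y))).
  rewrite J0 in A. assert (B := Rabs_pos (primitive (x + P) y - primitive x y - (0 - 0))).
  assert (E : Rabs (primitive (x + P) y - primitive x y - (0 - 0)) = 0) by lra. apply Rabs_eq_0 in E. lra.
Qed.

Lemma primitive_lipschitz : exists L, 0 <= L /\ forall x y x' y', 0 <= x <= P -> 0 <= x' <= P ->
  Rabs y <= Rs -> Rabs y' <= Rs -> Rabs (primitive x y - primitive x' y') <= L * (Rabs (x - x') + Rabs (y - y')).
Proof.
  destruct w_lipschitz_y as (M & M0 & HM).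
  exists (M * (2 * Rs) + P * M). split.
  { assert (0 <= M * (2 * Rs)) by (apply Rmult_le_pos; lra). assert (0 <= P * M) by (apply Rmult_le_pos; lra). lra. }
  intros x y x' y' Hx Hx' Hy Hy'.
  assert (Wb : forall t, Rabs (w t y) <= M * (2 * Rs)).
  { intro t. assert (A := HM t y Rs Hy ltac:(rewrite Rabs_pos_eq; lra)).
    rewrite (proj1 (w_boundary t)), Rminus_0_r in A. apply Rle_trans with (1 := A).
    apply Rmult_le_compat_l; auto. apply Rabs_le_between in Hy. apply Rabs_le. lra. }
  assert (A1 : Rabs (primitive x y - primitive x' y) <= M * (2 * Rs) * Rabs (x - x')).
  { apply (lipschitz_of_derive (fun x => primitive x y) (fun x => w x y)).
    intros; apply primitive_derive_x, Hy. intros; apply Wb. }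
  assert (A2 : Rabs (primitive x' y - primitive x' y') <= P * M * Rabs (y - y')).
  { unfold primitive.
    replace (RInt (fun t => w t y) 0 x' - RInt (fun t => w t y') 0 x')
      with (RInt (fun t => w t y - w t y') 0 x').
    - apply Rle_trans with ((x' - 0) * (M * Rabs (y - y'))).
      + apply abs_RInt_le_const. lra.
        * apply (ex_RInt_minus (fun t => w t y) (fun t => w t y')); apply w_integrable; auto.
        * intros t _. apply HM; auto.
      + rewrite Rminus_0_r, Rmult_assoc. apply Rmult_le_compat_r. apply Rmult_le_pos; auto. apply Rabs_pos. lra.
    - apply (RInt_minus (fun t => w t y) (fun t => w t y')); apply w_integrable; auto. }
  replace (primitive x y - primitive x' y') with ((primitive x y - primitive x' y) + (primitive x' y - primitive x' y')) by ring.
  eapply Rle_trans; [apply Rabs_triang|].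
  assert (0 <= M * (2 * Rs) * Rabs (y - y')) by (apply Rmult_le_pos; [apply Rmult_le_pos; lra|apply Rabs_pos]).
  assert (0 <= P * M * Rabs (x - x')) by (apply Rmult_le_pos; [apply Rmult_le_pos; lra|apply Rabs_pos]).
  lra.
Qed.

(** Carries maximality over one period to a neighbourhood of any of its points, so that a maximum at
    0 or [P] can be treated as an interior one. *)
Lemma primitive_near x x0 y : Rabs y <= Rs -> 0 <= x0 <= P -> Rabs (x - x0) < P ->
  exists x', 0 <= x' <= P /\ primitive x' y = primitive x y.
Proof.
  intros Hy H0 Hx. apply Rabs_def2 in Hx. destruct (Rlt_dec x 0).
  - exists (x + P). split. lra. apply primitive_periodic, Hy.
  - destruct (Rlt_dec P x).
    + exists (x - P). split. lra. rewrite <- (primitive_periodic (x - P) y Hy). f_equal. ring.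
    + exists x. split; auto. lra.
Qed.

(** At a maximum of [primitive x1 y - primitive x2 y + eps y^2] both [v1 - v2] vanish, so that the
    coefficients coincide and the equation gives the wrong sign for the [y]-derivative. *)
Lemma primitive_oscillation eps x1 x2 y : 0 < eps -> 0 <= x1 <= P -> 0 <= x2 <= P -> Rabs y <= Rs ->
  primitive x1 y - primitive x2 y <= eps * Rs ^ 2.
Proof.
  intros He K1 K2 K3.
  destruct primitive_lipschitz as (L & L0 & HL).
  destruct (box_max (fun x1 x2 y => primitive x1 y - primitive x2 y + eps * y ^ 2) P Rs (2 * L + eps * (2 * Rs)))
    as (a1 & a2 & b & A1 & A2 & Hb & Hmax); try lra.
  { assert (0 <= eps * (2 * Rs)) by (apply Rmult_le_pos; lra). lra. }
  { intros u1 u2 z u1' u2' z' E1 E2 E3 E1' E2' E3'.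
    assert (B1 := HL u1 z u1' z' E1 E1' E3 E3'). assert (B2 := HL u2 z u2' z' E2 E2' E3 E3').
    assert (B3 : Rabs (eps * z ^ 2 - eps * z' ^ 2) <= eps * (2 * Rs) * Rabs (z - z')).
    { replace (eps * z ^ 2 - eps * z' ^ 2) with (eps * (z + z') * (z - z')) by ring.
      rewrite Rabs_mult. apply Rmult_le_compat_r. apply Rabs_pos.
      rewrite Rabs_mult, (Rabs_pos_eq eps) by lra. apply Rmult_le_compat_l. lra.
      eapply Rle_trans; [apply Rabs_triang|]. lra. }
    assert (P1 := Rabs_pos (u1 - u1')). assert (P2 := Rabs_pos (u2 - u2')). assert (P3 := Rabs_pos (z - z')).
    assert (0 <= L * Rabs (u1 - u1')) by (apply Rmult_le_pos; lra).
    assert (0 <= L * Rabs (u2 - u2')) by (apply Rmult_le_pos; lra).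
    assert (0 <= eps * (2 * Rs) * Rabs (u1 - u1')) by (apply Rmult_le_pos; auto; apply Rmult_le_pos; lra).
    assert (0 <= eps * (2 * Rs) * Rabs (u2 - u2')) by (apply Rmult_le_pos; auto; apply Rmult_le_pos; lra).
    apply Rabs_le_between in B1. apply Rabs_le_between in B2. apply Rabs_le_between in B3.
    apply Rabs_le. lra. }
  apply Rle_trans with (primitive x1 y - primitive x2 y + eps * y ^ 2).
  { assert (0 <= eps * y ^ 2) by (apply Rmult_le_pos; [lra|apply pow2_ge_0]). lra. }
  apply Rle_trans with (1 := Hmax x1 x2 y K1 K2 K3).
  assert (sq : forall z, Rabs z <= Rs -> z ^ 2 <= Rs ^ 2).
  { intros z Hz. rewrite <- (pow2_abs z). apply pow_incr. split; [apply Rabs_pos|auto]. }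
  destruct (Rle_lt_or_eq_dec _ _ Hb) as [Hin|Hedge].
  (* On the edges [primitive] vanishes and [eps b ^ 2] is at most the claimed bound. *)
  2:{ assert (Jb : forall x, primitive x b = 0).
      { intro x. unfold primitive. rewrite (RInt_ext _ (fun _ => 0)).
        - rewrite RInt_const. unfold scal; simpl; unfold mult; simpl; ring.
        - intros t _. unfold Rabs in Hedge. destruct (Rcase_abs b).
          + replace b with (- Rs) by lra. apply w_boundary.
          + rewrite Hedge. apply w_boundary. }
      rewrite !Jb. assert (b ^ 2 <= Rs ^ 2) by (apply sq; lra).
      assert (eps * b ^ 2 <= eps * Rs ^ 2) by (apply Rmult_le_compat_l; lra). lra. }
  exfalso.
  assert (W : forall x, is_derive (fun x => w x b) x (pdx v1 x b - pdx v2 x b)).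
  { intro x. apply (is_derive_minus (fun x => v1 x b) (fun x => v2 x b)).
    - apply (pd_derive _ _ _ _ _ _ _ _ H1 nil x b); auto. simpl; lia.
    - apply (pd_derive _ _ _ _ _ _ _ _ H2 nil x b); auto. simpl; lia. }
  destruct (second_derivative_max (fun x => primitive x b) (fun x => w x b) a1 (pdx v1 a1 b - pdx v2 a1 b) P HP)
    as [W1 S1]; auto.
  { intros x _. apply primitive_derive_x, Hb. }
  { intros x Hx. destruct (primitive_near x a1 b Hb A1 Hx) as (x' & Hx' & <-).
    assert (Q := Hmax x' a2 b Hx' A2 Hb). lra. }
  destruct (second_derivative_max (fun x => - primitive x b) (fun x => - w x b) a2 (- (pdx v1 a2 b - pdx v2 a2 b)) P HP)
    as [W2 S2]; auto.
  { intros x _. apply (is_derive_opp (fun x => primitive x b)). apply primitive_derive_x, Hb. }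
  { apply (is_derive_opp (fun x => w x b)). apply W. }
  { intros x Hx. destruct (primitive_near x a2 b Hb A2 Hx) as (x' & Hx' & <-).
    assert (Q := Hmax a1 x' b A1 Hx' Hb). lra. }
  set (f' := fun y => RInt (fun t => wy t y) 0 a1 - RInt (fun t => wy t y) 0 a2 + eps * (2 * y)).
  (* By the integrated equation the second [y]-derivative is [- / 2] times the difference of [q]
     between [a1] and [a2], plus [2 eps]; the values of [q] at 0 cancel. *)
  destruct (second_derivative_max (fun y => primitive a1 y - primitive a2 y + eps * y ^ 2) f' b
    (- / 2 * (q a1 b - q 0 b) - - / 2 * (q a2 b - q 0 b) + eps * 2) (Rs - Rabs b)) as [_ S3].
  - lra.
  - intros z Hz.
    assert (Hz' : Rabs z < Rs).
    { replace z with ((z - b) + b) by ring. eapply Rle_lt_trans; [apply Rabs_triang|]. lra. }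
    unfold f'. apply (is_derive_plus (fun y => primitive a1 y - primitive a2 y) (fun y => eps * y ^ 2)).
    + apply (is_derive_minus (fun y => primitive a1 y) (fun y => primitive a2 y));
        apply (integral_derive_y nil); simpl; auto.
    + auto_derive; auto. ring.
  - unfold f'. apply (is_derive_plus (fun y => RInt (fun t => wy t y) 0 a1 - RInt (fun t => wy t y) 0 a2)
      (fun y => eps * (2 * y))).
    + rewrite <- !integral_wyy by auto.
      apply (is_derive_minus (fun y => RInt (fun t => wy t y) 0 a1) (fun y => RInt (fun t => wy t y) 0 a2));
        apply (integral_derive_y (true :: nil)); simpl; auto.
    + auto_derive; auto. ring.
  - intros z Hz.
    assert (Hz' : Rabs z < Rs).
    { replace z with ((z - b) + b) by ring. eapply Rle_lt_trans; [apply Rabs_triang|]. lra. }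
    apply Hmax; auto. lra.
  - assert (Q : forall x, w x b = 0 -> q x b = / sqrt (v1 x b ^ 2 + b ^ 2 + a ^ 2) * (pdx v1 x b - pdx v2 x b)).
    { intros x Hx. unfold w in Hx. unfold q, weighted_dx. replace (v2 x b) with (v1 x b) by lra. ring. }
    rewrite (Q a1 W1) in S3. rewrite (Q a2 ltac:(lra)) in S3.
    assert (Pos : forall x, 0 < / sqrt (v1 x b ^ 2 + b ^ 2 + a ^ 2)).
    { intro x. apply Rinv_0_lt_compat, sqrt_lt_R0. assert (Z1 := pow2_ge_0 (v1 x b)).
      assert (Z2 := pow2_ge_0 b). assert (Z3 : 0 < a ^ 2) by (apply pow2_gt_0, Ha). lra. }
    assert (I1 := Pos a1). assert (I2 := Pos a2).
    assert (T1 : / sqrt (v1 a1 b ^ 2 + b ^ 2 + a ^ 2) * (pdx v1 a1 b - pdx v2 a1 b) <= 0) by nra.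
    assert (T2 : 0 <= / sqrt (v1 a2 b ^ 2 + b ^ 2 + a ^ 2) * (pdx v1 a2 b - pdx v2 a2 b)) by nra.
    lra.
Qed.

(** Letting [eps] tend to 0 for both orders of the pair [z], 0 shows that [primitive] vanishes on a
    period. So does its [x]-derivative [w], and periodicity reaches every [x]. *)
Theorem solution_unique x y : Rabs y <= Rs -> v1 x y = v2 x y.
Proof.
  intro Hy.
  assert (J0 : forall x, 0 <= x <= P -> primitive x y = 0).
  { intros z Hz. assert (Z : primitive 0 y = 0) by (exact (RInt_point (V:=R_CompleteNormedModule) 0 (fun t => w t y))).
    assert (R2 : 0 < Rs ^ 2) by (apply pow_lt, HRs).
    apply Rle_antisym; apply le_epsilon; intros e He.
    - assert (A := primitive_oscillation (e / Rs ^ 2) z 0 y ltac:(apply Rdiv_lt_0_compat; lra) Hz ltac:(lra) Hy).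
      replace (e / Rs ^ 2 * Rs ^ 2) with e in A by (field; lra). lra.
    - assert (A := primitive_oscillation (e / Rs ^ 2) 0 z y ltac:(apply Rdiv_lt_0_compat; lra) ltac:(lra) Hz Hy).
      replace (e / Rs ^ 2 * Rs ^ 2) with e in A by (field; lra). lra. }
  assert (Hw : forall z, 0 <= z <= P -> w z y = 0).
  { intros z Hz. apply (fermat (fun x => primitive x y) z (w z y) P HP).
    - apply primitive_derive_x, Hy.
    - intros t Ht. destruct (primitive_near t z y Hy Hz Ht) as (t' & Ht' & <-). rewrite !J0 by auto. lra. }
  assert (Hper : forall n : nat, forall z, w (z + INR n * P) y = w z y).
  { destruct H1 as (_ & _ & Q1 & _). destruct H2 as (_ & _ & Q2 & _).
    induction n; intro z. { f_equal. simpl. ring. }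
    rewrite S_INR. replace (z + (INR n + 1) * P) with ((z + INR n * P) + P) by ring.
    rewrite <- (IHn z). unfold w. rewrite Q1, Q2 by auto. reflexivity. }
  assert (Wx : w x y = 0).
  { assert (A := base_Int_part (x / P)). set (i := Int_part (x / P)) in *.
    assert (Ex : x = (x - IZR i * P) + IZR i * P) by ring.
    assert (Hr : 0 <= x - IZR i * P <= P).
    { assert (E : x = x / P * P) by (field; lra). split; rewrite E; nra. }
    destruct (Z_le_gt_dec 0 i).
    - rewrite Ex, <- (Z2Nat.id i), <- INR_IZR_INZ at 1 by auto.
      rewrite INR_IZR_INZ, Z2Nat.id by auto.
      rewrite <- (Hw _ Hr). rewrite <- (Hper (Z.to_nat i) (x - IZR i * P)).
      f_equal. rewrite INR_IZR_INZ, Z2Nat.id by auto. reflexivity.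
    - rewrite <- (Hper (Z.to_nat (- i)) x).
      replace (x + INR (Z.to_nat (- i)) * P) with (x - IZR i * P). apply Hw, Hr.
      rewrite INR_IZR_INZ, Z2Nat.id, opp_IZR by lia. ring. }
  unfold w in Wx. lra.
Qed.

End Uniqueness.

Theorem theorem7p1 (Rs P a alpha : R) (k : nat) (phip phim : R -> R) :
  0 < Rs -> 0 < P -> a <> 0 -> 0 < alpha < 1 ->
  holder1 (k + 2) alpha phip -> holder1 (k + 2) alpha phim ->
  (forall x, phip (x + P) = phip x) -> (forall x, phim (x + P) = phim x) ->
  exists v : R -> R -> R,
    is_solution k alpha a Rs P phip phim v /\
    (forall w : R -> R -> R, is_solution k alpha a Rs P phip phim w ->
       forall x y, Rabs y <= Rs -> w x y = v x y).
Proof.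
  intros HRs HP Ha Hal Hp Hm Pp Pm.
  destruct (solution_exists Rs P a alpha k phip phim HRs HP Ha Hal Hp Hm Pp Pm) as [v Hv].
  exists v. split; auto. intros w Hw x y Hy.
  apply (solution_unique k alpha a Rs P phip phim w v HRs HP Ha Hal Hw Hv x y Hy).
Qed.
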